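(* Let $0<\beta<1/2$ and suppose that for a subsequence $\{\varepsilon_\ell\}\to0$ and some $A\in[0,1]$ we have $$\varepsilon_\ell^{-\beta}-\lfloor\varepsilon_\ell^{-\beta}\rfloor\to A.$$ Then $\{F_{\varepsilon_\ell}\}$ $\Gamma$-converges to $E_{0,A}$ in $L^2\left((0,1);\mathbb{R}^2\right)$.
   Context: Fix a constant $L>0$ and $\alpha\in[0,2\pi)$. Identify $\mathbb{R}^2$ with $\mathbb{C}$ when convenient; $\lfloor\cdot\rfloor$ is the integer part. Let $$\mathcal{A}_\alpha=\{w\in H^1((0,1);\mathbb{R}^2): w(0)=1,\ w(1)=e^{i\alpha}\}.$$ For $\varepsilon>0$ and $w=(w_1,w_2)\in\mathcal{A}_\alpha$ set $$F_\varepsilon(w)=\int_0^1\frac{\varepsilon}{2}\left|(we^{2\pi i\lfloor\varepsilon^{-\beta}\rfloor x})'\right|^2+\frac{1}{4\varepsilon}(|w|^2-1)^2+\frac{L}{2}\left(w_1w_2'-w_2w_1'+|w|^2\,2\pi\lfloor\varepsilon^{-\beta}\rfloor-2\pi\varepsilon^{-\beta}\right)^2dx,$$ and $F_\varepsilon(w)=+\infty$ for $w\in L^2((0,1);\mathbb{R}^2)\setminus\mathcal{A}_\alpha$. For $A\in[0,1]$ define on $L^2((0,1);\mathbb{R}^2)$ $$E_{0,A}(w)=\begin{cases}\displaystyle\frac{L}{2}\int_0^1(w_1w_2'-w_2w_1'-2\pi A)^2\,dx+\frac{2\sqrt2}{3}\mathcal{H}^0(J)&\text{if }w\in H^1((0,1)\setminus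 J;S^1),\\ +\infty&\text{otherwise,}\end{cases}$$ where $\mathcal{H}^0$ is counting measure, and $J$ is a finite (possibly empty) collection of points consisting of points $0<x_1<\dots<x_k<1$ together with possibly $0$ and/or $1$: the point $0$ is included in $J$ only if the trace $w(0^+)\neq1$, and the point $1$ is included in $J$ only if the trace $w(1^-)\neq e^{i\alpha}$ (and they are included in those cases). $J$ is taken to be the minimal such set, meaning that if any point of $J\cap(0,1)$ were removed, $w$ would no longer be an $H^1$ function on the complement of the smaller set. The case ''otherwise'' means that no such finite set exists. Derivatives in $E_{0,A}$ are taken on $(0,1)\setminus J$. $\Gamma$-convergence in $L^2$ means: (1) whenever $w_{\varepsilon_\ell}\to w$ in $L^2$, $\liminf_{\ell\to\infty}F_{\varepsilon_\ell}(w_{\varepsilon_\ell})\ge E_{0,A}(w)$; (2) for every $w\in L^2$ there is a sequence $\tilde w_{\varepsilon_\ell}\to w$ in $L^2$ with $\lim_{\ell\to\infty}F_{\varepsilon_\ell}(\tilde w_{\varepsilon_\ell})=E_{0,A}(w)$. *)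

(* Defs.v *)
From mathcomp Require Import all_boot all_order all_algebra.
From mathcomp Require Import all_classical all_reals all_analysis.
Set Implicit Arguments.
Unset Strict Implicit.
Unset Printing Implicit Defensive.
Import Order.TTheory GRing.Theory Num.Theory.
Import numFieldNormedType.Exports.
Local Open Scope classical_set_scope.
Local Open Scope ring_scope.

(* Elements of L^2 and H^1 are given by representatives [R -> R] or
   [R -> R * R]: only the values on the set [U] matter, and every notion
   involving them is invariant under a.e. equality on [U]. The plane is
   [R * R]; its library norm is the max norm, so the Euclidean norm is always
   written out in coordinates. *)

Section Sobolev.
Context {R : realType}.
Local Notation mu := (@lebesgue_measure R).
Implicit Types (U : set R) (f g phi : R -> R) (w v : R -> R * R).

Definition comp1 w : R -> R := fun x => (w x).1.
Definition comp2 w : R -> R := fun x => (w x).2.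
Definition sqnorm (z : R * R) : R := z.1 ^+ 2 + z.2 ^+ 2.

Definition L2 U f : Prop :=
  measurable_fun U f /\ (\int[mu]_(x in U) (f x ^+ 2)%:E < +oo)%E.

(* C^1_c(U), which yields the same weak derivatives as C^oo_c(U) *)
Definition test_function U phi : Prop :=
  [/\ forall x, derivable phi x 1,
      continuous (derive1 phi) &
      exists K : set R, [/\ compact K, K `<=` U & forall x, ~ K x -> phi x = 0]].

Definition weak_derivative U f g : Prop :=
  forall phi, test_function U phi ->
    \int[mu]_(x in U) (f x * derive1 phi x) = - \int[mu]_(x in U) (g x * phi x).

Definition H1 U f : Prop :=
  L2 U f /\ exists g, L2 U g /\ weak_derivative U f g.

(* The weak derivative of f in L^2(U), unique up to a.e. equality on U;
   arbitrary when f is not in H^1(U). *)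
Definition weakD U f : R -> R :=
  xget (cst 0) [set g | L2 U g /\ weak_derivative U f g].

Definition L2_plane U w : Prop := L2 U (comp1 w) /\ L2 U (comp2 w).

Definition H1_plane U w : Prop := H1 U (comp1 w) /\ H1 U (comp2 w).

Definition H1_circle U w : Prop :=
  H1_plane U w /\ {ae mu, forall x, U x -> sqnorm (w x) = 1}.

(* Boundary value l of w along F (F = a^'+ or a^'- in use), read off the
   continuous representative of w on U. *)
Definition has_trace U w (F : set_system R) (l : R * R) : Prop :=
  exists v, [/\ {in U, continuous v},
                {ae mu, forall x, U x -> v x = w x} &
                v y @[y --> F] --> l].

Definition cvg_L2 U (wn : nat -> R -> R * R) w : Prop :=
  (fun n => \int[mu]_(x in U) (sqnorm (wn n x - w x))%:E)%E @ \oo --> 0%E.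

Definition Gamma_cvg_L2 U (F : nat -> (R -> R * R) -> \bar R)
    (E : (R -> R * R) -> \bar R) : Prop :=
  (forall (wn : nat -> R -> R * R) w,
     (forall n, L2_plane U (wn n)) -> L2_plane U w -> cvg_L2 U wn w ->
     (E w <= limn_einf (fun n => F n (wn n)))%E) /\
  (forall w, L2_plane U w ->
     exists wn : nat -> R -> R * R,
       [/\ forall n, L2_plane U (wn n), cvg_L2 U wn w &
           (fun n => F n (wn n)) @ \oo --> E w]).

End Sobolev.

Section Energies.
Context {R : realType}.
Local Notation mu := (@lebesgue_measure R).
Implicit Types (U J : set R) (w : R -> R * R).

Definition unit_interval : set R := `]0, 1[%classic.

Definition expi (t : R) : R * R := (cos t, sin t).

Definition cmul (z z' : R * R) : R * R :=
  (z.1 * z'.1 - z.2 * z'.2, z.1 * z'.2 + z.2 * z'.1).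

Definition admissible (alpha : R) w : Prop :=
  [/\ H1_plane unit_interval w,
      has_trace unit_interval w 0^'+ (1, 0) &
      has_trace unit_interval w 1^'- (expi alpha)].

(* w_1 w_2' - w_2 w_1' *)
Definition current U w (x : R) : R :=
  comp1 w x * weakD U (comp2 w) x - comp2 w x * weakD U (comp1 w) x.

Definition twist (k : int) w : R -> R * R :=
  fun x => cmul (w x) (expi (2 * pi * k%:~R * x)).

Definition F_density (L beta eps : R) w (x : R) : R :=
  let U := unit_interval in
  let k := Num.floor (eps `^ (- beta)) in
  let u := twist k w in
  eps / 2 * (weakD U (comp1 u) x ^+ 2 + weakD U (comp2 u) x ^+ 2)
  + (4 * eps)^-1 * (sqnorm (w x) - 1) ^+ 2
  + L / 2 * (current U w x + sqnorm (w x) * (2 * pi * k%:~R)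
             - 2 * pi * eps `^ (- beta)) ^+ 2.

Definition F_energy (L alpha beta eps : R) w : \bar R :=
  if `[< admissible alpha w >]
  then (\int[mu]_(x in unit_interval) (F_density L beta eps w x)%:E)%E
  else +oo%E.

Definition jump_set (alpha : R) w J : Prop :=
  let U := unit_interval `\` J in
  [/\ finite_set J /\ J `<=` `[0, 1]%classic,
      H1_circle U w,
      forall x, J x -> 0 < x < 1 ->
        ~ H1_plane (unit_interval `\` (J `\ x)) w,
      J 0 <-> ~ has_trace U w 0^'+ (1, 0) &
      J 1 <-> ~ has_trace U w 1^'- (expi alpha)].

(* There is at most one J with [jump_set alpha w J]. *)
Definition E_energy (L alpha A : R) w : \bar R :=
  if `[< exists J, jump_set alpha w J >]
  then let J := xget set0 (jump_set alpha w) in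
       let U := unit_interval `\` J in
       ((L / 2)%:E * \int[mu]_(x in U) ((current U w x - 2 * pi * A) ^+ 2)%:E
        + (2 * Num.sqrt 2 / 3)%:E * counting J)%E
  else +oo%E.

End Energies.

(* Main.v *)
(**
Write p for the absolutely continuous representative of w and theta = 2 pi A.

Lower bound. Along a subsequence of bounded energy, |p|^2 tends to 1 in L^2 at
rate sqrt eps. A point near which |p| keeps dropping below a fixed level d < 1
costs at least 2 sqrt 2 / 3 up to o(1) as d -> 0, by the Modica-Mortola
inequality; hence a further subsequence has a finite maximal set D of such
points, and |p| is bounded below on compact intervals avoiding D. There the
unit field p / |p|, rotated by - theta x, has angular speed equal to the
quantity penalised by L / 2 up to an error that is small in L^1: this uses
2 pi eps^-beta - 2 pi floor (eps^-beta) -> theta and eps^(1/2 - beta) -> 0.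
Its difference quotients are therefore controlled by the energy, so the limit
is H^1 off D and its phase energy is lower semicontinuous. The jump set of the
limit is contained in D.

Recovery. Endpoint jumps are first moved slightly inside (0, 1). The limit map
is then multiplied by a modulus rho vanishing near each jump and rising to 1
along a slightly accelerated optimal profile, which reaches 1 at a finite
distance of order sqrt eps.
*)

Require Import Defs.
From mathcomp Require Import all_boot all_order all_algebra.
From mathcomp Require Import all_classical all_reals all_analysis.
From mathcomp Require Import measurable_realfun ring lra.
Set Implicit Arguments.
Unset Strict Implicit.
Unset Printing Implicit Defensive.
Import Order.TTheory GRing.Theory Num.Theory.
Import numFieldNormedType.Exports.
Local Open Scope classical_set_scope.
Local Open Scope ring_scope.

(** The limit is given in L^2; what must be recovered is its derivative. So the unit fields are
    shown to converge pointwise, from equicontinuity up to a vanishing error and L^1 convergence,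
    and dyadic difference quotients then yield both the derivative and its sharp lower bound.
    Working with the unit field instead of an angle avoids any lifting across the dips.

    Since [weakD] is a choice among weak derivatives, the energies are first rewritten through
    absolutely continuous representatives: [prim] carries all the calculus.

    The level [d] stays fixed while subsequences are extracted. The set of dips depends on [d] but
    the limit energy does not, so the loss 12 M sqrt d is removed at the very end without a diagonal
    sequence.

    The cost of a jump is 2 sqrt 2 / 3 = 2 (1 - 1/3) / sqrt 2: the modulus goes down and up again
    along the primitive of (1 - r^2) / sqrt 2. The recovery profile solves the equality case of that
    inequality, with 1 replaced by 1 + sqrt eps so that it ends in finite time. *)

Ltac prune := repeat match goal with
  | H : ?T |- _ => lazymatch T with
    | is_true (Order.le _ _) => fail
    | is_true (Order.lt _ _) => fail
    | is_true (_ && _) => fail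
    | _ => clear H
    end
  end.
Ltac prune_eq := repeat match goal with
  | H : ?T |- _ => lazymatch T with
    | is_true (Order.le _ _) => fail
    | is_true (Order.lt _ _) => fail
    | is_true (_ && _) => fail
    | _ = _ => fail
    | _ => clear H
    end
  end.
Ltac lin := solve [prune; lra | prune_eq; lra].

(** * Integrals and primitives on intervals *)

Section IntervalIntegrals.
Context {R : realType}.
Local Notation mu := (@lebesgue_measure R).
Implicit Types (A B : set R) (f g h : R -> R) (a b c x y z : R).

Definition integ A f := mu.-integrable A (EFin \o f).

Lemma integ_meas A f : integ A f -> measurable_fun A f.
Proof. by move=> /integrableP[/measurable_EFinP]. Qed.

Lemma integS A B f : measurable A -> measurable B -> A `<=` B ->
  integ B f -> integ A f.
Proof. by move=> mA mB AB fB; exact: (@integrableS _ _ _ mu _ _ _ mB mA AB fB). Qed.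

Lemma integD A f g : measurable A -> integ A f -> integ A g ->
  integ A (fun x => f x + g x).
Proof.
move=> mA iF iG; apply: (@eq_integrable _ _ _ mu A mA _ _ _ (@integrableD _ _ _ mu A mA _ _ iF iG)) => x _ //=.
Qed.

Lemma integZ A k f : measurable A -> integ A f -> integ A (fun x => k * f x).
Proof.
move=> mA iF; apply: (@eq_integrable _ _ _ mu A mA _ _ _ (@integrableZl _ _ _ mu A mA k _ iF)) => x _ //=.
Qed.

Lemma integN A f : measurable A -> integ A f -> integ A (fun x => - f x).
Proof.
move=> mA iF; apply: (@eq_integrable _ _ _ mu A mA _ _ _ (integrableN iF)) => x _ //=.
Qed.

Lemma integB A f g : measurable A -> integ A f -> integ A g ->
  integ A (fun x => f x - g x).
Proof. by move=> mA iF iG; apply: integD => //; apply: integN. Qed.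

Lemma integ_le A f g : measurable A -> measurable_fun A f ->
  (forall x, A x -> `|f x| <= g x) -> integ A g -> integ A f.
Proof.
move=> mA mf fg ig; apply: le_integrable ig => //; first exact/measurable_EFinP.
by move=> x Ax /=; rewrite lee_fin (le_trans (fg x Ax))// ler_norm.
Qed.

Lemma integ_norm A f : measurable A -> integ A f -> integ A (fun x => `|f x|).
Proof.
move=> mA iF; apply: (@eq_integrable _ _ _ mu A mA _ _ _ (integrable_abse iF)) => x _ //=.
Qed.

Lemma eq_integ A f g : measurable A -> {in A, f =1 g} -> integ A f -> integ A g.
Proof.
move=> mA fg iF; apply: (@eq_integrable _ _ _ mu A mA _ _ _ iF) => x xA /=; by rewrite fg.
Qed.

Lemma mu_itv a b : a <= b -> mu `[a, b] = (b - a)%:E.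
Proof.
move=> ab; rewrite lebesgue_measure_itv/= lte_fin; case: ltP => //.
by move=> ba; rewrite (@le_anti _ _ a b) ?ab// subrr.
Qed.

Lemma mu_itv_lty a b : (mu `[a, b] < +oo)%E.
Proof.
by rewrite lebesgue_measure_itv/=; case: ifP => _; rewrite ?ltry// -EFinB ltry.
Qed.

Lemma integ_cst a b k : integ `[a, b] (fun=> k).
Proof.
apply: (@measurable_bounded_integrable _ _ _ mu) => //=.
- exact: mu_itv_lty.
- exact: bounded_cst.
Qed.

Lemma integ_sqr a b f : measurable_fun `[a, b] f ->
  integ `[a, b] (fun x => f x ^+ 2) -> integ `[a, b] f.
Proof.
move=> mf i2; apply: (integ_le _ mf _ (integD _ i2 (@integ_cst a b 1))) => //.
move=> x _; have := sqr_ge0 (`|f x| - 1); rewrite sqrrB expr1n mulr1 real_normK ?num_real//.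
have := sqr_ge0 (f x); have := normr_ge0 (f x); lra.
Qed.

Lemma integM A f g : measurable A -> measurable_fun A f -> measurable_fun A g ->
  integ A (fun x => f x ^+ 2) -> integ A (fun x => g x ^+ 2) ->
  integ A (fun x => f x * g x).
Proof.
move=> mA mf mg f2 g2; apply: (integ_le mA _ _ (integD mA f2 g2)).
  exact: measurable_funM.
move=> x _; rewrite ler_norml; have := sqr_ge0 (f x - g x).
have := sqr_ge0 (f x + g x).
by have := sqr_ge0 (f x); have := sqr_ge0 (g x); nra.
Qed.

Lemma integM_bnd A f g C : measurable A -> measurable_fun A f ->
  (forall x, A x -> `|f x| <= C) -> integ A g -> integ A (fun x => f x * g x).
Proof.
move=> mA mf fC ig.
apply: (integ_le mA _ _ (integZ C mA (integ_norm mA ig))).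
  by apply: measurable_funM => //; exact: integ_meas.
by move=> x Ax; rewrite normrM ler_wpM2r// fC.
Qed.

(** On a reversed interval the value is 0, not the opposite of the integral; additivity therefore
    asks for ordered endpoints. *)
Definition I a b f := \int[mu]_(t in `[a, b]) f t.

Lemma I_split a b c f : a <= b -> b <= c -> integ `[a, c] f ->
  I a c f = I a b f + I b c f.
Proof.
move=> ab bc iF; rewrite /I.
have := @Rintegral_itvB R f (BLeft a) (BRight c) b iF.
rewrite !bnd_simp => /(_ ab bc) /eqP; rewrite subr_eq addrC => /eqP ->.
by rewrite Rintegral_itv_obnd_cbnd//; apply: integS iF => //;
  apply: subset_itv; rewrite bnd_simp.
Qed.

Lemma I_id a f : I a a f = 0.
Proof. by rewrite /I set_itv1 Rintegral_set1. Qed.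

Lemma I_gt a b f : b < a -> I a b f = 0.
Proof. by move=> ba; rewrite /I set_itv_ge ?Rintegral_set0// bnd_simp -ltNge. Qed.

Lemma I_norm a b f : integ `[a, b] f -> `|I a b f| <= I a b (fun x => `|f x|).
Proof. by move=> iF; exact: le_normr_Rintegral. Qed.

Lemma I_ge0 a b f : (forall x, a <= x -> x <= b -> 0 <= f x) -> 0 <= I a b f.
Proof.
by move=> f0; apply: Rintegral_ge0 => x /=; rewrite in_itv/= => /andP[]; exact: f0.
Qed.

Lemma I_le a b f g : integ `[a, b] f -> integ `[a, b] g ->
  (forall x, a <= x -> x <= b -> f x <= g x) -> I a b f <= I a b g.
Proof.
move=> iF iG fg; apply: le_Rintegral => // x /=; rewrite in_itv/= => /andP[].
exact: fg.
Qed.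

Lemma eq_I a b f g : (forall x, a <= x -> x <= b -> f x = g x) -> I a b f = I a b g.
Proof.
move=> fg; apply: eq_Rintegral => x; rewrite inE/= in_itv/= => /andP[]; exact: fg.
Qed.

Lemma I_cst a b k : a <= b -> I a b (fun=> k) = k * (b - a).
Proof. by move=> ab; rewrite /I Rintegral_cst// [X in fine X]mu_itv. Qed.

Lemma ID a b f g : integ `[a, b] f -> integ `[a, b] g ->
  I a b (fun x => f x + g x) = I a b f + I a b g.
Proof. by move=> iF iG; exact: RintegralD. Qed.

Lemma IB a b f g : integ `[a, b] f -> integ `[a, b] g ->
  I a b (fun x => f x - g x) = I a b f - I a b g.
Proof. by move=> iF iG; exact: RintegralB. Qed.

Lemma IZ a b k f : integ `[a, b] f -> I a b (fun x => k * f x) = k * I a b f.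
Proof. by move=> iF; exact: RintegralZl. Qed.

Lemma integ_sub a b c d f : integ `[a, b] f -> a <= c -> d <= b -> integ `[c, d] f.
Proof.
by move=> iF ac db; apply: integS iF => //; apply: subset_itv; rewrite bnd_simp.
Qed.

Lemma I_sub a b c d f : integ `[a, b] f -> (forall x, a <= x -> x <= b -> 0 <= f x) ->
  a <= c -> d <= b -> I c d f <= I a b f.
Proof.
move=> iF f0 ac db; case: (leP c d) => [cd|/I_gt ->]; last exact: I_ge0.
rewrite (@I_split a c b)//; last 1 first.
  exact: le_trans db.
rewrite (@I_split c d b)//; last exact: (integ_sub iF).
have h1 : 0 <= I a c f.
  by apply: I_ge0 => x ax xc; apply: f0 => //; lra.
have h2 : 0 <= I d b f.
  by apply: I_ge0 => x ax xc; apply: f0 => //; lra.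
lra.
Qed.

(** The square of |f| minus its mean m / (b - a) has a nonnegative integral. *)
Lemma I_CS a b f : a <= b -> integ `[a, b] f -> integ `[a, b] (fun x => f x ^+ 2) ->
  (I a b (fun x => `|f x|)) ^+ 2 <= (b - a) * I a b (fun x => f x ^+ 2).
Proof.
move=> ab iF i2; set m := I a b _.
have := ab; rewrite le_eqVlt => /predU1P[ab'|ltab].
  by rewrite /m -ab' I_id expr0n/= mulr_ge0 ?subrr//= I_id.
have n1 : integ `[a, b] (fun x => `|f x|) by exact: integ_norm.
have := @I_ge0 a b (fun x => f x ^+ 2 - ((2 * (m / (b - a))) * `|f x| - (m / (b - a)) ^+ 2)).
have i3 : integ `[a, b] (fun x => (2 * (m / (b - a))) * `|f x| - (m / (b - a)) ^+ 2).
  by apply: integB => //; [exact: integZ|exact: integ_cst].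
rewrite IB// IB; [|exact: integZ|exact: integ_cst].
rewrite IZ// I_cst//.
set M := I a b (fun x => f x ^+ 2).
move=> H; have {H} : 0 <= M - (2 * (m / (b - a)) * m - (m / (b - a)) ^+ 2 * (b - a)).
  apply: H => x _ _; have := sqr_ge0 (`|f x| - m / (b - a)).
  rewrite sqrrB real_normK ?num_real//; lra.
have ba : 0 < b - a by rewrite subr_gt0.
have -> : M - (2 * (m / (b - a)) * m - (m / (b - a)) ^+ 2 * (b - a)) = ((b - a) * M - m ^+ 2) / (b - a).
  by field; rewrite gt_eqF.
by rewrite pmulr_lge0 ?invr_gt0// subr_ge0.
Qed.

(** The supremum of the points that [P] reaches from [a] has a neighbourhood where [P] holds
    locally, so it is reached and can be passed unless it is [b]. This replaces finite subcovers
    whenever an additive property of intervals is checked near each point. *)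
Lemma cousin (P : R -> R -> Prop) a b : a <= b ->
  (forall x y z, a <= x -> x <= y -> y <= z -> z <= b -> P x y -> P y z -> P x z) ->
  (forall c, a <= c -> c <= b -> exists2 d, 0 < d & forall x y, a <= x -> x <= y ->
     y <= b -> c - d < x -> y < c + d -> P x y) ->
  P a b.
Proof.
move=> ab Padd Ploc.
pose S := [set x | a <= x <= b /\ P a x].
have Sa : S a.
  split; first by rewrite lexx.
  by have [d d0] := Ploc a (lexx a) ab; apply => //; lra.
have Sub : ubound S b by move=> x [/andP[]].
have hS : has_sup S by split; [exists a|exists b].
pose c := sup S.
have ac : a <= c by apply: ub_le_sup => //; exists b.
have cb : c <= b by apply: ge_sup => //; exists a.
have [d d0 Pd] := Ploc c ac cb.
have [x [/andP[ax xb] Pax] cx] := sup_adherent d0 hS.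
have xc : x <= c by apply: ub_le_sup; [exists b|split=> //; rewrite ax xb].
pose y := Order.min b (c + d / 2).
have xy : x <= y.
  by rewrite /y le_min xb/=; lra.
have yb : y <= b by rewrite /y ge_min lexx.
have yd : y < c + d by rewrite /y gt_min; apply/orP; right; lra.
have Pay : P a y.
  by apply: (Padd a x y) => //; apply: Pd.
have Sy : S y by split=> //; rewrite yb andbT; lra.
have yc : y <= c by apply: ub_le_sup; [exists b|].
suff <- : y = b by [].
move: yc; rewrite /y; case: (leP b (c + d / 2)) => // _; lra.
Qed.

End IntervalIntegrals.

(** * Calculus of absolutely continuous functions *)

Section Primitives.
Context {R : realType}.
Local Notation mu := (@lebesgue_measure R).
Implicit Types (A B : set R) (f g h : R -> R) (a b c x y z : R).

(* [f] is absolutely continuous on [a, b] with almost everywhere derivative [g]. *)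
Definition prim a b f g := integ `[a, b] g /\
  forall x y, a <= x -> x <= y -> y <= b -> f y - f x = I x y g.

Lemma prim_sub a b c d f g : prim a b f g -> a <= c -> d <= b -> prim c d f g.
Proof.
move=> [ig fg] ac db; split; first exact: (integ_sub ig).
by move=> x y cx xy yd; apply: fg => //; [exact: le_trans cx|exact: le_trans db].
Qed.

Lemma prim_within a b f g : prim a b f g -> {within `[a, b], continuous f}.
Proof.
move=> [ig fg]; case: (leP a b) => [ab|ba]; last first.
  by rewrite set_itv_ge ?bnd_simp -?ltNge//; exact: continuous_subspace0.
have cF := @parameterized_integral_continuous R a b g ab ig.
apply: (@subspace_eq_continuous _ _ _ (fun x => f a + parameterized_integral mu a x g)).
  move=> y; rewrite inE/= in_itv/= => /andP[ay yb].
  by have := fg a y (lexx _) ay yb; rewrite /I /parameterized_integral /from_subspace/=; lin.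
by move=> x; apply: cvgD; [exact: cvg_cst|exact: cF].
Qed.

Lemma withinP a b f c : {within `[a, b], continuous f} -> a <= c -> c <= b ->
  forall e, 0 < e -> exists2 d, 0 < d &
    forall x, a <= x -> x <= b -> c - d < x -> x < c + d -> `|f x - f c| < e.
Proof.
move=> /subspace_continuousP cf ac cb e e0.
have /cvgrPdist_lt/(_ e e0) : f @ within `[a, b] (nbhs c) --> f c.
  by apply: cf; rewrite /= in_itv/= ac cb.
rewrite near_withinE => /nbhs_ballP[d /= d0 H]; exists d => // x ax xb cx xc.
rewrite distrC; apply: (H x); last by rewrite /= in_itv/= ax xb.
by rewrite /ball/= ltr_norml; lin.
Qed.

Lemma within_bnd a b f : {within `[a, b], continuous f} ->
  exists2 C : R, 0 <= C & forall x, a <= x -> x <= b -> `|f x| <= C.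
Proof.
move=> cf; case: (leP a b) => [ab|ba]; last first.
  exists 0 => // x ax xb; exfalso; lin.
have [M _ HM] := EVT_max ab cf; have [m _ Hm] := EVT_min ab cf.
exists (`|f M| + `|f m|); first by rewrite addr_ge0.
move=> x ax xb; have xab : x \in `[a, b] by rewrite in_itv/= ax xb.
have := HM _ xab; have := Hm _ xab; have := ler_norm (f M); have := ler_norm (- f m).
have := normr_ge0 (f M); have := normr_ge0 (f m).
by rewrite normrN ler_norml; lin.
Qed.

Lemma within_meas a b f : {within `[a, b], continuous f} -> measurable_fun `[a, b] f.
Proof. by move=> cf; apply: subspace_continuous_measurable_fun. Qed.

Lemma prim_cont a b f g c : prim a b f g -> a <= c -> c <= b ->
  forall e, 0 < e -> exists2 d, 0 < d &
    forall x, a <= x -> x <= b -> c - d < x -> x < c + d -> `|f x - f c| < e.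
Proof. by move=> /prim_within; exact: withinP. Qed.

Lemma prim_bnd a b f g : prim a b f g ->
  exists2 C : R, 0 <= C & forall x, a <= x -> x <= b -> `|f x| <= C.
Proof. by move=> /prim_within/within_bnd. Qed.

Lemma prim_meas a b f g : prim a b f g -> measurable_fun `[a, b] f.
Proof. by move=> /prim_within/within_meas. Qed.

Lemma prim_integ a b f g : prim a b f g -> integ `[a, b] g.
Proof. by case. Qed.

(** Errors proportional to the integral of [m] add up along adjacent intervals, so [cousin] makes a
    local estimate global, and then [e] tends to 0. Product and chain rules follow from continuity
    alone, without differentiating at almost every point. *)
Lemma prim_glue a b f g m : integ `[a, b] g -> integ `[a, b] m ->
  (forall x, a <= x -> x <= b -> 0 <= m x) ->
  (forall e, 0 < e -> forall c, a <= c -> c <= b -> exists2 d, 0 < d &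
    forall x y, a <= x -> x <= y -> y <= b -> c - d < x -> y < c + d ->
      `|f y - f x - I x y g| <= e * I x y m) ->
  prim a b f g.
Proof.
move=> ig im m0 H; split=> // u v au uv vb.
apply/eqP; rewrite -subr_eq0 -normr_le0.
have Hm : 0 <= I u v m by apply: I_ge0 => x ux xv; apply: m0; lin.
apply/ler_addgt0Pl => e e0; rewrite addr0.
pose e' := e / (1 + I u v m).
have e'0 : 0 < e' by rewrite divr_gt0//; lin.
suff : `|f v - f u - I u v g| <= e' * I u v m.
  move/le_trans; apply; rewrite /e' mulrAC ler_pdivrMr; last lin.
  by rewrite ler_wpM2l//; lin.
apply: (@cousin _ (fun x y => `|f y - f x - I x y g| <= e' * I x y m) u v) => //.
  move=> x y z ux xy yz zv h1 h2.
  rewrite (@I_split _ x y z g)// ?(@I_split _ x y z m)//.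
  - have -> : f z - f x - (I x y g + I y z g) = (f y - f x - I x y g) + (f z - f y - I y z g).
      by ring.
    by rewrite mulrDr (le_trans (ler_normD _ _))// lerD.
  - by apply: (integ_sub im); lin.
  - by apply: (integ_sub ig); lin.
move=> c uc cv; have [||d d0 Hd] := H e' e'0 c; [lin|lin|].
by exists d => // x y ux xy yv; apply: Hd => //; lin.
Qed.

Lemma primD a b f f' g g' : prim a b f f' -> prim a b g g' ->
  prim a b (fun x => f x + g x) (fun x => f' x + g' x).
Proof.
move=> [if' Ef] [ig' Eg]; split; first exact: integD.
move=> x y ax xy yb; rewrite ID; try by apply: integ_sub ax yb.
rewrite -Ef// -Eg//; ring.
Qed.

Lemma primZ a b k f f' : prim a b f f' ->
  prim a b (fun x => k * f x) (fun x => k * f' x).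
Proof.
move=> [if' Ef]; split; first exact: integZ.
move=> x y ax xy yb; rewrite IZ; last by apply: integ_sub ax yb.
rewrite -Ef//; ring.
Qed.

Lemma primB a b f f' g g' : prim a b f f' -> prim a b g g' ->
  prim a b (fun x => f x - g x) (fun x => f' x - g' x).
Proof.
move=> [if' Ef] [ig' Eg]; split; first exact: integB.
move=> x y ax xy yb; rewrite IB; try by apply: integ_sub ax yb.
rewrite -Ef// -Eg//; ring.
Qed.

Lemma prim_cst a b k : prim a b (fun=> k) (fun=> 0).
Proof.
split; first exact: integ_cst.
by move=> x y ax xy yb; rewrite I_cst// mul0r subrr.
Qed.

Lemma prim_id a b : prim a b id (fun=> 1).
Proof.
split; first exact: integ_cst.
by move=> x y ax xy yb; rewrite I_cst// mul1r.
Qed.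

Lemma prim_ext a b f f' g g' : prim a b f g ->
  (forall x, a <= x -> x <= b -> f x = f' x) ->
  (forall x, a <= x -> x <= b -> g x = g' x) -> prim a b f' g'.
Proof.
move=> [ig Ef] ff gg; split.
  by apply: eq_integ ig => // x; rewrite inE/= in_itv/= => /andP[ax xb]; rewrite gg.
move=> x y ax xy yb; rewrite -!ff ?Ef//; [|lin|lin].
by apply: eq_I => t xt ty; apply: gg; lin.
Qed.

Lemma prim_mul a b f f' g g' : prim a b f f' -> prim a b g g' ->
  prim a b (fun x => f x * g x) (fun x => f' x * g x + f x * g' x).
Proof.
move=> Pf Pg.
have [Cf Cf0 Hf] := prim_bnd Pf; have [Cg Cg0 Hg] := prim_bnd Pg.
have i1 : integ `[a, b] (fun x => f' x * g x).
  apply: (@eq_integ _ _ (fun x => g x * f' x)) => //; first by move=> x _; rewrite mulrC.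
  apply: (integM_bnd (C := Cg)) => //; [exact: prim_meas Pg| |exact: prim_integ Pf].
  by move=> x /=; rewrite in_itv/= => /andP[]; exact: Hg.
have i2 : integ `[a, b] (fun x => f x * g' x).
  apply: (integM_bnd (C := Cf)) => //; [exact: prim_meas Pf| |exact: prim_integ Pg].
  by move=> x /=; rewrite in_itv/= => /andP[]; exact: Hf.
apply: (@prim_glue _ _ _ _ (fun x => `|f' x| + `|g' x|)).
- exact: integD.
- by apply: integD => //; apply: integ_norm => //; [exact: prim_integ Pf|exact: prim_integ Pg].
- by move=> x _ _; rewrite addr_ge0.
move=> e e0 c ac cb.
have e2 : 0 < e / 2 by lin.
have [d1 d10 H1] := prim_cont Pf ac cb e2.
have [d2 d20 H2] := prim_cont Pg ac cb e2.
exists (Order.min d1 d2); first by rewrite lt_min d10.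
move=> x y ax xy yb cx yc.
have [c1 c2] : c - d1 < x /\ c - d2 < x.
  by move: cx; rewrite !ltrBlDr -!ltrBlDl lt_min => /andP[].
have [c3 c4] : y < c + d1 /\ y < c + d2.
  by move: yc; rewrite -!ltrBlDl lt_min => /andP[].
have sI h : integ `[a, b] h -> integ `[x, y] h by move=> ih; exact: (integ_sub ih).
have if' := sI _ (prim_integ Pf); have ig' := sI _ (prim_integ Pg).
have Ef : f y - f x = I x y f' by apply: Pf.2.
have Eg : g y - g x = I x y g' by apply: Pg.2.
(* The increment of the product is g(y) (f(y) - f(x)) + f(x) (g(y) - g(x)). With [g] frozen at [y]
   and [f] at [x], the error is an exact integral whose integrand is small by continuity. *)
have -> : f y * g y - f x * g x - I x y (fun t => f' t * g t + f t * g' t)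
   = I x y (fun t => (g y * f' t - f' t * g t) + (f x * g' t - f t * g' t)).
  rewrite [RHS]ID; [|by apply: integB => //; [exact: integZ|exact: sI]..].
  rewrite !IB//; [|exact: integZ|exact: sI|exact: integZ|exact: sI].
  rewrite !IZ// -Ef -Eg ID; [|exact: sI|exact: sI]; ring.
apply: (le_trans (I_norm _)).
  by apply: integD => //; apply: integB => //; try exact: integZ; exact: sI.
rewrite -IZ; last by apply: integD => //; apply: integ_norm.
apply: I_le.
- apply: integ_norm => //; by apply: integD => //; apply: integB => //; try exact: integZ; exact: sI.
- by apply: integZ => //; apply: integD => //; apply: integ_norm.
move=> t xt ty.
apply: (le_trans (ler_normD _ _)).
have -> : g y * f' t - f' t * g t = (g y - g t) * f' t by ring.
rewrite -mulrBl !normrM mulrDr lerD// ler_wpM2r//.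
- have := H2 y; have := H2 t; rewrite !ltr_norml ler_norml.
  move=> /(_ _ _ _ _)/andP[||||? ?]; [lin..|]. move=> /(_ _ _ _ _)/andP[||||? ?]; [lin..|]. lin.
- have := H1 x; have := H1 t; rewrite !ltr_norml ler_norml.
  move=> /(_ _ _ _ _)/andP[||||? ?]; [lin..|]. move=> /(_ _ _ _ _)/andP[||||? ?]; [lin..|]. lin.
Qed.

(** The mean value theorem turns the increment of [P] along [f] into p(xi) times that of [f], and
    p(xi) is close to p(f t) nearby. The half-line from [m] accommodates square roots, which are
    differentiable only away from 0. *)
Lemma prim_comp a b f g (m : R) (P p : R -> R) : prim a b f g ->
  (forall x, a <= x -> x <= b -> m <= f x) ->
  (forall t : R, m <= t -> is_derive t 1 P (p t)) ->
  (forall t : R, m <= t -> {for t, continuous p}) ->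
  prim a b (fun x => P (f x)) (fun x => p (f x) * g x).
Proof.
move=> Pf mf dP cp.
have cpf : {within `[a, b], continuous (p \o f)}.
  apply/subspace_continuousP => x xab.
  have /subspace_continuousP/(_ x xab) cf := prim_within Pf.
  apply: cvg_comp cf _; apply: cp; apply: mf; move: xab; rewrite /= in_itv/= => /andP[]//.
have [C C0 HC] := within_bnd cpf.
have ig := prim_integ Pf.
have ipg : integ `[a, b] (fun x => p (f x) * g x).
  apply: (integM_bnd (C := C)) => //; first exact: within_meas.
  by move=> x /=; rewrite in_itv/= => /andP[]; exact: HC.
apply: (@prim_glue _ _ _ _ (fun x => `|g x|)) => //; first exact: integ_norm.
move=> e e0 c ac cb.
have /cvgrPdist_lt/(_ (e / 2)) : p t @[t --> f c] --> p (f c) by apply: cp; apply: mf.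
move=> /(_ ltac:(lin))/nbhs_ballP[r /= r0 Hr].
have [d d0 Hd] := prim_cont Pf ac cb r0.
exists d => // x y ax xy yb cx yc.
have sI h : integ `[a, b] h -> integ `[x, y] h by move=> ih; exact: (integ_sub ih).
have Hp t : f c - r < t -> t < f c + r -> `|p (f c) - p t| < e / 2.
  by move=> h1 h2; apply: Hr; rewrite /ball/= ltr_norml; lin.
have [ct1 ct2] : `|f x - f c| < r /\ `|f y - f c| < r by split; apply: Hd => //; lin.
have [xi [xi1 xi2 Exi]] : exists xi, [/\ f c - r < xi, xi < f c + r &
   P (f y) - P (f x) = p xi * (f y - f x)].
  move: ct1 ct2; rewrite !ltr_norml => /andP[h1 h2] /andP[h3 h4].
  have mfx : m <= f x by apply: mf => //; lin.
  have mfy : m <= f y by apply: mf => //; lin.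
  have cP u v : m <= u -> {within `[u, v], continuous P}.
    move=> mu_; apply: derivable_within_continuous => t; rewrite in_itv/= => /andP[ut tv].
    by have [] : is_derive t 1 P (p t) by apply: dP; lin.
  case: (leP (f x) (f y)) => fxy.
    have [|xi + Exi] := @MVT_segment R P p _ _ fxy _ (cP _ _ mfx).
      by move=> t; rewrite in_itv/= => /andP[h5 h6]; apply: dP; lin.
    by rewrite in_itv/= => /andP[h5 h6]; exists xi; split; lin.
  have [|xi + Exi] := @MVT_segment R P p _ _ (ltW fxy) _ (cP _ _ mfy).
    by move=> t; rewrite in_itv/= => /andP[h5 h6]; apply: dP; lin.
  by rewrite in_itv/= => /andP[h5 h6]; exists xi; split; lin.
rewrite Exi (Pf.2 x y)// -IZ; last exact: sI.
rewrite -IB; [|exact/integZ/sI|exact: sI].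
apply: (le_trans (I_norm _)).
  by apply: integB => //; [exact/integZ/sI|exact: sI].
rewrite -IZ; last exact/integ_norm/sI.
apply: I_le.
- apply: integ_norm => //; apply: integB => //; [exact/integZ/sI|exact: sI].
- by apply: integZ => //; exact/integ_norm/sI.
move=> t xt ty; rewrite -mulrBl normrM ler_wpM2r//.
have := Hd t; rewrite ltr_norml => /(_ _ _ _ _)/andP[||||? ?]; [lin..|].
have := Hp xi xi1 xi2; have := Hp (f t).
rewrite !ltr_norml => /(_ _ _)/andP[||? ?]; [lin..|] => /andP[? ?].
by rewrite ler_norml; lin.
Qed.

Lemma prim_C1 a b (P p : R -> R) : (forall t : R, is_derive t 1 P (p t)) ->
  continuous p -> prim a b P p.
Proof.
move=> dP cp; have := @prim_comp a b id (fun=> 1) a P p (@prim_id a b).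
move=> /(_ (fun x ax _ => ax) (fun t _ => dP t) (fun t _ => cp t)).
by move/prim_ext; apply => // x _ _; rewrite mulr1.
Qed.

End Primitives.

(** * Explicit C^1 step functions *)

Section Bump.
Context {R : realType}.
Local Notation mu := (@lebesgue_measure R).
Implicit Types (A U : set R) (f g h : R -> R) (a b c x y z r s t : R).

(** A quadratic remainder is easily checked by cases for the square of a positive part, including at
    its kink. *)
Lemma is_derive_quad f x l C :
  (forall k, `|f (x + k) - f x - l * k| <= C * k ^+ 2) -> is_derive x 1 f l.
Proof.
move=> H.
have cv : h^-1 *: (f (h *: (1:R) + x) - f x) @[h --> 0^'] --> l.
  apply/cvgrPdist_le => e e0; near=> h.
  have h0 : h != 0 by near: h; exact: nbhs_dnbhs_neq.
  have := H h; rewrite [x + h]addrC => Hh.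
  rewrite /GRing.scale/= mulr1.
  have -> : l - h^-1 * (f (h + x) - f x) = - (h^-1 * (f (h + x) - f x - l * h)).
    by field.
  rewrite normrN normrM normfV ler_pdivrMl ?normr_gt0//.
  apply: (le_trans Hh); rewrite -(real_normK (num_real h)) expr2 mulrA mulrC ler_wpM2l//.
  apply: (@le_trans _ _ (`|C| * `|h|)).
    by rewrite ler_wpM2r// ler_norm.
  have hs : `|h| < e / (1 + `|C|).
    near: h; apply: dnbhs0_lt; rewrite divr_gt0//; have := normr_ge0 C; lra.
  have c1 : 0 < 1 + `|C| by have := normr_ge0 C; lra.
  move: hs; rewrite ltr_pdivlMr// mulrDr mulr1 => hs.
  have := normr_ge0 h; rewrite mulrC; lra.
by apply: DeriveDef; [apply/cvg_ex; exists l|apply/cvg_lim].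
Unshelve. all: by end_near. Qed.

(* [stp s r] is a C^1 step from 0 to 1 across [s - r, s + r]; as a second
   difference of [(max x 0)^2] it is a piecewise quadratic, and differences of
   two such steps are the only test functions needed. *)
Definition pp x := Num.max x 0.

Lemma pp_cont : continuous pp.
Proof. by move=> x; apply: continuous_max; [exact: cvg_id|exact: cvg_cst]. Qed.

Definition step x := (pp (x + 1) ^+ 2 - 2 * pp x ^+ 2 + pp (x - 1) ^+ 2) / 2.
Definition tent x := pp (x + 1) - 2 * pp x + pp (x - 1).


Lemma step_lo x : x <= -1 -> step x = 0.
Proof.
move=> x1; rewrite /step /pp.
by case: (leP (x + 1) 0); case: (leP x 0); case: (leP (x - 1) 0) => ? ? ?; try lra; nra.
Qed.

Lemma step_hi x : 1 <= x -> step x = 1.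
Proof.
move=> x1; rewrite /step /pp.
by case: (leP (x + 1) 0); case: (leP x 0); case: (leP (x - 1) 0) => ? ? ?; try lra; nra.
Qed.

Lemma tent_lo x : x <= -1 -> tent x = 0.
Proof.
move=> x1; rewrite /tent /pp.
by case: (leP (x + 1) 0); case: (leP x 0); case: (leP (x - 1) 0) => ? ? ?; lra.
Qed.

Lemma tent_hi x : 1 <= x -> tent x = 0.
Proof.
move=> x1; rewrite /tent /pp.
by case: (leP (x + 1) 0); case: (leP x 0); case: (leP (x - 1) 0) => ? ? ?; lra.
Qed.

Lemma tent_ge0 x : 0 <= tent x.
Proof.
rewrite /tent /pp.
by case: (leP (x + 1) 0); case: (leP x 0); case: (leP (x - 1) 0) => ? ? ?; lra.
Qed.

Lemma tent_le1 x : tent x <= 1.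
Proof.
rewrite /tent /pp.
by case: (leP (x + 1) 0); case: (leP x 0); case: (leP (x - 1) 0) => ? ? ?; lra.
Qed.

Lemma tent_cont : continuous tent.
Proof.
move=> x; apply: cvgD.
  apply: cvgB; first by apply: (@cvg_comp _ _ _ (fun y => y + 1) pp);
    [apply: cvgD; [exact: cvg_id|exact: cvg_cst]|exact: pp_cont].
  by apply: cvgM; [exact: cvg_cst|exact: pp_cont].
by apply: (@cvg_comp _ _ _ (fun y => y - 1) pp);
  [apply: cvgB; [exact: cvg_id|exact: cvg_cst]|exact: pp_cont].
Qed.

Definition stp s r x := step ((x - s) / r).
Definition dstp s r x := tent ((x - s) / r) / r.

Lemma is_derive_pp2_comp c k x : is_derive x 1 (fun y => pp (k * y + c) ^+ 2) (2 * pp (k * x + c) * k).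
Proof.
apply: (@is_derive_quad _ _ _ (k ^+ 2)) => h; rewrite /pp.
rewrite ler_norml mulrDr.
have h1 : (k * h) ^+ 2 = k ^+ 2 * h ^+ 2 by ring.
move: h1; set u := k * x; set v := k * h => <-.
have -> : forall z, z * k * h = z * v by move=> z; rewrite /v; ring.
by case: (leP (u + v + c) 0); case: (leP (u + c) 0) => ? ?; nra.
Qed.

Lemma is_derive_stp s r x : 0 < r -> is_derive x 1 (stp s r) (dstp s r x).
Proof.
move=> r0.
have E : stp s r = (fun y => 2^-1 * (pp (r^-1 * y + (1 - s / r)) ^+ 2
   + (-2) * pp (r^-1 * y + (- s / r)) ^+ 2 + pp (r^-1 * y + (-1 - s / r)) ^+ 2)).
  apply/funext => y; rewrite /stp /step.
  have -> : (y - s) / r + 1 = r^-1 * y + (1 - s / r) by ring.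
  have -> : (y - s) / r - 1 = r^-1 * y + (-1 - s / r) by ring.
  have -> : (y - s) / r = r^-1 * y + (- s / r) by ring.
  lra.
have E' : dstp s r x = 2^-1 * (2 * pp (r^-1 * x + (1 - s / r)) * r^-1
   + (-2) * (2 * pp (r^-1 * x + (- s / r)) * r^-1) + 2 * pp (r^-1 * x + (-1 - s / r)) * r^-1).
  rewrite /dstp /tent.
  have -> : (x - s) / r + 1 = r^-1 * x + (1 - s / r) by ring.
  have -> : (x - s) / r - 1 = r^-1 * x + (-1 - s / r) by ring.
  have -> : (x - s) / r = r^-1 * x + (- s / r) by ring.
  lra.
rewrite E E'; apply: is_deriveZ; apply: is_deriveD; last exact: is_derive_pp2_comp.
apply: is_deriveD; first exact: is_derive_pp2_comp.
by apply: is_deriveZ; exact: is_derive_pp2_comp.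
Qed.

Lemma dstp_cont s r : continuous (dstp s r).
Proof.
move=> x; apply: cvgM; last exact: cvg_cst.
apply: (@cvg_comp _ _ _ (fun y => (y - s) / r) tent); last exact: tent_cont.
by apply: cvgM; [apply: cvgB; [exact: cvg_id|exact: cvg_cst]|exact: cvg_cst].
Qed.

Lemma stp_lo s r x : 0 < r -> x <= s - r -> stp s r x = 0.
Proof. by move=> r0 xs; rewrite /stp step_lo// ler_pdivrMr//; lra. Qed.

Lemma stp_hi s r x : 0 < r -> s + r <= x -> stp s r x = 1.
Proof. by move=> r0 xs; rewrite /stp step_hi// ler_pdivlMr//; lra. Qed.

Lemma dstp_out s r x : 0 < r -> x <= s - r \/ s + r <= x -> dstp s r x = 0.
Proof.
move=> r0 [xs|xs]; rewrite /dstp.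
  by rewrite tent_lo ?mul0r// ler_pdivrMr//; lra.
by rewrite tent_hi ?mul0r// ler_pdivlMr//; lra.
Qed.

Lemma dstp_ge0 s r x : 0 < r -> 0 <= dstp s r x.
Proof. by move=> r0; rewrite /dstp divr_ge0 ?tent_ge0// ltW. Qed.

Lemma dstp_le s r x : 0 < r -> dstp s r x <= r^-1.
Proof. by move=> r0; rewrite /dstp ler_piMl ?tent_le1// invr_ge0 ltW. Qed.

Lemma prim_stp s r a b : 0 < r -> prim a b (stp s r) (dstp s r).
Proof.
by move=> r0; apply: prim_C1 => [t|]; [exact: is_derive_stp|exact: dstp_cont].
Qed.

End Bump.

(** * Absolutely continuous representatives of weakly differentiable functions *)

Section WeakAC.
Context {R : realType}.
Local Notation mu := (@lebesgue_measure R).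
Implicit Types (A U : set R) (f g h : R -> R) (a b c x y z r s t : R).

Lemma integ_patch A f : measurable A -> integ A f <-> integ setT (f \_ A).
Proof.
move=> mA; rewrite /integ.
have -> : EFin \o (f \_ A) = (EFin \o f) \_ A.
  by apply/funext => x /=; rewrite /patch; case: ifP.
exact: (@integrable_mkcond _ _ _ mu A (EFin \o f) mA).
Qed.

Lemma integE A f : measurable A -> integ A f ->
  (\int[mu]_(x in A) (f x)%:E)%E = (\int[mu]_(x in A) f x)%:E.
Proof. by move=> mA iF; rewrite /Rintegral fineK//; exact: integrable_fin_num. Qed.

Lemma L2_sqr A f : measurable A -> L2 A f -> integ A (fun x => f x ^+ 2).
Proof.
move=> mA [mf lf]; apply/integrableP; split.
  by apply/measurable_EFinP; exact: measurable_funX.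
rewrite (@eq_integral _ _ _ mu A (fun x => (f x ^+ 2)%:E)) // => x _ /=.
by rewrite ger0_norm ?sqr_ge0.
Qed.

Lemma sqr_L2 A f : measurable_fun A f -> integ A (fun x => f x ^+ 2) -> L2 A f.
Proof.
move=> mf /integrableP[_ H]; split=> //; apply: le_lt_trans H.
rewrite (@eq_integral _ _ _ mu A (fun x => `|(EFin \o (fun x0 => (f x0 ^+ 2)%R)) x|%E)) // => x _ /=.
by rewrite ger0_norm ?sqr_ge0.
Qed.

Lemma integ_of_sqr A f a b : measurable A -> A `<=` `[a, b] -> measurable_fun A f ->
  integ A (fun x => f x ^+ 2) -> integ A f.
Proof.
move=> mA AB mf i2.
have i1 : integ A (fun=> 1) by apply: (@integS _ _ `[a, b]) => //; exact: integ_cst.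
apply: (integ_le mA mf _ (integD mA i2 i1)) => x _.
have := sqr_ge0 (`|f x| - 1); rewrite sqrrB expr1n mulr1 real_normK ?num_real//.
have := sqr_ge0 (f x); have := normr_ge0 (f x); lra.
Qed.

Lemma L2_integ A f a b : measurable A -> A `<=` `[a, b] -> L2 A f -> integ A f.
Proof.
by move=> mA AB lf; apply: (integ_of_sqr mA AB lf.1); exact: L2_sqr.
Qed.

Lemma lebesgue_ptP h x : integ setT h -> lebesgue_pt h x ->
  forall e, 0 < e -> exists2 d, 0 < d & forall r, 0 < r -> r < d ->
    I (x - r) (x + r) (fun y => `|h y - h x|) <= e * r.
Proof.
move=> ih; move=> /fine_cvgP[_ /cvgrPdist_lt H] e e0.
have /H := divr_gt0 e0 (ltr0Sn R 1).
rewrite near_withinE => /nbhs_ballP[d /= d0 Hd]; exists d => // r r0 rd.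
have := Hd r; rewrite /ball/= sub0r normrN gtr0_norm// => /(_ rd r0).
have E : davg h x r = (((r *+ 2)%:E)^-1 *
    \int[mu]_(y in `](x - r)%R, (x + r)%R[) `|(h y - h x)%:E|)%E.
  by rewrite /davg /iavg lebesgue_measure_ball ?ltW// -ball_itv.
rewrite sub0r normrN E -(@integral_itv_bndoo _ _ _ _ true false); last first.
  apply/measurable_EFinP/measurableT_comp => //; apply/measurable_EFinP.
  apply/measurable_EFinP; apply: measurable_funB => //.
  by apply: measurable_funS (integ_meas ih).
set J := (\int[mu]_(y in _) _)%E.
have JE : J = (I (x - r) (x + r) (fun y => `|h y - h x|))%:E.
  rewrite -integE//; apply: (@integ_norm R `[x - r, x + r] (fun y => h y - h x)) => //.
  apply: integB => //; last exact: integ_cst.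
  by apply: (integS _ _ _ ih).
rewrite JE inver gt_eqF; last by rewrite mulrn_wgt0.
rewrite -EFinM/= ger0_norm; last first.
  have i0 : 0 <= I (x - r) (x + r) (fun y => `|h y - h x|) by exact: I_ge0.
  by rewrite mulr_ge0// invr_ge0 mulrn_wge0// ltW.
rewrite ltr_pdivrMl; last by rewrite mulrn_wgt0.
by move/ltW; rewrite -mulr_natl; lra.
Qed.


(** The kernel [dstp s r] is nonnegative, has mass 1 and is at most 1 / r, so its average of h -
    h(s) is controlled by that of |h - h(s)| over the ball. *)
Lemma avg_lim h s e : integ setT h -> lebesgue_pt h s -> 0 < e ->
  exists2 d, 0 < d & forall r, 0 < r -> r < d ->
    `|I (s - r) (s + r) (fun x => h x * dstp s r x) - h s| <= e.
Proof.
move=> ih ps e0; have [d d0 Hd] := lebesgue_ptP ih ps e0.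
exists d => // r r0 rd.
have sr : s - r <= s + r by lra.
have ih' : integ `[s - r, s + r] h by apply: (integS _ _ _ ih).
have ihs : integ `[s - r, s + r] (fun x => h x - h s).
  by apply: integB => //; exact: integ_cst.
have Pd := @prim_stp R s r (s - r) (s + r) r0.
have i1 : integ `[s - r, s + r] (fun x => dstp s r x * (h x - h s)).
  apply: (integM_bnd (C := r^-1)) => //.
    exact: (integ_meas (prim_integ Pd)).
  by move=> x _; rewrite ger0_norm ?dstp_ge0// dstp_le.
have E1 : I (s - r) (s + r) (dstp s r) = 1.
  by rewrite -Pd.2// stp_hi// stp_lo// subr0.
have -> : I (s - r) (s + r) (fun x => h x * dstp s r x) - h s =
          I (s - r) (s + r) (fun x => dstp s r x * (h x - h s)).
  rewrite -[X in _ - X]mulr1 -E1 -IZ; last exact: prim_integ Pd.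
  rewrite -IB; [by apply: eq_I => x _ _; ring| |exact/integZ/prim_integ/Pd].
  apply: (@eq_integ _ _ (fun x => dstp s r x * (h x - h s) + h s * dstp s r x)) => //.
    by move=> x _; ring.
  by apply: integD => //; exact/integZ/prim_integ/Pd.
apply: (le_trans (I_norm i1)).
apply: (@le_trans _ _ (I (s - r) (s + r) (fun x => r^-1 * `|h x - h s|))).
  apply: I_le; [exact: integ_norm|exact/integZ/integ_norm|].
  move=> x _ _; rewrite normrM ler_wpM2r//.
  by rewrite ger0_norm ?dstp_ge0// dstp_le.
rewrite IZ; last exact: integ_norm.
by rewrite ler_pdivrMl// mulrC; exact: Hd.
Qed.

Lemma ae_mono (P Q : set R) : {ae mu, forall x, P x} -> (forall x, P x -> Q x) ->
  {ae mu, forall x, Q x}.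
Proof. by move=> aeP PQ; apply: negligibleS aeP => x /= nQ Px; apply/nQ/PQ. Qed.

Lemma ae_and (P Q : set R) : {ae mu, forall x, P x} -> {ae mu, forall x, Q x} ->
  {ae mu, forall x, P x /\ Q x}.
Proof.
move=> aeP aeQ; have := negligibleU aeP aeQ; apply: negligibleS => x /= nPQ.
by case: (pselect (P x)) => Px; [right=> Qx; apply: nPQ|left].
Qed.

Lemma ae_pick (P : set R) a b : {ae mu, forall x, P x} -> a < b ->
  exists x, [/\ a < x, x < b & P x].
Proof.
move=> aeP ab; apply: contrapT => nP.
have : mu.-negligible `]a, b[.
  apply: negligibleS aeP => x /=; rewrite in_itv/= => /andP[ax xb] Px.
  by apply: nP; exists x.
move=> N; have : mu `]a, b[ = 0%E by apply/negligibleP.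
rewrite lebesgue_measure_itv/= lte_fin ab -EFinB => /eqP.
by rewrite eqe subr_eq0 gt_eqF.
Qed.

Lemma int_supp A B h : measurable A -> measurable B -> B `<=` A ->
  (forall x, A x -> ~ B x -> h x = 0) ->
  \int[mu]_(x in A) h x = \int[mu]_(x in B) h x.
Proof.
move=> mA mB BA h0; rewrite Rintegral_mkcond [RHS]Rintegral_mkcond.
congr Rintegral; apply/funext => x; rewrite /patch.
case: ifPn => [|/negP] xA; case: ifPn => [|/negP] xB //.
- by apply: h0; [exact: set_mem|move=> Bx; apply: xB; exact: mem_set].
- by exfalso; apply: xA; apply: mem_set; apply: BA; exact: set_mem.
Qed.

Lemma stp_test U s t r : 0 < r -> s <= t -> (forall x, s - r <= x <= t + r -> U x) ->
  test_function U (fun x => stp s r x - stp t r x) /\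
  derive1 (fun x => stp s r x - stp t r x) = (fun x => dstp s r x - dstp t r x).
Proof.
move=> r0 st sU.
have D x : is_derive x 1 (fun x => stp s r x - stp t r x) (dstp s r x - dstp t r x).
  by apply: is_deriveB; exact: is_derive_stp.
have E : derive1 (fun x => stp s r x - stp t r x) = (fun x => dstp s r x - dstp t r x).
  by apply/funext => x; rewrite derive1E derive_val.
split=> //; split.
- by move=> x; case: (D x).
- by rewrite E => x; apply: cvgB; exact: dstp_cont.
- exists `[s - r, t + r]%classic; split.
  + exact: segment_compact.
  + by move=> x /=; rewrite in_itv/=; exact: sU.
  + move=> x /=; rewrite in_itv/= => /negP; rewrite negb_and -!ltNge => /orP[xs|xt].
      by rewrite !stp_lo ?subrr//; lra.
    by rewrite !stp_hi ?subrr//; lra.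
Qed.

Definition connects U x y := forall z, (x <= z <= y) \/ (y <= z <= x) -> U z.

Lemma conn_sym U x y : connects U x y -> connects U y x.
Proof. by move=> H z [?|?]; apply: H; [right|left]. Qed.

Lemma conn_trans U x y z : connects U x y -> connects U y z -> connects U x z.
Proof.
move=> H1 H2 w [/andP[h1 h2]|/andP[h1 h2]].
- case: (leP w y) => wy; first by apply: H1; left; rewrite h1.
  by apply: H2; left; rewrite h2 ltW.
- case: (leP w y) => wy; first by apply: H2; right; rewrite h1.
  by apply: H1; right; rewrite h2 ltW.
Qed.

Lemma small2 a b : 0 < a -> 0 < b -> exists r, [/\ 0 < r, r < a & r < b].
Proof.
move=> a0 b0; case: (leP a b) => ab; [exists (a / 2)|exists (b / 2)]; split; lra.
Qed.

Lemma open_ball U x : open U -> U x ->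
  exists2 r, 0 < r & forall y, x - r <= y <= x + r -> U y.
Proof.
move=> oU Ux; have /nbhs_ballP[d /= d0 Hd] : nbhs x U by apply: open_nbhs_nbhs; split.
exists (d / 2); first lra.
by move=> y /andP[h1 h2]; apply: Hd; rewrite /ball/= ltr_norml; lra.
Qed.

(* The locally absolutely continuous representatives of H^1 functions on an
   open [U]: the endpoints of [a, b] must themselves lie in [U]. *)
Definition acU U f g := forall a b, (forall x, a <= x <= b -> U x) -> prim a b f g.

(* Tested against a difference of two steps of width [r] at Lebesgue points
   [s < t] of [f], the weak derivative identity tends to [f t - f s = I s t g]. *)
Lemma weak_ac U f g : open U -> U `<=` `[0, 1] -> L2 U f -> L2 U g ->
  weak_derivative U f g ->
  exists v, acU U v g /\ {ae mu, forall x, U x -> v x = f x}.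
Proof.
move=> oU U01 lf lg wfg.
have mU : measurable U by exact: open_measurable.
have if0 : integ setT (f \_ U) by apply: (integ_patch f mU).1; apply: (@L2_integ U f 0 1 mU U01 lf).
have ig0 : integ setT (g \_ U) by apply: (integ_patch g mU).1; apply: (@L2_integ U g 0 1 mU U01 lg).
set f0 := f \_ U in if0; set g0 := g \_ U in ig0.
have ig a b : integ `[a, b] g0 by apply: (integS _ _ _ ig0).
have iF a b : integ `[a, b] f0 by apply: (integS _ _ _ if0).
pose G x := I 0 x g0.
have PG : prim 0 1 G g0.
  split; first exact: ig.
  move=> x y x0 xy y1; rewrite /G (@I_split _ 0 x y g0 x0 xy (ig _ _)); ring.
(* Subtracting a primitive of [g] leaves a function to be proved constant on each component of [U].
   It is cut off to be integrable on the line, where the differentiation theorem applies. *)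
pose F := (fun x => f0 x - G x) \_ `[0, 1].
have iFF : integ setT F.
  apply: (integ_patch _ (measurable_itv `[0, 1])).1; apply: integB => //.
  have [C C0 HC] := prim_bnd PG.
  apply: (integ_le _ (prim_meas PG) (g := fun=> C)) => //; last exact: integ_cst.
  by move=> x /=; rewrite in_itv/= => /andP[]; exact: HC.
have FE x : U x -> F x = f x - G x.
  by move=> Ux; rewrite /F /f0 patchE mem_set ?patchE ?mem_set//; exact: U01.
have key s t : lebesgue_pt F s -> lebesgue_pt F t -> s < t -> connects U s t -> F s = F t.
  move=> ps pt st sU.
  have Us : U s by apply: sU; left; rewrite lexx ltW.
  have Ut : U t by apply: sU; left; rewrite lexx ltW.
  have [r1 r10 H1] := open_ball oU Us; have [r2 r20 H2] := open_ball oU Ut.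
  apply/eqP; rewrite -subr_eq0 -normr_le0; apply/ler_addgt0Pl => e e0; rewrite addr0.
  have e2 : 0 < e / 2 by lin.
  have [d1 d10 D1] := avg_lim iFF ps e2; have [d2 d20 D2] := avg_lim iFF pt e2.
  have [r3 [r30 r31 r32]] := small2 r10 r20; have [d3 [d30 d31 d32]] := small2 d10 d20.
  have [r [r0 rr3 rd3]] := small2 r30 d30.
  have [[rr1 rr2] [rd1 rd2]] : (r < r1 /\ r < r2) /\ (r < d1 /\ r < d2).
    by split; split; lin.
  have rU x : s - r <= x <= t + r -> U x.
    move=> /andP[h1 h2]; case: (leP x s) => h3; first by apply: H1; lin.
    case: (leP x t) => h4; first by apply: sU; left; lin.
    by apply: H2; lin.
  have r01 x : s - r <= x <= t + r -> 0 <= x <= 1.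
    by move=> /rU /U01 /=; rewrite in_itv.
  have [tf Etf] := stp_test r0 (ltW st) rU.
  have := wfg _ tf; rewrite Etf.
  have KU : `[s - r, t + r] `<=` U by move=> x /=; rewrite in_itv; exact: rU.
  have str : s - r <= t + r by lin.
  rewrite (int_supp mU _ KU)//; last first.
    move=> x _ /=; rewrite in_itv/= => /negP; rewrite negb_and -!ltNge => H.
    have [h1 h2] : (x <= s - r \/ s + r <= x) /\ (x <= t - r \/ t + r <= x).
      by case/orP: H => H; split; [left|left|right|right]; lin.
    by rewrite !dstp_out ?subrr ?mulr0.
  rewrite (int_supp mU _ KU)//; last first.
    by have [_ _ [K [_ KU' K0]]] := tf; move=> x _ /=; rewrite in_itv/= => /negP;
      rewrite negb_and -!ltNge => /orP[h1|h1]; [rewrite !stp_lo|rewrite !stp_hi];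
      rewrite ?subrr ?mulr0//; lin.
  rewrite -/(I _ _ _) -/(I _ _ _) => W.
  have PGr : prim (s - r) (t + r) G g0.
    by apply: (prim_sub PG); have := r01 (s - r); have := r01 (t + r);
      rewrite !lexx str/= => /(_ isT)/andP[? ?] /(_ isT)/andP[? ?].
  have Pphi : prim (s - r) (t + r) (fun x => stp s r x - stp t r x)
      (fun x => dstp s r x - dstp t r x) by apply: primB; exact: prim_stp.
  (* Integration by parts for [G] has no boundary terms, since the two steps agree at both ends.
     Combined with the weak identity, it makes [F] orthogonal to [dstp s r - dstp t r]. *)
  have [iM EM] := prim_mul PGr Pphi.
  have tr1 : stp s r (t + r) = 1 by rewrite stp_hi//; lin.
  have tr2 : stp t r (t + r) = 1 by rewrite stp_hi.
  have tr3 : stp s r (s - r) = 0 by rewrite stp_lo.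
  have tr4 : stp t r (s - r) = 0 by rewrite stp_lo//; lin.
  have := EM _ _ (lexx _) str (lexx _); rewrite tr1 tr2 tr3 tr4.
  rewrite !subrr !mulr0 subrr.
  have [CG CG0 HCG] := prim_bnd PGr.
  have mphi' : measurable_fun `[s - r, t + r] (fun x => dstp s r x - dstp t r x).
    exact: (integ_meas (prim_integ Pphi)).
  have bphi' x : `|dstp s r x - dstp t r x| <= 2 * r^-1.
    apply: (le_trans (ler_normB _ _)).
    rewrite !ger0_norm ?dstp_ge0//; have := dstp_le s x r0; have := dstp_le t x r0; lin.
  have i1 : integ `[s - r, t + r] (fun x => G x * (dstp s r x - dstp t r x)).
    apply: (integM_bnd (C := CG) _ (prim_meas PGr)) => //; last exact: prim_integ Pphi.
    by move=> x /=; rewrite in_itv/= => /andP[]; exact: HCG.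
  have i2 : integ `[s - r, t + r] (fun x => g0 x * (stp s r x - stp t r x)).
    apply: eq_integ (integB _ iM i1) => // x _ /=; ring.
  rewrite ID// => E2.
  have E3 : I (s - r) (t + r) (fun x => g x * (stp s r x - stp t r x)) =
            I (s - r) (t + r) (fun x => g0 x * (stp s r x - stp t r x)).
    by apply: eq_I => x h1 h2; rewrite /g0 patchE mem_set//; apply: rU; rewrite h1.
  have iFm u : integ `[s - r, t + r] (fun x => F x * dstp u r x).
    apply: (@eq_integ _ _ (fun x => dstp u r x * F x)) => //; first by move=> x _; ring.
    apply: (integM_bnd (C := r^-1)) => //.
    - exact: (integ_meas (prim_integ (@prim_stp R u r _ _ r0))).
    - by move=> x _; rewrite ger0_norm ?dstp_ge0// dstp_le.
    - by apply: (integS _ _ _ iFF).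
  have E4 : I (s - r) (t + r) (fun x => F x * dstp s r x) =
            I (s - r) (t + r) (fun x => F x * dstp t r x).
    apply/eqP; rewrite -subr_eq0 -IB//; apply/eqP.
    transitivity (I (s - r) (t + r) (fun x => f x * (dstp s r x - dstp t r x)
       - G x * (dstp s r x - dstp t r x))).
      by apply: eq_I => x h1 h2; rewrite FE; [ring|apply: rU; rewrite h1].
    rewrite IB//; last first.
      apply: (@eq_integ _ _ (fun x => (dstp s r x - dstp t r x) * f0 x)) => //.
        move=> x; rewrite inE/= in_itv/= => h; rewrite /f0 patchE mem_set//; [ring|exact: rU].
      by apply: (integM_bnd (C := 2 * r^-1)) => // x _; exact: bphi'.
    rewrite W E3; lin.
  have E5 : I (s - r) (t + r) (fun x => F x * dstp s r x) =
            I (s - r) (s + r) (fun x => F x * dstp s r x).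
    rewrite (@I_split _ (s - r) (s + r) (t + r)) //; [|lin..].
    rewrite [X in _ + X](_ : _ = 0) ?addr0//.
    rewrite (@eq_I _ _ _ _ (fun=> 0)) ?I_cst ?mul0r//; first lin.
    by move=> x h1 h2; rewrite dstp_out ?mulr0//; right.
  have E6 : I (s - r) (t + r) (fun x => F x * dstp t r x) =
            I (t - r) (t + r) (fun x => F x * dstp t r x).
    rewrite (@I_split _ (s - r) (t - r) (t + r)) //; [|lin..].
    rewrite [X in X + _](_ : _ = 0) ?add0r//.
    rewrite (@eq_I _ _ _ _ (fun=> 0)) ?I_cst ?mul0r//; first lin.
    by move=> x h1 h2; rewrite dstp_out ?mulr0//; left.
  have := D1 r r0 rd1; have := D2 r r0 rd2; rewrite -E5 -E6 E4.
  move: (I _ _ _) => J; rewrite !ler_norml => /andP[h1 h2] /andP[h3 h4]; lin.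
have aeF : {ae mu, forall x, lebesgue_pt F x}.
  apply: lebesgue_differentiation; apply: open_integrable_locally => //; exact: openT.
have key' s t : lebesgue_pt F s -> lebesgue_pt F t -> connects U s t -> F s = F t.
  move=> ps pt st; case: (ltgtP s t) => [h|h|->//]; first exact: key.
  by apply/esym/key => //; exact: conn_sym.
(* All Lebesgue points in the component of [x] share one value of [F]; [w x] is this value, defined
   also where [x] is not such a point. *)
pose Q x := [set c | exists s, [/\ lebesgue_pt F s, connects U s x & c = F s]].
have Qex x : U x -> exists c, Q x c.
  move=> Ux; have [r r0 Hr] := open_ball oU Ux.
  have [|s [h1 h2 ps]] := @ae_pick _ (x - r) (x + r) aeF; first lin.
  exists (F s), s; split=> // z [|] h; apply: Hr; lin.
pose w x := xget 0 (Q x).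
have wQ x : U x -> Q x (w x) by move=> /Qex[c Qc]; apply: (xgetPex _ (ex_intro _ c Qc)).
exists (fun x => w x + G x); split.
- move=> a b abU; case: (leP a b) => [ab|ba]; last first.
    split; first exact: (eq_integ _ _ (ig a b)) || rewrite set_itv_ge ?bnd_simp -?ltNge//.
      by move: (@integrable_set0 _ _ _ mu (EFin \o g)).
    by move=> x y ax xy yb; exfalso; lin.
  have wab x : a <= x <= b -> w x = w a.
    move=> /[dup] xab /andP[ax xb].
    have [s [ps cs ->]] := wQ x (abU _ xab).
    have [t [pt ct ->]] := wQ a (abU _ (introT andP (conj (lexx a) ab))).
    apply: key' => //; apply: (conn_trans cs); apply: conn_sym.
    by apply: (conn_trans ct) => z [|] h; apply: abU; lin.
  have ab01 x : a <= x <= b -> 0 <= x <= 1 by move=> /abU/U01 /=; rewrite in_itv.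
  have a0 : 0 <= a by have := ab01 a; rewrite lexx ab => /(_ isT)/andP[].
  have b1 : b <= 1 by have := ab01 b; rewrite lexx ab => /(_ isT)/andP[].
  have := primD (@prim_cst R a b (w a)) (prim_sub PG a0 b1).
  move/prim_ext; apply.
    by move=> x ax xb; rewrite wab// ax.
  by move=> x ax xb; rewrite add0r /g0 patchE mem_set//; apply: abU; rewrite ax.
- apply: (ae_mono aeF) => x px Ux.
  have [s [ps cs ->]] := wQ x Ux.
  by rewrite (key' _ _ ps px cs) FE//; lin.
Qed.

End WeakAC.

Section WeakAC2.
Context {R : realType}.
Local Notation mu := (@lebesgue_measure R).
Implicit Types (A B U V : set R) (f g h v : R -> R) (a b c x y z r s t : R).

Lemma eq_I_ae a b f g : integ `[a, b] f -> integ `[a, b] g ->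
  {ae mu, forall x, `[a, b]%classic x -> f x = g x} -> I a b f = I a b g.
Proof.
move=> iF iG H; rewrite /I /Rintegral; congr fine.
apply: (@ae_eq_integral _ _ _ mu) => //.
- by apply/measurable_EFinP; exact: integ_meas iF.
- by apply/measurable_EFinP; exact: integ_meas iG.
- by apply: (ae_mono H) => x Hx xab /=; rewrite Hx.
Qed.

Lemma acU_cont U v g x : open U -> acU U v g -> U x -> {for x, continuous v}.
Proof.
move=> oU ac Ux; have [r r0 Hr] := open_ball oU Ux.
have P := ac (x - r) (x + r) Hr.
apply/cvgrPdist_lt => e e0.
have [d d0 Hd] := prim_cont P (c := x) ltac:(lra) ltac:(lra) e0.
have [k [k0 kr kd]] := small2 r0 d0.
apply/nbhs_ballP; exists k => //= y; rewrite /ball/= ltr_norml => /andP[h1 h2].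
rewrite distrC; apply: Hd; lin.
Qed.

Lemma acU_eq U v1 g1 v2 g2 : open U -> acU U v1 g1 -> acU U v2 g2 ->
  {ae mu, forall x, U x -> v1 x = v2 x} -> forall x, U x -> v1 x = v2 x.
Proof.
move=> oU a1 a2 ae12 x Ux; apply/eqP; rewrite -subr_eq0 -normr_le0.
apply/ler_addgt0Pl => e e0; rewrite addr0.
have [r r0 Hr] := open_ball oU Ux.
have e2 : 0 < e / 2 by lra.
have [d1 d10 H1] := prim_cont (a1 _ _ Hr) (c := x) ltac:(lra) ltac:(lra) e2.
have [d2 d20 H2] := prim_cont (a2 _ _ Hr) (c := x) ltac:(lra) ltac:(lra) e2.
have [k [k0 kd1 kd2]] := small2 d10 d20; have [l [l0 lk lr]] := small2 k0 r0.
have [|y [h1 h2 Hy]] := @ae_pick R _ (x - l) (x + l) ae12; first lra.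
have := Hy (Hr y ltac:(apply/andP; split; lin)) => E.
have := H1 y ltac:(lin) ltac:(lin) ltac:(lin) ltac:(lin).
have := H2 y ltac:(lin) ltac:(lin) ltac:(lin) ltac:(lin).
by rewrite E !ltr_norml ler_norml; move: (v1 x) (v2 x) (v2 y) => ? ? ? /andP[? ?] /andP[? ?]; lin.
Qed.

Lemma lebesgue_pt0 h x : integ setT h -> lebesgue_pt h x ->
  (exists2 r, 0 < r & forall k, 0 < k -> k < r -> I (x - k) (x + k) h = 0) -> h x = 0.
Proof.
move=> ih px [r r0 Hr]; apply/eqP; rewrite -normr_le0.
apply/ler_addgt0Pl => e e0; rewrite addr0.
have [d d0 Hd] := lebesgue_ptP ih px e0.
have [k [k0 kr kd]] := small2 r0 d0.
have := Hd k k0 kd.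
have ihk : integ `[x - k, x + k] h by apply: (integS _ _ _ ih).
have ic : integ `[x - k, x + k] (fun=> h x) by exact: integ_cst.
have := I_norm (integB (measurable_itv _) ihk ic).
rewrite IB// Hr// I_cst; last lra.
rewrite sub0r normrN normrM [`|x + k - _|]ger0_norm; last lra.
have -> : x + k - (x - k) = 2 * k by ring.
move: (I _ _ _) => J h1 h2.
have : `|h x| * (2 * k) <= e * k by exact: le_trans h1 h2.
by rewrite mulrA ler_pM2r//; have := normr_ge0 (h x); lin.
Qed.

(** The difference of the two derivatives integrates to 0 over every small interval in [U], hence
    vanishes at its Lebesgue points. *)
Lemma acU_unique U v1 g1 v2 g2 : open U -> integ U g1 -> integ U g2 ->
  acU U v1 g1 -> acU U v2 g2 -> (forall x, U x -> v1 x = v2 x) ->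
  {ae mu, forall x, U x -> g1 x = g2 x}.
Proof.
move=> oU i1 i2 a1 a2 v12.
have mU : measurable U by exact: open_measurable.
pose h := (fun x => g1 x - g2 x) \_ U.
have ih : integ setT h by apply: (integ_patch _ mU).1; apply: integB.
have aeh : {ae mu, forall x, lebesgue_pt h x}.
  apply: lebesgue_differentiation; apply: open_integrable_locally => //; exact: openT.
apply: (ae_mono aeh) => x px Ux.
have : h x = 0.
  apply: lebesgue_pt0 => //; have [r r0 Hr] := open_ball oU Ux.
  exists r => // k k0 kr.
  have kU y : x - k <= y <= x + k -> U y.
    by move=> /andP[? ?]; apply: Hr; apply/andP; split; lin.
  have [j1 e1] := a1 _ _ kU; have [j2 e2] := a2 _ _ kU.
  transitivity (I (x - k) (x + k) (fun x => g1 x - g2 x)).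
    by apply: eq_I => y h1 h2; rewrite /h patchE mem_set//; apply: kU; rewrite h1.
  rewrite IB// -e1 ?lexx//; last lin.
  rewrite -e2 ?lexx//; last lin.
  by rewrite !v12 ?subrr//; apply: kU; apply/andP; split; lin.
by rewrite /h patchE mem_set// => /eqP; rewrite subr_eq0 => /eqP.
Qed.

Lemma derive1_near0 (phi : R -> R) c d : 0 < d ->
  (forall x, c - d < x -> x < c + d -> phi x = 0) -> derive1 phi c = 0.
Proof.
move=> d0 H; rewrite derive1E.
have H0 : is_derive c 1 (fun=> 0 : R) (0 : R) by exact: is_derive_cst.
have N : \near c, (fun=> 0 : R) c = phi c.
  apply/nbhs_ballP; exists d => //= y; rewrite /ball/= ltr_norml => /andP[h1 h2].
  by rewrite H//; lin.
by have := near_eq_is_derive N H0 => /@derive_val.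
Qed.

Lemma L2_sub A B f : measurable A -> measurable B -> A `<=` B -> L2 B f -> L2 A f.
Proof.
move=> mA mB AB lf; apply: sqr_L2; first exact: measurable_funS lf.1.
by apply: (integS mA mB AB); exact: L2_sqr.
Qed.

(** Converse of [weak_ac]: the product with a test function, extended by 0 off [U], is absolutely
    continuous on the line, and its total increment is 0. *)
Lemma ac_weak U v f g : open U -> U `<=` `[0, 1] -> acU U v g ->
  {ae mu, forall x, U x -> v x = f x} -> L2 U f -> L2 U g -> weak_derivative U f g.
Proof.
move=> oU U01 ac aev lf lg phi tphi.
have [dphi cphi [K [cK KU K0]]] := tphi.
set phi' := derive1 phi.
have Dphi x : is_derive x 1 phi (phi' x).
  by apply: DeriveDef; [exact: dphi|rewrite /phi' derive1E].
have mU : measurable U by exact: open_measurable.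
have [C C0 HC] : exists2 C : R, 0 <= C & forall x, 0 <= x -> x <= 1 -> `|phi x| <= C.
  by apply: (prim_bnd (g := phi')); exact: prim_C1.
have [C' C'0 HC'] : exists2 C : R, 0 <= C & forall x, 0 <= x -> x <= 1 -> `|phi' x| <= C.
  by apply: within_bnd; apply: continuous_subspaceT.
have mphi : measurable_fun setT phi.
  by apply: continuous_measurable_fun => x; apply: differentiable_continuous; apply/derivable1_diffP.
have mphi' : measurable_fun setT phi' by exact: continuous_measurable_fun.
have i1 : integ U (fun x => phi x * g x).
  apply: (integM_bnd (C := C)) => //; first exact: measurable_funTS.
    by move=> x /U01/=; rewrite in_itv/= => /andP[]; exact: HC.
  exact: (@L2_integ R U g 0 1).
have i2 : integ U (fun x => phi' x * f x).
  apply: (integM_bnd (C := C')) => //; first exact: measurable_funTS.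
    by move=> x /U01/=; rewrite in_itv/= => /andP[]; exact: HC'.
  exact: (@L2_integ R U f 0 1).
pose P := (fun x => v x * phi x) \_ U.
pose p := (fun x => phi x * g x + phi' x * f x) \_ U.
have ip : integ setT p by apply: (integ_patch _ mU).1; apply: integD.
have nU x : ~ U x -> P x = 0 /\ p x = 0.
  by move=> Ux; rewrite /P /p !patchE memNset.
(* The window reaches beyond [0, 1] on both sides, so that the product vanishes at its two ends. *)
have PP : prim (-1) 2 P p.
  apply: (@prim_glue _ _ _ _ _ (fun=> 0)) => //.
  - by apply: (integS _ _ _ ip).
  - exact: integ_cst.
  move=> e e0 c c1 c2.
  have I0 x y : x <= y -> I x y (fun=> 0 : R) = 0 by move=> xy; rewrite I_cst// mul0r.
  have [Uc|nUc] := pselect (U c).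
    have [r r0 Hr] := open_ball oU Uc; exists r => // x y hx xy hy xc yc.
    have xyU z : x <= z <= y -> U z.
      by move=> /andP[? ?]; apply: Hr; apply/andP; split; lin.
    have Pvp := prim_mul (ac _ _ xyU) (@prim_C1 _ x y phi phi' Dphi cphi).
    have E z : x <= z -> z <= y -> P z = v z * phi z.
      by move=> h1 h2; rewrite /P patchE mem_set//; apply: xyU; rewrite h1.
    rewrite !E// Pvp.2// (@eq_I_ae _ _ _ p) ?subrr ?normr0 ?I0 ?mulr0//.
    - exact: prim_integ Pvp.
    - by apply: (integS _ _ _ ip).
    - apply: (ae_mono aev) => z Hz /=; rewrite in_itv/= => zxy.
      by rewrite /p patchE mem_set ?Hz//; [ring|exact: xyU|exact: xyU].
  (* A point outside [U] has a neighbourhood disjoint from the support, on which the test function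
     and its derivative both vanish. *)
  have nKc : ~ K c by move=> /KU.
  have [r r0 Hr] : exists2 r, 0 < r & forall x, c - r < x -> x < c + r -> ~ K x.
    have oK : open (~` K) by apply: closed_openC; exact: (compact_closed (@Rhausdorff R) cK).
    have [r r0 Hr] := open_ball oK nKc; exists r => // x h1 h2.
    by apply: Hr; apply/andP; split; lin.
  exists r => // x y hx xy hy xc yc.
  have Z z : x <= z -> z <= y -> P z = 0 /\ p z = 0.
    move=> h1 h2.
    have pz : phi z = 0 by apply: K0; apply: Hr; lin.
    have pz' : phi' z = 0.
      have [k [k0 k1 k2]] : exists k, [/\ 0 < k, k < z - (c - r) & k < c + r - z].
        by apply: small2; lin.
      apply: (derive1_near0 k0) => u u1 u2; apply: K0; apply: Hr; lin.
    have [Uz|/nU//] := pselect (U z).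
    by rewrite /P /p !patchE mem_set// pz pz' mulr0 !mul0r addr0.
  rewrite !(Z _ _ _).1// (@eq_I _ _ _ p (fun=> 0)) ?I0 ?mulr0 ?subrr ?normr0//.
  by move=> z h1 h2; apply: (Z _ _ _).2.
have := PP.2 (-1) 2 (lexx _) ltac:(lra) (lexx _).
have o x : x < 0 \/ 1 < x -> ~ U x.
  by move=> H /U01 /=; rewrite in_itv/= => /andP[? ?]; case: H => ?; lin.
rewrite (nU 2 (o _ _)).1; last by right; lra.
rewrite (nU (-1) (o _ _)).1; last by left; lra.
have -> : I (-1) 2 p = \int[mu]_(x in U) (phi x * g x + phi' x * f x).
  have U12 : U `<=` `[(-1:R), 2].
    by move=> x /U01 /=; rewrite !in_itv/= => /andP[? ?]; apply/andP; split; lin.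
  rewrite /I (int_supp _ mU U12)//; last by move=> x _ /nU[].
  by apply: eq_Rintegral => x xU; rewrite /p patchE xU.
rewrite RintegralD// subrr => E.
have -> : \int[mu]_(x in U) (f x * phi' x) = \int[mu]_(x in U) (phi' x * f x).
  by apply: eq_Rintegral => x _; rewrite mulrC.
have -> : \int[mu]_(x in U) (g x * phi x) = \int[mu]_(x in U) (phi x * g x).
  by apply: eq_Rintegral => x _; rewrite mulrC.
by move: E; move: (Rintegral _ _ _) (Rintegral _ _ _) => u w E; lra.
Qed.

Definition sq g := measurable_fun setT g /\ integ setT (fun x => g x ^+ 2).

Lemma sq_L2 U g : measurable U -> sq g -> L2 U g.
Proof.
move=> mU [mg ig]; apply: sqr_L2; first exact: measurable_funTS.
by apply: (integS _ _ _ ig).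
Qed.

Lemma sq_patch U g : measurable U -> L2 U g -> sq (g \_ U).
Proof.
move=> mU lg; split; first by apply/(measurable_restrictT _ mU); exact: lg.1.
have := (integ_patch _ mU).1 (L2_sqr mU lg).
apply: eq_integ => // x _; rewrite !patchE; case: ifP => // _.
by rewrite /point/= expr0n.
Qed.

Lemma acU_ext U f f' g g' : acU U f g -> (forall x, U x -> f x = f' x) ->
  (forall x, U x -> g x = g' x) -> acU U f' g'.
Proof.
move=> ac ff gg a b abU; apply: (prim_ext (ac _ _ abU)) => x ax xb.
  by apply: ff; apply: abU; rewrite ax.
by apply: gg; apply: abU; rewrite ax.
Qed.

Lemma acU_sub U V f g : V `<=` U -> acU U f g -> acU V f g.
Proof. by move=> VU ac a b abV; apply: ac => x /abV/VU. Qed.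

(** The chosen weak derivative is cut to 0 off [U], which makes it square integrable on the whole
    line and leaves it intact where the representative lives. *)
Lemma H1_inv U f : open U -> U `<=` `[0, 1] -> H1 U f ->
  exists v, [/\ acU U v (weakD U f \_ U), {ae mu, forall x, U x -> v x = f x} &
    sq (weakD U f \_ U)].
Proof.
move=> oU U01 [lf [g0 Hg]].
have [lg wg] : [set g | L2 U g /\ weak_derivative U f g] (weakD U f).
  exact: (xgetPex _ (ex_intro _ g0 Hg)).
have [v [ac aev]] := weak_ac oU U01 lf lg wg.
exists v; split=> //; last by apply: sq_patch => //; exact: open_measurable.
by apply: (acU_ext ac) => // x Ux; rewrite patchE mem_set.
Qed.

(** [weakD] is an arbitrary choice, so a known derivative [g] determines it only almost everywhere:
    its own representative coincides with [v], and equal representatives have equal derivatives. *)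
Lemma H1_intro U f v g : open U -> U `<=` `[0, 1] -> L2 U f -> L2 U g -> acU U v g ->
  {ae mu, forall x, U x -> v x = f x} ->
  H1 U f /\ {ae mu, forall x, U x -> weakD U f x = g x}.
Proof.
move=> oU U01 lf lg ac aev.
have hf : H1 U f by split=> //; exists g; split=> //; exact: (ac_weak oU U01 ac).
split=> //.
have mU : measurable U by exact: open_measurable.
have [v' [ac' aev' sg]] := H1_inv oU U01 hf.
have aevv : {ae mu, forall x, U x -> v x = v' x}.
  by apply: (ae_mono (ae_and aev aev')) => x [h1 h2] Ux; rewrite h1// h2.
have ig : integ U g by exact: (@L2_integ R U g 0 1).
have ig' : integ U (weakD U f \_ U).
  by apply: (@L2_integ R U _ 0 1) => //; exact: sq_L2.
have E := acU_eq oU ac ac' aevv.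
apply: (ae_mono (acU_unique oU ig ig' ac ac' E)) => x Hx Ux.
by rewrite Hx// patchE mem_set.
Qed.

End WeakAC2.

(** * Limits of rapidly Cauchy sequences in L^2 *)

Section L2Limit.
Context {R : realType}.
Local Notation mu := (@lebesgue_measure R).
Implicit Types (A B U V : set R) (f g h v : R -> R) (a b c x y z r s t : R).

Lemma sum_geom2 n : \sum_(0 <= i < n) (2^-1 : R) ^+ i <= 2.
Proof.
suff -> : \sum_(0 <= i < n) (2^-1 : R) ^+ i = 2 - 2 * 2^-1 ^+ n.
  by rewrite lerBlDr lerDl mulr_ge0// exprn_ge0// invr_ge0.
elim: n => [|n IH]; first by rewrite big_geq// expr0; lra.
by rewrite big_nat_recr//= IH exprS; lra.
Qed.

(** The increments have summable L^1 norms, so their sum [G] is integrable and the sequence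
    converges wherever [G] is finite. Integrals pass to the limit by domination with |u_0| + G, the
    quadratic bound by Fatou. *)
Lemma L2_fast_lim (u : nat -> R -> R) : (forall j, measurable_fun setT (u j)) ->
  (forall j, integ `[0, 1] (fun x => u j x ^+ 2)) ->
  (forall j, I 0 1 (fun x => (u j.+1 x - u j x) ^+ 2) <= (2^-1 ^+ j) ^+ 2) ->
  exists h, [/\ measurable_fun setT h,
    forall x y, 0 <= x -> y <= 1 -> (fun j => I x y (u j)) @ \oo --> I x y h &
    forall C, (forall j, I 0 1 (fun x => u j x ^+ 2) <= C) ->
      integ `[0, 1] (fun x => h x ^+ 2) /\ I 0 1 (fun x => h x ^+ 2) <= C].
Proof.
move=> mu_ iu du.
pose d j (x : R) : R := `|u j.+1 x - u j x|.
have d0 j x : (0 <= (d j x)%:E)%E by rewrite lee_fin /d.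
have mu1 j : measurable_fun (`[0, 1] : set R) (u j) by exact: measurable_funTS.
have md j : measurable_fun setT (d j).
  by apply: measurableT_comp => //; exact: measurable_funB.
have md01 j : measurable_fun (`[0, 1] : set R) (d j) by apply: measurable_funTS.
have iu1 j : integ `[0, 1] (u j) by exact: integ_sqr.
have id2 j : integ `[0, 1] (fun x => (u j.+1 x - u j x) ^+ 2).
  apply: (@eq_integ _ _ (fun x => u j.+1 x ^+ 2 + u j x ^+ 2 - 2 * (u j.+1 x * u j x))) => //.
    by move=> x _; ring.
  apply: integB => //; first exact: integD.
  by apply: integZ => //; apply: integM.
have id j : integ `[0, 1] (fun x => u j.+1 x - u j x) by exact: integB.
have Id j : I 0 1 (d j) <= 2^-1 ^+ j.
  have := @I_CS R 0 1 _ ler01 (id j) (id2 j); rewrite subr0 mul1r => /le_trans/(_ (du j)).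
  rewrite ler_sqr// nnegrE; first exact: I_ge0.
  by rewrite exprn_ge0// invr_ge0.
pose G (x : R) : \bar R := (\sum_(j <oo) (d j x)%:E)%E.
have mG : measurable_fun (`[0, 1] : set R) G.
  apply: ge0_emeasurable_sum => [j x _ _|j _]; first exact: d0.
  by apply/measurable_EFinP/measurable_funTS.
have G0 x : (0 <= G x)%E by apply: nneseries_ge0 => j _ _; exact: d0.
have iG : (\int[mu]_(x in `[0%R, 1%R]) G x <= 2%:E)%E.
  rewrite integral_nneseries//; last first.
    by move=> j; apply/measurable_EFinP; exact: md01.
  apply: lime_le; first by apply: is_cvg_nneseries => j _ _; apply: integral_ge0 => x _; exact: d0.
  apply: nearW => n; under eq_bigr do (rewrite integE//; last exact: integ_norm).
  rewrite sumEFin lee_fin (le_trans _ (sum_geom2 n))//; apply: ler_sum => i _; exact: Id.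
have IG : mu.-integrable (`[0, 1] : set R) G.
  apply/integrableP; split=> //; apply: le_lt_trans (ltry 2).
  rewrite (@eq_integral _ _ _ mu _ G)// => x _; by rewrite gee0_abs.
(* The upper limit is measurable everywhere and equals the limit wherever that exists. *)
pose h x := fine (limn_esup (fun n => (u n x)%:E)).
have mh : measurable_fun setT h.
  apply: measurableT_comp => //.
  by apply: measurable_fun_limn_esup => n; exact/measurable_EFinP.
have uG n x : (`|(u n x)%:E| <= `|u 0%N x|%:E + G x)%E.
  have : (`|u n x|%:E <= `|u 0%N x|%:E + \sum_(0 <= j < n) (d j x)%:E)%E.
    rewrite sumEFin -EFinD lee_fin.
    elim: n => [|n IH]; first by rewrite big_geq// addr0.
    rewrite big_nat_recr//= addrA.
    have -> : u n.+1 x = u n x + (u n.+1 x - u n x) by ring.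
    by apply: (le_trans (ler_normD _ _)); rewrite lerD.
  move/le_trans; apply; rewrite leeD2l//.
  by apply: nneseries_lim_ge => j _ _; exact: d0.
have cvu x : (G x < +oo)%E -> u n x @[n --> \oo] --> h x.
  move=> Gfin.
  have cvd : cvgn (series (fun j => d j x)).
    apply: nondecreasing_is_cvgn.
      by apply: nondecreasing_series => j _ _; rewrite -lee_fin; exact: d0.
    exists (fine (G x)) => _ [n _ <-]; rewrite -lee_fin fineK ?ge0_fin_numE//.
    rewrite /series/= -sumEFin.
    by apply: nneseries_lim_ge => j _ _; exact: d0.
  have cvD : cvgn (series (fun j => u j.+1 x - u j x)) by exact: normed_cvg.
  have cv : cvgn (fun n => u n x).
    have -> : (fun n => u n x) = (fun n => u 0%N x + series (fun j => u j.+1 x - u j x) n).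
      by apply/funext => n; rewrite /series/= telescope_sumr// addrC subrK.
    by apply: is_cvgD => //; exact: is_cvg_cst.
  suff -> : h x = limn (fun n => u n x) by [].
  rewrite /h is_cvg_limn_esupE; last by apply/cvg_ex; exists (limn (fun n => u n x))%:E; apply/cvg_EFin; [exact: nearW|].
  by rewrite EFin_lim.
have aeG : {ae mu, forall x, `[(0 : R), 1]%classic x -> (G x < +oo)%E}.
  have H := @integrable_ae _ _ _ mu `[0, 1] (measurable_itv _) G IG.
  by apply: (ae_mono H) => x {}H /H; rewrite fin_numElt => /andP[].
exists h; split=> //.
- move=> x y x0 y1.
  have sub : `[x, y] `<=` `[0, 1].
    by apply: subset_itv; rewrite bnd_simp.
  have [] := @dominated_convergence _ _ _ mu `[x, y] (measurable_itv _)
     (fun n z => (u n z)%:E) (EFin \o h) (fun z => `|u 0%N z|%:E + G z)%E.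
  + by move=> n; apply/measurable_EFinP; apply: measurable_funTS; exact: mu_.
  + by apply/measurable_EFinP; apply: measurable_funTS; exact: mh.
  + apply: (ae_mono aeG) => z Hz zxy; apply/cvg_EFin; first exact: nearW.
    by apply: cvu; apply: Hz; exact: sub.
  + apply: (@integrableS _ _ _ mu `[0, 1]) => //.
    by apply: integrableD => //; apply: (@integ_norm R `[0, 1] (u 0%N)).
  + by apply: aeW => z n _; exact: uG.
  move=> ih _; have E := @integE R `[x, y] h (measurable_itv _) ih.
  rewrite [X in _ --> X]E => /fine_cvgP[_]; apply: cvg_trans; apply: near_eq_cvg; exact: nearW.
- move=> C HC.
  have mh2 : measurable_fun (`[0, 1] : set R) (fun x => (h x ^+ 2)%:E).
    by apply/measurable_EFinP/measurable_funX/measurable_funTS.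
  have F : (\int[mu]_(x in `[0%R, 1%R]) (h x ^+ 2)%:E <= C%:E)%E.
    have -> : (\int[mu]_(x in `[0%R, 1%R]) (h x ^+ 2)%:E =
       \int[mu]_(x in `[0%R, 1%R]) limn_einf (fun n => (u n x ^+ 2)%:E))%E.
      apply: ae_eq_integral => //.
        rewrite /limn_einf; apply: (measurableT_comp (@oppe_measurable R setT)).
        apply: measurable_fun_limn_esup => n; apply: (measurableT_comp (@oppe_measurable R setT)).
        by apply/measurable_EFinP; apply: measurable_funX; exact: mu1.
      apply: (ae_mono aeG) => x Hx x01 /=.
      have := cvu x (Hx x01) => cvx.
      have cv2 : (fun n => (u n x ^+ 2)%:E) @ \oo --> (h x ^+ 2)%:E.
        apply/cvg_EFin; first exact: nearW.
        by rewrite /comp/=; under eq_fun do rewrite expr2; rewrite expr2; apply: cvgM.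
      by rewrite (cvg_limn_einf_sup cv2).1.
    apply: (le_trans (@fatou _ _ _ mu `[0, 1] (measurable_itv _) (fun n x => (u n x ^+ 2)%:E) _ _)).
    + by move=> n; apply/measurable_EFinP; apply: measurable_funX; exact: mu1.
    + by move=> n x _; rewrite lee_fin sqr_ge0.
    have -> : (fun n => \int[mu]_(x in `[0%R, 1%R]) (u n x ^+ 2)%:E)%E =
              (fun n => (I 0 1 (fun x => u n x ^+ 2))%:E).
      by apply/funext => n; rewrite integE.
    rewrite limn_einf_lim; apply: lime_le; first exact: is_cvg_einfs.
    apply: nearW => n; apply: (@le_trans _ _ (I 0 1 (fun x => u n x ^+ 2))%:E).
      by apply: ereal_inf_lbound; exists n => //=.
    by rewrite lee_fin.
  have ih2 : integ `[0, 1] (fun x => h x ^+ 2).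
    apply/integrableP; split=> //; apply: le_lt_trans (ltry C).
    apply: le_trans F; rewrite (@eq_integral _ _ _ mu _ (fun x => (h x ^+ 2)%:E))// => x _ /=.
    by rewrite ger0_norm ?sqr_ge0.
  by split=> //; rewrite -lee_fin /I -integE.
Qed.

End L2Limit.

(** * The dyadic Riesz criterion *)

Section Riesz.
Context {R : realType}.
Local Notation mu := (@lebesgue_measure R).
Implicit Types (A B U V : set R) (f g h : R -> R) (a b c x y z r s t : R) (K i j n m : nat).

Lemma I_eq_lt a b f g : integ `[a, b] f -> integ `[a, b] g ->
  (forall x, a <= x -> x < b -> f x = g x) -> I a b f = I a b g.
Proof.
move=> iF iG H; apply: eq_I_ae => //.
have Nb : {ae mu, forall x : R, x <> b}.
  apply: (@negligibleS _ _ _ mu [set b]); first by move=> x /= /contrapT.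
  by apply/negligibleP => //; exact: lebesgue_measure_set1.
apply: (ae_mono Nb) => x xb /=; rewrite in_itv/= => /andP[ax xleb].
by apply: H => //; rewrite lt_neqAle xleb andbT; apply/eqP.
Qed.

Definition dyadic_pt K i : R := i%:R / 2 ^+ K.

Lemma p2 K : 0 < (2 : R) ^+ K.
Proof. by rewrite exprn_gt0. Qed.

Lemma pt_le K i j : (i <= j)%N -> dyadic_pt K i <= dyadic_pt K j.
Proof. by move=> ij; rewrite /dyadic_pt ler_pM2r ?invr_gt0 ?p2// ler_nat. Qed.

Lemma pt0 K : dyadic_pt K 0 = 0.
Proof. by rewrite /dyadic_pt mul0r. Qed.

Lemma pt_ge0 K i : 0 <= dyadic_pt K i.
Proof. by rewrite -(pt0 K) pt_le. Qed.

Lemma pt1 K : dyadic_pt K (2 ^ K) = 1.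
Proof. by rewrite /dyadic_pt natrX divff// gt_eqF// p2. Qed.

Lemma pt_le1 K i : (i <= 2 ^ K)%N -> dyadic_pt K i <= 1.
Proof. by move=> iK; rewrite -(pt1 K) pt_le. Qed.

Lemma ptS K i : dyadic_pt K i.+1 = dyadic_pt K i + (2 ^+ K)^-1.
Proof. by rewrite /dyadic_pt -natr1 mulrDl mul1r. Qed.

Lemma pt_refine K m i : dyadic_pt K i = dyadic_pt (K + m) (i * 2 ^ m).
Proof.
rewrite /dyadic_pt natrM natrX exprD invfM mulrACA.
by rewrite divff ?mulr1 ?mulrA// ?gt_eqF ?p2//; rewrite mulrC.
Qed.

Lemma I_cells K n f : integ `[0, 1] f -> (n <= 2 ^ K)%N ->
  I 0 (dyadic_pt K n) f = \sum_(0 <= i < n) I (dyadic_pt K i) (dyadic_pt K i.+1) f.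
Proof.
move=> iF; elim: n => [|n IH] nK; first by rewrite pt0 I_id big_geq.
rewrite big_nat_recr//= -IH; last exact: ltnW.
rewrite -I_split//; first exact: pt_ge0.
- exact: pt_le.
- by apply: (integ_sub iF) => //; exact: pt_le1.
Qed.

Variables (v : R -> R) (X : set R).

(* Riesz' criterion on a dyadic grid: cells not contained in [X] are discarded,
   so that the squared difference quotients of [v] only see increments inside
   [X]; a uniform bound on their sum yields an L^2 derivative. *)
Definition cell_inside K i := `[< forall x, dyadic_pt K i <= x <= dyadic_pt K i.+1 -> X x >].
Definition cell_slope K i := if cell_inside K i then (v (dyadic_pt K i.+1) - v (dyadic_pt K i)) * 2 ^+ K else 0.
Definition slope_step K x := \sum_(0 <= i < 2 ^ K) cell_slope K i * \1_(`[dyadic_pt K i, dyadic_pt K i.+1[) x.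
Definition slope_energy K := \sum_(0 <= i < 2 ^ K) cell_slope K i ^+ 2 / 2 ^+ K.

Lemma hh_val K i x : (i < 2 ^ K)%N -> dyadic_pt K i <= x -> x < dyadic_pt K i.+1 -> slope_step K x = cell_slope K i.
Proof.
move=> iK ix xi; rewrite /slope_step (bigD1_seq i) ?iota_uniq ?mem_index_iota//=.
rewrite indicE mem_set ?mulr1; last by rewrite /= in_itv/= ix xi.
rewrite big1 ?addr0// => j ji; rewrite indicE memNset ?mulr0//=.
rewrite in_itv/= => /andP[jx xj].
move: ji; rewrite neq_ltn => /orP[ji|ij].
  by have := pt_le K ji; lra.
by have := pt_le K ij; lra.
Qed.

Lemma hh_meas K : measurable_fun setT (slope_step K).
Proof.
rewrite /slope_step; apply: measurable_sum => i; apply: measurable_funM => //.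
Qed.

Lemma hh_bnd K x : `|slope_step K x| <= \sum_(0 <= i < 2 ^ K) `|cell_slope K i|.
Proof.
apply: (le_trans (ler_norm_sum _ _ _)); apply: ler_sum => i _.
by rewrite normrM indicE ler_piMr//; case: (_ \in _); rewrite ?normr1 ?normr0.
Qed.

Lemma hh_integM K K' : integ `[0, 1] (fun x => slope_step K x * slope_step K' x).
Proof.
apply: (@integ_le _ _ _ (fun=> (\sum_(0 <= i < 2 ^ K) `|cell_slope K i|) * \sum_(0 <= i < 2 ^ K') `|cell_slope K' i|)) => //.
- by apply: measurable_funM; apply: measurable_funTS; exact: hh_meas.
- by move=> x _; rewrite normrM ler_pM// hh_bnd.
- exact: integ_cst.
Qed.

Lemma hh_integ K : integ `[0, 1] (slope_step K).
Proof.
apply: (@integ_le _ _ _ (fun=> (\sum_(0 <= i < 2 ^ K) `|cell_slope K i|))) => //.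
- by apply: measurable_funTS; exact: hh_meas.
- by move=> x _; exact: hh_bnd.
- exact: integ_cst.
Qed.

Lemma hh_cell K i : (i < 2 ^ K)%N -> I (dyadic_pt K i) (dyadic_pt K i.+1) (slope_step K) = cell_slope K i / 2 ^+ K.
Proof.
move=> iK; rewrite (@I_eq_lt _ _ _ (fun=> cell_slope K i)).
- by rewrite I_cst ?pt_le// ptS; congr (_ * _); ring.
- by apply: (integ_sub (hh_integ K)); [exact: pt_ge0|exact: pt_le1].
- exact: integ_cst.
- by move=> x; exact: hh_val.
Qed.

Lemma hh_tele K i j : (i <= j)%N -> (j <= 2 ^ K)%N ->
  (forall x, dyadic_pt K i <= x <= dyadic_pt K j -> X x) ->
  I (dyadic_pt K i) (dyadic_pt K j) (slope_step K) = v (dyadic_pt K j) - v (dyadic_pt K i).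
Proof.
elim: j => [|j IH]; first by rewrite leqn0 => /eqP ->; rewrite I_id subrr.
rewrite leq_eqVlt => /predU1P[->|]; first by rewrite I_id subrr.
rewrite ltnS => ij jK HX.
rewrite (@I_split _ _ (dyadic_pt K j)); [|exact: pt_le|exact: pt_le|].
- rewrite IH//; [|exact: ltnW|]; last first.
    move=> x /andP[h1 h2]; apply: HX; rewrite h1/= (le_trans h2)//; exact: pt_le.
  rewrite hh_cell// /cell_slope ifT; last first.
    apply/asboolP => x /andP[h1 h2]; apply: HX; rewrite h2 andbT (le_trans _ h1)//; exact: pt_le.
  by rewrite mulfK; [ring|rewrite gt_eqF// p2].
- by apply: (integ_sub (hh_integ K)); [exact: pt_ge0|exact: pt_le1].
Qed.

(* On a cell of level [K] inside [X] the finer slopes average to the coarse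
   one, so the [slope_step K] form a martingale: increments are orthogonal. *)
Lemma hh_cross K K' : (K <= K')%N -> I 0 1 (fun x => slope_step K' x * slope_step K x) = slope_energy K.
Proof.
move=> KK'; rewrite -[X in I _ X _](pt1 K) I_cells//; last exact: hh_integM.
apply: eq_big_nat => i /andP[_ iK].
have sub h : integ `[0, 1] h -> integ `[dyadic_pt K i, dyadic_pt K i.+1] h.
  by move=> ih; apply: (integ_sub ih); [exact: pt_ge0|exact: pt_le1].
rewrite (@I_eq_lt _ _ _ (fun x => cell_slope K i * slope_step K' x)).
- rewrite IZ; last exact/sub/hh_integ.
  rewrite /cell_slope; case: ifPn => [/asboolP okK|_]; last by rewrite expr0n/= !mul0r.
  rewrite -(subnKC KK') (pt_refine K (K' - K) i) (pt_refine K (K' - K) i.+1).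
  rewrite hh_tele.
  + by rewrite expr2; field; rewrite gt_eqF ?p2.
  + by rewrite leq_mul2r leqnSn orbT.
  + by rewrite expnD leq_mul2r iK orbT.
  + by rewrite -!pt_refine.
- exact/sub/hh_integM.
- exact/integZ/sub/hh_integ.
- by move=> x h1 h2; rewrite (hh_val iK)// mulrC.
Qed.

(** Pythagoras for the orthogonal increments: the gain in energy is the squared L^2 distance of the
    steps. *)
Lemma hh_diff K K' : (K <= K')%N ->
  I 0 1 (fun x => (slope_step K' x - slope_step K x) ^+ 2) = slope_energy K' - slope_energy K.
Proof.
move=> KK'.
rewrite (@eq_I _ _ _ _ (fun x => (slope_step K' x * slope_step K' x - slope_step K' x * slope_step K x)
   - (slope_step K' x * slope_step K x - slope_step K x * slope_step K x))); last by move=> x _ _; ring.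
rewrite IB; [|by apply: integB => //; exact: hh_integM..].
rewrite !IB; try exact: hh_integM.
by rewrite !hh_cross//; ring.
Qed.

Lemma Q_mono K K' : (K <= K')%N -> slope_energy K <= slope_energy K'.
Proof.
move=> KK'; rewrite -subr_ge0 -hh_diff//; apply: I_ge0 => x _ _; exact: sqr_ge0.
Qed.

(** The energies increase to a finite supremum, so by [hh_diff] the steps are Cauchy in L^2. The
    third conclusion bounds the limit by the energy of a single fine level, the form in which lower
    semicontinuity is used. *)
Lemma riesz C : (forall K, slope_energy K <= C) ->
  exists h, [/\ measurable_fun setT h, integ `[0, 1] (fun x => h x ^+ 2),
    forall e, 0 < e -> exists K0, forall K, (K0 <= K)%N -> I 0 1 (fun x => h x ^+ 2) <= slope_energy K + e &
    forall K i j, (i <= j)%N -> (j <= 2 ^ K)%N -> (forall x, dyadic_pt K i <= x <= dyadic_pt K j -> X x) ->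
      I (dyadic_pt K i) (dyadic_pt K j) h = v (dyadic_pt K j) - v (dyadic_pt K i)].
Proof.
move=> QC.
have hS : has_sup (range slope_energy) by split; [exists (slope_energy 0), 0%N|exists C => _ [K _ <-]].
pose S := sup (range slope_energy).
have QS K : slope_energy K <= S by apply: ub_le_sup; [case: hS|exists K].
have cau e : 0 < e -> exists K0, forall K, (K0 <= K)%N -> S <= slope_energy K + e.
  move=> e0; have [_ [K _ <-] HK] := sup_adherent e0 hS; exists K => K' KK'.
  by have := Q_mono KK'; rewrite /S; lra.
have ej j : 0 < ((2^-1 : R) ^+ j) ^+ 2 by rewrite exprn_gt0// exprn_gt0// invr_gt0.
have [f Hf] := @choice nat nat (fun j (n : nat) => forall K, (n <= K)%N -> S <= slope_energy K + (2^-1 ^+ j) ^+ 2)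
  (fun j => cau _ (ej j)).
(* Strictly increasing levels, the j-th one within (2^-j)^2 of the supremum, hence rapidly
   Cauchy. *)
pose k := fix k j := if j is j'.+1 then maxn (k j').+1 (f j'.+1) else f 0%N.
have kS j : (k j < k j.+1)%N by rewrite /= leq_maxl.
have kf j : (f j <= k j)%N by case: j => [|j] //=; rewrite leq_maxr.
have kid j : (j <= k j)%N by elim: j => // j IH; exact: leq_ltn_trans (kS j).
have E2 K : (fun x => slope_step K x ^+ 2) = (fun x => slope_step K x * slope_step K x).
  by apply/funext => x; rewrite expr2.
have [|||h [mh Ih Sh]] := @L2_fast_lim R (fun j => slope_step (k j)).
- by move=> j; exact: hh_meas.
- by move=> j; rewrite E2; exact: hh_integM.
- move=> j; rewrite hh_diff; last exact: ltnW.
  by have := Hf j (k j) (kf j); have := QS (k j.+1); lra.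
have [|ih2 Ih2] := Sh S; first by move=> j; rewrite E2 hh_cross.
exists h; split=> //.
- move=> e /cau[K0 HK0]; exists K0 => K /HK0; exact: le_trans.
- move=> K i j ij jK HX.
  have c1 := Ih _ _ (pt_ge0 K i) (pt_le1 jK).
  (* From level [K] on, the slopes telescope and this sequence is constant. *)
  have c2 : (fun n => I (dyadic_pt K i) (dyadic_pt K j) (slope_step (k n))) @ \oo --> v (dyadic_pt K j) - v (dyadic_pt K i).
    apply: cvg_near_cst; exists K => // n /= Kn.
    have Kk : (K <= k n)%N by exact: leq_trans (kid n).
    rewrite -(subnKC Kk) (pt_refine K (k n - K) i) (pt_refine K (k n - K) j).
    rewrite hh_tele//.
    + by rewrite leq_mul2r ij orbT.
    + by rewrite expnD leq_mul2r jK orbT.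
    + by rewrite -!pt_refine.
  exact: (cvg_unique _ c1 c2).
Qed.

Lemma dyadic_between x y e : 0 <= x -> x < y -> y <= 1 -> 0 < e ->
  exists K i j, [/\ (i <= j)%N, (j <= 2 ^ K)%N, x <= dyadic_pt K i <= x + e & y - e <= dyadic_pt K j <= y].
Proof.
move=> x0 xy y1 e0.
have [k [k0 ke kxy]] := @small2 R e ((y - x) / 2) e0 ltac:(lra).
have [K HK] : exists K : nat, (2 ^+ K)^-1 < k.
  have /cvgrPdist_lt/(_ k k0)[K0 _ HK0] := @cvg_geometric R 1 2^-1 ltac:(rewrite gtr0_norm; lra).
  exists K0; have := HK0 K0 (leqnn _).
  by rewrite sub0r normrN /geometric /= mul1r exprVn gtr0_norm// invr_gt0 p2.
have tr z : 0 <= z -> dyadic_pt K (Num.truncn (z * 2 ^+ K)) <= z < dyadic_pt K (Num.truncn (z * 2 ^+ K)).+1.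
  move=> z0; rewrite /dyadic_pt ler_pdivrMr ?p2// ltr_pdivlMr ?p2//.
  by apply: Num.Theory.truncn_itv; rewrite mulr_ge0// ltW// p2.
have y0 : 0 <= y by lra.
set i := Num.truncn (x * 2 ^+ K); set j := Num.truncn (y * 2 ^+ K).
have := tr x x0; have := tr y y0; rewrite -/i -/j !ptS => /andP[h1 h2] /andP[h3 h4].
have ij : (i.+1 <= j)%N.
  rewrite leqNgt; apply/negP; rewrite ltnS => /(@pt_le K); lra.
(* Rounding [x] up and [y] down stays inside [x, y]; a mesh below (y - x) / 2 keeps the two points
   in order. *)
exists K, i.+1, j; split=> //.
- rewrite -(ler_nat R) natrX; have : dyadic_pt K j <= 1 by lra.
  by rewrite /dyadic_pt ler_pdivrMr ?p2// mul1r.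
- by rewrite ptS; apply/andP; split; lra.
- by apply/andP; split; lra.
Qed.

(** [v] and the primitive of [h] are both continuous, so the identity between dyadic points extends
    to all points. *)
Lemma riesz_ext h : measurable_fun setT h -> integ `[0, 1] (fun x => h x ^+ 2) ->
  (forall x, X x -> 0 <= x <= 1) ->
  (forall a b, (forall x, a <= x <= b -> X x) -> {within `[a, b], continuous v}) ->
  (forall K i j, (i <= j)%N -> (j <= 2 ^ K)%N -> (forall x, dyadic_pt K i <= x <= dyadic_pt K j -> X x) ->
      I (dyadic_pt K i) (dyadic_pt K j) h = v (dyadic_pt K j) - v (dyadic_pt K i)) ->
  forall a b, a <= b -> (forall x, a <= x <= b -> X x) -> prim a b v h.
Proof.
move=> mh ih2 X01 cv tele a b ab abX.
have ih : integ `[0, 1] h by apply: integ_sqr => //; exact: measurable_funTS.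
have a0 : 0 <= a by have := X01 a (abX a ltac:(rewrite lexx; lra)); lra.
have b1 : b <= 1 by have := X01 b (abX b ltac:(rewrite lexx andbT; lra)); lra.
split; first exact: (integ_sub ih).
move=> x y ax; rewrite le_eqVlt => /predU1P[->|xy] yb; first by rewrite subrr I_id.
have PH : prim 0 1 (fun x => I 0 x h) h.
  split=> // u w u0 uw w1; rewrite (@I_split _ 0 u w)//; first ring.
  exact: (integ_sub ih).
have cvab := cv a b abX.
apply/eqP; rewrite -subr_eq0 -normr_le0; apply/ler_addgt0Pl => e e0; rewrite addr0.
have e4 : 0 < e / 4 by lra.
have [d1 d10 D1] := withinP cvab (c := x) ltac:(lra) ltac:(lra) e4.
have [d2 d20 D2] := withinP cvab (c := y) ltac:(lra) ltac:(lra) e4.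
have [d3 d30 D3] := prim_cont PH (c := x) ltac:(lra) ltac:(lra) e4.
have [d4 d40 D4] := prim_cont PH (c := y) ltac:(lra) ltac:(lra) e4.
have [k1 [k10 k11 k12]] := small2 d10 d20; have [k2 [k20 k23 k24]] := small2 d30 d40.
have [k3 [k30 k31 k32]] := small2 k10 k20.
have [k [k0 kk3 kxy]] := @small2 R k3 ((y - x) / 2) k30 ltac:(lra).
have [K [i [j [ij jK /andP[i1 i2] /andP[j1 j2]]]]] :=
  @dyadic_between x y k ltac:(lra) xy ltac:(lra) k0.
set p := dyadic_pt K i in i1 i2; set q := dyadic_pt K j in j1 j2.
have pq : I p q h = v q - v p.
  by apply: tele => // z /andP[h1 h2]; apply: abX; rewrite -/p -/q in h1 h2; apply/andP; split; lra.
have := D1 p ltac:(lin) ltac:(lin) ltac:(lin) ltac:(lin).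
have := D2 q ltac:(lin) ltac:(lin) ltac:(lin) ltac:(lin).
have := D3 p ltac:(lin) ltac:(lin) ltac:(lin) ltac:(lin).
have := D4 q ltac:(lin) ltac:(lin) ltac:(lin) ltac:(lin).
have E1 := PH.2 x y ltac:(lin) ltac:(lin) ltac:(lin).
have E2 := PH.2 p q ltac:(lin) ltac:(lin) ltac:(lin).
move: E1 E2; rewrite pq; move: (I 0 x h) (I 0 y h) (I 0 p h) (I 0 q h) (I x y h) (v x) (v y) (v p) (v q).
move=> A1 A2 A3 A4 A5 A6 A7 A8 A9; rewrite !ltr_norml ler_norml.
move=> E1 E2 /andP[? ?] /andP[? ?] /andP[? ?] /andP[? ?]; apply/andP; split; lin.
Qed.

End Riesz.

(** * The energy in terms of absolutely continuous representatives *)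

Section Profiles.
Context {R : realType}.
Local Notation mu := (@lebesgue_measure R).
Implicit Types (A B U V : set R) (f g h : R -> R) (a b c x y z r s t : R) (w : R -> R * R).

Lemma cont_ae_eq U f g : open U -> (forall x, U x -> {for x, continuous f}) ->
  (forall x, U x -> {for x, continuous g}) ->
  {ae mu, forall x, U x -> f x = g x} -> forall x, U x -> f x = g x.
Proof.
move=> oU cf cg aefg x Ux; apply/eqP; rewrite -subr_eq0 -normr_le0.
apply/ler_addgt0Pl => e e0; rewrite addr0.
have e2 : 0 < e / 2 by lra.
have [r r0 Hr] := open_ball oU Ux.
have /cvgrPdist_lt/(_ _ e2)/nbhs_ballP[d1 /= d10 H1] := cf x Ux.
have /cvgrPdist_lt/(_ _ e2)/nbhs_ballP[d2 /= d20 H2] := cg x Ux.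
have [k [k0 kd1 kd2]] := small2 d10 d20; have [l [l0 lk lr]] := small2 k0 r0.
have [|y [h1 h2 Hy]] := @ae_pick R _ (x - l) (x + l) aefg; first lra.
have E := Hy (Hr y ltac:(apply/andP; split; lin)).
have := H1 y; have := H2 y; rewrite /ball/= E !ltr_norml.
move=> /(_ ltac:(apply/andP; split; lin))/andP[? ?] /(_ ltac:(apply/andP; split; lin))/andP[? ?].
by rewrite ler_norml; apply/andP; split; lin.
Qed.

(** To the left of 0 the expression [I 0 x q] is 0 by the convention on reversed intervals, which is
    the right primitive because [q] vanishes there. *)
Lemma prim_global q : integ setT q -> (forall x, x <= 0 -> q x = 0) ->
  forall a b, prim a b (fun x => I 0 x q) q.
Proof.
move=> iq q0 a b; have iq' u v : integ `[u, v] q by apply: (integS _ _ _ iq).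
split=> // x y ax xy yb.
have Z u v : v <= 0 -> I u v q = 0.
  move=> v0; case: (leP u v) => [uv|/I_gt//].
  rewrite (@eq_I _ _ _ q (fun=> 0)) ?I_cst ?mul0r// => t _ tv; apply: q0; lra.
case: (leP 0 x) => x0; first by rewrite (@I_split _ 0 x y q x0 xy (iq' _ _)); ring.
rewrite (Z 0 x (ltW x0)) subr0; case: (leP 0 y) => y0; last by rewrite !Z// ltW.
by rewrite (@I_split _ x 0 y q (ltW x0) y0 (iq' _ _)) (Z x 0 (lexx 0)) add0r.
Qed.

Definition sqi a b f := measurable_fun (`[a, b] : set R) f /\ integ `[a, b] (fun x => f x ^+ 2).

Lemma sqi_of_sq a b f : sq f -> sqi a b f.
Proof.
move=> [mf if2]; split; first exact: measurable_funTS.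
by apply: (integS _ _ _ if2).
Qed.

Lemma sqi_mulI a b f g : sqi a b f -> sqi a b g -> integ `[a, b] (fun x => f x * g x).
Proof. by move=> [mf if2] [mg ig2]; apply: integM. Qed.

Lemma sqi_integ a b f : sqi a b f -> integ `[a, b] f.
Proof. by move=> [mf if2]; exact: integ_sqr. Qed.

Lemma sqiD a b f g : sqi a b f -> sqi a b g -> sqi a b (fun x => f x + g x).
Proof.
move=> Sf Sg; have [mf if2] := Sf; have [mg ig2] := Sg.
split; first exact: measurable_funD.
apply: (@eq_integ _ _ (fun x => f x ^+ 2 + g x ^+ 2 + 2 * (f x * g x))) => //.
  by move=> x _; ring.
by apply: integD => //; [exact: integD|apply: integZ => //; exact: sqi_mulI].
Qed.

Lemma sqiZ a b k f : sqi a b f -> sqi a b (fun x => k * f x).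
Proof.
move=> [mf if2]; split; first exact: measurable_funM.
apply: (@eq_integ _ _ (fun x => k ^+ 2 * f x ^+ 2)) => //; last exact: integZ.
by move=> x _; ring.
Qed.

Lemma sqi_ext a b f g : sqi a b f -> f =1 g -> sqi a b g.
Proof. by move=> Sf /funext <-. Qed.

Lemma sqiB a b f g : sqi a b f -> sqi a b g -> sqi a b (fun x => f x - g x).
Proof.
move=> Sf Sg; apply: (sqi_ext (sqiD Sf (sqiZ (-1) Sg))) => x; ring.
Qed.

Lemma sqi_cst a b k : sqi a b (fun=> k).
Proof. by split=> //; exact: integ_cst. Qed.

Lemma sqiM_bnd a b f g C : measurable_fun (`[a, b] : set R) f ->
  (forall x, a <= x -> x <= b -> `|f x| <= C) -> sqi a b g -> sqi a b (fun x => f x * g x).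
Proof.
move=> mf fC [mg ig2]; split; first exact: measurable_funM.
apply: (@eq_integ _ _ (fun x => f x ^+ 2 * g x ^+ 2)) => //; first by move=> x _; ring.
apply: (integM_bnd (C := C ^+ 2)) => //; first exact: measurable_funX.
move=> x /=; rewrite in_itv/= => /andP[ax xb]; have := fC x ax xb; rewrite normrX => h.
by rewrite ler_sqr// nnegrE (le_trans _ h).
Qed.

Lemma prim_sqi a b f g : prim a b f g -> sqi a b f.
Proof.
move=> P; have [C C0 HC] := prim_bnd P.
have := @sqiM_bnd a b f (fun=> 1) C (prim_meas P) HC (sqi_cst a b 1).
by move/sqi_ext; apply => x; rewrite mulr1.
Qed.

Lemma sqiM_prim a b f g h : prim a b f g -> sqi a b h -> sqi a b (fun x => f x * h x).
Proof.
by move=> P; have [C C0 HC] := prim_bnd P; apply: sqiM_bnd; [exact: prim_meas P|exact: HC].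
Qed.

(* The continuous representative of an admissible map, extended by its boundary
   values outside [0, 1]; [q1], [q2] are its derivatives. *)
Definition pdata (alpha : R) (p1 p2 q1 q2 : R -> R) :=
  [/\ (forall a b, prim a b p1 q1) /\ (forall a b, prim a b p2 q2), sq q1 /\ sq q2,
   forall x, x <= 0 \/ 1 <= x -> q1 x = 0 /\ q2 x = 0,
   p1 0 = 1 /\ p2 0 = 0 & p1 1 = cos alpha /\ p2 1 = sin alpha].

(* With [kap = 2 pi floor (eps^-beta)] and [tN = 2 pi eps^-beta] this is the
   integrand of F_eps. *)
Definition dens (L eps kap tN : R) (p1 p2 q1 q2 : R -> R) (x : R) : R :=
  eps / 2 * ((q1 x - kap * p2 x) ^+ 2 + (q2 x + kap * p1 x) ^+ 2)
  + (4 * eps)^-1 * (p1 x ^+ 2 + p2 x ^+ 2 - 1) ^+ 2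
  + L / 2 * (p1 x * q2 x - p2 x * q1 x + (p1 x ^+ 2 + p2 x ^+ 2) * kap - tN) ^+ 2.

Lemma unit_sub : @unit_interval R `<=` `[0, 1].
Proof. by move=> x; rewrite /unit_interval /= !in_itv/= => /andP[/ltW -> /ltW ->]. Qed.

Lemma unit_open : open (@unit_interval R).
Proof. exact: interval_open. Qed.

Lemma unitP x : @unit_interval R x <-> 0 < x < 1.
Proof. by rewrite /unit_interval/= in_itv/=. Qed.

Lemma prim_continuous f g : (forall a b, prim a b f g) -> continuous f.
Proof. by move=> P x; apply: (@acU_cont R setT f g) => //; exact: openT. Qed.

Lemma is_derive_cosk kap x : is_derive x 1 (fun x => cos (kap * x)) (- (sin (kap * x)) * kap).
Proof.
have H : is_derive x 1 (fun x : R => kap * x) (kap * 1) by exact: is_deriveZ.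
rewrite mulr1 in H.
have := @is_derive1_comp R cos (fun x => kap * x) x _ _ (is_derive_cos _) H.
exact.
Qed.

Lemma is_derive_sink kap x : is_derive x 1 (fun x => sin (kap * x)) (cos (kap * x) * kap).
Proof.
have H : is_derive x 1 (fun x : R => kap * x) (kap * 1) by exact: is_deriveZ.
rewrite mulr1 in H.
have := @is_derive1_comp R sin (fun x => kap * x) x _ _ (is_derive_sin _) H.
exact.
Qed.

Lemma mulk_cont kap : continuous (fun x : R => kap * x).
Proof. by move=> x; apply: cvgM; [exact: cvg_cst|exact: cvg_id]. Qed.

Lemma cosk_cont kap : continuous (fun x : R => cos (kap * x)).
Proof. by move=> x; apply: (cvg_comp _ _ (@mulk_cont kap x)); exact: continuous_cos. Qed.

Lemma sink_cont kap : continuous (fun x : R => sin (kap * x)).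
Proof. by move=> x; apply: (cvg_comp _ _ (@mulk_cont kap x)); exact: continuous_sin. Qed.

Lemma prim_cosk a b kap : prim a b (fun x => cos (kap * x)) (fun x => - (sin (kap * x)) * kap).
Proof.
apply: prim_C1; first by move=> t; exact: is_derive_cosk.
by move=> x; apply: cvgM; [apply: cvgN; exact: sink_cont|exact: cvg_cst].
Qed.

Lemma prim_sink a b kap : prim a b (fun x => sin (kap * x)) (fun x => cos (kap * x) * kap).
Proof.
apply: prim_C1; first by move=> t; exact: is_derive_sink.
by move=> x; apply: cvgM; [exact: cosk_cont|exact: cvg_cst].
Qed.

Lemma dens_integ alpha L eps kap tN p1 p2 q1 q2 : pdata alpha p1 p2 q1 q2 ->
  integ `[0, 1] (dens L eps kap tN p1 p2 q1 q2).
Proof.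
move=> [[P1 P2] [S1 S2] _ _ _].
have s1 : sqi 0 1 q1 by exact: sqi_of_sq.
have s2 : sqi 0 1 q2 by exact: sqi_of_sq.
have t1 : sqi 0 1 p1 := prim_sqi (P1 0 1).
have t2 : sqi 0 1 p2 := prim_sqi (P2 0 1).
have n2 : sqi 0 1 (fun x => p1 x ^+ 2 + p2 x ^+ 2).
  by apply: sqiD; [exact: (sqiM_prim (P1 0 1) t1)|exact: (sqiM_prim (P2 0 1) t2)].
apply: integD => //; first apply: integD => //; apply: integZ => //.
- apply: integD => //.
    by have [] : sqi 0 1 (fun x => q1 x - kap * p2 x) by apply: sqiB => //; exact: sqiZ.
  by have [] : sqi 0 1 (fun x => q2 x + kap * p1 x) by apply: sqiD => //; exact: sqiZ.
- by have [] : sqi 0 1 (fun x => p1 x ^+ 2 + p2 x ^+ 2 - 1) by apply: sqiB => //; exact: sqi_cst.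
- have [] // : sqi 0 1 (fun x => p1 x * q2 x - p2 x * q1 x + (p1 x ^+ 2 + p2 x ^+ 2) * kap - tN).
  apply: sqiB; last exact: sqi_cst.
  apply: sqiD; first by apply: sqiB; [exact: (sqiM_prim (P1 0 1))|exact: (sqiM_prim (P2 0 1))].
  by apply: (sqi_ext (sqiZ kap n2)) => x; rewrite mulrC.
Qed.


Lemma trace_right f g : (forall a b, prim a b f g) -> forall a, f x @[x --> a^'+] --> f a.
Proof. by move=> P a; apply: cvg_at_right_filter; exact: (prim_continuous P). Qed.

Lemma trace_left f g : (forall a b, prim a b f g) -> forall a, f x @[x --> a^'-] --> f a.
Proof. by move=> P a; apply: cvg_at_left_filter; exact: (prim_continuous P). Qed.

Lemma acU_of_prim U f g : (forall a b, prim a b f g) -> acU U f g.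
Proof. by move=> P a b _. Qed.

Lemma cvg_pair2 (F : set_system R) (FF : Filter F) f g a b :
  f x @[x --> F] --> a -> g x @[x --> F] --> b ->
  (fun x => (f x, g x)) @ F --> (a, b).
Proof. by move=> fa gb; exact: (cvg_pair fa gb). Qed.

Lemma cvg_fst2 (F : set_system R) (FF : Filter F) w (l : R * R) :
  w x @[x --> F] --> l -> (w x).1 @[x --> F] --> l.1.
Proof. by move=> fa; apply: (cvg_comp _ _ fa); exact: cvg_fst. Qed.

Lemma cvg_snd2 (F : set_system R) (FF : Filter F) w (l : R * R) :
  w x @[x --> F] --> l -> (w x).2 @[x --> F] --> l.2.
Proof. by move=> fa; apply: (cvg_comp _ _ fa); exact: cvg_snd. Qed.

Lemma int_unit h : integ `[0, 1] h ->
  (\int[mu]_(x in @unit_interval R) (h x)%:E)%E = (I 0 1 h)%:E.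
Proof.
move=> ih; rewrite /I -integE//; symmetry; apply: integral_itv_bndoo.
by apply/measurable_EFinP; apply: measurable_funS (integ_meas ih) => //; exact: unit_sub.
Qed.

(** The derivative of the twisted field is the rotation by kap x of (q1 - kap p2, q2 + kap p1), so
    its squared length is free of the rotation. All weak derivatives involved are identified almost
    everywhere by [H1_intro]. *)
Lemma F_formula L alpha beta eps p1 p2 q1 q2 w : pdata alpha p1 p2 q1 q2 ->
  L2_plane unit_interval w ->
  {ae mu, forall x, @unit_interval R x -> w x = (p1 x, p2 x)} ->
  F_energy L alpha beta eps w =
    (I 0 1 (dens L eps (2 * pi * (Num.floor (eps `^ (- beta)))%:~R) (2 * pi * eps `^ (- beta))
       p1 p2 q1 q2))%:E.
Proof.
move=> pd [l1 l2] aew; have [[P1 P2] [S1 S2] q0 [p10 p20] [p11 p21]] := pd.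
set k := Num.floor _; set kap := 2 * pi * k%:~R; set tN := 2 * pi * _.
have oU := @unit_open; have U01 := @unit_sub.
have mU : measurable (@unit_interval R) by exact: open_measurable.
have ae1 : {ae mu, forall x, @unit_interval R x -> p1 x = comp1 w x}.
  by apply: (ae_mono aew) => x Hx /Hx; rewrite /comp1 => ->.
have ae2 : {ae mu, forall x, @unit_interval R x -> p2 x = comp2 w x}.
  by apply: (ae_mono aew) => x Hx /Hx; rewrite /comp2 => ->.
have [h1 D1] := H1_intro oU U01 l1 (sq_L2 mU S1) (acU_of_prim P1) ae1.
have [h2 D2] := H1_intro oU U01 l2 (sq_L2 mU S2) (acU_of_prim P2) ae2.
have c1 := prim_continuous P1; have c2 := prim_continuous P2.
have adm : admissible alpha w.
  split=> //.
  - exists (fun x => (p1 x, p2 x)); split.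
    + by move=> x _; apply: cvg_pair2; [exact: c1|exact: c2].
    + by apply: (ae_mono aew) => x Hx /Hx ->.
    + have r1 := trace_right P1 (a := 0); have r2 := trace_right P2 (a := 0).
      by rewrite p10 in r1; rewrite p20 in r2; exact: cvg_pair2.
  - exists (fun x => (p1 x, p2 x)); split.
    + by move=> x _; apply: cvg_pair2; [exact: c1|exact: c2].
    + by apply: (ae_mono aew) => x Hx /Hx ->.
    + have r1 := trace_left P1 (a := 1); have r2 := trace_left P2 (a := 1).
      by rewrite p11 in r1; rewrite p21 in r2; exact: cvg_pair2.
rewrite /F_energy asboolT// -int_unit; last exact: dens_integ pd.
pose u := twist k w.
have PC a b := @prim_cosk a b kap; have PS a b := @prim_sink a b kap.
have PU1 a b : prim a b (fun x => p1 x * cos (kap * x) - p2 x * sin (kap * x))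
   (fun x => (q1 x - kap * p2 x) * cos (kap * x) - (q2 x + kap * p1 x) * sin (kap * x)).
  apply: (prim_ext (primB (prim_mul (P1 a b) (PC a b)) (prim_mul (P2 a b) (PS a b)))) => x _ _ //.
  by ring.
have PU2 a b : prim a b (fun x => p1 x * sin (kap * x) + p2 x * cos (kap * x))
   (fun x => (q1 x - kap * p2 x) * sin (kap * x) + (q2 x + kap * p1 x) * cos (kap * x)).
  apply: (prim_ext (primD (prim_mul (P1 a b) (PS a b)) (prim_mul (P2 a b) (PC a b)))) => x _ _ //.
  by ring.
have L2s f : sqi 0 1 f -> L2 unit_interval f.
  move=> [mf if2]; apply: sqr_L2; first exact: measurable_funS mf.
  exact: (integS _ _ _ if2).
have s1 : sqi 0 1 q1 by exact: sqi_of_sq.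
have s2 : sqi 0 1 q2 by exact: sqi_of_sq.
have t1 : sqi 0 1 p1 := prim_sqi (P1 0 1).
have t2 : sqi 0 1 p2 := prim_sqi (P2 0 1).
have sa : sqi 0 1 (fun x => q1 x - kap * p2 x) by apply: sqiB => //; exact: sqiZ.
have sb : sqi 0 1 (fun x => q2 x + kap * p1 x) by apply: sqiD => //; exact: sqiZ.
have scos f : sqi 0 1 f -> sqi 0 1 (fun x => f x * cos (kap * x)).
  by move=> sf; apply: (sqi_ext (sqiM_prim (PC 0 1) sf)) => x; rewrite mulrC.
have ssin f : sqi 0 1 f -> sqi 0 1 (fun x => f x * sin (kap * x)).
  by move=> sf; apply: (sqi_ext (sqiM_prim (PS 0 1) sf)) => x; rewrite mulrC.
have mcos : measurable_fun (@unit_interval R) (fun x => cos (kap * x)).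
  by apply: measurable_funTS; apply: continuous_measurable_fun; exact: cosk_cont.
have msin : measurable_fun (@unit_interval R) (fun x => sin (kap * x)).
  by apply: measurable_funTS; apply: continuous_measurable_fun; exact: sink_cont.
(* [w] is only almost everywhere equal to its representative: square integrability is transported,
   measurability is taken from [w] itself. *)
have L2ae f g : measurable_fun (@unit_interval R) f -> sqi 0 1 g ->
   {ae mu, forall x, @unit_interval R x -> g x = f x} -> L2 unit_interval f.
  move=> mf sg H; split=> //.
  have [mg lg] := L2s _ sg; apply: le_lt_trans lg.
  rewrite le_eqVlt; apply/orP; left; apply/eqP; apply: ae_eq_integral => //.
  - by apply/measurable_EFinP; exact: measurable_funX.
  - by apply/measurable_EFinP; exact: measurable_funX.
  - by apply: (ae_mono H) => x Hx /Hx /= ->.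
have [m1 _] := l1; have [m2 _] := l2.
have aeu1 : {ae mu, forall x, @unit_interval R x ->
    p1 x * cos (kap * x) - p2 x * sin (kap * x) = comp1 u x}.
  by apply: (ae_mono aew) => x Hx /Hx; rewrite /u /comp1 /twist /cmul /expi => -> /=.
have aeu2 : {ae mu, forall x, @unit_interval R x ->
    p1 x * sin (kap * x) + p2 x * cos (kap * x) = comp2 u x}.
  by apply: (ae_mono aew) => x Hx /Hx; rewrite /u /comp2 /twist /cmul /expi => -> /=.
have lu1 : L2 unit_interval (comp1 u).
  apply: (L2ae _ _ _ _ aeu1).
    by apply: measurable_funB; apply: measurable_funM.
  by apply: sqiB; [exact: scos|exact: ssin].
have lu2 : L2 unit_interval (comp2 u).
  apply: (L2ae _ _ _ _ aeu2).
    by apply: measurable_funD; apply: measurable_funM.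
  by apply: sqiD; [exact: ssin|exact: scos].
have lg1 := L2s _ (sqiB (scos _ sa) (ssin _ sb)).
have lg2 := L2s _ (sqiD (ssin _ sa) (scos _ sb)).
have [hu1 DU1] := H1_intro oU U01 lu1 lg1 (acU_of_prim PU1) aeu1.
have [hu2 DU2] := H1_intro oU U01 lu2 lg2 (acU_of_prim PU2) aeu2.
have mW f : H1 unit_interval f -> measurable_fun (@unit_interval R) (weakD unit_interval f).
  move=> /(H1_inv oU U01)[v [_ _ [ms _]]].
  by apply/(measurable_restrictT _ mU).
apply: ae_eq_integral => //.
- apply/measurable_EFinP; rewrite /F_density -/k -/u.
  have mn : measurable_fun (@unit_interval R) (fun x => sqnorm (w x)).
    by apply: measurable_funD; exact: measurable_funX.
  apply: measurable_funD; first apply: measurable_funD; apply: measurable_funM => //.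
  + by apply: measurable_funD; apply: measurable_funX; exact: mW.
  + by apply: measurable_funX; apply: measurable_funB.
  + apply: measurable_funX; apply: measurable_funB => //; apply: measurable_funD.
      by apply: measurable_funB; apply: measurable_funM => //; exact: mW.
    exact: measurable_funM.
- apply/measurable_EFinP; apply: measurable_funS (integ_meas (dens_integ L eps kap tN pd)) => //.
- have AE := ae_and (ae_and aew (ae_and DU1 DU2)) (ae_and D1 D2).
  apply: (ae_mono AE) => x [[Hw [Hu1 Hu2]] [Hd1 Hd2]] Ux /=.
  congr EFin; rewrite /F_density -/k -/u Hu1// Hu2// /current Hd1// Hd2// /comp1 /comp2 /sqnorm Hw//=.
  rewrite -/kap -/tN /dens; congr (_ + _ + _); congr (_ * _).
  rewrite -[X in _ = X]mulr1 -(cos2Dsin2 (kap * x)); ring.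
Qed.

Lemma sq_integT g : sq g -> (forall x, x < 0 \/ 1 < x -> g x = 0) -> integ setT g.
Proof.
move=> sg g0; have := (integ_patch _ (measurable_itv `[(0:R), 1])).1 (sqi_integ (sqi_of_sq 0 1 sg)).
apply: eq_integ => // x _; rewrite patchE; case: ifPn => // /negP h.
rewrite g0//; have {h} /negP : ~ (0 <= x <= 1).
  by move=> h'; apply: h; apply: mem_set; rewrite /= in_itv.
by rewrite negb_and -!ltNge => /orP.
Qed.

(** The representative of an H^1 map is a constant plus a primitive, and the trace at 0 fixes the
    constant. Extending the derivative by 0 makes the map constant outside [0, 1]. *)
Lemma F_inv alpha w : admissible alpha w ->
  exists p1 p2 q1 q2, pdata alpha p1 p2 q1 q2 /\
    {ae mu, forall x, @unit_interval R x -> w x = (p1 x, p2 x)}.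
Proof.
move=> [[h1 h2] [v [cv aev v0]] [v' [cv' aev' v1]]].
have oU := @unit_open; have U01 := @unit_sub.
have mU : measurable (@unit_interval R) by exact: open_measurable.
have [f1 [ac1 aef1 sq1]] := H1_inv oU U01 h1.
have [f2 [ac2 aef2 sq2]] := H1_inv oU U01 h2.
set q1 := _ \_ _ in ac1 sq1; set q2 := _ \_ _ in ac2 sq2.
have q0 x : x <= 0 \/ 1 <= x -> q1 x = 0 /\ q2 x = 0.
  move=> hx; rewrite /q1 /q2 !patchE memNset// => /unitP /andP[? ?]; case: hx => ?; lra.
have iq1 : integ setT q1.
  by apply: sq_integT => // x hx; apply: (q0 x _).1; lra.
have iq2 : integ setT q2.
  by apply: sq_integT => // x hx; apply: (q0 x _).2; lra.
have P1 := prim_global iq1 (fun x hx => (q0 x (or_introl hx)).1).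
have P2 := prim_global iq2 (fun x hx => (q0 x (or_introl hx)).2).
have cf1 x (Ux : unit_interval x) := acU_cont oU ac1 Ux.
have cf2 x (Ux : unit_interval x) := acU_cont oU ac2 Ux.
(* The two traces may be witnessed by different continuous functions [cu] and [cu']; both coincide
   with [f] on (0, 1). *)
have key f q c k (cu : R -> R) (cu' : R -> R) : acU unit_interval f q -> (forall a b, prim a b (fun x => I 0 x q) q) ->
   (forall x, @unit_interval R x -> {for x, continuous cu}) ->
   (forall x, @unit_interval R x -> {for x, continuous cu'}) ->
   {ae mu, forall x, @unit_interval R x -> cu x = f x} ->
   {ae mu, forall x, @unit_interval R x -> cu' x = f x} ->
   cu x @[x --> 0^'+] --> c -> cu' x @[x --> 1^'-] --> k ->
   (forall x, @unit_interval R x -> f x = c + I 0 x q) /\ c + I 0 1 q = k.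
  move=> ac P ccu ccu' ae1 ae2 lim0 lim1.
  have E1 := cont_ae_eq oU ccu (fun x Ux => acU_cont oU ac Ux) ae1.
  have E2 := cont_ae_eq oU ccu' (fun x Ux => acU_cont oU ac Ux) ae2.
  have [m Em] : exists m, forall x, @unit_interval R x -> f x - I 0 x q = m.
    exists (f (1/2) - I 0 (1/2) q) => x /unitP/andP[x0 x1].
    have sub a b : 0 < a -> b < 1 -> a <= b -> f b - I 0 b q = f a - I 0 a q.
      move=> a0 b1 ab.
      have [_ /(_ a b)] := ac a b ltac:(move=> z /andP[? ?]; apply/unitP/andP; split; lra).
      rewrite !lexx => /(_ isT ab isT).
      by have := (P a b).2 a b (lexx _) ab (lexx _); lra.
    case: (leP x (1/2)) => h; [have := sub x (1/2)|have := sub (1/2) x]; lra.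
  have fm x : @unit_interval R x -> f x = m + I 0 x q by move=> /Em; lra.
  have mc : m = c.
    have l1 : m + I 0 x q @[x --> 0^'+] --> m + 0.
      apply: cvgD; first exact: cvg_cst.
      by have := trace_right P (a := 0); rewrite I_id.
    rewrite addr0 in l1.
    apply: (cvg_unique (@Rhausdorff R) l1).
    apply: cvg_trans lim0; apply: near_eq_cvg; near=> x.
    have Ux : @unit_interval R x.
      by apply/unitP/andP; split; near: x; [exact: nbhs_right_gt|exact: nbhs_right_lt].
    by rewrite E1// fm.
  split; first by move=> x Ux; rewrite fm// mc.
  have l1 : m + I 0 x q @[x --> 1^'-] --> m + I 0 1 q.
    by apply: cvgD; [exact: cvg_cst|exact: (trace_left P)].
  rewrite mc in l1; apply: (cvg_unique (@Rhausdorff R) l1).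
  apply: cvg_trans lim1; apply: near_eq_cvg; near=> x.
  have Ux : @unit_interval R x.
    by apply/unitP/andP; split; near: x; [exact: nbhs_left_gt|exact: nbhs_left_lt].
  by rewrite E2// fm// mc.
have cv1 (g : R -> R * R) : {in @unit_interval R, continuous g} ->
    forall x, @unit_interval R x -> {for x, continuous (fun y => (g y).1)}.
  by move=> cg x Ux; apply: cvg_fst2; apply: cg; rewrite inE.
have cv2 (g : R -> R * R) : {in @unit_interval R, continuous g} ->
    forall x, @unit_interval R x -> {for x, continuous (fun y => (g y).2)}.
  by move=> cg x Ux; apply: cvg_snd2; apply: cg; rewrite inE.
have aeg1 (g : R -> R * R) : {ae mu, forall x, @unit_interval R x -> g x = w x} ->
   {ae mu, forall x, @unit_interval R x -> (g x).1 = f1 x}.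
  by move=> H; apply: (ae_mono (ae_and H aef1)) => x [h3 h4] Ux; rewrite h3// h4.
have aeg2 (g : R -> R * R) : {ae mu, forall x, @unit_interval R x -> g x = w x} ->
   {ae mu, forall x, @unit_interval R x -> (g x).2 = f2 x}.
  by move=> H; apply: (ae_mono (ae_and H aef2)) => x [h3 h4] Ux; rewrite h3// h4.
have [K1 K1'] := key f1 q1 _ _ _ _ ac1 P1 (cv1 _ cv) (cv1 _ cv') (aeg1 _ aev) (aeg1 _ aev')
  (cvg_fst2 _ v0) (cvg_fst2 _ v1).
have [K2 K2'] := key f2 q2 _ _ _ _ ac2 P2 (cv2 _ cv) (cv2 _ cv') (aeg2 _ aev) (aeg2 _ aev')
  (cvg_snd2 _ v0) (cvg_snd2 _ v1).
have PD c q : (forall a b, prim a b (fun x => I 0 x q) q) -> forall a b, prim a b (fun x => c + I 0 x q) q.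
  move=> P a b; apply: (prim_ext (primD (@prim_cst R a b c) (P a b))) => x _ _ //.
  by rewrite add0r.
exists (fun x => 1 + I 0 x q1), (fun x => 0 + I 0 x q2), q1, q2; split.
  split; [by split; exact: PD|by split|exact: q0| |by split].
  by rewrite !I_id !addr0.
apply: (ae_mono (ae_and aef1 aef2)) => x [H1' H2'] Ux.
have := K1 x Ux; have := K2 x Ux; rewrite H1'// H2'// /comp1 /comp2 /= => <- <-.
exact: surjective_pairing.
Unshelve. all: by end_near. Qed.

End Profiles.

(** * Modica-Mortola cost and dips *)

Section ModicaMortola.
Context {R : realType}.
Local Notation mu := (@lebesgue_measure R).
Implicit Types (A B U V : set R) (f g h : R -> R) (a b c d x y z r s t : R) (w : R -> R * R).

(* [Psi 0 (rho^2)] is the Modica-Mortola primitive of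
   [(1 - rho^2) / sqrt 2]; in the variable [t = rho^2] the shift by [d] makes
   it differentiable at [t = 0]. *)
Definition Psi d t : R := ((1 + d) * Num.sqrt (t + d) - Num.sqrt (t + d) ^+ 3 / 3) / Num.sqrt 2.
Definition psi d t : R := (1 - t) / (2 * Num.sqrt 2 * Num.sqrt (t + d)).

Lemma sqrt2_gt0 : 0 < Num.sqrt (2 : R).
Proof. by rewrite sqrtr_gt0. Qed.

Lemma sqr_sqrt2 : Num.sqrt (2 : R) ^+ 2 = 2.
Proof. by rewrite sqr_sqrtr. Qed.

Lemma is_derive_Psi d t : 0 < d -> 0 <= t -> is_derive t 1 (Psi d) (psi d t).
Proof.
move=> d0 t0; have td : 0 < t + d by lra.
have D1 : is_derive t 1 (fun t => t + d) (1 + 0) by apply: is_deriveD.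
rewrite addr0 in D1.
have D2 : is_derive t 1 (fun t => Num.sqrt (t + d)) (2 * Num.sqrt (t + d))^-1.
  have := @is_derive1_comp R Num.sqrt (fun t => t + d) t _ _ (is_derive1_sqrt td) D1.
  by rewrite mulr1.
have D3 : is_derive t 1 (fun t => Num.sqrt (t + d) ^+ 3) (3 * Num.sqrt (t + d) ^+ 2 * (2 * Num.sqrt (t + d))^-1).
  have D3' := is_deriveX 3 D2.
  have E : (fun t => Num.sqrt (t + d)) ^+ 3 = (fun t => Num.sqrt (t + d) ^+ 3).
    by apply/funext => u; rewrite fctE.
  rewrite E in D3'; apply: (is_derive_eq D3').
  by rewrite /GRing.scale/=; ring.
have s0 : 0 < Num.sqrt (t + d) by rewrite sqrtr_gt0.
have s2 : Num.sqrt (t + d) ^+ 2 = t + d by rewrite sqr_sqrtr// ltW.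
have -> : Psi d = (fun t => (Num.sqrt 2)^-1 * ((1 + d) * Num.sqrt (t + d) - 3^-1 * Num.sqrt (t + d) ^+ 3)).
  by apply/funext => u; rewrite /Psi; ring.
have -> : psi d t = (Num.sqrt 2)^-1 * ((1 + d) * (2 * Num.sqrt (t + d))^-1 - 3^-1 * (3 * Num.sqrt (t + d) ^+ 2 * (2 * Num.sqrt (t + d))^-1)).
  rewrite s2 /psi; field; apply/andP; split; rewrite gt_eqF//; exact: sqrt2_gt0.
by apply: is_deriveZ; apply: is_deriveB; apply: is_deriveZ.
Qed.

Lemma psi_cont d t : 0 < d -> 0 <= t -> {for t, continuous (psi d)}.
Proof.
move=> d0 t0; have td : 0 < t + d by lra.
have s0 : 0 < Num.sqrt (t + d) by rewrite sqrtr_gt0.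
apply: cvgM; first by apply: cvgB; [exact: cvg_cst|exact: cvg_id].
apply: cvgV; first by rewrite gt_eqF// !mulr_gt0// sqrt2_gt0.
apply: cvgM; first exact: cvg_cst.
apply: (@cvg_comp _ _ _ (fun t => t + d) Num.sqrt); last exact: sqrt_continuous.
by apply: cvgD; [exact: cvg_id|exact: cvg_cst].
Qed.

Lemma Psi_mono d s t : 0 < d -> 0 <= s -> s <= t -> t <= 1 -> Psi d s <= Psi d t.
Proof.
move=> d0 s0 st t1; rewrite /Psi ler_pM2r ?invr_gt0 ?sqrt2_gt0//.
have u2 : Num.sqrt (s + d) ^+ 2 = s + d by rewrite sqr_sqrtr//; lra.
have v2 : Num.sqrt (t + d) ^+ 2 = t + d by rewrite sqr_sqrtr//; lra.
have uv : Num.sqrt (s + d) <= Num.sqrt (t + d) by rewrite ler_wsqrtr//; lra.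
have u0 := sqrtr_ge0 (s + d).
move: u2 v2 uv u0; move: (Num.sqrt (s + d)) (Num.sqrt (t + d)) => u v u2 v2 uv u0.
rewrite -subr_ge0.
have -> : (1 + d) * v - v ^+ 3 / 3 - ((1 + d) * u - u ^+ 3 / 3) =
  (v - u) * ((1 + d) - (u ^+ 2 + u * v + v ^+ 2) / 3) by field.
apply: mulr_ge0; first lra.
have : u * v <= v ^+ 2 by rewrite expr2 ler_wpM2r//; lra.
lra.
Qed.

(** At d = 0 the right side is 1 - 1/3. For d > 0 the upper value only increases, and the lower one
    is at most (1 + d) sqrt(2 d) <= 4 sqrt d. *)
Lemma Psi_gap d : 0 < d -> d <= 1 -> 2 / 3 - 4 * Num.sqrt d <= (Psi d 1 - Psi d d) * Num.sqrt 2.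
Proof.
move=> d0 d1; rewrite /Psi -mulrBl mulfVK; last by rewrite gt_eqF// sqrt2_gt0.
have a2 : Num.sqrt (1 + d) ^+ 2 = 1 + d by rewrite sqr_sqrtr//; lra.
have b2 : Num.sqrt (d + d) ^+ 2 = d + d by rewrite sqr_sqrtr//; lra.
have c2 : Num.sqrt d ^+ 2 = d by rewrite sqr_sqrtr//; lra.
have := sqrtr_ge0 (1 + d); have := sqrtr_ge0 (d + d); have := sqrtr_ge0 d.
move: a2 b2 c2; move: (Num.sqrt (1 + d)) (Num.sqrt (d + d)) (Num.sqrt d) => a b c a2 b2 c2 c0 b0 a0.
have a1 : 1 <= a by rewrite -(@ler_pXn2r _ 2)// ?nnegrE// expr1n a2; lra.
have bc : b <= 2 * c by rewrite -(@ler_pXn2r _ 2)// ?nnegrE ?mulr_ge0// exprMn b2 c2; lra.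
have -> : a ^+ 3 = a * (1 + d) by rewrite -a2; ring.
have h1 : 2 / 3 <= (1 + d) * a - a * (1 + d) / 3 by nra.
have h2 : (1 + d) * b <= 4 * c by nra.
have h3 : 0 <= b ^+ 3 by rewrite exprn_ge0.
lra.
Qed.

Lemma Psi_lt d : 0 < d -> d < 1 -> Psi d d < Psi d 1.
Proof.
move=> d0 d1; rewrite /Psi ltr_pM2r ?invr_gt0 ?sqrt2_gt0//.
have u2 : Num.sqrt (d + d) ^+ 2 = d + d by rewrite sqr_sqrtr//; lra.
have v2 : Num.sqrt (1 + d) ^+ 2 = 1 + d by rewrite sqr_sqrtr//; lra.
have uv : Num.sqrt (d + d) < Num.sqrt (1 + d) by rewrite ltr_sqrt//; lra.
have u0 := sqrtr_ge0 (d + d).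
move: u2 v2 uv u0; move: (Num.sqrt (d + d)) (Num.sqrt (1 + d)) => u v u2 v2 uv u0.
rewrite -subr_gt0.
have -> : (1 + d) * v - v ^+ 3 / 3 - ((1 + d) * u - u ^+ 3 / 3) =
  (v - u) * ((1 + d) - (u ^+ 2 + u * v + v ^+ 2) / 3) by field.
apply: mulr_gt0; first lra.
have : u * v <= v ^+ 2 by rewrite expr2 ler_wpM2r//; lra.
lra.
Qed.

Lemma Psi_cont1 d e : 0 < d -> 0 < e -> exists2 eta, 0 < eta &
  forall t, `|t - 1| <= eta -> `|Psi d t - Psi d 1| < e.
Proof.
move=> d0 e0.
have [D _] := is_derive_Psi d0 (ler01 : 0 <= 1).
have : {for 1, continuous (Psi d)} by apply: differentiable_continuous; apply/derivable1_diffP.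
move=> /cvgrPdist_lt/(_ e e0)/nbhs_ballP[r /= r0 Hr].
exists (r / 2); first lra.
by move=> t ht; rewrite distrC; apply: Hr; rewrite /ball/= distrC; lra.
Qed.

(** One term of a sequence: eps, 2 pi floor(eps^-beta), 2 pi eps^-beta, a map and its derivative.
    The three numbers are independent fields, linked only through the limits in [good_seq]. *)
Record cfg := Cfg { ceps : R; ckap : R; ctN : R;
  cp1 : R -> R; cp2 : R -> R; cq1 : R -> R; cq2 : R -> R }.

Definition cs (c : cfg) x : R := cp1 c x ^+ 2 + cp2 c x ^+ 2.
(** Squared length of the twisted derivative. The cut is essential: outside [0, 1] the constant
    extension of the map would contribute kap^2. *)
Definition cA (c : cfg) := (fun x => (cq1 c x - ckap c * cp2 c x) ^+ 2 + (cq2 c x + ckap c * cp1 c x) ^+ 2) \_ `[0, 1].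
(* The phase transition part of the integrand, and the quantity whose square is
   penalised by [L / 2]. *)
Definition mm (c : cfg) x : R := ceps c / 2 * cA c x + (4 * ceps c)^-1 * (cs c x - 1) ^+ 2.
Definition gg (c : cfg) x : R :=
  cp1 c x * cq2 c x - cp2 c x * cq1 c x + cs c x * ckap c - ctN c.
Definition cdens L (c : cfg) := dens L (ceps c) (ckap c) (ctN c) (cp1 c) (cp2 c) (cq1 c) (cq2 c).
Definition cpdata alpha (c : cfg) := pdata alpha (cp1 c) (cp2 c) (cq1 c) (cq2 c).

Section OneConfig.
Variables (alpha : R) (c : cfg).
Hypotheses (pd : cpdata alpha c) (eps0 : 0 < ceps c).

Lemma cs_prim a b : prim a b (cs c) (fun x => 2 * (cp1 c x * cq1 c x + cp2 c x * cq2 c x)).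
Proof.
have [[P1 P2] _ _ _ _] := pd.
apply: (prim_ext (primD (prim_mul (P1 a b) (P1 a b)) (prim_mul (P2 a b) (P2 a b)))) => x _ _.
  by rewrite /cs; ring.
by ring.
Qed.

Lemma cs_ge0 x : 0 <= cs c x.
Proof. by rewrite /cs addr_ge0 ?sqr_ge0. Qed.

Lemma cs_out x : x <= 0 \/ 1 <= x -> cs c x = 1.
Proof.
have [[P1 P2] _ q0 [p10 p20] [p11 p21]] := pd.
have Z a b (q : R -> R) : (forall x, x <= 0 \/ 1 <= x -> q x = 0) -> a <= b -> b <= 0 \/ 1 <= a -> I a b q = 0.
  move=> qz ab h; rewrite (@eq_I _ _ _ q (fun=> 0)) ?I_cst ?mul0r// => t at_ tb.
  by apply: qz; case: h => h; [left|right]; lra.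
have z1 y hy := (q0 y hy).1; have z2 y hy := (q0 y hy).2.
case=> x0; rewrite /cs.
- have := (P1 x 0).2 x 0 (lexx _) x0 (lexx _); rewrite (Z _ _ _ z1)//; last by left.
  have := (P2 x 0).2 x 0 (lexx _) x0 (lexx _); rewrite (Z _ _ _ z2)//; last by left.
  by rewrite p10 p20 => /eqP; rewrite sub0r oppr_eq0 => /eqP -> /eqP; rewrite subr_eq0 => /eqP <-;
    rewrite expr0n addr0 expr1n.
- have := (P1 1 x).2 1 x (lexx _) x0 (lexx _); rewrite (Z _ _ _ z1)//; last by right.
  have := (P2 1 x).2 1 x (lexx _) x0 (lexx _); rewrite (Z _ _ _ z2)//; last by right.
  rewrite p11 p21 => /eqP; rewrite subr_eq0 => /eqP -> /eqP; rewrite subr_eq0 => /eqP ->.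
  exact: cos2Dsin2.
Qed.

Lemma cA_ge0 x : 0 <= cA c x.
Proof. by rewrite /cA patchE; case: ifP => // _; rewrite addr_ge0 ?sqr_ge0. Qed.

Lemma mm_ge0 x : 0 <= mm c x.
Proof.
have := cA_ge0 x; move=> ?; rewrite /mm addr_ge0// mulr_ge0 ?sqr_ge0//.
  by rewrite divr_ge0 ?ltW.
by rewrite invr_ge0 mulr_ge0// ltW.
Qed.

Lemma mm_out x : x < 0 \/ 1 < x -> mm c x = 0.
Proof.
move=> hx; rewrite /mm cs_out; last by case: hx => ?; [left|right]; lra.
rewrite subrr expr0n mulr0 addr0 /cA patchE memNset ?mulr0//=.
by rewrite in_itv/= => /andP[? ?]; case: hx => ?; lra.
Qed.

Lemma cA_integ : integ setT (cA c).
Proof.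
have [[P1 P2] [S1 S2] _ _ _] := pd.
apply: (integ_patch _ (measurable_itv `[(0:R), 1])).1; apply: integD => //.
  have [//] : sqi 0 1 (fun x => cq1 c x - ckap c * cp2 c x).
  by apply: sqiB; [exact: sqi_of_sq|apply: sqiZ; exact: (prim_sqi (P2 0 1))].
have [//] : sqi 0 1 (fun x => cq2 c x + ckap c * cp1 c x).
by apply: sqiD; [exact: sqi_of_sq|apply: sqiZ; exact: (prim_sqi (P1 0 1))].
Qed.

Lemma cs1_sqi a b : sqi a b (fun x => cs c x - 1).
Proof. by apply: sqiB; [exact: (prim_sqi (cs_prim a b))|exact: sqi_cst]. Qed.

Lemma mm_integ a b : integ `[a, b] (mm c).
Proof.
apply: integD => //; apply: integZ => //; first by apply: (integS _ _ _ cA_integ).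
by have [] := cs1_sqi a b.
Qed.

Lemma I_supp_le f a b : (forall u v, integ `[u, v] f) -> (forall x, 0 <= f x) ->
  (forall x, x < 0 \/ 1 < x -> f x = 0) -> I a b f <= I 0 1 f.
Proof.
move=> iF f0 fz; pose u := Num.min a 0; pose v := Num.max b 1.
have ua : u <= a by rewrite /u ge_min lexx.
have u0 : u <= 0 by rewrite /u ge_min lexx orbT.
have bv : b <= v by rewrite /v le_max lexx.
have v1 : 1 <= v by rewrite /v le_max lexx orbT.
apply: (@le_trans _ _ (I u v f)); first exact: I_sub.
rewrite (@I_split _ u 0 v)//; last lra.
rewrite (@I_split _ 0 1 v)//.
have z1 : I u 0 f = 0.
  rewrite (@I_eq_lt _ _ _ f (fun=> 0)) ?I_cst ?mul0r//; first exact: integ_cst.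
  by move=> x _ x0; apply: fz; left.
have z2 : I 1 v f = 0.
  rewrite (@eq_I_ae _ 1 v f (fun=> 0)) ?I_cst ?mul0r//; first exact: integ_cst.
  have Nb : {ae mu, forall x : R, x <> 1}.
    apply: (@negligibleS _ _ _ mu [set 1]); first by move=> x /= /contrapT.
    by apply/negligibleP => //; exact: lebesgue_measure_set1.
  apply: (ae_mono Nb) => x x1 /=; rewrite in_itv/= => /andP[hx _].
  by apply: fz; right; rewrite lt_neqAle hx andbT; apply/eqP => /esym.
lra.
Qed.

Lemma mm_le a b : I a b (mm c) <= I 0 1 (mm c).
Proof.
by apply: I_supp_le; [exact: mm_integ|exact: mm_ge0|exact: mm_out].
Qed.

Lemma mm_pot a b : a <= b -> I a b (fun x => (cs c x - 1) ^+ 2) <= 4 * ceps c * I a b (mm c).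
Proof.
move=> ab; rewrite -IZ; last exact: mm_integ.
apply: I_le; [by have [] := cs1_sqi a b|apply: integZ => //; exact: mm_integ|].
move=> x _ _; rewrite /mm mulrDr.
have -> : 4 * ceps c * ((4 * ceps c)^-1 * (cs c x - 1) ^+ 2) = (cs c x - 1) ^+ 2.
  by field; rewrite gt_eqF.
rewrite lerDr; have := cA_ge0 x => ?; rewrite !mulr_ge0//; try exact: ltW.
Qed.

(** By the chain rule the integrand is [psi] times 2 p.p'. Since p is orthogonal to its rotation i
    p, p.p' equals p.(p' + i kap p), so (p.p')^2 <= |p|^2 [cA] by Cauchy-Schwarz. The inequality 4 u
    v <= (u + v)^2 between the two terms of [mm] concludes. *)
Lemma modica_mortola d x y : 0 < d -> x <= y ->
  `|Psi d (cs c y) - Psi d (cs c x)| <= I x y (mm c).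
Proof.
move=> d0 xy.
have P := prim_comp (cs_prim x y) (fun z _ _ => cs_ge0 z) (fun u u0 => is_derive_Psi d0 u0)
  (fun u u0 => psi_cont d0 u0).
rewrite (P.2 x y)//; apply: (le_trans (I_norm P.1)).
apply: I_le; [exact/integ_norm/P.1|exact: mm_integ|] => z _ _.
have [[P1 P2] _ q0 _ _] := pd.
have s0 := cs_ge0 z; have m0 := mm_ge0 z.
have [/andP[z0 z1]|nz] := pselect (0 < z < 1); last first.
  have hz : z <= 0 \/ 1 <= z.
    by move/negP: nz; rewrite negb_and -!leNgt => /orP.
  by have [-> ->] := q0 z hz; rewrite !mulr0 addr0 !mulr0 normr0.
rewrite -ler_sqr ?nnegrE// real_normK ?num_real//.

have AE : cA c z = (cq1 c z - ckap c * cp2 c z) ^+ 2 + (cq2 c z + ckap c * cp1 c z) ^+ 2.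
  by rewrite /cA patchE mem_set//= in_itv/= !ltW.
have sd : 0 < cs c z + d by lra.
have sig : (2 * (cp1 c z * cq1 c z + cp2 c z * cq2 c z)) ^+ 2 <= 4 * cs c z * cA c z.
  rewrite AE /cs.
  have := sqr_ge0 (cp1 c z * (cq2 c z + ckap c * cp1 c z) - cp2 c z * (cq1 c z - ckap c * cp2 c z)).
  move: (cp1 c z) (cp2 c z) (cq1 c z) (cq2 c z) (ckap c) => u1 u2 v1 v2 k h.
  rewrite -subr_ge0.
  have -> : 4 * (u1 ^+ 2 + u2 ^+ 2) * ((v1 - k * u2) ^+ 2 + (v2 + k * u1) ^+ 2) - (2 * (u1 * v1 + u2 * v2)) ^+ 2
    = 4 * (u1 * (v2 + k * u1) - u2 * (v1 - k * u2)) ^+ 2 by ring.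
  by rewrite mulr_ge0.
rewrite exprMn /psi exprMn exprVn exprMn sqr_sqrtr ?(ltW sd)// exprMn sqr_sqrt2.
have h1 : (1 - cs c z) ^+ 2 * (2 ^+ 2 * 2 * (cs c z + d))^-1 * (2 * (cp1 c z * cq1 c z + cp2 c z * cq2 c z)) ^+ 2
   <= (1 - cs c z) ^+ 2 * (2 ^+ 2 * 2 * (cs c z + d))^-1 * (4 * cs c z * cA c z).
  by rewrite ler_wpM2l// mulr_ge0 ?sqr_ge0// invr_ge0 mulr_ge0// ltW.
apply: (le_trans h1).
have A0 := cA_ge0 z.
have h2 : (1 - cs c z) ^+ 2 * (2 ^+ 2 * 2 * (cs c z + d))^-1 * (4 * cs c z * cA c z) <= (1 - cs c z) ^+ 2 * cA c z / 2.
  have -> : (1 - cs c z) ^+ 2 * (2 ^+ 2 * 2 * (cs c z + d))^-1 * (4 * cs c z * cA c z) =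
    (1 - cs c z) ^+ 2 * cA c z / 2 * (cs c z / (cs c z + d)).
    by field; rewrite gt_eqF.
  apply: ler_piMr; first by rewrite divr_ge0// mulr_ge0// sqr_ge0.
  by rewrite ler_pdivrMr//; lra.
apply: (le_trans h2); rewrite /mm.
have -> : (1 - cs c z) ^+ 2 * cA c z / 2 =
  4 * ((ceps c / 2 * cA c z) * ((4 * ceps c)^-1 * (cs c z - 1) ^+ 2)) by field; rewrite gt_eqF.
move: (ceps c / 2 * cA c z) ((4 * ceps c)^-1 * (cs c z - 1) ^+ 2) => u v.
by rewrite -subr_ge0; have := sqr_ge0 (u - v); congr (0 <= _); ring.
Qed.

End OneConfig.
End ModicaMortola.

(** * Dips of the modulus along a sequence of bounded energy *)

Section Dips.
Context {R : realType}.
Local Notation mu := (@lebesgue_measure R).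
Implicit Types (f g h : R -> R) (a b d x y z r s t : R) (c : nat -> @cfg R)
  (sg : nat -> nat) (D : seq R).

(** Encodes subsequences by domination of the identity: this is what lets limits and eventual
    properties pass to [u \o sg], and it is stable under composition. *)
Definition subs sg := forall n, (n <= sg n)%N.

Lemma near_sub sg (P : nat -> Prop) : subs sg -> (\forall n \near \oo, P n) ->
  \forall n \near \oo, P (sg n).
Proof.
move=> ss [N _ HN]; exists N => // n /= Nn; apply: HN => /=; exact: leq_trans (ss n).
Qed.

Lemma cvg_sub sg (u : nat -> R) (l : R) : subs sg -> u @ \oo --> l -> (u \o sg) @ \oo --> l.
Proof.
move=> ss ul; apply: cvg_comp ul => P [N _ HN]; exists N => // n /= Nn; apply: HN => /=.
exact: leq_trans (ss n).
Qed.

Lemma ex_sub (P : nat -> nat -> Prop) : (forall j, exists2 n, (j <= n)%N & P j n) ->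
  exists2 sg, subs sg & forall j, P j (sg j).
Proof.
move=> H; have [sg Hs] := @choice nat nat (fun j n => (j <= n)%N /\ P j n)
  (fun j => let: ex_intro2 n h1 h2 := H j in ex_intro _ n (conj h1 h2)).
by exists sg => j; have [] := Hs j.
Qed.

Lemma not_near (P : nat -> Prop) : ~ (\forall n \near \oo, P n) ->
  forall j, exists2 n, (j <= n)%N & ~ P n.
Proof.
move=> H j; apply: contrapT => H2; apply: H; exists j => // n /= jn.
by apply: contrapT => H3; apply: H2; exists n.
Qed.

(** The asymptotic content of the hypotheses: the fractional parts enter through [ctN - ckap], the
    range of beta through [ckap * sqrt(ceps)], and L^2 convergence in its L^1 form. *)
Definition good_seq (alpha L M A : R) (w1 w2 : R -> R) c :=
 [/\ forall n, [/\ cpdata alpha (c n), 0 < ceps (c n), 0 <= ckap (c n) & I 0 1 (cdens L (c n)) <= M],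
   (fun n => ceps (c n)) @ \oo --> (0 : R),
   (fun n => ctN (c n) - ckap (c n)) @ \oo --> 2 * pi * A,
   (fun n => ckap (c n) * Num.sqrt (ceps (c n))) @ \oo --> (0 : R)
 & (fun n => I 0 1 (fun x => `|cp1 (c n) x - w1 x|)) @ \oo --> (0 : R) /\
   (fun n => I 0 1 (fun x => `|cp2 (c n) x - w2 x|)) @ \oo --> (0 : R)].

Lemma good_seq_sub alpha L M A w1 w2 c sg : subs sg ->
  good_seq alpha L M A w1 w2 c -> good_seq alpha L M A w1 w2 (c \o sg).
Proof.
move=> ss [H1 H2 H3 H4 [H5 H6]]; split.
- by move=> n; exact: H1.
- exact: (cvg_sub ss H2).
- exact: (cvg_sub ss H3).
- exact: (cvg_sub ss H4).
- by split; [exact: (cvg_sub ss H5)|exact: (cvg_sub ss H6)].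
Qed.

Lemma gg_sqi alpha (c : @cfg R) : cpdata alpha c -> sqi 0 1 (gg c).
Proof.
move=> pd; have [[P1 P2] [S1 S2] _ _ _] := pd.
apply: sqiB; last exact: sqi_cst.
apply: sqiD; first by apply: sqiB; [apply: (sqiM_prim (P1 0 1))|apply: (sqiM_prim (P2 0 1))];
  exact: sqi_of_sq.
by apply: (sqi_ext (sqiZ (ckap c) (prim_sqi (cs_prim pd 0 1)))) => x; rewrite mulrC.
Qed.

Lemma cdens_split alpha L (c : @cfg R) : cpdata alpha c ->
  I 0 1 (cdens L c) = I 0 1 (mm c) + L / 2 * I 0 1 (fun x => gg c x ^+ 2).
Proof.
move=> pd; have [_ ig2] := gg_sqi pd.
rewrite -IZ// -ID; [|exact: (mm_integ pd)|exact: integZ].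
apply: eq_I => x x0 x1; rewrite /cdens /dens /mm /gg /cs /cA patchE mem_set//.
by rewrite /= in_itv/= x0.
Qed.

Section GoodSeq.
Variables (alpha L M A : R) (w1 w2 : R -> R).
Hypothesis L0 : 0 < L.

Lemma good_bounds c n : good_seq alpha L M A w1 w2 c ->
  I 0 1 (mm (c n)) <= M /\ I 0 1 (fun x => gg (c n) x ^+ 2) <= 2 * M / L.
Proof.
move=> [/(_ n)[pd e0 k0 HM] _ _ _ _]; move: HM; rewrite (cdens_split _ pd).
have m0 : 0 <= I 0 1 (mm (c n)) by apply: I_ge0 => x _ _; exact: (mm_ge0 e0).
have g0 : 0 <= I 0 1 (fun x => gg (c n) x ^+ 2) by apply: I_ge0 => x _ _; exact: sqr_ge0.
have lg : 0 <= L / 2 * I 0 1 (fun x => gg (c n) x ^+ 2) by rewrite mulr_ge0// divr_ge0// ltW.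
move=> H; split; first lra.
by rewrite ler_pdivlMr//; lra.
Qed.

Lemma good_pot c n a b : good_seq alpha L M A w1 w2 c -> a <= b ->
  I a b (fun x => (cs (c n) x - 1) ^+ 2) <= 4 * ceps (c n) * M.
Proof.
move=> gs ab; have [bm _] := good_bounds n gs.
have [/(_ n)[pd e0 _ _] _ _ _ _] := gs.
apply: (le_trans (mm_pot pd e0 ab)); rewrite ler_wpM2l//; first by rewrite mulr_ge0// ltW.
exact: le_trans (mm_le pd e0 a b) bm.
Qed.

(** If |p|^2 stayed further than eta from 1 on all of [u, v], the potential would exceed its bound 4
    eps M. *)
Lemma good_point c u v eta : good_seq alpha L M A w1 w2 c -> u < v -> 0 < eta ->
  \forall n \near \oo, exists a, [/\ u <= a, a <= v & `|cs (c n) a - 1| <= eta].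
Proof.
move=> gs uv eta0.
have M0 : 0 <= M.
  have [bm _] := good_bounds 0 gs; apply: le_trans bm; apply: I_ge0 => x _ _.
  by have [/(_ 0%N)[_ e0 _ _] _ _ _ _] := gs; exact: (mm_ge0 e0).
have [_ ec _ _ _] := gs.
(* M + 1 in place of M keeps the quotient meaningful when M = 0. *)
have k0 : 0 < eta ^+ 2 * (v - u) / (4 * (M + 1)).
  by rewrite divr_gt0 ?mulr_gt0 ?exprn_gt0//; lra.
move/cvgrPdist_lt/(_ _ k0): ec; apply: filterS => n; rewrite sub0r normrN.
have [/(_ n)[pd e0 _ _] _ _ _ _] := gs.
rewrite gtr0_norm// ltr_pdivlMr; last lra.
move=> H; apply: contrapT => nH.
have : eta ^+ 2 * (v - u) <= 4 * ceps (c n) * M.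
  apply: le_trans (good_pot n gs (ltW uv)).
  rewrite -(I_cst _ (ltW uv)); apply: I_le; [exact: integ_cst|by have [] := cs1_sqi pd u v|].
  move=> x ux xv; rewrite -[X in _ <= X]real_normK ?num_real// ler_sqr ?nnegrE//; last exact: ltW.
  by rewrite leNgt; apply/negP => Hx; apply: nH; exists x; split=> //; exact: ltW.
have := mulr_ge0 (ltW e0) M0; nra.
Qed.

(* A dip is a point near which every late term of the sequence has a point
   where the modulus squared is at most [d]; each one costs [2 (Psi d 1 - Psi d d)], which tends to
   [2 sqrt 2 / 3] as [d] goes to 0. *)
Definition dip_at c d x := forall r, 0 < r ->
  \forall n \near \oo, exists2 y, x - r <= y <= x + r & cs (c n) y <= d.

(** Between two points with |p|^2 near 1, one on each side of [x], the modulus goes down to the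
    level [d] and up again, and each way costs [Psi d 1 - Psi d d]. Dips at 0 or 1 pay in full,
    since the map is extended with modulus 1 and [mm] vanishes outside [0, 1]. *)
Lemma dip_cost c d x r e : good_seq alpha L M A w1 w2 c -> 0 < d -> d < 1 ->
  dip_at c d x -> 0 < r -> 0 < e ->
  \forall n \near \oo, 2 * (Psi d 1 - Psi d d) - e <= I (x - r) (x + r) (mm (c n)).
Proof.
move=> gs d0 d1 dx r0 e0; have e4 : 0 < e / 2 by lra.
have [eta eta0 Heta] := Psi_cont1 d0 e4.
have N1 := @good_point c (x - r) (x - r / 2) eta gs ltac:(lra) eta0.
have N2 := @good_point c (x + r / 2) (x + r) eta gs ltac:(lra) eta0.
have N3 := dx (r / 2) ltac:(lra).
near=> n.
have [a [a1 a2 a3]] : exists a, [/\ x - r <= a, a <= x - r / 2 & `|cs (c n) a - 1| <= eta] by near: n.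
have [b [b1 b2 b3]] : exists a, [/\ x + r / 2 <= a, a <= x + r & `|cs (c n) a - 1| <= eta] by near: n.
have [y /andP[y1 y2] y3] : exists2 y, x - r / 2 <= y <= x + r / 2 & cs (c n) y <= d by near: n.
have [/(_ n)[pd ep0 _ _] _ _ _ _] := gs.
have imm u v := mm_integ pd u v.
have m0 := mm_ge0 ep0.
have h1 : I a b (mm (c n)) <= I (x - r) (x + r) (mm (c n)).
  by apply: I_sub.
have h2 : I a b (mm (c n)) = I a y (mm (c n)) + I y b (mm (c n)).
  by apply: I_split => //; lra.
have h3 := modica_mortola pd ep0 d0 (x := a) (y := y) ltac:(lra).
have h4 := modica_mortola pd ep0 d0 (x := y) (y := b) ltac:(lra).
have h5 := Heta _ a3; have h6 := Heta _ b3.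
have h7 : Psi d (cs (c n) y) <= Psi d d by apply: Psi_mono => //; [exact: cs_ge0|exact: ltW].
move: h1 h2 h3 h4 h5 h6 h7; rewrite !ler_norml !ltr_norml.
move: (I _ _ _) (I _ _ _) (I _ _ _) (I _ _ _) (Psi _ _) (Psi _ _) (Psi _ _) (Psi _ _) (Psi _ _) => *.
lra.
Unshelve. all: by end_near. Qed.

Lemma separation D : exists2 r, 0 < r & forall x y, x \in D -> y \in D -> x <> y -> 2 * r < `|x - y|.
Proof.
have sep1 x D' : exists2 r, 0 < r & forall y, y \in D' -> x <> y -> 2 * r < `|x - y|.
  elim: D' => [|z D' [r r0 IH]]; first by exists 1.
  have [xz|xz] := eqVneq x z.
    by exists r => // y; rewrite inE => /orP[/eqP -> //|]; exact: IH.
  have xz0 : 0 < `|x - z| / 2 by rewrite divr_gt0// normr_gt0 subr_eq0.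
  have [k [k0 kr kz]] := small2 r0 xz0.
  exists k => // y; rewrite inE => /orP[/eqP -> _|yD xy]; first lra.
  by have := IH y yD xy; lra.
elim: D => [|z D [r r0 IH]]; first by exists 1.
have [s s0 Hs] := sep1 z D.
have [k [k0 kr ks]] := small2 r0 s0.
exists k => // x y; rewrite !inE => /orP[/eqP ->|xD] /orP[/eqP ->|yD] // xy.
- by have := Hs y yD xy; lra.
- by have := Hs x xD (nesym xy); rewrite distrC; lra.
- by have := IH x y xD yD xy; lra.
Qed.

Lemma sum_disjoint f D r : integ setT f -> (forall x, 0 <= f x) -> uniq D -> 0 < r ->
  (forall x y, x \in D -> y \in D -> x <> y -> 2 * r < `|x - y|) ->
  \sum_(x <- D) I (x - r) (x + r) f <= \int[mu]_(x in setT) f x.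
Proof.
move=> iF f0 uD r0 sep.
have iI a b : integ `[a, b] f by apply: (integS _ _ _ iF).
rewrite -lee_fin -sumEFin /I.
under eq_bigr do rewrite -integE//.
rewrite -integE// -(@ge0_integral_bigsetU _ _ _ mu _ (fun x => `[x - r, x + r]%classic) _ D) //=.
- apply: ge0_subset_integral => //=.
  + by apply: bigsetU_measurable.
  + by apply/measurable_EFinP; exact: integ_meas.
  + by move=> x _; rewrite lee_fin.
- apply/trivIsetP => x y /= xD yD xy; apply/seteqP; split=> z //=.
  rewrite !in_itv/= => -[/andP[h1 h2] /andP[h3 h4]].
  have := sep x y xD yD (elimN eqP xy); rewrite ltr_normr => /orP[?|?]; lra.
- by apply/measurable_EFinP; apply: measurable_funTS; exact: integ_meas.
- by move=> x _; rewrite lee_fin.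
Qed.

Lemma near_all (T : eqType) (l : seq T) (P : T -> nat -> Prop) :
  (forall i, i \in l -> \forall n \near \oo, P i n) ->
  \forall n \near \oo, forall i, i \in l -> P i n.
Proof.
elim: l => [|i l IH] H; first by apply: nearW.
have H1 : \forall n \near \oo, P i n by apply: H; rewrite inE eqxx.
have H2 : \forall n \near \oo, forall j, j \in l -> P j n.
  by apply: IH => j js; apply: H; rewrite inE js orbT.
near=> n => j; rewrite inE => /orP[/eqP ->|]; first by near: n.
by move: j; near: n.
Unshelve. all: by end_near. Qed.

Definition dips c d D := [/\ uniq D, forall x, x \in D -> 0 <= x <= 1 & forall x, x \in D -> dip_at c d x].

Lemma mm_integT n c : good_seq alpha L M A w1 w2 c -> integ setT (mm (c n)).
Proof.
move=> gs; have [/(_ n)[pd ep0 _ _] _ _ _ _] := gs.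
have := (integ_patch _ (measurable_itv `[(0:R), 1])).1 (mm_integ pd 0 1).
apply: eq_integ => // x _; rewrite patchE; case: ifPn => // /negP h.
rewrite (mm_out pd)//; have {h} /negP : ~ (0 <= x <= 1).
  by move=> h'; apply: h; apply: mem_set; rewrite /= in_itv.
by rewrite negb_and -!ltNge => /orP.
Qed.

Lemma mm_intT n c : good_seq alpha L M A w1 w2 c -> \int[mu]_(x in setT) mm (c n) x = I 0 1 (mm (c n)).
Proof.
move=> gs; have [/(_ n)[pd ep0 _ _] _ _ _ _] := gs.
apply: int_supp => // x _ /=; rewrite in_itv/= => /negP h.
by apply: (mm_out pd); move: h; rewrite negb_and -!ltNge => /orP.
Qed.

Lemma dips_cost c d D e : good_seq alpha L M A w1 w2 c -> 0 < d -> d < 1 -> dips c d D -> 0 < e ->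
  \forall n \near \oo, (size D)%:R * (2 * (Psi d 1 - Psi d d) - e) <= I 0 1 (mm (c n)).
Proof.
move=> gs d0 d1 [uD D01 dD] e0.
have [r r0 sep] := separation D.
have N := @near_all _ D (fun x n => 2 * (Psi d 1 - Psi d d) - e <= I (x - r) (x + r) (mm (c n)))
  (fun x xD => dip_cost gs d0 d1 (dD x xD) r0 e0).
near=> n.
have Nn : forall x, x \in D -> 2 * (Psi d 1 - Psi d d) - e <= I (x - r) (x + r) (mm (c n)).
  by near: n; exact: N.
rewrite -(mm_intT n gs).
have [/(_ n)[pd ep0 _ _] _ _ _ _] := gs.
apply: le_trans (sum_disjoint (mm_integT n gs) (mm_ge0 ep0) uD r0 sep).
set k := 2 * _ - e in Nn *.
have -> : (size D)%:R * k = \sum_(x <- D) k.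
  by rewrite big_const_seq count_predT iter_addr addr0 mulr_natl.
by rewrite big_seq [X in _ <= X]big_seq; apply: ler_sum => x; exact: Nn.
Unshelve. all: by end_near. Qed.

Lemma dips_sub c d D sg : subs sg -> dips c d D -> dips (c \o sg) d D.
Proof.
move=> ss [uD D01 dD]; split=> // x xD r r0.
exact: (near_sub ss (dD x xD r r0)).
Qed.

(* The energy bound limits the number of dips that a subsequence may have. When
   this number is maximal, no further subsequence dips away from [D], so
   |p_n|^2 > d eventually on compact intervals avoiding [D]. *)
Lemma max_dips c d : good_seq alpha L M A w1 w2 c -> 0 < d -> d < 1 ->
  exists sg D, [/\ subs sg, dips (c \o sg) d D &
    forall a b, a <= b -> 0 <= a -> b <= 1 -> (forall x, a <= x <= b -> x \notin D) ->
      \forall n \near \oo, forall y, a <= y <= b -> d < cs (c (sg n)) y].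
Proof.
move=> gs d0 d1.
pose P m := exists sg D, [/\ subs sg, dips (c \o sg) d D & size D = m].
have P0 : P 0%N by exists id, [::]; split=> //; split.
have gap : 0 < Psi d 1 - Psi d d by rewrite subr_gt0; exact: Psi_lt.
have bnd m : P m -> m%:R * (Psi d 1 - Psi d d) <= M.
  move=> [sg [D [ss dD <-]]].
  have gs' := good_seq_sub ss gs.
  have [N _ HN] := dips_cost gs' d0 d1 dD gap.
  have := HN N (leqnn _); have [bm _] := good_bounds N gs'.
  move=> h; apply: le_trans bm; apply: le_trans h; rewrite ler_wpM2l//; lra.
have [m [Pm nPm]] : exists m, P m /\ ~ P m.+1.
  apply: contrapT => H.
  have Pall m : P m.
    elim: m => // m Pm; apply: contrapT => nP; apply: H; by exists m.
  have := bnd _ (Pall (Num.truncn (M / (Psi d 1 - Psi d d))).+1).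
  rewrite -ler_pdivlMr// leNgt => /negP; apply; exact: Num.Theory.truncnS_gt.
have [sg [D [ss dD sD]]] := Pm.
exists sg, D; split=> // a b ab a0 b1 abD.
apply: (@cousin _ (fun x y => \forall n \near \oo, forall z, x <= z <= y -> d < cs (c (sg n)) z) a b) => //.
  move=> x y z ax xy yz zb H1 H2; near=> n => t /andP[xt tz].
  case: (leP t y) => ty.
    have : forall z, x <= z <= y -> d < cs (c (sg n)) z by near: n.
    by apply; rewrite xt.
  have : forall t, y <= t <= z -> d < cs (c (sg n)) t by near: n.
  by apply; rewrite tz ltW.
move=> x0 ax0 x0b.
have [[r r0 Hr]|nH] := pselect (exists2 r, 0 < r &
    \forall n \near \oo, forall y, x0 - r <= y <= x0 + r -> d < cs (c (sg n)) y).
  exists r => // x y ax xy yb xr yr; apply: filterS Hr => n Hn z /andP[? ?].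
  by apply: Hn; apply/andP; split; lra.
exfalso; apply: nPm.
(* The j-th selected term has a low point within 1 / (j + 1) of [x0], which makes [x0] one more dip
   of the subsequence and contradicts maximality. *)
have [tau stau Htau] : exists2 tau, subs tau & forall j,
    exists2 y, x0 - j.+1%:R^-1 <= y <= x0 + j.+1%:R^-1 & cs (c (sg (tau j))) y <= d.
  apply: (@ex_sub (fun j n => exists2 y, x0 - j.+1%:R^-1 <= y <= x0 + j.+1%:R^-1 & cs (c (sg n)) y <= d)) => j.
  have nj : ~ \forall n \near \oo, forall y, x0 - j.+1%:R^-1 <= y <= x0 + j.+1%:R^-1 -> d < cs (c (sg n)) y.
    by move=> H; apply: nH; exists j.+1%:R^-1 => //; rewrite invr_gt0.
  have [n jn Hn] := not_near nj j.
  exists n => //; apply: contrapT => H; apply: Hn => y hy; rewrite ltNge; apply/negP => h.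
  by apply: H; exists y.
exists (sg \o tau), (x0 :: D); split.
- by move=> n; apply: leq_trans (ss _); exact: stau.
- have [uD D01 dDD] := dips_sub stau dD.
  split.
  + by rewrite /= uD andbT; apply: abD; rewrite ax0.
  + by move=> x; rewrite inE => /orP[/eqP ->|]; [lra|exact: D01].
  + move=> x; rewrite inE => /orP[/eqP ->|]; last exact: dDD.
    move=> r r0.
    have /cvgrPdist_lt/(_ r r0) := @cvg_harmonic R.
    apply: filterS => n; rewrite sub0r normrN /harmonic gtr0_norm ?invr_gt0// => hr.
    have {}hr : n.+1%:R^-1 < r := hr.
    have [y /andP[y1 y2] y3] := Htau n; exists y => //.
    move: hr y1 y2; move: (n.+1%:R^-1) => k hr y1 y2.
    by apply/andP; split; lra.
- by rewrite /= sD.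
Unshelve. all: by end_near. Qed.

End GoodSeq.
End Dips.

(** * The phase away from the dips *)

Section UnitField.
Context {R : realType}.
Local Notation mu := (@lebesgue_measure R).
Implicit Types (f g h : R -> R) (a b d x y z r s t th : R) (c : @cfg R).

Lemma inv_meas : measurable_fun setT (fun x : R => x^-1).
Proof.
have o0 : open [set x : R | x != 0].
  rewrite (_ : [set x : R | x != 0] = `]-oo, 0[ `|` `]0, +oo[).
    by apply: openU; exact: interval_open.
  apply/seteqP; split=> x /=; rewrite !in_itv/= andbT neq_lt; first by move=> /orP.
  by case=> ->; rewrite ?orbT.
have -> : [set: R] = [set 0] `|` [set x | x != 0].
  by apply/seteqP; split=> x //= _; case: (eqVneq x 0) => ?; [left|right].
apply/measurable_funU; [exact: measurable_set1|exact: open_measurable|split].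
  exact: measurable_fun_set1.
apply: open_continuous_measurable_fun => // x; rewrite inE /= => x0.
exact: inv_continuous.
Qed.

Lemma sqrt_meas : measurable_fun setT (@Num.sqrt R).
Proof. by apply: continuous_measurable_fun; exact: sqrt_continuous. Qed.

(* [z1], [z2] is the normalised map p / |p| rotated by [- th x]; its angular
   speed is [hc - th] with [hc = (p x p') / |p|^2]. At zeros of [p] the
   convention 0^-1 = 0 gives z = 0. *)
Definition zr c x : R := (Num.sqrt (cs c x))^-1.
Definition z1 th c x : R := (cp1 c x * cos (th * x) + cp2 c x * sin (th * x)) * zr c x.
Definition z2 th c x : R := (cp2 c x * cos (th * x) - cp1 c x * sin (th * x)) * zr c x.
Definition jj c x : R := cp1 c x * cq2 c x - cp2 c x * cq1 c x.
Definition hc c x : R := jj c x * zr c x ^+ 2.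

Lemma is_derive_isqrt t : 0 < t ->
  is_derive t 1 (fun u : R => (Num.sqrt u)^-1) (- (2^-1) * (Num.sqrt t)^-1 ^+ 3).
Proof.
move=> t0; have s0 : Num.sqrt t != 0 by rewrite gt_eqF// sqrtr_gt0.
have D1 := is_derive1_sqrt t0.
have D2 := @is_deriveV _ (@Num.sqrt R) t (2 * Num.sqrt t)^-1 1 s0 D1.
apply: (is_derive_eq D2).
by rewrite /GRing.scale/=; field.
Qed.

Lemma isqrt_cont t : 0 < t -> {for t, continuous (fun u : R => - (2^-1) * (Num.sqrt u)^-1 ^+ 3)}.
Proof.
move=> t0; have s0 : Num.sqrt t != 0 by rewrite gt_eqF// sqrtr_gt0.
have cV : {for t, continuous (fun u : R => (Num.sqrt u)^-1)}.
  by apply: cvgV => //; exact: sqrt_continuous.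
apply: cvgM; first exact: cvg_cst.
have -> : (fun u : R => (Num.sqrt u)^-1 ^+ 3) = (fun u => (Num.sqrt u)^-1 * ((Num.sqrt u)^-1 * (Num.sqrt u)^-1)).
  by apply/funext => u; ring.
rewrite (_ : (Num.sqrt t)^-1 ^+ 3 = (Num.sqrt t)^-1 * ((Num.sqrt t)^-1 * (Num.sqrt t)^-1)); last by ring.
by apply: cvgM => //; apply: cvgM.
Qed.

Lemma zr_sq c x : 0 < cs c x -> zr c x ^+ 2 * cs c x = 1.
Proof.
by move=> s0; rewrite /zr exprVn sqr_sqrtr ?(ltW s0)// mulVf// gt_eqF.
Qed.

Lemma z_norm th c x : 0 < cs c x -> z1 th c x ^+ 2 + z2 th c x ^+ 2 = 1.
Proof.
move=> s0; rewrite -[RHS](zr_sq s0) -[RHS]mulr1 -(cos2Dsin2 (th * x)) /z1 /z2 /cs; ring.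
Qed.

Lemma z_norm_le th c x : z1 th c x ^+ 2 + z2 th c x ^+ 2 <= 1.
Proof.
have := cs_ge0 c x; rewrite le_eqVlt => /predU1P[s0|s0]; last by rewrite z_norm.
by rewrite /z1 /z2 /zr -s0 sqrtr0 invr0 !mulr0 expr0n addr0 ler01.
Qed.

Lemma z1_le th c x : `|z1 th c x| <= 1.
Proof.
rewrite -ler_sqr ?nnegrE// expr1n real_normK ?num_real//.
have := z_norm_le th c x; have := sqr_ge0 (z2 th c x); lra.
Qed.

Lemma z2_le th c x : `|z2 th c x| <= 1.
Proof.
rewrite -ler_sqr ?nnegrE// expr1n real_normK ?num_real//.
have := z_norm_le th c x; have := sqr_ge0 (z1 th c x); lra.
Qed.

Section One.
Variables (alpha th : R) (c : @cfg R).
Hypotheses (pd : cpdata alpha c) (eps0 : 0 < ceps c).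

Lemma z_meas : measurable_fun setT (z1 th c) /\ measurable_fun setT (z2 th c).
Proof.
have [[P1 P2] _ _ _ _] := pd.
have m1 : measurable_fun setT (cp1 c) by apply: continuous_measurable_fun; exact: prim_continuous P1.
have m2 : measurable_fun setT (cp2 c) by apply: continuous_measurable_fun; exact: prim_continuous P2.
have mc : measurable_fun setT (fun x : R => cos (th * x)) by apply: continuous_measurable_fun; exact: cosk_cont.
have ms : measurable_fun setT (fun x : R => sin (th * x)) by apply: continuous_measurable_fun; exact: sink_cont.
have mz : measurable_fun setT (zr c).
  apply: (measurableT_comp inv_meas); apply: (measurableT_comp sqrt_meas).
  apply: continuous_measurable_fun; apply: prim_continuous => a b; exact: (cs_prim pd).
by split; apply: measurable_funM => //; [apply: measurable_funD|apply: measurable_funB];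
  apply: measurable_funM.
Qed.

Lemma z_integ a b : integ `[a, b] (z1 th c) /\ integ `[a, b] (z2 th c).
Proof.
have [m1 m2] := z_meas.
split; apply: (integ_le _ _ (g := fun=> 1)) => //; try exact: measurable_funTS; try exact: integ_cst.
- by move=> x _; exact: z1_le.
- by move=> x _; exact: z2_le.
Qed.

(** A unit field moves orthogonally to itself, so its derivative is a scalar speed times its
    rotation by a right angle. The lower bound [d] keeps 1 / |p| absolutely continuous. *)
Lemma z_prim d a b : 0 < d -> (forall x, a <= x <= b -> d <= cs c x) ->
  prim a b (z1 th c) (fun x => - (hc c x - th) * z2 th c x) /\
  prim a b (z2 th c) (fun x => (hc c x - th) * z1 th c x).
Proof.
move=> d0 sd; have [[P1 P2] _ _ _ _] := pd.
have PR : prim a b (zr c) (fun x => - zr c x ^+ 3 * (cp1 c x * cq1 c x + cp2 c x * cq2 c x)).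
  have := @prim_comp R a b (cs c) _ d (fun u => (Num.sqrt u)^-1) (fun u => - (2^-1) * (Num.sqrt u)^-1 ^+ 3) (cs_prim pd a b).
  move=> /(_ _ _ _)/prim_ext; apply => //.
  - by move=> x ax xb; apply: sd; rewrite ax.
  - by move=> u du; apply: is_derive_isqrt; lra.
  - by move=> u du; apply: isqrt_cont; lra.
  - by move=> x _ _; rewrite /zr; move: (Num.sqrt _)^-1 => r; lra.
have PC := @prim_cosk R a b th; have PS := @prim_sink R a b th.
have rs x : a <= x -> x <= b -> zr c x ^+ 2 * (cp1 c x ^+ 2 + cp2 c x ^+ 2) = 1.
  move=> ax xb; apply: zr_sq; apply: lt_le_trans d0 _; apply: sd; by rewrite ax.
split.
- apply: (prim_ext (prim_mul (primD (prim_mul (P1 a b) PC) (prim_mul (P2 a b) PS)) PR)) => // x ax xb.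
  have := rs x ax xb; rewrite /hc /jj /z2.
  move: (cp1 c x) (cp2 c x) (cq1 c x) (cq2 c x) (zr c x) (cos (th * x)) (sin (th * x)) => u1 u2 v1 v2 r co si E.
  apply/eqP; rewrite -subr_eq0.
  (* The product rule and the rotation form differ by a multiple of 1 - r^2 |p|^2, which is 0
     because r = 1 / |p|. *)
  match goal with |- is_true (?X == 0) => have -> : X = (v1 * co + v2 * si) * r * (1 - r ^+ 2 * (u1 ^+ 2 + u2 ^+ 2)) by ring end.
  by rewrite E subrr mulr0.
- apply: (prim_ext (prim_mul (primB (prim_mul (P2 a b) PC) (prim_mul (P1 a b) PS)) PR)) => // x ax xb.
  have := rs x ax xb; rewrite /hc /jj /z1.
  move: (cp1 c x) (cp2 c x) (cq1 c x) (cq2 c x) (zr c x) (cos (th * x)) (sin (th * x)) => u1 u2 v1 v2 r co si E.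
  apply/eqP; rewrite -subr_eq0.
  match goal with |- is_true (?X == 0) => have -> : X = (v2 * co - v1 * si) * r * (1 - r ^+ 2 * (u1 ^+ 2 + u2 ^+ 2)) by ring end.
  by rewrite E subrr mulr0.
Qed.

Lemma jj_sqi a b : sqi a b (jj c).
Proof.
have [[P1 P2] [S1 S2] _ _ _] := pd.
by apply: sqiB; [apply: (sqiM_prim (P1 a b))|apply: (sqiM_prim (P2 a b))]; exact: sqi_of_sq.
Qed.

Lemma zr_le d x : 0 < d -> d <= cs c x -> zr c x ^+ 2 <= d^-1.
Proof.
move=> d0 ds; have s0 : 0 < cs c x by lra.
have := zr_sq s0; rewrite -[X in _ <= X]mul1r ler_pdivlMr// => E.
rewrite -[X in _ <= X]E ler_wpM2l ?sqr_ge0//.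
Qed.

Lemma zr_meas a b d : 0 < d -> (forall x, a <= x <= b -> d <= cs c x) -> measurable_fun (`[a, b] : set R) (zr c).
Proof.
move=> d0 sd; apply: measurable_funTS.
apply: (measurableT_comp inv_meas); apply: (measurableT_comp sqrt_meas).
by apply: continuous_measurable_fun; apply: prim_continuous => u v; exact: (cs_prim pd).
Qed.

Lemma hc_sqi d a b : 0 < d -> (forall x, a <= x <= b -> d <= cs c x) -> sqi a b (hc c).
Proof.
move=> d0 sd.
have := @sqiM_bnd R a b (fun x => zr c x ^+ 2) (jj c) d^-1 _ _ (jj_sqi a b).
move=> H; apply: (sqi_ext (H _ _)) => [|x ax xb|x].
- by apply: measurable_funX; exact: (zr_meas d0).
- by rewrite ger0_norm ?sqr_ge0//; apply: zr_le => //; apply: sd; rewrite ax.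
- by rewrite /hc mulrC.
Qed.

Lemma hc_le d a b : 0 < d -> a <= b -> (forall x, a <= x <= b -> d <= cs c x) ->
  I a b (fun x => hc c x ^+ 2) <= (d^-1) ^+ 2 * I a b (fun x => jj c x ^+ 2).
Proof.
move=> d0 ab sd; have [_ ij2] := jj_sqi a b; rewrite -IZ//.
apply: I_le; [by have [] := hc_sqi d0 sd|exact: integZ|].
move=> x ax xb; rewrite /hc exprMn mulrC ler_wpM2r ?sqr_ge0//.
rewrite ler_sqr ?nnegrE ?sqr_ge0// ?invr_ge0 ?(ltW d0)//.
by apply: zr_le => //; apply: sd; rewrite ax.
Qed.

(** The chord is at most the length of the arc. *)
Lemma z_diff d a b : 0 < d -> a <= b -> (forall x, a <= x <= b -> d <= cs c x) ->
  (z1 th c b - z1 th c a) ^+ 2 + (z2 th c b - z2 th c a) ^+ 2 <= I a b (fun x => `|hc c x - th|) ^+ 2.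
Proof.
move=> d0 ab sd; have [Q1 Q2] := z_prim d0 sd.
have E1 := Q1.2 a b (lexx _) ab (lexx _); have E2 := Q2.2 a b (lexx _) ab (lexx _).
set u := z1 th c b - z1 th c a in E1 *; set v := z2 th c b - z2 th c a in E2 *.
have ih : integ `[a, b] (fun x => hc c x - th).
  by apply: sqi_integ; apply: sqiB; [exact: (hc_sqi d0)|exact: sqi_cst].
set J := I a b (fun x => `|hc c x - th|).
have J0 : 0 <= J by apply: I_ge0.
pose N := Num.sqrt (u ^+ 2 + v ^+ 2).
have N2 : N ^+ 2 = u ^+ 2 + v ^+ 2 by rewrite sqr_sqrtr// addr_ge0 ?sqr_ge0.
have N0 : 0 <= N by exact: sqrtr_ge0.
(* The increment is paired with itself: N^2 is the integral of its scalar product with z', and |z'|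
   <= |hc - th|. *)
have H : N ^+ 2 <= N * J.
  rewrite N2 2!expr2 {1}E1 {1}E2.
  have -> : I a b (fun x => - (hc c x - th) * z2 th c x) * u + I a b (fun x => (hc c x - th) * z1 th c x) * v =
     I a b (fun x => u * (- (hc c x - th) * z2 th c x) + v * ((hc c x - th) * z1 th c x)).
    by rewrite ID; [rewrite !IZ; [ring|exact: Q2.1|exact: Q1.1]|exact/integZ/Q1.1|exact/integZ/Q2.1].
  rewrite -IZ; last exact: integ_norm.
  apply: I_le; [by apply: integD => //; [exact/integZ/Q1.1|exact/integZ/Q2.1]|exact/integZ/integ_norm|].
  move=> x ax xb; have zn := z_norm_le th c x.
  rewrite -[X in _ <= X](@ger0_norm _ (N * _)) ?mulr_ge0//.
  apply: (le_trans (ler_norm _)).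
  rewrite -ler_sqr ?nnegrE// !real_normK ?num_real// exprMn real_normK ?num_real// N2.
  move: (hc c x - th) zn; move: (z1 th c x) (z2 th c x) => a1 a2 hh zn.
  have -> : (u * (- hh * a2) + v * (hh * a1)) ^+ 2 = (v * a1 - u * a2) ^+ 2 * hh ^+ 2 by ring.
  rewrite ler_wpM2r ?sqr_ge0//.
  apply: (@le_trans _ _ ((u ^+ 2 + v ^+ 2) * (a1 ^+ 2 + a2 ^+ 2))).
    rewrite -subr_ge0.
    have -> : (u ^+ 2 + v ^+ 2) * (a1 ^+ 2 + a2 ^+ 2) - (v * a1 - u * a2) ^+ 2 = (u * a1 + v * a2) ^+ 2 by ring.
    exact: sqr_ge0.
  by rewrite ler_piMr// addr_ge0 ?sqr_ge0.
rewrite -N2 ler_sqr ?nnegrE//.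
move: N0; rewrite le_eqVlt => /predU1P[<-//|N0].
by move: H; rewrite expr2 ler_pM2l.
Qed.

(** Normalising moves p by |1 - |p||, which is at most |1 - |p|^2|; at a zero of p the convention
    for [z1] and [z2] gives no error. *)
Lemma v_close a b : a <= b ->
  I a b (fun x => `|z1 th c x - (cp1 c x * cos (th * x) + cp2 c x * sin (th * x))|) <= I a b (fun x => `|cs c x - 1|) /\
  I a b (fun x => `|z2 th c x - (cp2 c x * cos (th * x) - cp1 c x * sin (th * x))|) <= I a b (fun x => `|cs c x - 1|).
Proof.
move=> ab; have [[P1 P2] _ _ _ _] := pd.
have [i1 i2] := z_integ a b.
have PC := @prim_cosk R a b th; have PS := @prim_sink R a b th.
have j1 := sqi_integ (prim_sqi (primD (prim_mul (P1 a b) PC) (prim_mul (P2 a b) PS))).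
have j2 := sqi_integ (prim_sqi (primB (prim_mul (P2 a b) PC) (prim_mul (P1 a b) PS))).
have key N x : N ^+ 2 <= cs c x -> `|N * zr c x - N| <= `|cs c x - 1|.
  have := cs_ge0 c x; rewrite le_eqVlt => /predU1P[<-|s0].
    move=> N0; have {N0} /eqP : N ^+ 2 = 0 by apply/eqP; rewrite eq_le N0 sqr_ge0.
    by rewrite sqrf_eq0 => /eqP ->; rewrite mul0r subrr normr0.
  move=> Ns; set q := Num.sqrt (cs c x).
  have q0 : 0 < q by rewrite sqrtr_gt0.
  have q2 : q ^+ 2 = cs c x by rewrite sqr_sqrtr// ltW.
  have Nq : `|N| <= q by rewrite -ler_sqr ?nnegrE ?(ltW q0)// real_normK ?num_real// q2.
  rewrite /zr -/q -q2.
  have -> : N / q - N = N / q * (1 - q) by field; rewrite gt_eqF.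
  have -> : q ^+ 2 - 1 = (- (1 + q)) * (1 - q) by ring.
  rewrite !normrM ler_wpM2r// normrN.
  apply: (@le_trans _ _ 1); first by rewrite normfV (gtr0_norm q0) ler_pdivrMr// mul1r.
  by rewrite ger0_norm; lra.
have cs1 : integ `[a, b] (fun x => cs c x - 1) by exact: sqi_integ (cs1_sqi pd a b).
split; (apply: I_le; [by apply: integ_norm => //; exact: integB|exact: integ_norm|]) => x _ _;
  apply: key; rewrite -[X in _ <= X]mulr1 -(cos2Dsin2 (th * x)) /cs -subr_ge0;
  move: (cp1 c x) (cp2 c x) (cos (th * x)) (sin (th * x)) => u1 u2 co si.
- have -> : (u1 ^+ 2 + u2 ^+ 2) * (co ^+ 2 + si ^+ 2) - (u1 * co + u2 * si) ^+ 2 = (u1 * si - u2 * co) ^+ 2 by ring.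
  exact: sqr_ge0.
- have -> : (u1 ^+ 2 + u2 ^+ 2) * (co ^+ 2 + si ^+ 2) - (u2 * co - u1 * si) ^+ 2 = (u1 * co + u2 * si) ^+ 2 by ring.
  exact: sqr_ge0.
Qed.

End One.
End UnitField.

(** * Passage to the limit away from the dips *)

Section OffLimit.
Context {R : realType}.
Local Notation mu := (@lebesgue_measure R).
Implicit Types (f g h : R -> R) (a b x y z r s t : R) (n K i j : nat).

Lemma cvg_expr2 (u : nat -> R) (l : R) : u @ \oo --> l -> (fun n => u n ^+ 2) @ \oo --> l ^+ 2.
Proof. by move=> cu; under eq_fun do rewrite expr2; rewrite expr2; exact: cvgM. Qed.

(** Averaging over a short interval around [x] transfers L^1 convergence to the point: the
    oscillations of the two terms cost e / 4 each, the two L^1 distances to [zeta] e / 8 each. *)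
Lemma avg_cauchy (f : nat -> R -> R) (zeta : R -> R) x :
  (forall n a b, integ `[a, b] (f n)) -> integ `[0, 1] zeta ->
  (fun n => I 0 1 (fun t => `|f n t - zeta t|)) @ \oo --> (0 : R) ->
  (forall e, 0 < e -> exists u v, [/\ 0 <= u, u < v, v <= 1 &
     \forall n \near \oo, forall t, u <= t <= v -> `|f n t - f n x| <= e]) ->
  cvgn (fun n => f n x).
Proof.
move=> fi iz c0 H; apply/cauchy_cvgP; apply: cauchy_exP => e e0.
have [|u [v [u0 uv v1 N1]]] := H (e / 4); first lra.
have iz' : integ `[u, v] zeta by apply: (integ_sub iz).
have k0 : 0 < e / 8 * (v - u) by rewrite mulr_gt0//; lra.
have N2 : \forall n \near \oo, I u v (fun t => `|f n t - zeta t|) < e / 8 * (v - u).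
  move/cvgrPdist_lt/(_ _ k0): c0; apply: filterS => n; rewrite sub0r normrN.
  move=> h; apply: le_lt_trans (le_lt_trans (ler_norm _) h).
  by apply: I_sub => //; apply: integ_norm => //; exact: integB.
have [N _ HN] := filterI N1 N2.
have [HN1 HN2] := HN N (leqnn _).
exists (f N x); exists N => // n /= Nn.
have [Hn1 Hn2] := HN n Nn.
rewrite /ball/=.
rewrite -(@ltr_pM2r _ (v - u)) ?subr_gt0// -I_cst ?(ltW uv)//.
have i1 n' : integ `[u, v] (fun t => `|f n' t - zeta t|) by apply: integ_norm => //; exact: integB.
apply: (@le_lt_trans _ _ (I u v (fun t => (e / 4 + e / 4) + (`|f N t - zeta t| + `|f n t - zeta t|)))).
  apply: I_le; [exact: integ_cst| |].
    by apply: integD => //; [exact: integ_cst|exact: integD].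
  move=> t ut tv; have := HN1 t; have := Hn1 t; rewrite ut tv => /(_ isT) h1 /(_ isT) h2.
  have -> : f N x - f n x = (f N x - f N t) + ((f N t - zeta t) + - (f n t - zeta t)) + (f n t - f n x) by ring.
  have t1 := ler_normD (f N x - f N t + ((f N t - zeta t) + - (f n t - zeta t))) (f n t - f n x).
  have t2 := ler_normD (f N x - f N t) ((f N t - zeta t) + - (f n t - zeta t)).
  have t3 := ler_normD (f N t - zeta t) (- (f n t - zeta t)).
  rewrite normrN in t3; rewrite distrC in h2; lra.
have E1 : I u v (fun=> e / 4 + e / 4) = (e / 4 + e / 4) * (v - u) by rewrite I_cst// ltW.
rewrite ID; [|exact: integ_cst|exact: integD].
rewrite E1 ID//; lra.
Qed.

Lemma near_point (D : seq R) x : 0 <= x <= 1 -> x \notin D ->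
  forall l, 0 < l -> exists u v, [/\ 0 <= u, u < v, v <= 1 & v - u <= l] /\ u <= x <= v /\
     forall t, u <= t <= v -> t \notin D.
Proof.
move=> /andP[x0 x1] xD l l0.
have [r r0 Hr] : exists2 r, 0 < r & forall y, y \in D -> r <= `|x - y|.
  elim: D xD => [|z D IH] xD; first by exists 1.
  move: xD; rewrite inE negb_or => /andP[xz /IH[r r0 Hr]].
  have xz0 : 0 < `|x - z| by rewrite normr_gt0 subr_eq0.
  have [k [k0 kr kz]] := small2 r0 xz0.
  exists k => // y; rewrite inE => /orP[/eqP ->|yD]; first exact: ltW.
  by have := Hr y yD; lra.
have l2 : 0 < l / 2 by lra.
have [k [k0 kr kl]] := small2 r0 l2.
have Hk t : x - k <= t <= x + k -> t \notin D.
  move=> /andP[h1 h2]; apply/negP => tD; have := Hr t tD.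
  by move/(lt_le_trans kr); rewrite ltNge ler_norml => /negP; apply; apply/andP; split; lra.
exists (Num.max 0 (x - k)), (Num.min 1 (x + k)).
case: (leP 0 (x - k)) => h1; case: (leP 1 (x + k)) => h2; (split; [|split]).
all: try by move=> t /andP[? ?]; apply: Hk; apply/andP; split; lra.
all: try (by split; lra).
all: by apply/andP; split; lra.
Qed.

(** Dominated convergence computes the limit of the L^1 distances to [zeta] in a second way, as the
    distance from [h] to [zeta]. *)
Lemma L1_ptw (U : set R) (f : nat -> R -> R) (h zeta : R -> R) (C : R) : measurable U -> U `<=` `[0, 1] ->
  (forall n, measurable_fun setT (f n)) -> (forall n x, `|f n x| <= C) -> integ `[0, 1] zeta ->
  (fun n => I 0 1 (fun t => `|f n t - zeta t|)) @ \oo --> (0 : R) ->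
  (forall x, U x -> (fun n => f n x) @ \oo --> h x) ->
  {ae mu, forall x, U x -> h x = zeta x}.
Proof.
move=> mU U01 mf fC iz c0 ptw.
have izU : integ U zeta by apply: (integS _ _ _ iz).
have mfU n : measurable_fun U (f n) by exact: measurable_funTS.
have mzU : measurable_fun U zeta by exact: integ_meas.
have mhU : measurable_fun U h by exact: (measurable_fun_cvg mfU ptw).
have inf n : integ `[0, 1] (fun t => `|f n t - zeta t|).
  apply: integ_norm => //; apply: integB => //.
  apply: (@integ_le _ _ _ (fun=> C)) => //; first exact: measurable_funTS.
  exact: integ_cst.
have infU n : integ U (fun t => `|f n t - zeta t|) by apply: (integS _ _ _ (inf n)).
have dc : (fun n => \int[mu]_(x in U) (`|f n x - zeta x|)%:E)%E @ \oo -->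
    (\int[mu]_(x in U) (`|h x - zeta x|)%:E)%E.
  apply: (@dominated_cvg _ _ _ mu U mU (fun n x => (`|f n x - zeta x|)%:E)
     (fun x => (`|h x - zeta x|)%:E) (fun x => (C + `|zeta x|)%:E)).
  - by move=> n; apply/measurable_EFinP; exact: integ_meas (infU n).
  - move=> x Ux; apply/cvg_EFin; first exact: nearW.
    by apply: cvg_norm; apply: cvgB; [exact: ptw|exact: cvg_cst].
  - by [].
  - apply: (integD mU); last exact: integ_norm.
    by apply: (@integS _ U `[0, 1]) => //; exact: integ_cst.
  - move=> n x _; rewrite /= lee_fin normr_id.
    by apply: (le_trans (ler_normB _ _)); rewrite lerD2r.
have d0 : (fun n => \int[mu]_(x in U) (`|f n x - zeta x|)%:E)%E @ \oo --> 0%E.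
  apply: (@squeeze_cvge _ _ _ _ (fun=> 0%E) _ (fun n => (I 0 1 (fun t => `|f n t - zeta t|))%:E)).
  - apply: nearW => n; apply/andP; split; first by apply: integral_ge0 => x _; rewrite lee_fin.
    rewrite /I -integE//; apply: (@ge0_subset_integral _ _ _ mu U `[0, 1] mU (measurable_itv _)) => //.
    by apply/measurable_EFinP; exact: integ_meas.
  - exact: cvg_cst.
  - by apply/cvg_EFin; [exact: nearW|].
have E0 : (\int[mu]_(x in U) (`|h x - zeta x|)%:E = 0)%E.
  exact: (cvg_unique (@ereal_hausdorff R) dc d0).
have := (@ae_eq_integral_abs _ _ _ mu U mU (fun x => (h x - zeta x)%:E)
   (ltac:(apply/measurable_EFinP; exact: measurable_funB))).1 E0.
move=> H; apply: (ae_mono H) => x Hx Ux; have [] := Hx Ux; move/eqP; rewrite subr_eq0; exact/eqP.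
Qed.

Lemma X_meas (D : seq R) : measurable [set x : R | 0 <= x <= 1 /\ x \notin D].
Proof.
have -> : [set x : R | 0 <= x <= 1 /\ x \notin D] = `[0, 1]%classic `\` [set` D].
  by apply/seteqP; split=> x /= []; rewrite in_itv/= => h1 /negP.
apply: measurableD => //; apply: countable_measurable => //.
by apply: finite_set_countable; exact: finite_seq.
Qed.

Variables (alpha L M A : R) (w1 w2 : R -> R) (c : nat -> @cfg R) (d : R) (D : seq R).
Hypotheses (L0 : 0 < L) (gs : good_seq alpha L M A w1 w2 c) (d0 : 0 < d)
  (iw1 : integ `[0, 1] w1) (iw2 : integ `[0, 1] w2)
  (Hoff : forall a b, a <= b -> 0 <= a -> b <= 1 -> (forall x, a <= x <= b -> x \notin D) ->
      \forall n \near \oo, forall y, a <= y <= b -> d < cs (c n) y).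

Let th := 2 * pi * A.
Let X := [set x : R | 0 <= x <= 1 /\ x \notin D].
Let B := 2 * M / L.

Let pdn n : cpdata alpha (c n).
Proof. by have [/(_ n)[]] := gs. Qed.
Let e0n n : 0 < ceps (c n).
Proof. by have [/(_ n)[]] := gs. Qed.
Let k0n n : 0 <= ckap (c n).
Proof. by have [/(_ n)[]] := gs. Qed.
Let M0 : 0 <= M.
Proof.
have [bm _] := good_bounds L0 0 gs; apply: le_trans bm; apply: I_ge0 => x _ _.
exact: (mm_ge0 (e0n 0)).
Qed.
Let B0 : 0 <= B.
Proof. by rewrite /B divr_ge0 ?mulr_ge0// ltW. Qed.
Let lam n : R := Num.sqrt (ceps (c n)).
Let lam0 n : 0 < lam n.
Proof. by rewrite sqrtr_gt0. Qed.
Let lam2 n : lam n ^+ 2 = ceps (c n).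
Proof. by rewrite sqr_sqrtr// ltW. Qed.
Let lam_cvg : lam @ \oo --> (0 : R).
Proof.
have [_ ec _ _ _] := gs; rewrite -(@sqrtr0 R).
by apply: (cvg_comp _ _ ec); exact: sqrt_continuous.
Qed.
Let gsq n a b : 0 <= a -> b <= 1 -> sqi a b (gg (c n)).
Proof.
move=> a0 b1; have [m i2] := gg_sqi (pdn n); split; last exact: (integ_sub i2).
by apply: measurable_funS m => //; apply: subset_itv; rewrite bnd_simp.
Qed.
(** [jj] is the sum of [gg], - kap (|p|^2 - 1) and tN - kap, and the square of a sum of three terms
    is at most three times the sum of squares. The bounds are B for the first, kap^2 * 4 eps M <= 4
    M for the second once kap sqrt eps <= 1, and (|th| + 1)^2 for the third. *)
Let CJ := 3 * B + 12 * M + 3 * (`|th| + 1) ^+ 2.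

Let jbound : \forall n \near \oo, I 0 1 (fun x => jj (c n) x ^+ 2) <= CJ.
Proof.
have [_ _ tc kc _] := gs.
move/cvgrPdist_lt/(_ 1 ltr01): tc => N1; move/cvgrPdist_lt/(_ 1 ltr01): kc => N2.
near=> n.
have h1 : `|th - (ctN (c n) - ckap (c n))| < 1 by near: n.
have h2 : `|0 - ckap (c n) * lam n| < 1 by near: n.
have [_ gb] := good_bounds L0 n gs.
have [_ ig2] := gsq n (lexx 0) (lexx 1).
have [_ ij2] := jj_sqi (pdn n) 0 1; have [_ is2] := cs1_sqi (pdn n) 0 1.
apply: (@le_trans _ _ (I 0 1 (fun x => 3 * gg (c n) x ^+ 2 + (3 * ckap (c n) ^+ 2 * (cs (c n) x - 1) ^+ 2
   + 3 * (ctN (c n) - ckap (c n)) ^+ 2)))).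
  apply: I_le => //; first by apply: integD => //; [exact: integZ|apply: integD => //; [exact: integZ|exact: integ_cst]].
  move=> x _ _.
  have -> : jj (c n) x = gg (c n) x - ckap (c n) * (cs (c n) x - 1) + (ctN (c n) - ckap (c n)).
    by rewrite /jj /gg; ring.
  have key (u v w k : R) : (u - k * v + w) ^+ 2 <= 3 * u ^+ 2 + (3 * k ^+ 2 * v ^+ 2 + 3 * w ^+ 2).
    rewrite -subr_ge0.
    have -> : 3 * u ^+ 2 + (3 * k ^+ 2 * v ^+ 2 + 3 * w ^+ 2) - (u - k * v + w) ^+ 2 =
      (u + k * v) ^+ 2 + (u - w) ^+ 2 + (k * v + w) ^+ 2 by ring.
    by rewrite !addr_ge0 ?sqr_ge0.
  exact: key.
rewrite ID; [|exact: integZ|by apply: integD => //; [exact: integZ|exact: integ_cst]].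
rewrite ID; [|exact: integZ|exact: integ_cst].
have E1 v : I 0 1 (fun=> v : R) = v by rewrite I_cst// subr0 mulr1.
rewrite E1 IZ// IZ// /CJ -addrA lerD//.
  by rewrite ler_wpM2l.
have pb := good_pot L0 n gs ler01.
rewrite lerD//.
  apply: (@le_trans _ _ (3 * ckap (c n) ^+ 2 * (4 * ceps (c n) * M))).
    by rewrite ler_wpM2l// mulr_ge0 ?sqr_ge0.
  rewrite -lam2.
  have -> : 3 * ckap (c n) ^+ 2 * (4 * lam n ^+ 2 * M) = (ckap (c n) * lam n) ^+ 2 * (12 * M) by ring.
  rewrite ler_piMl ?mulr_ge0//.
  have : `|ckap (c n) * lam n| <= 1 by move: h2; rewrite sub0r normrN; exact: ltW.
  by rewrite -(@ler_sqr _ `|_|) ?nnegrE// real_normK ?num_real// expr1n.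
rewrite ler_wpM2l// -real_normK ?num_real// ler_sqr ?nnegrE ?addr_ge0//.
have -> : ctN (c n) - ckap (c n) = th - (th - (ctN (c n) - ckap (c n))) by ring.
by apply: (le_trans (ler_normB _ _)); rewrite lerD2l ltW.
Unshelve. all: by end_near. Qed.

(** Total of the error terms met in [h_bound]: [CJ / d^2] bounds the square integral of [hc], and 4
    eps M that of |p|^2 - 1. Each summand carries lam = sqrt eps, kap lam, or the phase
    discrepancy. *)
Let err n : R := lam n * (CJ * (d^-1) ^+ 2 / 2 + 2 * M) + (ckap (c n) * lam n) * (2 * M + 1 / 2)
  + `|ctN (c n) - ckap (c n) - th|.

Let err_cvg : err @ \oo --> (0 : R).
Proof.
have [_ _ tc kc _] := gs.
have -> : (0 : R) = 0 * (CJ * (d^-1) ^+ 2 / 2 + 2 * M) + 0 * (2 * M + 1 / 2) + `|th - th|.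
  by rewrite subrr normr0 !mul0r !addr0.
apply: cvgD; first apply: cvgD.
- by apply: cvgM => //; exact: cvg_cst.
- by apply: cvgM => //; exact: cvg_cst.
- by apply: cvg_norm; apply: cvgB => //; exact: cvg_cst.
Qed.

Let err_ge0 n : 0 <= err n.
Proof.
have CJ0 : 0 <= CJ by rewrite /CJ addr_ge0 ?mulr_ge0 ?sqr_ge0// addr_ge0// mulr_ge0.
have l0 := ltW (lam0 n); rewrite /err addr_ge0// addr_ge0//.
- apply: mulr_ge0 => //; apply: addr_ge0; last exact: mulr_ge0.
  by apply: mulr_ge0 => //; apply: mulr_ge0; rewrite ?sqr_ge0.
- by rewrite mulr_ge0 ?mulr_ge0// addr_ge0 ?mulr_ge0.
Qed.

(* [hc - th - gg] is a combination of [jj (1/|p|^2 - 1)] and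
   [kap (|p|^2 - 1)], up to a constant tending to 0. As [|p|^2 - 1] is of
   order sqrt eps in L^2, this is where [beta < 1/2] enters, through
   [kap sqrt eps] going to 0. *)
Let h_bound : \forall n \near \oo, forall x y, 0 <= x -> x <= y -> y <= 1 ->
  (forall t, x <= t <= y -> d < cs (c n) t) ->
  I x y (fun t => `|hc (c n) t - th|) <= I x y (fun t => `|gg (c n) t|) + err n.
Proof.
have N := jbound; near=> n => x y x0 xy y1 ds.
have jb : I 0 1 (fun x => jj (c n) x ^+ 2) <= CJ by near: n.
have ds' t : x <= t <= y -> d <= cs (c n) t by move=> /ds/ltW.
have [mh ih2] := hc_sqi (pdn n) d0 ds'.
have [mg ig2] := gsq n x0 y1; have [_ is2] := cs1_sqi (pdn n) x y.
have ig := integ_sqr mg ig2.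
have ih : integ `[x, y] (fun t => hc (c n) t - th).
  by apply: integB => //; [exact: integ_sqr|exact: integ_cst].
set k := ckap (c n); set l := lam n; set E := `|ctN (c n) - ckap (c n) - th|.
have l0 : 0 < l by exact: lam0.
have k0 : 0 <= k by exact: k0n.
apply: (@le_trans _ _ (I x y (fun t => `|gg (c n) t| + (l / 2 * hc (c n) t ^+ 2 +
   ((1 + k) / (2 * l) * (cs (c n) t - 1) ^+ 2 + (k * l / 2 + E)))))).
  apply: I_le; [exact: integ_norm| |].
    apply: integD => //; [exact: integ_norm|apply: integD => //; first exact: integZ].
    by apply: integD => //; [exact: integZ|exact: integ_cst].
  move=> t xt ty.
  have s0 : 0 < cs (c n) t by apply: lt_trans d0 _; apply: ds; rewrite xt.
  have -> : hc (c n) t - th = gg (c n) t + (hc (c n) t * (1 - cs (c n) t) + ((- k) * (cs (c n) t - 1) +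
      (ctN (c n) - ckap (c n) - th))).
    have -> : gg (c n) t = hc (c n) t * cs (c n) t + cs (c n) t * k - ctN (c n).
      have := zr_sq s0; rewrite /hc /gg /jj -/k.
      move: (zr _ _ ^+ 2) (cs _ _) => r s E1.
      by rewrite -mulrA E1 mulr1.
    by rewrite /k; ring.
  apply: (le_trans (ler_normD _ _)); rewrite lerD2l.
  apply: (le_trans (ler_normD _ _)).
  (* The weight l = sqrt eps balances a bounded factor against |p|^2 - 1, whose square integrates to
     order l^2. *)
  have am u v : `|u * v| <= l / 2 * u ^+ 2 + (2 * l)^-1 * v ^+ 2.
    rewrite -(@ler_pM2l _ (2 * l)) ?mulr_gt0// normrM.
    have -> : 2 * l * (l / 2 * u ^+ 2 + (2 * l)^-1 * v ^+ 2) = (l * u) ^+ 2 + v ^+ 2 by field; rewrite gt_eqF.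
    rewrite -(real_normK (num_real (l * u))) -(real_normK (num_real v)) normrM (gtr0_norm l0).
    rewrite -subr_ge0.
    have -> : (l * `|u|) ^+ 2 + `|v| ^+ 2 - 2 * l * (`|u| * `|v|) = (l * `|u| - `|v|) ^+ 2 by ring.
    exact: sqr_ge0.
  have h1 := am (hc (c n) t) (1 - cs (c n) t).
  have h2 := am 1 (cs (c n) t - 1).
  rewrite mul1r expr1n mulr1 in h2.
  have h3 : `|(- k) * (cs (c n) t - 1)| <= k * (l / 2 + (2 * l)^-1 * (cs (c n) t - 1) ^+ 2).
    by rewrite normrM normrN (ger0_norm k0) ler_wpM2l.
  have h4 := ler_normD ((- k) * (cs (c n) t - 1)) (ctN (c n) - ckap (c n) - th).
  have h5 : (1 - cs (c n) t) ^+ 2 = (cs (c n) t - 1) ^+ 2 by ring.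
  have -> : (1 + k) / (2 * l) * (cs (c n) t - 1) ^+ 2 = (2 * l)^-1 * (cs (c n) t - 1) ^+ 2 +
     k * ((2 * l)^-1 * (cs (c n) t - 1) ^+ 2) by ring.
  rewrite h5 in h1; rewrite -/E in h4.
  rewrite [leRHS]mulrDr in h3; have -> : k * l / 2 = k * (l / 2) by ring.
  move: h1 h3 h4.
  set q1 := `|hc (c n) t * _|; set q2 := `|(- k) * (cs (c n) t - 1)|; set q3 := `|_ + _|.
  set q4 := l / 2 * _ ^+ 2; set q5 := (2 * l)^-1 * _; set q6 := k * q5; set q7 := k * (l / 2).
  clearbody q1 q2 q3 q4 q5 q6 q7; move=> h1 h3 h4; lin.
rewrite ID; [|exact: integ_norm|apply: integD => //; [exact: integZ|apply: integD => //; [exact: integZ|exact: integ_cst]]].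
rewrite lerD2l.
rewrite ID; [|exact: integZ|by apply: integD => //; [exact: integZ|exact: integ_cst]].
rewrite ID; [|exact: integZ|exact: integ_cst].
rewrite !IZ// I_cst//.
have hb : I x y (fun t => hc (c n) t ^+ 2) <= CJ * (d^-1) ^+ 2.
  apply: (le_trans (hc_le (pdn n) d0 xy ds')); rewrite mulrC ler_wpM2r ?sqr_ge0//.
  apply: le_trans jb; apply: I_sub => //; first by have [] := jj_sqi (pdn n) 0 1.
  by move=> t _ _; exact: sqr_ge0.
have sb := good_pot L0 n gs xy.
have t1 : l / 2 * I x y (fun t => hc (c n) t ^+ 2) <= l / 2 * (CJ * (d^-1) ^+ 2).
  by rewrite ler_wpM2l// divr_ge0// ltW.
have t2 : (1 + k) / (2 * l) * I x y (fun t => (cs (c n) t - 1) ^+ 2) <= (1 + k) * (2 * l * M).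
  apply: (@le_trans _ _ ((1 + k) / (2 * l) * (4 * ceps (c n) * M))).
    by rewrite ler_wpM2l// divr_ge0 ?addr_ge0// mulr_ge0// ltW.
  by rewrite -lam2 -/l le_eqVlt; apply/orP; left; apply/eqP; field; rewrite gt_eqF.
have E0 : 0 <= E by exact: normr_ge0.
have t3 : (k * l / 2 + E) * (y - x) <= k * l / 2 + E.
  rewrite ler_piMr//; last lra.
  by rewrite addr_ge0// divr_ge0// mulr_ge0// ltW.
rewrite /err -/l -/k -/E.
have -> : l * (CJ * d^-1 ^+ 2 / 2 + 2 * M) + k * l * (2 * M + 1 / 2) + E =
  l / 2 * (CJ * d^-1 ^+ 2) + ((1 + k) * (2 * l * M) + (k * l / 2 + E)) by ring.
by rewrite lerD// lerD.
Unshelve. all: by end_near. Qed.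

(** An upper bound of sqrt B free of roots, as (1 + B)^2 >= B. *)
Let GB := 1 + B.
Let gL1 n x y : 0 <= x -> x <= y -> y <= 1 ->
  I x y (fun t => `|gg (c n) t|) ^+ 2 <= (y - x) * I x y (fun t => gg (c n) t ^+ 2) /\
  I x y (fun t => gg (c n) t ^+ 2) <= B.
Proof.
move=> x0 xy y1; have S := gsq n x0 y1; split.
  by apply: I_CS => //; [exact: sqi_integ|exact: S.2].
have [_ gb] := good_bounds L0 n gs; apply: le_trans gb.
by apply: I_sub => //; [have [] := gsq n (lexx 0) (lexx 1)|move=> t _ _; exact: sqr_ge0].
Qed.

Let gL1b n x y : 0 <= x -> x <= y -> y <= 1 -> 0 <= I x y (fun t => `|gg (c n) t|) <= GB.
Proof.
move=> x0 xy y1; have [g1 g2] := gL1 n x0 xy y1.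
have i0 : 0 <= I x y (fun t => `|gg (c n) t|) by apply: I_ge0.
rewrite i0 /=; rewrite -(@ler_sqr _ _ GB) ?nnegrE ?addr_ge0//.
apply: (le_trans g1); apply: (@le_trans _ _ B).
  apply: le_trans g2; rewrite ler_piMl//; last lra.
  by apply: I_ge0 => t _ _; exact: sqr_ge0.
by rewrite /GB sqrrD expr1n mul1r; have := sqr_ge0 B; have := B0; lra.
Qed.

(** Excess of (v + err)^2 over v^2 when 0 <= v <= [GB]. *)
Let errb n := err n * (2 * GB + err n).
Let errb_cvg : errb @ \oo --> (0 : R).
Proof.
rewrite -[X in _ --> X](mul0r (2 * GB + 0)); apply: cvgM => //.
by apply: cvgD => //; exact: cvg_cst.
Qed.

Let z_diff_n : \forall n \near \oo, forall x y, 0 <= x -> x <= y -> y <= 1 ->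
  (forall t, x <= t <= y -> d < cs (c n) t) ->
  (z1 th (c n) y - z1 th (c n) x) ^+ 2 + (z2 th (c n) y - z2 th (c n) x) ^+ 2 <=
    (y - x) * I x y (fun t => gg (c n) t ^+ 2) + errb n.
Proof.
have N := h_bound; near=> n => x y x0 xy y1 ds.
have hb : I x y (fun t => `|hc (c n) t - th|) <= I x y (fun t => `|gg (c n) t|) + err n.
  by move: x0 xy y1 ds; move: x y; near: n.
have ds' t : x <= t <= y -> d <= cs (c n) t by move=> /ds/ltW.
apply: (le_trans (z_diff th (pdn n) d0 xy ds')).
have [g1 _] := gL1 n x0 xy y1; have /andP[g2 g3] := gL1b n x0 xy y1.
have h0 : 0 <= I x y (fun t => `|hc (c n) t - th|) by apply: I_ge0.
have e0 := err_ge0 n.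
move: hb g1 g2 g3 h0; rewrite /errb; move: (I x y (fun t => `|hc _ _ - _|)) (I x y (fun t => `|gg _ _|)).
move=> u v uv g1 v0 vG u0.
apply: (@le_trans _ _ ((v + err n) ^+ 2)); first by rewrite ler_sqr ?nnegrE// addr_ge0.
have -> : (v + err n) ^+ 2 = v ^+ 2 + err n * (2 * v + err n) by ring.
by rewrite lerD// ler_wpM2l// lerD2r ler_wpM2l.
Unshelve. all: by end_near. Qed.

Let zeta1 x := w1 x * cos (th * x) + w2 x * sin (th * x).
Let zeta2 x := w2 x * cos (th * x) - w1 x * sin (th * x).

Let iwc w : integ `[0, 1] w -> integ `[0, 1] (fun x => w x * cos (th * x)) /\
  integ `[0, 1] (fun x => w x * sin (th * x)).
Proof.
move=> iw; have mc : measurable_fun (`[0, 1] : set R) (fun x => cos (th * x)).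
  by apply: measurable_funTS; apply: continuous_measurable_fun; exact: cosk_cont.
have ms : measurable_fun (`[0, 1] : set R) (fun x => sin (th * x)).
  by apply: measurable_funTS; apply: continuous_measurable_fun; exact: sink_cont.
split; [apply: (@eq_integ _ _ (fun x => cos (th * x) * w x)) => //|
  apply: (@eq_integ _ _ (fun x => sin (th * x) * w x)) => //].
- by move=> x _; rewrite mulrC.
- by apply: (@integM_bnd _ _ _ _ 1) => // x _; exact: cos_max.
- by move=> x _; rewrite mulrC.
- by apply: (@integM_bnd _ _ _ _ 1) => // x _; exact: sin_max.
Qed.

Let izeta1 : integ `[0, 1] zeta1.
Proof. by apply: integD => //; [have [] := iwc iw1|have [] := iwc iw2]. Qed.
Let izeta2 : integ `[0, 1] zeta2.
Proof. by apply: integB => //; [have [] := iwc iw2|have [] := iwc iw1]. Qed.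

Let zL1 : (fun n => I 0 1 (fun x => `|z1 th (c n) x - zeta1 x|)) @ \oo --> (0 : R) /\
  (fun n => I 0 1 (fun x => `|z2 th (c n) x - zeta2 x|)) @ \oo --> (0 : R).
Proof.
have [_ _ _ _ [pc1 pc2]] := gs.
pose u n := lam n * (1 / 2 + 2 * M) + (I 0 1 (fun x => `|cp1 (c n) x - w1 x|) + I 0 1 (fun x => `|cp2 (c n) x - w2 x|)).
have ucvg : u @ \oo --> (0 : R).
  have -> : (0 : R) = 0 * (1 / 2 + 2 * M) + (0 + 0) by rewrite mul0r !addr0.
  by apply: cvgD; [apply: cvgM => //; exact: cvg_cst|exact: cvgD].
have sb n : I 0 1 (fun x => `|cs (c n) x - 1|) <= lam n * (1 / 2 + 2 * M).
  have l0 := lam0 n; have [ms is2] := cs1_sqi (pdn n) 0 1.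
  apply: (@le_trans _ _ (I 0 1 (fun x => lam n / 2 + (2 * lam n)^-1 * (cs (c n) x - 1) ^+ 2))).
    apply: I_le; [by apply: integ_norm => //; exact: integ_sqr|by apply: integD => //; [exact: integ_cst|exact: integZ]|].
    move=> x _ _; move: (cs (c n) x - 1) => v; rewrite -(real_normK (num_real v)); move: `|v| => {}v.
    rewrite -subr_ge0.
    have -> : lam n / 2 + (2 * lam n)^-1 * v ^+ 2 - v = (2 * lam n)^-1 * (v - lam n) ^+ 2.
      by field; rewrite gt_eqF.
    by rewrite mulr_ge0 ?sqr_ge0// invr_ge0 mulr_ge0// ltW.
  rewrite ID; [|exact: integ_cst|exact: integZ].
  rewrite I_cst// IZ// subr0 mulr1 mulrDr lerD//; first lra.
  have := good_pot L0 n gs ler01 => hp.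
  apply: (@le_trans _ _ ((2 * lam n)^-1 * (4 * ceps (c n) * M))).
    by rewrite ler_wpM2l// invr_ge0 mulr_ge0// ltW.
  by rewrite -lam2 le_eqVlt; apply/orP; left; apply/eqP; field; rewrite gt_eqF.
have ipw n : integ `[0, 1] (fun x => `|cp1 (c n) x - w1 x|) /\ integ `[0, 1] (fun x => `|cp2 (c n) x - w2 x|).
  have [[P1 P2] _ _ _ _] := pdn n.
  by split; apply: integ_norm => //; apply: integB => //; apply: sqi_integ;
    [exact: prim_sqi (P1 0 1)|exact: prim_sqi (P2 0 1)].
have key n (z N zeta : R -> R) : integ `[0, 1] z -> integ `[0, 1] N -> integ `[0, 1] zeta ->
   I 0 1 (fun x => `|z x - N x|) <= I 0 1 (fun x => `|cs (c n) x - 1|) ->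
   (forall x, `|N x - zeta x| <= `|cp1 (c n) x - w1 x| + `|cp2 (c n) x - w2 x|) ->
   I 0 1 (fun x => `|z x - zeta x|) <= u n.
  move=> iz iN izt h1 h2; have [ip1 ip2] := ipw n.
  have izN : integ `[0, 1] (fun x => `|z x - N x|) by apply: integ_norm => //; exact: integB.
  have ip : integ `[0, 1] (fun x => `|cp1 (c n) x - w1 x| + `|cp2 (c n) x - w2 x|) by exact: integD.
  apply: (@le_trans _ _ (I 0 1 (fun x => `|z x - N x| + (`|cp1 (c n) x - w1 x| + `|cp2 (c n) x - w2 x|)))).
    apply: I_le; [by apply: integ_norm => //; exact: integB|exact: integD|].
    move=> x _ _; have -> : z x - zeta x = (z x - N x) + (N x - zeta x) by ring.
    by apply: (le_trans (ler_normD _ _)); rewrite lerD2l.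
  by rewrite ID// ID// lerD2r; apply: (le_trans h1).
have tri (a b p q : R) : `|p| <= 1 -> `|q| <= 1 -> `|a * p + b * q| <= `|a| + `|b|.
  by move=> p1 q1; apply: (le_trans (ler_normD _ _)); rewrite !normrM lerD// ler_piMr.
have iN n : integ `[0, 1] (fun x => cp1 (c n) x * cos (th * x) + cp2 (c n) x * sin (th * x)) /\
    integ `[0, 1] (fun x => cp2 (c n) x * cos (th * x) - cp1 (c n) x * sin (th * x)).
  have [[P1 P2] _ _ _ _] := pdn n.
  have [h1 h2] := iwc (sqi_integ (prim_sqi (P1 0 1))).
  have [h3 h4] := iwc (sqi_integ (prim_sqi (P2 0 1))).
  by split; [exact: integD|exact: integB].
split.
- apply: (@squeeze_cvgr _ _ _ _ (fun=> 0) u) => //; last exact: cvg_cst.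
  apply: nearW => n; apply/andP; split; first by apply: I_ge0.
  have [iz1 _] := z_integ th (pdn n) 0 1; have [h1 _] := v_close th (pdn n) ler01.
  apply: (key n _ _ _ iz1 (iN n).1 izeta1 h1) => x.
  have -> : cp1 (c n) x * cos (th * x) + cp2 (c n) x * sin (th * x) - zeta1 x =
    (cp1 (c n) x - w1 x) * cos (th * x) + (cp2 (c n) x - w2 x) * sin (th * x) by rewrite /zeta1; ring.
  by apply: tri; [exact: cos_max|exact: sin_max].
- apply: (@squeeze_cvgr _ _ _ _ (fun=> 0) u) => //; last exact: cvg_cst.
  apply: nearW => n; apply/andP; split; first by apply: I_ge0.
  have [_ iz2] := z_integ th (pdn n) 0 1; have [_ h1] := v_close th (pdn n) ler01.
  apply: (key n _ _ _ iz2 (iN n).2 izeta2 h1) => x.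
  have -> : cp2 (c n) x * cos (th * x) - cp1 (c n) x * sin (th * x) - zeta2 x =
    (cp1 (c n) x - w1 x) * (- sin (th * x)) + (cp2 (c n) x - w2 x) * cos (th * x) by rewrite /zeta2; ring.
  by apply: tri; [rewrite normrN; exact: sin_max|exact: cos_max].
Qed.

(** Equicontinuity up to an error: squared increments of the unit fields are at most B times the
    length, plus [errb]. *)
Let osc x e : X x -> 0 < e -> exists u v, [/\ 0 <= u, u < v, v <= 1 &
     \forall n \near \oo, forall t, u <= t <= v ->
       `|z1 th (c n) t - z1 th (c n) x| <= e /\ `|z2 th (c n) t - z2 th (c n) x| <= e].
Proof.
move=> [x01 xD] e0.
(* An interval this short uses up half of e^2; the other half is left for [errb]. *)
have l0 : 0 < e ^+ 2 / 2 / (1 + B) by rewrite divr_gt0 ?divr_gt0 ?exprn_gt0//; have := B0; lra.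
have [u [v [[u0 uv v1 vul] [/andP[ux xv] HD]]]] := near_point x01 xD l0.
exists u, v; split=> //.
have N1 := Hoff (ltW uv) u0 v1 HD; have N2 := z_diff_n.
have e20 : 0 < e ^+ 2 / 2 by rewrite divr_gt0 ?exprn_gt0.
move/cvgrPdist_lt/(_ _ e20): errb_cvg => N3.
near=> n => t /andP[ut tv].
have ds y : u <= y <= v -> d < cs (c n) y by move: y; near: n.
have hE : errb n < e ^+ 2 / 2.
  by apply: (le_lt_trans (ler_norm _)); rewrite -normrN -sub0r; near: n.
have zd y z : 0 <= y -> y <= z -> z <= 1 -> (forall t, y <= t <= z -> d < cs (c n) t) ->
  (z1 th (c n) z - z1 th (c n) y) ^+ 2 + (z2 th (c n) z - z2 th (c n) y) ^+ 2 <=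
    (z - y) * I y z (fun t => gg (c n) t ^+ 2) + errb n by move: y z; near: n.
have fin y z : u <= y -> y <= z -> z <= v ->
    (z1 th (c n) z - z1 th (c n) y) ^+ 2 + (z2 th (c n) z - z2 th (c n) y) ^+ 2 <= e ^+ 2.
  move=> uy yz zv; have y0 : 0 <= y by exact: le_trans uy.
  have z1' : z <= 1 by exact: le_trans v1.
  apply: (le_trans (zd y z y0 yz z1' _)).
    by move=> s /andP[ys sz]; apply: ds; rewrite (le_trans uy)//= (le_trans sz).
  have [_ gb] := gL1 n y0 yz z1'.
  have : (z - y) * I y z (fun t => gg (c n) t ^+ 2) <= e ^+ 2 / 2.
    apply: (@le_trans _ _ (e ^+ 2 / 2 / (1 + B) * (1 + B))).
      have zy : z - y <= e ^+ 2 / 2 / (1 + B) by lra.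
      apply: ler_pM => //; [by rewrite subr_ge0|by apply: I_ge0 => s _ _; exact: sqr_ge0|].
      by apply: (le_trans gb); rewrite lerDr.
    by rewrite divfK// gt_eqF//; have := B0; lra.
  by lra.
have sq_le (a b : R) : a ^+ 2 + b ^+ 2 <= e ^+ 2 -> `|a| <= e /\ `|b| <= e.
  move=> H; have := sqr_ge0 a; have := sqr_ge0 b => ha hb.
  split; (rewrite -(@ler_sqr _ `|_|) ?nnegrE ?(ltW e0)// real_normK ?num_real//; lra).
case: (leP t x) => tx; last exact: sq_le (fin x t ux (ltW tx) tv).
by have [h1 h2] := sq_le _ _ (fin t x ut tx xv); split; rewrite distrC.
Unshelve. all: by end_near. Qed.

Let Z1 x := limn (fun n => z1 th (c n) x).
Let Z2 x := limn (fun n => z2 th (c n) x).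
Let Zcvg x : X x -> (fun n => z1 th (c n) x) @ \oo --> Z1 x /\ (fun n => z2 th (c n) x) @ \oo --> Z2 x.
Proof.
move=> Xx; split.
- apply: (@avg_cauchy (fun n => z1 th (c n)) zeta1) => //.
  + by move=> n a b; have [] := z_integ th (pdn n) a b.
  + exact: zL1.1.
  + move=> e /(osc Xx)[u [v [u0 uv v1 N]]]; exists u, v; split=> //.
    by apply: filterS N => n H t /H[].
- apply: (@avg_cauchy (fun n => z2 th (c n)) zeta2) => //.
  + by move=> n a b; have [] := z_integ th (pdn n) a b.
  + exact: zL1.2.
  + move=> e /(osc Xx)[u [v [u0 uv v1 N]]]; exists u, v; split=> //.
    by apply: filterS N => n H t /H[].
Qed.

Let mX : measurable X.
Proof. exact: X_meas. Qed.
Let X01 : X `<=` `[0, 1].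
Proof. by move=> x [h _]; rewrite /= in_itv. Qed.

Let Zae : {ae mu, forall x, X x -> Z1 x = zeta1 x} /\ {ae mu, forall x, X x -> Z2 x = zeta2 x}.
Proof.
split.
- apply: (@L1_ptw X (fun n => z1 th (c n)) Z1 zeta1 1) => //.
  + by move=> n; have [] := z_meas th (pdn n).
  + by move=> n x; exact: z1_le.
  + exact: zL1.1.
  + by move=> x /Zcvg[].
- apply: (@L1_ptw X (fun n => z2 th (c n)) Z2 zeta2 1) => //.
  + by move=> n; have [] := z_meas th (pdn n).
  + by move=> n x; exact: z2_le.
  + exact: zL1.2.
  + by move=> x /Zcvg[].
Qed.

Let Zmeas : measurable_fun X Z1 /\ measurable_fun X Z2.
Proof.
split.
- apply: (@measurable_fun_cvg _ _ _ X (fun n => z1 th (c n))) => [n|x /Zcvg[]//].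
  by apply: measurable_funTS; have [] := z_meas th (pdn n).
- apply: (@measurable_fun_cvg _ _ _ X (fun n => z2 th (c n))) => [n|x /Zcvg[]//].
  by apply: measurable_funTS; have [] := z_meas th (pdn n).
Qed.

Let Znorm x : X x -> Z1 x ^+ 2 + Z2 x ^+ 2 = 1.
Proof.
move=> Xx; have [c1 c2] := Zcvg Xx; have [/andP[x0 x1] xD] := Xx.
have H : \forall n \near \oo, forall y, x <= y <= x -> d < cs (c n) y.
  by apply: Hoff => // y; rewrite -eq_le => /eqP <-.
have l1 : (fun n => z1 th (c n) x ^+ 2 + z2 th (c n) x ^+ 2) @ \oo --> Z1 x ^+ 2 + Z2 x ^+ 2.
  by apply: cvgD; exact: cvg_expr2.
suff l2 : (fun n => z1 th (c n) x ^+ 2 + z2 th (c n) x ^+ 2) @ \oo --> (1 : R).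
  exact: (cvg_unique (@Rhausdorff R) l1 l2).
apply: cvg_near_cst; apply: filterS H => n Hn; apply: z_norm.
by apply: (lt_trans d0); apply: Hn; rewrite lexx.
Qed.

Let Zdiff x y : x <= y -> (forall t, x <= t <= y -> X t) ->
  (Z1 y - Z1 x) ^+ 2 + (Z2 y - Z2 x) ^+ 2 <= (y - x) * B.
Proof.
move=> xy HX.
have Xx : X x by apply: HX; rewrite lexx.
have Xy : X y by apply: HX; rewrite lexx andbT.
have [/andP[x0 _] _] := Xx; have [/andP[_ y1] _] := Xy.
have [cx1 cx2] := Zcvg Xx; have [cy1 cy2] := Zcvg Xy.
have l1 : (fun n => (z1 th (c n) y - z1 th (c n) x) ^+ 2 + (z2 th (c n) y - z2 th (c n) x) ^+ 2) @ \oo -->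
   (Z1 y - Z1 x) ^+ 2 + (Z2 y - Z2 x) ^+ 2.
  by apply: cvgD; apply: cvg_expr2; exact: cvgB.
have l2 : (fun n => (y - x) * B + errb n) @ \oo --> (y - x) * B.
  by rewrite -[X in _ --> X]addr0; apply: cvgD => //; exact: cvg_cst.
apply: (ler_cvg_to l1 l2).
have N1 : \forall n \near \oo, forall t, x <= t <= y -> d < cs (c n) t.
  by apply: Hoff => // t /HX[].
have N2 := z_diff_n; near=> n.
have ds : forall t, x <= t <= y -> d < cs (c n) t by near: n.
have zd u v : 0 <= u -> u <= v -> v <= 1 -> (forall t, u <= t <= v -> d < cs (c n) t) ->
  (z1 th (c n) v - z1 th (c n) u) ^+ 2 + (z2 th (c n) v - z2 th (c n) u) ^+ 2 <=
    (v - u) * I u v (fun t => gg (c n) t ^+ 2) + errb n by move: u v; near: n.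
apply: (le_trans (zd x y x0 xy y1 ds)); rewrite lerD2r ler_wpM2l ?subr_ge0//.
by have [] := gL1 n x0 xy y1.
Unshelve. all: by end_near. Qed.

Let within_of_lip (f : R -> R) a b C : 0 <= C ->
  (forall x y, a <= x -> x <= y -> y <= b -> (f y - f x) ^+ 2 <= (y - x) * C) ->
  {within `[a, b], continuous f}.
Proof.
move=> C0 H; apply/subspace_continuousP => x /=; rewrite in_itv/= => /andP[ax xb].
apply/cvgrPdist_lt => e e0.
have k0 : 0 < e ^+ 2 / (1 + C) by rewrite divr_gt0 ?exprn_gt0//; lra.
rewrite near_withinE; near=> y.
rewrite /= in_itv/= => /andP[ay yb].
have dxy : `|x - y| < e ^+ 2 / (1 + C) by near: y; exact: nbhsx_ballx.
have key u v : a <= u -> u <= v -> v <= b -> v - u < e ^+ 2 / (1 + C) -> `|f v - f u| < e.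
  move=> au uv vb vu; rewrite -(@ltr_sqr _ `|_|) ?nnegrE ?(ltW e0)// real_normK ?num_real//.
  apply: (le_lt_trans (H u v au uv vb)).
  apply: (@le_lt_trans _ _ ((v - u) * (1 + C))); first by rewrite ler_wpM2l ?subr_ge0// lerDr.
  by rewrite -ltr_pdivlMr//; lra.
case: (leP x y) => xy.
  by rewrite distrC; apply: key => //; move: dxy; rewrite distrC ger0_norm// subr_ge0.
by apply: key => //; [exact: ltW|move: dxy; rewrite gtr0_norm// subr_gt0].
Unshelve. all: by end_near. Qed.

Let Zwithin a b : (forall x, a <= x <= b -> X x) ->
  {within `[a, b], continuous Z1} /\ {within `[a, b], continuous Z2}.
Proof.
move=> HX; split; apply: (within_of_lip B0) => x y ax xy yb.
all: have Zd : (Z1 y - Z1 x) ^+ 2 + (Z2 y - Z2 x) ^+ 2 <= (y - x) * B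
  by apply: Zdiff => // t /andP[xt ty]; apply: HX; rewrite (le_trans ax)//= (le_trans ty).
all: by apply: le_trans Zd; rewrite ?lerDl ?lerDr sqr_ge0.
Qed.

(* By Cauchy-Schwarz on each cell, the squared difference quotients of the
   angular variable are at most the cell integrals of [gg^2]. *)
Let QQ K tau : 0 < tau -> \forall n \near \oo,
  slope_energy Z1 X K + slope_energy Z2 X K <= I 0 1 (fun x => gg (c n) x ^+ 2) + tau.
Proof.
move=> tau0.
have Xp i : (i <= 2 ^ K)%N -> 0 <= dyadic_pt K i :> R /\ dyadic_pt K i <= 1 :> R by split; [exact: pt_ge0|exact: pt_le1].
have okX i : cell_inside X K i -> X (dyadic_pt K i) /\ X (dyadic_pt K i.+1).
  by move/asboolP => H; split; apply: H; rewrite lexx ?andbT pt_le.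
pose qn n := \sum_(0 <= i < 2 ^ K) (if cell_inside X K i then
   ((z1 th (c n) (dyadic_pt K i.+1) - z1 th (c n) (dyadic_pt K i)) ^+ 2 +
    (z2 th (c n) (dyadic_pt K i.+1) - z2 th (c n) (dyadic_pt K i)) ^+ 2) * 2 ^+ K else 0).
have QE : slope_energy Z1 X K + slope_energy Z2 X K = \sum_(0 <= i < 2 ^ K) (if cell_inside X K i then
   ((Z1 (dyadic_pt K i.+1) - Z1 (dyadic_pt K i)) ^+ 2 +
    (Z2 (dyadic_pt K i.+1) - Z2 (dyadic_pt K i)) ^+ 2) * 2 ^+ K else 0).
  rewrite /slope_energy -big_split/=; apply: eq_bigr => i _; rewrite /cell_slope; case: ifP => _.
    by field; rewrite gt_eqF ?p2.
  by rewrite expr0n/= !mul0r addr0.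
have qc : qn @ \oo --> slope_energy Z1 X K + slope_energy Z2 X K.
  rewrite QE; apply: cvg_big => [|i _]; first exact: add_continuous.
  case: ifPn => [/okX[X1 X2]|_]; last exact: cvg_cst.
  have [cx1 cx2] := Zcvg X1; have [cy1 cy2] := Zcvg X2.
  apply: cvgM; last exact: cvg_cst.
  by apply: cvgD; apply: cvg_expr2; exact: cvgB.
have t2 : 0 < tau / 2 by lra.
have N1 : \forall n \near \oo, forall i, i \in index_iota 0 (2 ^ K) ->
    (cell_inside X K i -> forall t, dyadic_pt K i <= t <= dyadic_pt K i.+1 -> d < cs (c n) t).
  apply: near_all => i; rewrite mem_index_iota => /andP[_ iK].
  case/boolP: (cell_inside X K i) => [okK|_]; last by apply: nearW.
  suff : \forall n \near \oo, forall t, dyadic_pt K i <= t <= dyadic_pt K i.+1 -> d < cs (c n) t by apply: filterS => n H _.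
  apply: Hoff; [exact: pt_le|exact: pt_ge0|exact: pt_le1|].
  by move=> x hx; move/asboolP: okK => /(_ x hx)[].
(* Each cell multiplies [errb] by 2^K, and there are 2^K cells. *)
have kk : 0 < (tau / 2) / (2 ^+ K * 2 ^+ K) by rewrite divr_gt0// mulr_gt0 ?p2.
move/cvgrPdist_lt/(_ _ t2): qc => N2; move/cvgrPdist_lt/(_ _ kk): errb_cvg => N3.
have N4 := z_diff_n.
near=> n.
have h1 : `|slope_energy Z1 X K + slope_energy Z2 X K - qn n| < tau / 2 by near: n.
have h2 : errb n < (tau / 2) / (2 ^+ K * 2 ^+ K).
  by apply: (le_lt_trans (ler_norm _)); rewrite -normrN -sub0r; near: n.
have ds : forall i, i \in index_iota 0 (2 ^ K) ->
    (cell_inside X K i -> forall t, dyadic_pt K i <= t <= dyadic_pt K i.+1 -> d < cs (c n) t) by near: n.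
have zd y z : 0 <= y -> y <= z -> z <= 1 -> (forall t, y <= t <= z -> d < cs (c n) t) ->
  (z1 th (c n) z - z1 th (c n) y) ^+ 2 + (z2 th (c n) z - z2 th (c n) y) ^+ 2 <=
    (z - y) * I y z (fun t => gg (c n) t ^+ 2) + errb n by move: y z; near: n.
have [_ ig2] := gsq n (lexx 0) (lexx 1).
have qb : qn n <= I 0 1 (fun x => gg (c n) x ^+ 2) + tau / 2.
  rewrite -[X in I _ X _](pt1 K) I_cells//.
  apply: (@le_trans _ _ (\sum_(0 <= i < 2 ^ K) (I (dyadic_pt K i) (dyadic_pt K i.+1) (fun x => gg (c n) x ^+ 2) + (tau / 2) / 2 ^+ K))); last first.
    rewrite big_split/= lerD2l.
    have -> : \sum_(0 <= i < 2 ^ K) (tau / 2 / 2 ^+ K) = tau / 2 => [|//].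
    by rewrite sumr_const_nat subn0 -[LHS]mulr_natr natrX divfK// gt_eqF ?p2.
  rewrite /qn big_seq [leRHS]big_seq; apply: ler_sum => i iI; have := iI.
  rewrite mem_index_iota => /andP[_ iK].
  have tK : 0 <= tau / 2 / 2 ^+ K by rewrite divr_ge0 ?ltW// p2.
  have I0 : 0 <= I (dyadic_pt K i) (dyadic_pt K i.+1) (fun x => gg (c n) x ^+ 2) by apply: I_ge0 => t _ _; exact: sqr_ge0.
  case: ifPn => okK; last by rewrite addr_ge0.
  have := zd (dyadic_pt K i) (dyadic_pt K i.+1) (pt_ge0 K i) (pt_le K (leqnSn i)) (pt_le1 iK) (ds i iI okK).
  rewrite -(ler_pM2r (p2 K)) => /le_trans; apply.
  rewrite ptS; set J := I _ _ _.
  have -> : dyadic_pt K i + (2 ^+ K)^-1 - dyadic_pt K i = (2 ^+ K)^-1 :> R by ring.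
  rewrite mulrDl mulrAC mulVf ?gt_eqF ?p2// mul1r lerD2l.
  apply: (@le_trans _ _ ((tau / 2) / (2 ^+ K * 2 ^+ K) * 2 ^+ K)); first by rewrite ler_pM2r ?p2// ltW.
  by rewrite le_eqVlt; apply/orP; left; apply/eqP; field; rewrite gt_eqF ?p2.
by move: h1; rewrite ltr_norml => /andP[? ?]; lra.
Unshelve. all: by end_near. Qed.

Let Q_ge0 v K : 0 <= slope_energy v X K.
Proof. by apply: sumr_ge0 => i _; rewrite divr_ge0 ?sqr_ge0// ltW// p2. Qed.

Let Q_bnd K : slope_energy Z1 X K <= B + 1 /\ slope_energy Z2 X K <= B + 1.
Proof.
have [N _ /(_ N (leqnn _)) H] := QQ K ltr01; have [_ gb] := good_bounds L0 N gs.
have := Q_ge0 Z1 K; have := Q_ge0 Z2 K; rewrite /B in gb *; split; lra.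
Qed.

(** [riesz] provides a derivative G of the pointwise limit Z of the rotated unit fields, and v is Z
    rotated back by th x. As |Z| = 1, the squared angular speed of Z is at most |G|^2, which serves
    as [E]. The boundary data survive at the endpoints not in [D], because there every unit field
    takes the prescribed value. *)
Lemma off_limit : exists v1 v2 g1 g2 E : R -> R,
  [/\ forall a b, a <= b -> (forall x, a <= x <= b -> X x) -> prim a b v1 g1 /\ prim a b v2 g2,
      sq g1 /\ sq g2,
      forall x, X x -> v1 x ^+ 2 + v2 x ^+ 2 = 1,
      {ae mu, forall x, X x -> v1 x = w1 x /\ v2 x = w2 x} &
   [/\ X 0 -> v1 0 = 1 /\ v2 0 = 0, X 1 -> v1 1 = cos alpha /\ v2 1 = sin alpha,
      integ `[0, 1] E /\ (forall x, 0 <= E x), forall x, X x -> (v1 x * g2 x - v2 x * g1 x - th) ^+ 2 <= E x &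
      forall tau, 0 < tau -> \forall n \near \oo, I 0 1 E <= I 0 1 (fun x => gg (c n) x ^+ 2) + tau]].
Proof.
have [G1 [mG1 iG1 qG1 tG1]] := riesz (fun K => (Q_bnd K).1).
have [G2 [mG2 iG2 qG2 tG2]] := riesz (fun K => (Q_bnd K).2).
have X01' x : X x -> 0 <= x <= 1 by case.
have P1 := riesz_ext mG1 iG1 X01' (fun a b HX => (Zwithin HX).1) tG1.
have P2 := riesz_ext mG2 iG2 X01' (fun a b HX => (Zwithin HX).2) tG2.
pose C x := cos (th * x); pose S x := sin (th * x).
have CS x : C x ^+ 2 + S x ^+ 2 = 1 by exact: cos2Dsin2.
pose v1 x := Z1 x * C x - Z2 x * S x; pose v2 x := Z1 x * S x + Z2 x * C x.
pose g1 x := (G1 x * C x + Z1 x * (- S x * th)) - (G2 x * S x + Z2 x * (C x * th)).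
pose g2 x := (G1 x * S x + Z1 x * (C x * th)) + (G2 x * C x + Z2 x * (- S x * th)).
have mC : measurable_fun X C by apply: measurable_funTS; apply: continuous_measurable_fun; exact: cosk_cont.
have mS : measurable_fun X S by apply: measurable_funTS; apply: continuous_measurable_fun; exact: sink_cont.
have Zle x : X x -> `|Z1 x| <= 1 /\ `|Z2 x| <= 1.
  move=> /Znorm H; have := sqr_ge0 (Z1 x); have := sqr_ge0 (Z2 x) => h1 h2.
  by split; (rewrite -(@ler_sqr _ `|_|) ?nnegrE// real_normK ?num_real// expr1n; lra).
have LG (G F : R -> R) : measurable_fun setT G -> integ `[0, 1] (fun x => G x ^+ 2) ->
    measurable_fun X F -> (forall x, X x -> `|F x| <= 1) -> L2 X (fun x => G x * F x).
  move=> mG iG mF F1; have mGF : measurable_fun X (fun x => G x * F x).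
    by apply: measurable_funM => //; exact: measurable_funTS.
  apply: sqr_L2 => //; apply: (@integ_le _ X _ (fun x => G x ^+ 2)) => //.
  - exact: measurable_funX.
  - move=> x Xx; rewrite ger0_norm ?sqr_ge0// exprMn ler_piMr ?sqr_ge0//.
    by have := F1 x Xx; rewrite -(@ler_sqr _ `|_|) ?nnegrE// real_normK ?num_real// expr1n.
  - by apply: (integS _ _ _ iG).
have LZ (Z F : R -> R) : measurable_fun X Z -> (forall x, X x -> `|Z x| <= 1) -> measurable_fun X F ->
    (forall x, `|F x| <= 1) -> L2 X (fun x => Z x * (F x * th)).
  move=> mZ Z1' mF F1; have m : measurable_fun X (fun x => Z x * (F x * th)).
    by apply: measurable_funM => //; apply: measurable_funM.
  apply: sqr_L2 => //; apply: (@integ_le _ X _ (fun x => th ^+ 2)) => //.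
  - exact: measurable_funX.
  - move=> x Xx; rewrite ger0_norm ?sqr_ge0// mulrA exprMn ler_piMl ?sqr_ge0//.
    rewrite -real_normK ?num_real// expr_le1// normrM.
    by rewrite mulr_ile1//; exact: Z1'.
  - by apply: (@integS _ X `[0, 1]) => //; exact: integ_cst.
have LD (f h : R -> R) : L2 X f -> L2 X h -> L2 X (fun x => f x + h x).
  move=> lf lh; apply: sqr_L2; first by apply: measurable_funD; [exact: lf.1|exact: lh.1].
  apply: (@eq_integ _ _ (fun x => f x ^+ 2 + h x ^+ 2 + 2 * (f x * h x))) => //.
    by move=> x _; ring.
  have f2 := L2_sqr mX lf; have h2 := L2_sqr mX lh.
  apply: integD => //; first exact: integD.
  by apply: integZ => //; apply: integM => //; [exact: lf.1|exact: lh.1].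
have Cb x : `|C x| <= 1 by exact: cos_max.
have Sb x : `|S x| <= 1 by exact: sin_max.
have [mZ1 mZ2] := Zmeas.
have mNS : measurable_fun X (fun x => - S x) by exact: measurableT_comp.
have Lg1 : L2 X g1.
  have -> : g1 = (fun x => (G1 x * C x + Z1 x * (- S x * th)) + (G2 x * (- S x) + Z2 x * (- C x * th))).
    by apply/funext => x; rewrite /g1; ring.
  apply: (LD (fun x => G1 x * C x + Z1 x * (- S x * th))); apply: LD.
  - by apply: LG.
  - by apply: LZ => // [x /Zle[]//|x]; rewrite normrN.
  - by apply: LG => // x _; rewrite normrN.
  - by apply: LZ => // [x /Zle[]//||x]; [exact: measurableT_comp|rewrite normrN].
have Lg2 : L2 X g2.
  apply: (LD (fun x => G1 x * S x + Z1 x * (C x * th))); apply: LD.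
  - by apply: LG.
  - by apply: LZ => // x /Zle[].
  - by apply: LG.
  - by apply: LZ => // [x /Zle[]//|x]; rewrite normrN.
have gX g x : X x -> (g \_ X) x = g x by move=> Xx; rewrite patchE mem_set.
exists v1, v2, (g1 \_ X), (g2 \_ X), (fun x => G1 x ^+ 2 + G2 x ^+ 2).
have [Za1 Za2] := Zae.
split.
- move=> a b ab HX; have p1 := P1 a b ab HX; have p2 := P2 a b ab HX.
  have pc := prim_cosk a b th; have ps := prim_sink a b th.
  have HX' x : a <= x -> x <= b -> X x by move=> ax xb; apply: HX; rewrite ax.
  split.
  + apply: (prim_ext (primB (prim_mul p1 pc) (prim_mul p2 ps))) => x ax xb //.
    by rewrite gX; [rewrite /g1 /C /S|exact: HX'].
  + apply: (prim_ext (primD (prim_mul p1 ps) (prim_mul p2 pc))) => x ax xb //.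
    by rewrite gX; [rewrite /g2 /C /S|exact: HX'].
- by split; exact: sq_patch.
- move=> x /Znorm H; transitivity ((Z1 x ^+ 2 + Z2 x ^+ 2) * (C x ^+ 2 + S x ^+ 2)).
    by rewrite /v1 /v2; ring.
  by rewrite H (CS x) mulr1.
- have Zb := ae_and Za1 Za2; apply: (ae_mono Zb) => x [h1 h2] Xx.
  rewrite /v1 /v2 h1// h2// /zeta1 /zeta2 -/(C x) -/(S x).
  have cx := CS x; split.
    by transitivity (w1 x * (C x ^+ 2 + S x ^+ 2)); [ring|rewrite cx mulr1].
  by transitivity (w2 x * (C x ^+ 2 + S x ^+ 2)); [ring|rewrite cx mulr1].
- split.
  + move=> X0; have [c1 c2] := Zcvg X0.
    have E n : z1 th (c n) 0 = 1 /\ z2 th (c n) 0 = 0.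
      have [_ _ _ [p10 p20] _] := pdn n.
      rewrite /z1 /z2 /zr /cs p10 p20 mulr0 cos0 sin0; split; last ring.
      by rewrite expr1n expr0n/= addr0 sqrtr1 invr1; ring.
    have e1 : Z1 0 = 1.
      by apply: (cvg_unique (@Rhausdorff R) c1); apply: cvg_near_cst; apply: nearW => n; exact: (E n).1.
    have e2 : Z2 0 = 0.
      by apply: (cvg_unique (@Rhausdorff R) c2); apply: cvg_near_cst; apply: nearW => n; exact: (E n).2.
    by rewrite /v1 /v2 e1 e2 /C /S mulr0 cos0 sin0; split; ring.
  + move=> X1; have [c1 c2] := Zcvg X1.
    have E n : z1 th (c n) 1 = cos alpha * C 1 + sin alpha * S 1 /\ z2 th (c n) 1 = sin alpha * C 1 - cos alpha * S 1.
      have [_ _ _ _ [p10 p20]] := pdn n.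
      rewrite /z1 /z2 /zr /cs p10 p20 cos2Dsin2 sqrtr1 invr1 !mulr1.
      by rewrite /C /S mulr1.
    have e1 : Z1 1 = cos alpha * C 1 + sin alpha * S 1.
      by apply: (cvg_unique (@Rhausdorff R) c1); apply: cvg_near_cst; apply: nearW => n; exact: (E n).1.
    have e2 : Z2 1 = sin alpha * C 1 - cos alpha * S 1.
      by apply: (cvg_unique (@Rhausdorff R) c2); apply: cvg_near_cst; apply: nearW => n; exact: (E n).2.
    have cx := CS 1; rewrite /v1 /v2 e1 e2; split.
      by transitivity (cos alpha * (C 1 ^+ 2 + S 1 ^+ 2)); [ring|rewrite cx mulr1].
    by transitivity (sin alpha * (C 1 ^+ 2 + S 1 ^+ 2)); [ring|rewrite cx mulr1].
  + by split=> [|x]; [exact: integD|rewrite addr_ge0 ?sqr_ge0].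
  + move=> x Xx; rewrite !gX//; have Zn := Znorm Xx; have cx := CS x.
    (* Rotating a unit field by th x adds exactly [th] to its angular speed. *)
    have -> : v1 x * g2 x - v2 x * g1 x - th = Z1 x * G2 x - Z2 x * G1 x.
      have -> : v1 x * g2 x - v2 x * g1 x = (Z1 x * G2 x - Z2 x * G1 x) * (C x ^+ 2 + S x ^+ 2)
         + th * (Z1 x ^+ 2 + Z2 x ^+ 2) * (C x ^+ 2 + S x ^+ 2) by rewrite /v1 /v2 /g1 /g2; ring.
      by rewrite cx Zn; ring.
    rewrite -[leRHS]mul1r -{1}Zn -subr_ge0.
    have -> : (Z1 x ^+ 2 + Z2 x ^+ 2) * (G1 x ^+ 2 + G2 x ^+ 2) - (Z1 x * G2 x - Z2 x * G1 x) ^+ 2 =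
      (Z1 x * G1 x + Z2 x * G2 x) ^+ 2 by ring.
    exact: sqr_ge0.
  + move=> tau tau0; have t3 : 0 < tau / 3 by lra.
    have [K1 H1] := qG1 _ t3; have [K2 H2] := qG2 _ t3.
    have := H1 (maxn K1 K2) (leq_maxl _ _); have := H2 (maxn K1 K2) (leq_maxr _ _) => h2 h1.
    apply: filterS (QQ (maxn K1 K2) t3) => n h3.
    by rewrite ID//; lra.
Qed.

End OffLimit.

(** * Jump sets and the lower bound *)

Section Jumps.
Context {R : realType}.
Local Notation mu := (@lebesgue_measure R).
Implicit Types (f g h : R -> R) (a b x y z r s t : R) (n : nat) (w : R -> R * R) (D : seq R).
Local Notation U01 := (@unit_interval R).

Lemma prim_ae a b f g g' : prim a b f g -> integ `[a, b] g' ->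
  {ae mu, forall x, `[(a : R), b]%classic x -> g x = g' x} -> prim a b f g'.
Proof.
move=> [ig Ef] ig' aeg; split=> // x y ax xy yb; rewrite Ef//.
apply: eq_I_ae; [exact: (integ_sub ig)|exact: (integ_sub ig')|].
by apply: (ae_mono aeg) => t Ht; rewrite /= in_itv/= => /andP[xt ty]; apply: Ht;
  rewrite /= in_itv/= (le_trans ax)//= (le_trans ty).
Qed.

Lemma prim_cat a b c f g : prim a b f g -> prim b c f g -> integ `[a, c] g -> prim a c f g.
Proof.
move=> [_ E1] [_ E2] ig; split=> // x y ax xy yc.
case: (leP y b) => yb; first exact: E1.
case: (leP b x) => bx; first exact: E2.
rewrite (@I_split _ x b y); [|exact: ltW|exact: ltW|exact: (integ_sub ig)].
by rewrite -E1 -?E2//; [ring|exact: ltW|exact: ltW].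
Qed.

Lemma prim_gt a b f g : b < a -> prim a b f g.
Proof.
move=> ba; split; last by move=> x y *; lra.
by rewrite /integ set_itv_ge ?bnd_simp -?ltNge//; exact: integrable_set0.
Qed.

Lemma ae_notin D : {ae mu, forall x : R, x \notin D}.
Proof.
apply: (@negligibleS _ _ _ mu [set` D]); first by move=> x /= /negP; rewrite negbK.
have cD : countable [set` D] by apply: finite_set_countable; exact: finite_seq.
apply/negligibleP; first exact: countable_measurable.
exact: countable_lebesgue_measure0.
Qed.

Lemma ae_neq x : {ae mu, forall y : R, y <> x}.
Proof. by apply: (ae_mono (ae_notin [:: x])) => y; rewrite inE => /eqP. Qed.

Lemma open_set1C x : open (~` [set x]).
Proof. by apply: closed_openC; apply: accessible_closed_set1; apply: hausdorff_accessible; exact: Rhausdorff. Qed.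

(** An isolated point is removable as soon as some absolutely continuous function crosses it and
    agrees with [f] almost everywhere nearby. *)
Lemma H1_fill (V : set R) x r f (v : R -> R) g : open V -> V `<=` `[0, 1] -> 0 < r ->
  (forall y, x - r <= y <= x + r -> V y) -> L2 V f -> H1 (V `\ x) f ->
  prim (x - r) (x + r) v g ->
  {ae mu, forall y, x - r <= y <= x + r -> v y = f y} -> H1 V f.
Proof.
move=> oV V01 r0 Vr lf hf P aev.
have oW : open (V `\ x) by apply: openI => //; exact: open_set1C.
have mV : measurable V by exact: open_measurable.
have W01 : V `\ x `<=` `[0, 1] by move=> y [] /V01.
have [u [acu aeu squ]] := H1_inv oW W01 hf.
set gu := weakD _ _ \_ _ in acu squ.
have igu c d : integ `[c, d] gu by exact: sqi_integ (sqi_of_sq c d squ).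
pose Bx := `]x - r, x + r[%classic `\ x.
have oB : open Bx by apply: openI; [exact: interval_open|exact: open_set1C].
have BxP y : Bx y -> x - r < y < x + r /\ y <> x.
  by move=> [] /=; rewrite in_itv.
have BW : Bx `<=` V `\ x.
  move=> y By; have [/andP[h1 h2] yx] := BxP y By; split=> //; apply: Vr; apply/andP; split; exact: ltW.
have acv : acU Bx v g.
  move=> a b ab; case: (leP a b) => [leab|/prim_gt//].
  have [/andP[h1 _] _] := BxP a (ab a ltac:(by rewrite lexx leab)).
  have [/andP[_ h2] _] := BxP b (ab b ltac:(by rewrite lexx leab)).
  by apply: (prim_sub P); exact: ltW.
have acuB := acU_sub BW acu.
have Euv : forall y, Bx y -> u y = v y.
  apply: (acU_eq oB acuB acv); apply: (ae_mono (ae_and aeu aev)) => y [h1 h2] By.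
  have [/andP[h3 h4] yx] := BxP y By; rewrite h1 ?h2//; last exact: BW.
  by rewrite !ltW.
have mB : measurable Bx by exact: open_measurable.
have Bsub : Bx `<=` `[x - r, x + r] by move=> y /BxP[/andP[h1 h2] _]; rewrite /= in_itv/= !ltW.
have aeg := acU_unique oB (integS mB (measurable_itv _) Bsub (igu _ _))
  (integS mB (measurable_itv _) Bsub P.1) acuB acv Euv.
(* The representative [u] lives off [x] and carries no information at [x] itself; the value of [v]
   makes it continuous there. *)
pose f' y := if y == x then v x else u y.
have f'v y : x - r < y -> y < x + r -> f' y = v y.
  move=> h1 h2; rewrite /f'; case: eqP => [->//|yx]; apply: Euv.
  by split=> //=; rewrite in_itv/= h1.
have Pm : prim (x - r / 2) (x + r / 2) f' gu.
  have P' : prim (x - r / 2) (x + r / 2) v g by apply: (prim_sub P); lra.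
  apply: (@prim_ext _ _ _ v _ gu); last by [].
    apply: (prim_ae P' (igu _ _)); apply: (ae_mono (ae_and aeg (ae_neq x))) => y [h1 yx].
    rewrite /= in_itv/= => /andP[h2 h3]; rewrite h1//; split=> //=; rewrite in_itv/=; apply/andP; split; lra.
  by move=> y h1 h2; rewrite f'v//; lra.
have Pw a b : (forall y, a <= y <= b -> V y) -> (forall y, a <= y <= b -> y <> x) -> prim a b f' gu.
  move=> HV Hx; apply: (@prim_ext _ _ _ u _ gu); last by [].
    by apply: acu => y hy; split; [exact: HV|exact: Hx].
  by move=> y ay yb; rewrite /f'; case: eqP => // yx; case: (Hx y) => //; rewrite ay.
have acf : acU V f' gu.
  move=> a b HV; case: (boolP (a <= x <= b)) => [/andP[ax xb]|nx]; last first.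
    by apply: Pw => // y hy yx; move: nx; rewrite -yx hy.
  have Pb : prim (x - r / 2) b f' gu.
    case: (leP b (x + r / 2)) => hb; first by apply: (prim_sub Pm).
    apply: (prim_cat Pm) => //; apply: Pw => [y /andP[h1 h2]|y /andP[h1 h2]]; last by lra.
    by apply: HV; apply/andP; split; lra.
  case: (leP (x - r / 2) a) => ha; first by apply: (prim_sub Pb).
  apply: (prim_cat _ Pb) => //; apply: Pw => [y /andP[h1 h2]|y /andP[h1 h2]]; last by lra.
  by apply: HV; apply/andP; split; lra.
have [//] : H1 V f /\ {ae mu, forall y, V y -> weakD V f y = gu y}.
apply: (H1_intro oV V01 lf (sq_L2 mV squ) acf).
apply: (ae_mono (ae_and aeu (ae_neq x))) => y [h1 yx] Vy.
by rewrite /f'; case: eqP => // _; apply: h1.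
Qed.

Lemma ex_jump_set (alpha : R) w (s : seq R) : H1_plane (U01 `\` [set` s]) w ->
  {ae mu, forall x, U01 x -> sqnorm (w x) = 1} -> exists J, jump_set alpha w J.
Proof.
move=> hs aew.
pose P n := `[< exists s : seq R, size s = n /\ H1_plane (U01 `\` [set` s]) w >].
have exP : exists n, P n by exists (size s); apply/asboolP; exists s.
case: (ex_minnP exP) => n /asboolP[t [st ht]] minn.
pose V := U01 `\` [set` t].
(* The endpoints do not affect the open set [U01] minus [J], so they can be decided by the traces
   taken along [V]. *)
pose J := [set x | (x \in t /\ U01 x) \/ (x = 0 /\ ~ has_trace V w 0^'+ (1, 0)) \/
  (x = 1 /\ ~ has_trace V w 1^'- (expi alpha))].
have EJ (K : set R) : U01 `\` (J `\` K) = U01 `\` ([set` t] `\` K).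
  apply/seteqP; split=> x [Ux nx]; split=> //.
    by move=> [xt nK]; apply: nx; split=> //; left.
  move=> [Jx nK]; apply: nx; split=> //; case: Jx => [[]//|].
  by move/unitP: Ux => /andP[h1 h2] [[x0 _]|[x1 _]]; move: h1 h2; rewrite ?x0 ?x1 ltxx.
have EJ0 : U01 `\` J = V by have := EJ set0; rewrite !setD0.
exists J; split.
- split.
    apply: (@sub_finite_set _ _ [set` 0 :: 1 :: t]); last exact: finite_seq.
    by move=> x [[xt _]|[[-> _]|[-> _]]]; rewrite /= !inE ?xt ?eqxx ?orbT.
  move=> x [[_ /unit_sub//]|[[-> _]|[-> _]]]; by rewrite /= in_itv/= lexx ler01.
- rewrite EJ0; split=> //; apply: (ae_mono aew) => x Hx [Ux _]; exact: Hx.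
- move=> x Jx x01; rewrite EJ => hx.
  have xt : x \in t by case: Jx => [[]//|[[x0 _]|[x1 _]]]; move: x01; rewrite ?x0 ?x1 ltxx ?andbF.
  have := minn (size [seq y <- t | y != x]).
  have -> : P (size [seq y <- t | y != x]).
    apply/asboolP; exists [seq y <- t | y != x]; split=> //.
    have -> : [set` [seq y <- t | y != x]] = [set` t] `\ x.
      apply/seteqP; split=> y /=; rewrite mem_filter; first by move=> /andP[/eqP].
      by move=> [-> /eqP ->].
    exact: hx.
  move=> /(_ isT); rewrite leqNgt -st size_filter.
  move=> /negP; apply; rewrite -(count_predC (fun y => y != x) t).
  rewrite -[X in (X < _)%N]addn0 ltn_add2l -has_count.
  by apply/hasP; exists x => //=; rewrite negbK.
- rewrite EJ0; split; last by right; left.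
  by case=> [[_ /unitP]|[[]//|[/eqP]]]; rewrite ?ltxx// eq_sym oner_eq0.
- rewrite EJ0; split; last by right; right.
  by case=> [[_ /unitP]|[[/eqP]|[]//]]; rewrite ?ltxx ?andbF// oner_eq0.
Qed.

Variables (L alpha A : R) (w : R -> R * R) (D : seq R) (v1 v2 g1 g2 E : R -> R).
Let X := [set x : R | 0 <= x <= 1 /\ x \notin D].
Let th := 2 * pi * A.
Hypotheses (L0 : 0 < L) (l2w : L2_plane U01 w)
  (Pv : forall a b, a <= b -> (forall x, a <= x <= b -> X x) -> prim a b v1 g1 /\ prim a b v2 g2)
  (Sg : sq g1 /\ sq g2) (nv : forall x, X x -> v1 x ^+ 2 + v2 x ^+ 2 = 1)
  (aev : {ae mu, forall x, U01 x -> x \notin D -> v1 x = (w x).1 /\ v2 x = (w x).2})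
  (v0 : X 0 -> v1 0 = 1 /\ v2 0 = 0) (v1e : X 1 -> v1 1 = cos alpha /\ v2 1 = sin alpha)
  (iE : integ `[0, 1] E) (E0 : forall x, 0 <= E x)
  (Eb : forall x, X x -> (v1 x * g2 x - v2 x * g1 x - th) ^+ 2 <= E x).

Let U := U01 `\` [set` D].
Let oUJ (J : set R) : finite_set J -> open (U01 `\` J).
Proof.
move=> fJ; apply: openI; first exact: unit_open.
apply: closed_openC; apply: (accessible_finite_set_closed.1 _ J fJ).
by apply: hausdorff_accessible; exact: Rhausdorff.
Qed.
Let oU : open U.
Proof. by apply: oUJ; exact: finite_seq. Qed.
Let UX x : U x -> X x.
Proof. by move=> [/unitP/andP[h1 h2] /negP xD]; split=> //; rewrite !ltW. Qed.
Let USub (J : set R) : U01 `\` J `<=` `[0, 1].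
Proof. by move=> x [/unit_sub]. Qed.
Let L2J (J : set R) : finite_set J -> L2_plane (U01 `\` J) w.
Proof.
move=> fJ; have mJ : measurable (U01 `\` J) by apply: open_measurable; exact: oUJ.
have mU : measurable U01 by apply: open_measurable; exact: unit_open.
have sub : U01 `\` J `<=` U01 by move=> x [].
by have [h1 h2] := l2w; split; exact: (L2_sub mJ mU sub).
Qed.
Let acU12 : acU U v1 g1 /\ acU U v2 g2.
Proof.
by split=> a b H; (case: (leP a b) => [ab|/prim_gt//]); have [] := Pv ab (fun x hx => UX (H x hx)).
Qed.
Let aeU : {ae mu, forall x, U x -> v1 x = comp1 w x} /\ {ae mu, forall x, U x -> v2 x = comp2 w x}.
Proof.
by split; apply: (ae_mono aev) => x Hx [Ux /negP xD]; have [] := Hx Ux xD.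
Qed.
Let H1U : [/\ H1 U (comp1 w), H1 U (comp2 w), {ae mu, forall x, U x -> weakD U (comp1 w) x = g1 x} &
  {ae mu, forall x, U x -> weakD U (comp2 w) x = g2 x}].
Proof.
have mU : measurable U by exact: open_measurable.
have [l1 l2] := L2J (finite_seq D); have [s1 s2] := Sg; have [a1 a2] := acU12; have [e1 e2] := aeU.
have U01' : U `<=` `[0, 1] by exact: USub.
have [h1 h2] := H1_intro oU U01' l1 (sq_L2 mU s1) a1 e1.
by have [h3 h4] := H1_intro oU U01' l2 (sq_L2 mU s2) a2 e2.
Qed.

Let ae_norm : {ae mu, forall x, U01 x -> sqnorm (w x) = 1}.
Proof.
apply: (ae_mono (ae_and aev (ae_notin D))) => x [Hx xD] Ux.
have [e1 e2] := Hx Ux xD; rewrite /sqnorm -e1 -e2; apply: nv.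
by split=> //; have := unit_sub Ux; rewrite /= in_itv.
Qed.

Let jex : exists J, jump_set alpha w J.
Proof. by have [h1 h2 _ _] := H1U; apply: (ex_jump_set alpha _ ae_norm); split; [exact: h1|exact: h2]. Qed.

(** Off [D] the representative [v1], [v2] crosses [x], so [H1_fill] would let [x] be dropped,
    against minimality of [J]. *)
Let jump_int J x : jump_set alpha w J -> J x -> 0 < x < 1 -> x \in D.
Proof.
move=> [[fJ J01] [[h1 h2] _] mJ _ _] Jx x01; apply: contrapT => /negP xD.
have UJx : U x by split; [exact/unitP|apply/negP].
have [r1 r10 H1'] := open_ball oU UJx.
have fJx : finite_set (J `\ x) by apply: sub_finite_set fJ => y [].
pose V := U01 `\` (J `\ x).
have oV : open V by exact: oUJ.
have Vx : V x by split; [exact/unitP|move=> [_]; exact].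
have [r2 r20 H2'] := open_ball oV Vx.
have [r [r0 rr1 rr2]] := small2 r10 r20.
have EV : V `\ x = U01 `\` J.
  apply/seteqP; split=> y.
    by move=> [[Uy nJ] yx]; split=> // Jy; apply: nJ; split.
  by move=> [Uy nJ]; split; [split=> // [[/nJ]]|move=> /= yx; apply: nJ; rewrite yx].
have [P1 P2] := @Pv (x - r) (x + r) ltac:(lra) (fun y hy => UX (H1' y ltac:(move/andP: hy => [? ?]; apply/andP; split; lra))).
have HV y : x - r <= y <= x + r -> V y.
  by move=> /andP[? ?]; apply: H2'; apply/andP; split; lra.
have HU y : x - r <= y <= x + r -> U y.
  by move=> /andP[? ?]; apply: H1'; apply/andP; split; lra.
have [l1 l2] := L2J fJx; have [e1 e2] := aeU.
apply: (mJ x Jx x01); split.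
- apply: (H1_fill oV _ r0 HV l1 _ P1) => //; [exact: USub|by rewrite EV|].
  by apply: (ae_mono e1) => y Hy hy; apply: Hy; exact: HU.
- apply: (H1_fill oV _ r0 HV l2 _ P2) => //; [exact: USub|by rewrite EV|].
  by apply: (ae_mono e2) => y Hy hy; apply: Hy; exact: HU.
Qed.

Let subUJ J : jump_set alpha w J -> U `<=` U01 `\` J.
Proof.
move=> jJ x [Ux nx]; split=> // Jx; apply: nx; apply: (jump_int jJ Jx); exact/unitP.
Qed.

Let rep J : jump_set alpha w J -> exists u1 u2 h1 h2, [/\ acU (U01 `\` J) u1 h1, acU (U01 `\` J) u2 h2,
   {ae mu, forall x, (U01 `\` J) x -> (u1 x, u2 x) = w x},
   {in U01 `\` J, continuous (fun x => (u1 x, u2 x))} &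
   forall x, U x -> u1 x = v1 x /\ u2 x = v2 x].
Proof.
move=> jJ; have [[fJ _] [[h1 h2] _] _ _ _] := jJ; have oJ := oUJ fJ.
have [u1 [a1 e1 _]] := H1_inv oJ (@USub J) h1.
have [u2 [a2 e2 _]] := H1_inv oJ (@USub J) h2.
exists u1, u2; do 2!eexists; split; [exact: a1|exact: a2| | |].
- apply: (ae_mono (ae_and e1 e2)) => x [k1 k2] Ux; rewrite k1// k2// /comp1 /comp2.
  by case: (w x).
- move=> x; rewrite inE => Ux; apply: cvg_pair2; [exact: (acU_cont oJ a1 Ux)|exact: (acU_cont oJ a2 Ux)].
- move=> x Ux; have [b1 b2] := acU12; have [k1 k2] := aeU; have sub := subUJ jJ.
  split; [apply: (acU_eq oU (acU_sub sub a1) b1)|apply: (acU_eq oU (acU_sub sub a2) b2)] => //.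
    by apply: (ae_mono (ae_and e1 k1)) => y [q1 q2] Uy; rewrite q1 ?q2//; exact: sub.
  by apply: (ae_mono (ae_and e2 k2)) => y [q1 q2] Uy; rewrite q1 ?q2//; exact: sub.
Qed.

(** At an endpoint outside [D] the representative is continuous with the prescribed value, so the
    trace condition holds and the endpoint is not a jump. *)
Let jump_sub J : jump_set alpha w J -> J `<=` [set` D].
Proof.
move=> jJ x Jx; have [[fJ J01] _ _ j0 j1] := jJ.
have := J01 x Jx; rewrite /= in_itv/= => /andP[x0 x1].
have [u1 [u2 [h1 [h2 [a1 a2 aeu cu Euv]]]]] := rep jJ.
apply: contrapT => /negP xD.
have [u [v [[u0 uv vle1 _] [/andP[ux xv] HD]]]] := near_point (x := x) ltac:(by rewrite x0) xD ltr01.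
have HX y : u <= y <= v -> X y.
  by move=> hy; split; [move/andP: hy => [? ?]; apply/andP; split; lra|exact: HD].
have [P1 P2] := Pv (ltW uv) HX.
have HU y : u < y < v -> U y.
  move=> /andP[uy yv]; split; first by apply/unitP; apply/andP; split; lra.
  by apply/negP; apply: HD; rewrite !ltW.
case: (boolP (0 < x < 1)) => [/(jump_int jJ Jx)|]; first by rewrite (negbTE xD).
rewrite negb_and -!leNgt => /orP[x0'|x1'].
- have ex0 : x = 0 by apply/eqP; rewrite eq_le x0'.
  rewrite ex0 in Jx ux xv; have eu : u = 0 by apply/eqP; rewrite eq_le ux.
  have [e1 e2] := v0 (HX 0 ltac:(by rewrite ux)).
  apply: (j0.1 Jx); exists (fun x => (u1 x, u2 x)); split=> //.
  have lim f (q : R -> R) k : prim u v f q -> (forall x, U x -> k x = f x) -> k y @[y --> 0^'+] --> f 0.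
    move=> P Ek; apply/cvgrPdist_lt => e e0.
    have [dl dl0 Hd] := prim_cont P (c := 0) ltac:(lra) ltac:(lra) e0.
    near=> y.
    have y0 : 0 < y by near: y; exact: nbhs_right_gt.
    have yv : y < v by near: y; apply: nbhs_right_lt; lra.
    have yd : y < dl by near: y; exact: nbhs_right_lt.
    rewrite distrC Ek; last by apply: HU; rewrite eu y0.
    by apply: Hd; lra.
  have l1 := lim _ _ u1 P1 (fun y Uy => (Euv y Uy).1).
  have l2 := lim _ _ u2 P2 (fun y Uy => (Euv y Uy).2).
  by rewrite e1 in l1; rewrite e2 in l2; exact: cvg_pair2.
- have ex1 : x = 1 by apply/eqP; rewrite eq_le x1.
  rewrite ex1 in Jx ux xv; have ev : v = 1 by apply/eqP; rewrite eq_le vle1.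
  have [e1 e2] := v1e (HX 1 ltac:(by rewrite ux)).
  apply: (j1.1 Jx); exists (fun x => (u1 x, u2 x)); split=> //.
  have lim f (q : R -> R) k : prim u v f q -> (forall x, U x -> k x = f x) -> k y @[y --> 1^'-] --> f 1.
    move=> P Ek; apply/cvgrPdist_lt => e e0.
    have [dl dl0 Hd] := prim_cont P (c := 1) ltac:(lra) ltac:(lra) e0.
    near=> y.
    have y0 : y < 1 by near: y; exact: nbhs_left_lt.
    have yv : u < y by near: y; apply: nbhs_left_gt; lra.
    have yd : 1 - dl < y by near: y; apply: nbhs_left_gt; lra.
    rewrite distrC Ek; last by apply: HU; rewrite ev yv.
    by apply: Hd; lra.
  have l1 := lim _ _ u1 P1 (fun y Uy => (Euv y Uy).1).
  have l2 := lim _ _ u2 P2 (fun y Uy => (Euv y Uy).2).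
  by rewrite e1 in l1; rewrite e2 in l2; exact: cvg_pair2.
Unshelve. all: by end_near. Qed.

Lemma counting_le (J : set R) : J `<=` [set` D] -> (counting J <= (size D)%:R%:E :> \bar R)%E.
Proof.
move=> JD; have fJ : finite_set J by apply: sub_finite_set JD _; exact: finite_seq.
rewrite /counting asboolT// lee_fin ler_nat.
apply: uniq_leq_size; first exact: finmap.fset_uniq.
by move=> x; rewrite in_fset_set// inE => /JD.
Qed.

(** [J] lies in [D], and [D] is null, so off [J] the current of [w] is almost everywhere that of the
    representative. Dips that are not jumps only enlarge the right side. *)
Lemma E_energy_le : (E_energy L alpha A w <= (L / 2 * I 0 1 E + 2 * Num.sqrt 2 / 3 * (size D)%:R)%:E)%E.
Proof.
rewrite /E_energy asboolT//.
have jJ : jump_set alpha w (xget set0 (jump_set alpha w)).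
  by have [J hJ] := jex; exact: (xgetPex _ (ex_intro _ J hJ)).
move: (xget _ _) jJ => J jJ.
have [[fJ _] [[h1 h2] _] _ _ _] := jJ; have oJ := oUJ fJ; have J01 := @USub J.
have mJ : measurable (U01 `\` J) by exact: open_measurable.
have mU : measurable U by exact: open_measurable.
have sub := subUJ jJ.
have K0 : 0 <= 2 * Num.sqrt 2 / 3 :> R by rewrite divr_ge0// mulr_ge0// sqrtr_ge0.
rewrite EFinD; apply: leeD; last first.
  by rewrite (EFinM _ (size D)%:R) lee_wpmul2l ?lee_fin//; exact: counting_le (jump_sub jJ).
rewrite (EFinM (L / 2)); apply: lee_wpmul2l; first by rewrite lee_fin divr_ge0// ltW.
have [u1 [a1 e1 s1]] := H1_inv oJ J01 h1.
have [u2 [a2 e2 s2]] := H1_inv oJ J01 h2.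
have [b1 b2] := acU12; have [k1 k2] := aeU; have [t1 t2] := Sg.
have E1 : forall x, U x -> u1 x = v1 x.
  apply: (acU_eq oU (acU_sub sub a1) b1).
  by apply: (ae_mono (ae_and e1 k1)) => y [q1 q2] Uy; rewrite q1 ?q2//; exact: sub.
have E2 : forall x, U x -> u2 x = v2 x.
  apply: (acU_eq oU (acU_sub sub a2) b2).
  by apply: (ae_mono (ae_and e2 k2)) => y [q1 q2] Uy; rewrite q1 ?q2//; exact: sub.
have iU g : sq g -> integ U g.
  by move=> sg; apply: (@L2_integ R U g 0 1) => //; [exact: USub|exact: sq_L2].
have D1 := acU_unique oU (iU _ s1) (iU _ t1) (acU_sub sub a1) b1 E1.
have D2 := acU_unique oU (iU _ s2) (iU _ t2) (acU_sub sub a2) b2 E2.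
pose C x := (v1 x * g2 x - v2 x * g1 x - th) ^+ 2.
have mcur : measurable_fun (U01 `\` J) (fun x => (current (U01 `\` J) w x - th) ^+ 2).
  have [l1 l2] := L2J fJ.
  have mw1 : measurable_fun (U01 `\` J) (weakD (U01 `\` J) (comp1 w)).
    by apply/(measurable_restrictT _ mJ); exact: s1.1.
  have mw2 : measurable_fun (U01 `\` J) (weakD (U01 `\` J) (comp2 w)).
    by apply/(measurable_restrictT _ mJ); exact: s2.1.
  apply: measurable_funX; apply: measurable_funB => //.
  by apply: measurable_funB; apply: measurable_funM => //; [exact: l1.1|exact: l2.1].
have iEJ : integ (U01 `\` J) E by apply: (integS _ _ _ iE).
apply: (@le_trans _ _ (\int[mu]_(x in U01 `\` J) (E x)%:E)%E); last first.
  rewrite /I -integE//; apply: (@ge0_subset_integral _ _ _ mu _ `[0, 1] mJ (measurable_itv _)) => //.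
  - by apply/measurable_EFinP; exact: integ_meas iE.
  - by move=> x _; rewrite lee_fin.
apply: ae_ge0_le_integral => //.
- by move=> x _; rewrite lee_fin sqr_ge0.
- exact/measurable_EFinP.
- by move=> x _; rewrite lee_fin.
- by apply/measurable_EFinP; exact: integ_meas iEJ.
- have AE := ae_and (ae_and (ae_and e1 e2) (ae_and D1 D2)) (ae_notin D).
  apply: (ae_mono AE) => x [[[q1 q2] [q3 q4]] xD] Ux; rewrite lee_fin.
  have Ux' : U x by split; [exact: Ux.1|exact/negP].
  have -> : current (U01 `\` J) w x = v1 x * g2 x - v2 x * g1 x.
    rewrite /current -q1// -q2// E1// E2//.
    by have := q3 Ux'; have := q4 Ux'; rewrite !patchE mem_set// => -> ->.
  exact: (Eb (UX Ux')).
Qed.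

End Jumps.

(** * The liminf inequality *)

Section Liminf.
Context {R : realType}.
Local Notation mu := (@lebesgue_measure R).
Implicit Types (f g h : R -> R) (a b x y z r s t : R) (n : nat) (w : R -> R * R) (D : seq R).
Local Notation U01 := (@unit_interval R).

Lemma unit_meas : measurable U01.
Proof. by apply: open_measurable; exact: unit_open. Qed.

(** With k dips of cost P each, k P + (L / 2) J <= M. Here P falls short of 2 sqrt 2 / 3 by at most
    4 sqrt 2 sqrt d. For sqrt d <= 1/12 this leaves P >= sqrt 2 / 3, so k sqrt 2 / 3 <= M and the
    total shortfall is at most 12 M sqrt d. *)
Lemma liminf_bound (alpha L M A : R) w (c : nat -> @cfg R) (d : R) : 0 < L -> L2_plane U01 w ->
  good_seq alpha L M A (comp1 w \_ U01) (comp2 w \_ U01) c ->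
  0 < d -> d < 1 -> Num.sqrt d <= 1 / 12 ->
  (E_energy L alpha A w <= (M + 12 * M * Num.sqrt d)%:E)%E.
Proof.
move=> L0 l2w gs d0 d1 sd; have [l1 l2] := l2w; have mU := unit_meas.
have iw (f : R -> R) : L2 U01 f -> integ `[0, 1] (f \_ U01).
  by move=> lf; exact: sqi_integ (sqi_of_sq 0 1 (sq_patch mU lf)).
have [sg [D [subsg dD Hoff]]] := max_dips L0 gs d0 d1.
have gs' := good_seq_sub subsg gs.
have [v1 [v2 [g1 [g2 [E [Pv Sg nv aev [v0 v1e [iE E0] Eb HE]]]]]]] :=
  off_limit L0 gs' d0 (iw _ l1) (iw _ l2) Hoff.
have aev' : {ae mu, forall x, U01 x -> x \notin D -> v1 x = (w x).1 /\ v2 x = (w x).2}.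
  apply: (ae_mono aev) => x Hx Ux xD.
  have [|-> ->] := Hx; last by rewrite !patchE mem_set.
  by split=> //; have := unit_sub Ux; rewrite /= in_itv.
apply: (le_trans (E_energy_le L0 l2w Pv Sg nv aev' v0 v1e iE E0 Eb)); rewrite lee_fin.
set P := 2 * (Psi d 1 - Psi d d); set J := I 0 1 E; set k := (size D)%:R : R.
have k0 : 0 <= k by rewrite /k ler0n.
have J0 : 0 <= J by apply: I_ge0.
have main : k * P + L / 2 * J <= M.
  apply/ler_addgt0Pl => eta eta0.
  have kk : 0 < k + L / 2 by apply: ltr_wpDl => //; lra.
  (* The slack is lost once per dip and once, with the factor L / 2, in the phase term: together
     exactly [eta]. *)
  have e0 : 0 < eta / (k + L / 2) by rewrite divr_gt0.
  have N1 := dips_cost L0 gs' d0 d1 dD e0; have N2 := HE _ e0.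
  have [N _ HN] := filterI N1 N2; have [h1 h2] := HN N (leqnn _).
  have [/(_ N)[pd _ _ hM] _ _ _ _] := gs'.
  move: hM; rewrite (cdens_split L pd) => hM.
  have L2' : L / 2 * J <= L / 2 * (I 0 1 (fun x => gg ((c \o sg) N) x ^+ 2) + eta / (k + L / 2)).
    by rewrite ler_wpM2l// divr_ge0// ltW.
  rewrite -/P -/k in h1.
  have Ee : eta = k * (eta / (k + L / 2)) + L / 2 * (eta / (k + L / 2)).
    by rewrite -mulrDl mulrC divfK// gt_eqF.
  rewrite mulrDr in L2'; rewrite mulrBr in h1.
  rewrite Ee; move: (k * (eta / _)) (L / 2 * (eta / _)) (L / 2 * I _ _ _) (k * P) (L / 2 * J) h1 hM L2'.
  by move=> x1 x2 x3 x4 x5; lra.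
have := Psi_gap d0 (ltW d1) => gap.
set q := Num.sqrt 2 : R; set s := Num.sqrt d in gap sd *.
have q0 : 0 < q by rewrite sqrtr_gt0.
have qq : q * q = 2 by rewrite -expr2 sqr_sqrtr.
have hP : 2 * q / 3 - 4 * (q * s) <= P.
  have -> : P = q * ((Psi d 1 - Psi d d) * q) by rewrite mulrCA qq /P mulrC.
  apply: le_trans (ler_wpM2l (ltW q0) gap); rewrite le_eqVlt; apply/orP; left; apply/eqP; ring.
have s0 : 0 <= s by exact: sqrtr_ge0.
have qs : q * s <= q * (1 / 12) by rewrite ler_wpM2l// ltW.
have M0 : 0 <= M.
  apply: le_trans main; rewrite addr_ge0// mulr_ge0//; last by rewrite divr_ge0// ltW.
  by apply: le_trans hP; lra.
have hk : k * (q / 3) <= M.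
  have kP : k * (q / 3) <= k * P by apply: ler_wpM2l => //; apply: le_trans hP; lra.
  by apply: (le_trans kP); apply: le_trans main; rewrite lerDl mulr_ge0// divr_ge0// ltW.
have h1 : k * (2 * q / 3 - 4 * (q * s)) <= k * P by exact: ler_wpM2l.
have h2 : k * (4 * (q * s)) <= 12 * M * s.
  have -> : k * (4 * (q * s)) = 12 * (k * (q / 3)) * s by field.
  by rewrite ler_wpM2r// ler_wpM2l.
rewrite mulrBr in h1; rewrite [X in _ + X]mulrC.
move: (k * (4 * (q * s))) (k * P) (L / 2 * J) (12 * M * s) (k * (2 * q / 3)) main h1 h2 => x1 x2 x3 x4 x5.
lra.
Qed.

(** [liminf_bound] applies to the same sequence for every small [d], with the same left side; [d] is
    taken as a square s^2 and sent to 0. *)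
Lemma liminf_core (alpha L M A : R) w (c : nat -> @cfg R) : 0 < L -> L2_plane U01 w ->
  good_seq alpha L M A (comp1 w \_ U01) (comp2 w \_ U01) c ->
  (E_energy L alpha A w <= M%:E)%E.
Proof.
move=> L0 l2w gs; apply/lee_addgt0Pr => e e0.
have M0 : 0 <= M.
  have [bm _] := good_bounds L0 0 gs; have [/(_ 0%N)[_ e0n _ _] _ _ _ _] := gs.
  by apply: le_trans bm; apply: I_ge0 => x _ _; exact: mm_ge0.
have e12 : 0 < e / (12 * M + 1) by rewrite divr_gt0//; lra.
have [s [s0 s1 se]] := @small2 R (1 / 12) _ ltac:(lra) e12.
have ss : Num.sqrt (s ^+ 2) = s by rewrite sqrtr_sqr gtr0_norm.
have := @liminf_bound alpha L M A w c (s ^+ 2) L0 l2w gs; rewrite ss => H.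
apply: le_trans (H _ _ _) _; [by rewrite exprn_gt0|by rewrite expr_lt1 ?ltW//; lra|exact: ltW|].
rewrite -EFinD lee_fin lerD2l.
apply: (@le_trans _ _ ((12 * M + 1) * s)); first by rewrite ler_wpM2r ?(ltW s0)// lerDl.
by rewrite -ler_pdivlMl ?[_^-1 * _]mulrC 1?ltW//; lra.
Qed.

Lemma L1_of_L2 (p1 p2 q1 q2 : R -> R) (wn w : R -> R * R) alpha : pdata alpha p1 p2 q1 q2 ->
  L2_plane U01 wn -> L2_plane U01 w -> {ae mu, forall x, U01 x -> wn x = (p1 x, p2 x)} ->
  (((I 0 1 (fun x => `|p1 x - (comp1 w \_ U01) x|)) ^+ 2)%:E <= \int[mu]_(x in U01) (sqnorm (wn x - w x))%:E)%E /\
  (((I 0 1 (fun x => `|p2 x - (comp2 w \_ U01) x|)) ^+ 2)%:E <= \int[mu]_(x in U01) (sqnorm (wn x - w x))%:E)%E.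
Proof.
move=> [[P1 P2] _ _ _ _] [lw1 lw2] [l1 l2] aew; have mU := unit_meas.
have msq : measurable_fun U01 (fun x => (sqnorm (wn x - w x))%:E).
  apply/measurable_EFinP; rewrite /sqnorm.
  apply: measurable_funD; apply: measurable_funX; apply: measurable_funB.
  - exact: lw1.1.
  - exact: l1.1.
  - exact: lw2.1.
  - exact: l2.1.
have key (p u v : R -> R) : sqi 0 1 p -> L2 U01 v -> {ae mu, forall x, U01 x -> p x = u x} ->
   (forall x, (u x - v x) ^+ 2 <= sqnorm (wn x - w x)) ->
   (((I 0 1 (fun x => `|p x - (v \_ U01) x|)) ^+ 2)%:E <= \int[mu]_(x in U01) (sqnorm (wn x - w x))%:E)%E.
  move=> sp lv aeu le.
  have sf : sqi 0 1 (fun x => p x - (v \_ U01) x) by apply: sqiB => //; apply: sqi_of_sq; exact: sq_patch.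
  apply: (@le_trans _ _ (I 0 1 (fun x => (p x - (v \_ U01) x) ^+ 2))%:E).
    by rewrite lee_fin; have := I_CS ler01 (sqi_integ sf) sf.2; rewrite subr0 mul1r.
  rewrite -int_unit; last exact: sf.2.
  apply: ae_ge0_le_integral => //.
  - by move=> x _; rewrite lee_fin sqr_ge0.
  - by apply/measurable_EFinP; apply: measurable_funS (integ_meas sf.2) => //; exact: unit_sub.
  - by move=> x _; rewrite lee_fin /sqnorm addr_ge0 ?sqr_ge0.
  - by apply: (ae_mono aeu) => x Hx Ux; rewrite lee_fin patchE mem_set// Hx.
split.
- apply: (key _ (comp1 wn)) => //; first exact: prim_sqi (P1 0 1).
    by apply: (ae_mono aew) => x Hx /Hx; rewrite /comp1 => ->.
  by move=> x; rewrite /sqnorm lerDl sqr_ge0.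
- apply: (key _ (comp2 wn)) => //; first exact: prim_sqi (P2 0 1).
    by apply: (ae_mono aew) => x Hx /Hx; rewrite /comp2 => ->.
  by move=> x; rewrite /sqnorm lerDr sqr_ge0.
Qed.

Lemma sqr_cvg0 (u : nat -> R) (v : nat -> \bar R) : (forall n, 0 <= u n) ->
  (forall n, ((u n ^+ 2)%:E <= v n)%E) -> v @ \oo --> 0%E -> u @ \oo --> (0 : R).
Proof.
move=> u0 uv cv.
have c2 : (fun n => (u n ^+ 2)%:E) @ \oo --> 0%E.
  apply: (@squeeze_cvge _ _ _ _ (fun=> 0%E) _ v) => //; last exact: cvg_cst.
  by apply: nearW => n; rewrite lee_fin sqr_ge0/=.
have c3 : (fun n => u n ^+ 2) @ \oo --> (0 : R) by exact: (fine_cvg c2).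
have -> : u = Num.sqrt \o (fun n => u n ^+ 2).
  by apply/funext => n /=; rewrite sqrtr_sqr ger0_norm.
by rewrite -(@sqrtr0 R); apply: (cvg_comp _ _ c3); exact: sqrt_continuous.
Qed.

(** Bounding the floor by eps^-beta leaves 2 pi eps^(1/2 - beta), a positive power. *)
Lemma kap_cvg (eps : nat -> R) (beta : R) : 0 < beta -> beta < 1 / 2 -> (forall l, 0 < eps l) ->
  eps @ \oo --> (0 : R) ->
  (fun n => 2 * pi * (Num.floor (eps n `^ (- beta)))%:~R * Num.sqrt (eps n)) @ \oo --> (0 : R).
Proof.
move=> b0 b1 e0 ec.
have pw : (fun n => eps n `^ (1 / 2 - beta)) @ \oo --> (0 : R).
  apply/cvgrPdist_lt => e epos; pose g := 1 / 2 - beta.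
  have g0 : 0 < g by rewrite /g; lra.
  have dl0 : 0 < e `^ g^-1 by exact: powR_gt0.
  move/cvgrPdist_lt/(_ _ dl0): ec; apply: filterS => n; rewrite !sub0r !normrN => H.
  rewrite ger0_norm ?powR_ge0//.
  have -> : e = (e `^ g^-1) `^ g by rewrite -powRrM mulVf ?gt_eqF// powRr1// ltW.
  apply: gt0_ltr_powR => //; rewrite ?nnegrE ?powR_ge0 ?(ltW (e0 n))//.
  by apply: le_lt_trans H; exact: ler_norm.
have c2 : (fun n => 2 * pi * eps n `^ (1 / 2 - beta)) @ \oo --> (0 : R).
  by rewrite -(mulr0 (2 * pi)); apply: cvgM => //; exact: cvg_cst.
apply: (@squeeze_cvgr _ _ _ _ (fun=> 0) (fun n => 2 * pi * eps n `^ (1 / 2 - beta))) => //; last exact: cvg_cst.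
apply: nearW => n.
have p0 : 0 <= eps n `^ (- beta) by exact: powR_ge0.
have f0 : 0 <= (Num.floor (eps n `^ (- beta)))%:~R :> R by rewrite ler0z floor_ge0.
have pi2 : 0 <= 2 * pi :> R by rewrite mulr_ge0// pi_ge0.
have s0 : 0 <= Num.sqrt (eps n) by exact: sqrtr_ge0.
apply/andP; split; first exact: (mulr_ge0 (mulr_ge0 pi2 f0) s0).
rewrite -mulrA ler_wpM2l//.
apply: (@le_trans _ _ (eps n `^ (- beta) * Num.sqrt (eps n))); first by rewrite ler_wpM2r// floor_le_tmp.
rewrite -powR12_sqrt ?(ltW (e0 n))// -powRD ?(gt_eqF (e0 n)) ?implybT//.
by rewrite le_eqVlt; apply/orP; left; apply/eqP; congr (_ `^ _); lra.
Qed.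

Lemma F_ge0 (L alpha beta eps : R) w : 0 < L -> 0 < eps -> (0 <= F_energy L alpha beta eps w)%E.
Proof.
move=> L0 e0; rewrite /F_energy; case: ifP => _ //; apply: integral_ge0 => x _.
rewrite lee_fin /F_density !addr_ge0// mulr_ge0 ?sqr_ge0 ?addr_ge0 ?sqr_ge0//.
- by rewrite divr_ge0// ltW.
- by rewrite invr_ge0 mulr_ge0// ltW.
- by rewrite divr_ge0// ltW.
Qed.

Lemma le_limn_einf (u : nat -> \bar R) (m : \bar R) : (\forall n \near \oo, (m <= u n)%E) ->
  (m <= limn_einf u)%E.
Proof.
move=> [N _ HN]; rewrite limn_einf_lim; apply: lime_ge; first exact: is_cvg_einfs.
exists N => // n /= Nn; apply: le_ereal_inf_tmp => _ [k /= nk <-].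
by apply: HN => /=; exact: leq_trans nk.
Qed.

Variables (L alpha beta A : R) (eps : nat -> R).
Hypotheses (L_gt0 : 0 < L) (beta_gt0 : 0 < beta) (beta_lt : beta < 1 / 2)
  (eps_gt0 : forall l, 0 < eps l) (eps_cvg : eps @ \oo --> (0 : R))
  (A_cvg : (fun l => eps l `^ (- beta) - (Num.floor (eps l `^ (- beta)))%:~R) @ \oo --> A).

(** If infinitely many terms had energy below some real M < E(w), they would form a sequence to
    which [liminf_core] applies, giving E(w) <= M. Testing against real M treats finite and infinite
    E(w) together. *)
Lemma gamma_liminf (wn : nat -> R -> R * R) w :
  (forall n, L2_plane U01 (wn n)) -> L2_plane U01 w -> cvg_L2 U01 wn w ->
  (E_energy L alpha A w <= limn_einf (fun n => F_energy L alpha beta (eps n) (wn n)))%E.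
Proof.
move=> lwn lw cw.
have low (M : R) : (M%:E < E_energy L alpha A w)%E ->
    \forall n \near \oo, (M%:E <= F_energy L alpha beta (eps n) (wn n))%E.
  move=> ME; apply: contrapT => /not_near/ex_sub[sg subsg Hsg].
  move: ME; rewrite ltNge => /negP; apply.
  have exc n : exists c : cfg, [/\ cpdata alpha c, ceps c = eps (sg n),
     ckap c = 2 * pi * (Num.floor (eps (sg n) `^ (- beta)))%:~R /\ ctN c = 2 * pi * eps (sg n) `^ (- beta),
     {ae mu, forall x, U01 x -> wn (sg n) x = (cp1 c x, cp2 c x)} & I 0 1 (cdens L c) <= M].
    (* A term that is not admissible has infinite energy and cannot lie below M. *)
    have adm : admissible alpha (wn (sg n)).
      by apply: contrapT => nadm; apply: (Hsg n); rewrite /F_energy asboolF//; exact: leey.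
    have [p1 [p2 [q1 [q2 [pd aep]]]]] := F_inv adm.
    exists (Cfg (eps (sg n)) (2 * pi * (Num.floor (eps (sg n) `^ (- beta)))%:~R)
         (2 * pi * eps (sg n) `^ (- beta)) p1 p2 q1 q2); split=> //.
    rewrite leNgt; apply/negP => hlt; apply: (Hsg n).
    rewrite (F_formula _ _ _ pd (lwn (sg n)) aep) lee_fin; exact: ltW.
  have [c Hc] := choice exc.
  have cL1 := fun n => let: And5 pd _ _ aep _ := Hc n in L1_of_L2 pd (lwn (sg n)) lw aep.
  have csg : (fun n => \int[mu]_(x in U01) (sqnorm (wn (sg n) x - w x))%:E)%E @ \oo --> 0%E.
    by move=> U HU; apply: (near_sub subsg (cw U HU)).
  have es := cvg_sub subsg eps_cvg.
  apply: (liminf_core L_gt0 lw (c := c)); split.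
  - move=> n; have [pd ec [kc tc] aep dM] := Hc n; split=> //; first by rewrite ec.
    by rewrite kc mulr_ge0 ?mulr_ge0 ?pi_ge0// ler0z floor_ge0 powR_ge0.
  - by have -> : (fun n => ceps (c n)) = eps \o sg by apply/funext => n; have [] := Hc n.
  - have -> : (fun n => ctN (c n) - ckap (c n)) =
      (fun n => 2 * pi * (eps (sg n) `^ (- beta) - (Num.floor (eps (sg n) `^ (- beta)))%:~R)).
      by apply/funext => n; have [_ _ [-> ->] _ _] := Hc n; ring.
    by apply: cvgM; [exact: cvg_cst|exact: (cvg_sub subsg A_cvg)].
  - have -> : (fun n => ckap (c n) * Num.sqrt (ceps (c n))) =
      (fun n => 2 * pi * (Num.floor (eps n `^ (- beta)))%:~R * Num.sqrt (eps n)) \o sg.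
      by apply/funext => n; have [_ -> [-> _] _ _] := Hc n.
    exact: (cvg_sub subsg (kap_cvg beta_gt0 beta_lt eps_gt0 eps_cvg)).
  - split; apply: (sqr_cvg0 _ _ csg) => n; try (by apply: I_ge0); by have [] := cL1 n.
have e0 n : (0 <= F_energy L alpha beta (eps n) (wn n))%E by exact: F_ge0.
have low' (M : R) : (M%:E < E_energy L alpha A w)%E ->
    (M%:E <= limn_einf (fun n => F_energy L alpha beta (eps n) (wn n)))%E.
  by move=> /low; exact: le_limn_einf.
case: (E_energy L alpha A w) low' => [r| |] low'; last exact: leNye.
- apply/lee_addgt0Pr => e ep; rewrite -leeBlDr// -EFinB; apply: low'; rewrite lte_fin; lra.
- rewrite leye_eq; apply/eqP/eqyP => M _; apply: low'; exact: ltry.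
Qed.

End Liminf.

(** * The recovery sequence *)

Section Profile.
Context {R : realType}.
Local Notation mu := (@lebesgue_measure R).
Implicit Types (f g h : R -> R) (a b x y z r s t m : R).

Lemma prim_join z f g : (forall a b, integ `[a, b] g) ->
  (forall a b, b <= z -> prim a b f g) -> (forall a b, z <= a -> prim a b f g) ->
  forall a b, prim a b f g.
Proof.
move=> ig H1 H2 a b; case: (leP b z) => bz; first exact: H1.
case: (leP z a) => za; first exact: H2.
by apply: (prim_cat (H1 a z _) (H2 z b _)).
Qed.

Lemma integ_indic a b s t : integ `[a, b] (\1_(`[s, t]) : R -> R).
Proof.
apply: (@integ_le _ _ _ (fun=> 1)) => //; last exact: integ_cst.
by move=> x _; rewrite indicE; case: (_ \in _); rewrite ?normr1 ?normr0.
Qed.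

Lemma indicT s t x : s <= x -> x <= t -> \1_(`[s, t]) x = 1 :> R.
Proof. by move=> sx xt; rewrite indicE mem_set//= in_itv/= sx. Qed.

Lemma indicF s t x : x < s \/ t < x -> \1_(`[s, t]) x = 0 :> R.
Proof.
move=> H; rewrite indicE memNset//= in_itv/= => /andP[h1 h2].
by case: H => ?; lra.
Qed.

Lemma I_indic s t : s <= t -> I 0 1 \1_(`[s, t]) <= t - s.
Proof.
move=> st; apply: (@le_trans _ _ (I (Num.min 0 s) (Num.max 1 t) \1_(`[s, t]))).
  apply: I_sub; [exact: integ_indic|by move=> x _ _; rewrite indicE; case: (_ \in _)| |].
    by rewrite ge_min lexx.
  by rewrite le_max lexx.
rewrite (@I_split _ _ s); last exact: integ_indic.
- rewrite (@I_split _ s t); last exact: integ_indic.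
  + rewrite (@I_eq_lt _ (Num.min 0 s) s _ (fun=> 0)); [|exact: integ_indic|exact: integ_cst|]; last first.
      by move=> x _ xs; apply: indicF; left.
    rewrite I_cst ?mul0r ?add0r; last by rewrite ge_min lexx orbT.
    rewrite (@eq_I _ s t _ (fun=> 1)); last by move=> x *; exact: indicT.
    rewrite I_cst// mul1r (@eq_I_ae _ t _ _ (fun=> 0)); [|exact: integ_indic|exact: integ_cst|]; last first.
      apply: (ae_mono (ae_neq t)) => x xt; rewrite /= in_itv/= => /andP[tx _].
      by apply: indicF; right; rewrite lt_neqAle tx andbT; apply/eqP => /esym.
    by rewrite I_cst ?mul0r ?addr0// le_max lexx orbT.
  + by [].
  + by rewrite le_max lexx orbT.
- by rewrite ge_min lexx orbT.
- by rewrite (le_trans st)// le_max lexx orbT.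
Qed.

(** Clamping to [s, t]. Composed with the profile, it freezes the modulus at its end values outside
    the transition. *)
Definition cl s t x : R := Num.max s (Num.min t x).

Lemma cl_lo s t x : s <= t -> x <= s -> cl s t x = s.
Proof. by move=> st xs; rewrite /cl min_r ?max_l// (le_trans xs). Qed.
Lemma cl_hi s t x : s <= t -> t <= x -> cl s t x = t.
Proof. by move=> st tx; rewrite /cl min_l ?max_r. Qed.
Lemma cl_mid s t x : s <= x -> x <= t -> cl s t x = x.
Proof. by move=> sx xt; rewrite /cl min_r ?max_r. Qed.
Lemma cl_ge s t x : s <= cl s t x.
Proof. by rewrite /cl le_max lexx. Qed.
Lemma cl_le s t x : s <= t -> cl s t x <= t.
Proof. by move=> st; rewrite /cl ge_max st ge_min lexx. Qed.

Lemma prim_cl s t : s <= t -> forall a b, prim a b (cl s t) \1_(`[s, t]).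
Proof.
move=> st; apply: (@prim_join s) => [a b|a b bs|a b sa]; first exact: integ_indic.
  apply: (@prim_ae _ a b _ (fun=> 0)); [|exact: integ_indic|].
    by apply: (prim_ext (prim_cst a b s)) => // x _ xb; rewrite cl_lo// (le_trans xb).
  apply: (ae_mono (ae_neq s)) => x xs; rewrite /= in_itv/= => /andP[_ xb].
  rewrite indicF//; left; rewrite lt_neqAle (le_trans xb)// andbT; exact/eqP.
move: a b sa; suff H : forall a b, prim a b (fun x => if s <= x then cl s t x else x)
     (fun x => if s <= x then \1_(`[s, t]) x else 1).
  move=> a b sa; apply: (prim_ext (H a b)) => x ax xb; by rewrite (le_trans sa ax).
have mi a b : integ `[a, b] (fun x => if s <= x then \1_(`[s, t]) x else 1 : R).
  apply: (@eq_integ _ _ (fun x => 1 - \1_(`]t, +oo[) x : R)) => //.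
    move=> x _; case: (leP s x) => sx; case: (leP x t) => xt.
    - by rewrite indicT// indicE memNset ?subr0//= in_itv/= andbT; apply/negP; rewrite -leNgt.
    - by rewrite indicF ?indicE ?mem_set ?subrr//=; [rewrite in_itv/= xt|right].
    - by rewrite indicE memNset ?subr0//= in_itv/= andbT; apply/negP; rewrite -leNgt.
    - by exfalso; lra.
  apply: integB => //; first exact: integ_cst.
  apply: (@integ_le _ _ _ (fun=> 1)) => //; last exact: integ_cst.
  by move=> x _; rewrite indicE; case: (_ \in _); rewrite ?normr1 ?normr0.
apply: (@prim_join t) => [//|a b bt|a b ta].
  apply: (prim_ext (prim_id a b)) => x ax xb; have xt := le_trans xb bt.
    by case: leP => // sx; rewrite cl_mid.
  by case: leP => // sx; rewrite indicT.
apply: (@prim_ae _ a b _ (fun=> 0)); [|exact: mi|].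
  apply: (prim_ext (prim_cst a b t)) => // x ax xb; have tx := le_trans ta ax.
  by rewrite (le_trans st tx) cl_hi.
apply: (ae_mono (ae_neq t)) => x xt; rewrite /= in_itv/= => /andP[ax _]; have tx := le_trans ta ax.
rewrite (le_trans st tx) indicF//; right; rewrite lt_neqAle tx andbT; exact/eqP/nesym.
Qed.

Variables (eps eta : R).
Hypotheses (eps0 : 0 < eps) (eta0 : 0 < eta).

Ltac slra := move: eps0 eta0 => ? ?; lra.
Let c := 1 + eta.
Let s2 : R := Num.sqrt 2.
Let k := s2 * c / eps.
Let s20 : 0 < s2. Proof. by rewrite sqrtr_gt0. Qed.
Let ss : s2 * s2 = 2. Proof. by rewrite -expr2 sqr_sqrtr. Qed.
Let c0 : 0 < c. Proof. by rewrite addr_gt0. Qed.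
Let k0 : 0 < k. Proof. by rewrite divr_gt0// mulr_gt0. Qed.

(* Solution of [r' = (c^2 - r^2) / (sqrt 2 eps)], [r 0 = 0], for [c = 1 + eta].
   The optimal profile has [c = 1] and never reaches 1; with [c > 1] the value
   1 is attained at the finite time [T0]. *)
Definition prf t : R := (1 + eta) - 2 * (1 + eta) * (expR (Num.sqrt 2 * (1 + eta) / eps * t) + 1)^-1.
Definition dprf t : R := ((1 + eta) ^+ 2 - prf t ^+ 2) / (Num.sqrt 2 * eps).
Definition T0 : R := ln ((2 + eta) / eta) / (Num.sqrt 2 * (1 + eta) / eps).

Lemma is_derive_prf t : is_derive t 1 prf (dprf t).
Proof.
have H0 : is_derive t 1 (fun x : R => k * x) (k * 1) by exact: is_deriveZ.
rewrite mulr1 in H0.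
have H1 := @is_derive1_comp R (@expR R) (fun x => k * x) t _ _ (is_derive_expR _) H0.
have H2 : is_derive t 1 (fun x : R => expR (k * x) + 1) (expR (k * t) * k).
  by rewrite -[X in is_derive _ _ _ X]addr0; exact: is_deriveD.
have E0 : 0 < expR (k * t) + 1 by rewrite addr_gt0// expR_gt0.
have H3 := @is_deriveV R (fun x => expR (k * x) + 1) t _ 1 (lt0r_neq0 E0) H2.
have H4 : is_derive t 1 prf (0 - 2 * c * (- (expR (k * t) + 1) ^- 2 *: (expR (k * t) * k))).
  apply: is_deriveB; exact: is_deriveZ.
have -> // : dprf t = 0 - 2 * c * (- (expR (k * t) + 1) ^- 2 *: (expR (k * t) * k)).
rewrite /dprf /prf -/s2 -/c -/k; move: E0; set E := expR _ => E0.
have -> : - (E + 1) ^- 2 *: (E * k) = - (E + 1) ^- 2 * (E * k) by [].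
have sn : s2 != 0 by rewrite gt_eqF.
have -> : (s2 * eps)^-1 = s2 / (2 * eps) by rewrite -ss; field; rewrite gt_eqF//=.
rewrite /k; field; rewrite !gt_eqF//=.
Qed.

Lemma prf_cont : continuous prf.
Proof.
move=> t; apply: differentiable_continuous; apply/derivable1_diffP.
have H := is_derive_prf t; exact: ex_derive.
Qed.

Lemma dprf_cont : continuous dprf.
Proof.
move=> t; apply: cvgM; last exact: cvg_cst.
apply: cvgB; first exact: cvg_cst.
have cp := @prf_cont t; rewrite /=.
under eq_fun do rewrite expr2; rewrite expr2; exact: cvgM.
Qed.

Lemma prf0 : prf 0 = 0.
Proof. by rewrite /prf mulr0 expR0 -/c; field. Qed.

Lemma expT0 : expR (k * T0) = (2 + eta) / eta.
Proof.
rewrite /T0 -/s2 -/c -/k mulrC divfK ?gt_eqF// lnK// posrE divr_gt0// addr_gt0//.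
Qed.

Lemma prfT0 : prf T0 = 1.
Proof.
rewrite /prf -/s2 -/c -/k expT0.
have -> : (2 + eta) / eta + 1 = 2 * c / eta by rewrite /c; field; rewrite gt_eqF.
by rewrite invf_div mulrC divfK ?gt_eqF ?mulr_gt0// /c; ring.
Qed.

Lemma T0_gt0 : 0 < T0.
Proof.
rewrite /T0 divr_gt0//; apply: ln_gt0; rewrite ltr_pdivlMr// mul1r; slra.
Qed.

(** ln(1 + 2 / eta) <= 2 / eta, and sqrt 2 (1 + eta) >= 1. For eta = sqrt eps the transition has
    length at most 2 sqrt eps. *)
Lemma T0_le : T0 <= 2 * eps / eta.
Proof.
rewrite /T0 -/s2 -/c -/k ler_pdivrMr//.
have -> : (2 + eta) / eta = 1 + 2 / eta by field; rewrite gt_eqF.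
apply: le_trans (le_ln1Dx _) _; first by rewrite (lt_trans (ltrN10 R))// divr_gt0.
have -> : 2 * eps / eta * k = 2 / eta * (s2 * c) by rewrite /k; field; rewrite !gt_eqF.
rewrite ler_peMr//; first by rewrite divr_ge0// ltW.
have s21 : 1 <= s2 by rewrite -sqrtr1 ler_sqrt//; slra.
apply: (le_trans s21); rewrite ler_peMr ?(ltW s20)// /c; slra.
Qed.

Lemma prf_rng t : 0 <= t -> t <= T0 -> 0 <= prf t <= 1.
Proof.
move=> t0 tT; have E1 : 1 <= expR (k * t) by rewrite -expR0 ler_expR mulr_ge0// ltW.
have E2 : expR (k * t) <= expR (k * T0) by rewrite ler_expR ler_wpM2l// ltW.
have E0 : 0 < expR (k * t) + 1 by slra.
have mono u v : 0 < u + 1 -> u <= v -> 2 * c * (v + 1)^-1 <= 2 * c * (u + 1)^-1.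
  move=> u0 uv; rewrite ler_wpM2l ?mulr_ge0 ?(ltW c0)// lef_pV2 ?posrE ?lerD2r//; slra.
apply/andP; split.
  rewrite -prf0 /prf -/s2 -/c -/k mulr0 expR0 lerD2l lerN2; apply: mono => //; slra.
rewrite -prfT0 /prf -/s2 -/c -/k lerD2l lerN2; exact: mono.
Qed.

Lemma dprf_ge0 t : 0 <= t -> t <= T0 -> 0 <= dprf t.
Proof.
move=> t0 tT; have /andP[p0 p1] := prf_rng t0 tT; rewrite /dprf -/s2 -/c.
rewrite divr_ge0 ?mulr_ge0 ?(ltW eps0)// ?(ltW s20)// subr_ge0 ler_sqr ?nnegrE// ?(ltW c0)//.
by apply: (le_trans p1); rewrite /c; slra.
Qed.

(** Equipartition: the equation reads c^2 - r^2 = sqrt 2 eps r', and on [0, 1] the potential is at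
    most its version with c in place of 1. Both terms are then at most eps r'^2 / 2, and their sum
    is an exact derivative in r. *)
Lemma prf_dens t : 0 <= t -> t <= T0 ->
  eps / 2 * dprf t ^+ 2 + (4 * eps)^-1 * (prf t ^+ 2 - 1) ^+ 2 <=
  s2 / 2 * ((c ^+ 2 - prf t ^+ 2) * dprf t).
Proof.
move=> t0 tT; have /andP[p0 p1] := prf_rng t0 tT; have d0 := dprf_ge0 t0 tT.
have E : c ^+ 2 - prf t ^+ 2 = s2 * eps * dprf t.
  by rewrite /dprf -/s2 -/c mulrC divfK// gt_eqF// mulr_gt0.
have h1 : (prf t ^+ 2 - 1) ^+ 2 <= (s2 * eps * dprf t) ^+ 2.
  rewrite -E -subr_ge0.
  have -> : (c ^+ 2 - prf t ^+ 2) ^+ 2 - (prf t ^+ 2 - 1) ^+ 2 =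
     (c ^+ 2 - 1) * ((c ^+ 2 - prf t ^+ 2) + (1 - prf t ^+ 2)) by ring.
  have c1 : 1 <= c ^+ 2 by rewrite expr_ge1// /c; slra.
  have q1 : prf t ^+ 2 <= 1 by rewrite expr_le1.
  by rewrite mulr_ge0//; slra.
rewrite E; apply: (@le_trans _ _ (eps / 2 * dprf t ^+ 2 + (4 * eps)^-1 * (s2 * eps * dprf t) ^+ 2)).
  by rewrite lerD2l ler_wpM2l// invr_ge0 mulr_ge0// ltW.
rewrite le_eqVlt; apply/orP; left; apply/eqP.
have -> : (s2 * eps * dprf t) ^+ 2 = 2 * eps ^+ 2 * dprf t ^+ 2 by rewrite -ss; ring.
have -> : s2 / 2 * (s2 * eps * dprf t * dprf t) = (s2 * s2) / 2 * eps * dprf t ^+ 2 by ring.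
by rewrite ss; field; rewrite gt_eqF.
Qed.

Let T00 := ltW T0_gt0.

(** The profile run rightwards from [s]; [pl] below is its mirror image, run leftwards from [s]. *)
Definition pr s x : R := prf (cl s (s + T0) x - s).
Definition dpr s x : R := dprf (cl s (s + T0) x - s) * \1_(`[s, (s + T0)]) x.
Definition pl s x : R := prf (s - cl (s - T0) s x).
Definition dpl s x : R := - (dprf (s - cl (s - T0) s x) * \1_(`[(s - T0), s]) x).

Let sT s : s <= s + T0. Proof. by rewrite lerDl. Qed.
Let Ts s : s - T0 <= s. Proof. by rewrite gerBl. Qed.
Let rr s x : 0 <= cl s (s + T0) x - s <= T0.
Proof. by rewrite subr_ge0 cl_ge/= lerBlDl cl_le. Qed.
Let rl s x : 0 <= s - cl (s - T0) s x <= T0.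
Proof. by rewrite subr_ge0 cl_le//= lerBlDl -lerBlDr cl_ge. Qed.

Lemma prim_pr s a b : prim a b (pr s) (dpr s).
Proof.
have P := prim_cl (sT s) a b.
have P2 := primB P (prim_cst a b s).
apply: (@prim_ext _ a b _ _ (fun x => dprf (cl s (s + T0) x - s) * (\1_(`[s, (s + T0)]) x - 0))).
- apply: (@prim_comp _ a b _ _ 0 prf dprf P2).
  + by move=> x _ _; have /andP[] := rr s x.
  + by move=> t _; exact: is_derive_prf.
  + by move=> t _; exact: dprf_cont.
- by [].
- by move=> x _ _; rewrite subr0.
Qed.

Lemma prim_pl s a b : prim a b (pl s) (dpl s).
Proof.
have P := prim_cl (Ts s) a b.
have P2 := primB (prim_cst a b s) P.
apply: (@prim_ext _ a b _ _ (fun x => dprf (s - cl (s - T0) s x) * (0 - \1_(`[(s - T0), s]) x))).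
- apply: (@prim_comp _ a b _ _ 0 prf dprf P2).
  + by move=> x _ _; have /andP[] := rl s x.
  + by move=> t _; exact: is_derive_prf.
  + by move=> t _; exact: dprf_cont.
- by [].
- by move=> x _ _; rewrite /dpl sub0r mulrN.
Qed.

Lemma pr_rng s x : 0 <= pr s x <= 1.
Proof. by have /andP[h1 h2] := rr s x; exact: prf_rng. Qed.
Lemma pl_rng s x : 0 <= pl s x <= 1.
Proof. by have /andP[h1 h2] := rl s x; exact: prf_rng. Qed.
Lemma pr_lo s x : x <= s -> pr s x = 0.
Proof. by move=> xs; rewrite /pr cl_lo// subrr prf0. Qed.
Lemma pr_hi s x : s + T0 <= x -> pr s x = 1.
Proof. by move=> xs; rewrite /pr cl_hi// addrC addKr prfT0. Qed.
Lemma pl_hi s x : s <= x -> pl s x = 0.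
Proof. by move=> xs; rewrite /pl cl_hi// subrr prf0. Qed.
Lemma pl_lo s x : x <= s - T0 -> pl s x = 1.
Proof. by move=> xs; rewrite /pl cl_lo// opprB addrC subrK prfT0. Qed.
Lemma dpr_out s x : x < s \/ s + T0 < x -> dpr s x = 0.
Proof. by move=> H; rewrite /dpr indicF// mulr0. Qed.
Lemma dpl_out s x : x < s - T0 \/ s < x -> dpl s x = 0.
Proof. by move=> H; rewrite /dpl indicF// mulr0 oppr0. Qed.
Lemma dpr_ge0 s x : 0 <= dpr s x.
Proof. by have /andP[h1 h2] := rr s x; rewrite mulr_ge0 ?dprf_ge0// indicE; case: (_ \in _). Qed.
Lemma dpl_le0 s x : dpl s x <= 0.
Proof. by have /andP[h1 h2] := rl s x; rewrite oppr_le0 mulr_ge0 ?dprf_ge0// indicE; case: (_ \in _). Qed.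

(** Primitive of c^2 - u^2, with the cube spelled out to match iterated [prim_mul]; G(1) - G(0) =
    c^2 - 1/3 is the cost of one flank up to the factor sqrt 2 / 2. *)
Let G u := c ^+ 2 * u - 3^-1 * (u * (u * u)).
Let G_rng u : 0 <= u <= 1 -> 0 <= G u <= c ^+ 2 - 3^-1.
Proof.
move=> /andP[u0 u1]; have c1 : 1 <= c ^+ 2 by rewrite expr_ge1// /c; slra.
have u21 : u * u <= 1 by rewrite -[leRHS]mulr1 ler_pM.
have u31 : u * (u * u) <= u by rewrite ler_piMr.
have u30 : 0 <= u * (u * u) by rewrite !mulr_ge0.
have h1 : u <= c ^+ 2 * u by rewrite ler_peMl.
rewrite /G; apply/andP; split; first slra.
rewrite -subr_ge0.
have -> : c ^+ 2 - 3^-1 - (c ^+ 2 * u - 3^-1 * (u * (u * u))) =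
  (1 - u) * (c ^+ 2 - 3^-1 * (1 + u + u * u)) by field.
by rewrite mulr_ge0 ?subr_ge0//; slra.
Qed.

Let prim_G (p q : R -> R) a b : prim a b p q ->
  prim a b (fun x => G (p x)) (fun x => (c ^+ 2 - p x ^+ 2) * q x).
Proof.
move=> P; have := primB (primZ (c ^+ 2) P) (primZ 3^-1 (prim_mul P (prim_mul P P))).
by move/prim_ext; apply=> x _ _ //; field.
Qed.

Variable kp : R.
Hypothesis kp0 : 0 < kp.
Ltac slra2 := move: eps0 eta0 kp0 T00 => ? ? ? ?; lra.

(* Zero on the plateau |x - z| < kp: multiplying by [rho1] a map that jumps at
   [z] then leaves an absolutely continuous one, whatever the two traces. *)
Definition rho1 z x : R := pr (z + kp) x + pl (z - kp) x.
Definition drho1 z x : R := dpr (z + kp) x + dpl (z - kp) x.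
(** Majorant of the energy density of one modulus: two flanks as in [prf_dens], and the potential 1
    / (4 eps) of the zero plateau. *)
Definition eb1 z x : R :=
  Num.sqrt 2 / 2 * (((1 + eta) ^+ 2 - pr (z + kp) x ^+ 2) * dpr (z + kp) x
     - ((1 + eta) ^+ 2 - pl (z - kp) x ^+ 2) * dpl (z - kp) x)
  + (4 * eps)^-1 * \1_(`[(z - kp), (z + kp)]) x.

Lemma prim_rho1 z a b : prim a b (rho1 z) (drho1 z).
Proof. by apply: primD; [exact: prim_pr|exact: prim_pl]. Qed.

Lemma rho1_side z x : (z - kp <= x -> pl (z - kp) x = 0) /\ (x <= z + kp -> pr (z + kp) x = 0).
Proof. by split; [exact: pl_hi|exact: pr_lo]. Qed.

Lemma rho1_rng z x : 0 <= rho1 z x <= 1.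
Proof.
have /andP[a1 a2] := pr_rng (z + kp) x; have /andP[b1 b2] := pl_rng (z - kp) x.
have [s1 s2'] := rho1_side z x; rewrite /rho1.
case: (leP (z - kp) x) => h; first by rewrite s1// addr0 a1.
by rewrite s2'; [rewrite add0r b1|slra2].
Qed.

Lemma rho1_out z x : kp + T0 < `|x - z| -> rho1 z x = 1 /\ drho1 z x = 0.
Proof.
have t0 := T00.
rewrite lter_normr => /orP[h|h]; rewrite /rho1 /drho1.
- rewrite pr_hi ?pl_hi ?dpr_out ?dpl_out ?addr0//; [right|right| |]; slra2.
- rewrite pr_lo ?pl_lo ?dpr_out ?dpl_out ?addr0 ?add0r//; [left|left| |]; slra2.
Qed.

Lemma rho1_zero z x : `|x - z| < kp -> rho1 z x = 0 /\ drho1 z x = 0.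
Proof.
rewrite ltr_norml => /andP[h1 h2]; rewrite /rho1 /drho1.
rewrite pr_lo ?pl_hi ?dpr_out ?dpl_out ?addr0//; [right|left| |]; slra2.
Qed.

Lemma c2_ge z x : 0 <= z <= 1 -> 0 <= (1 + eta) ^+ 2 - z ^+ 2.
Proof.
move=> /andP[z0 z1]; rewrite subr_ge0 ler_sqr ?nnegrE//; first slra2.
by rewrite addr_ge0// ltW.
Qed.

Lemma eb1_ge0 z x : 0 <= eb1 z x.
Proof.
have h1 := c2_ge x (pr_rng (z + kp) x); have h2 := c2_ge x (pl_rng (z - kp) x).
have h3 := dpr_ge0 (z + kp) x; have h4 := dpl_le0 (z - kp) x.
rewrite /eb1 addr_ge0//; last first.
  by rewrite mulr_ge0 ?invr_ge0 ?mulr_ge0 ?(ltW eps0)// indicE; case: (_ \in _).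
rewrite mulr_ge0 ?divr_ge0 ?sqrtr_ge0// addr_ge0//; first exact: mulr_ge0.
by rewrite -mulrN; apply: mulr_ge0; rewrite ?oppr_ge0.
Qed.

Lemma eb1_dens z x :
  eps / 2 * drho1 z x ^+ 2 + (4 * eps)^-1 * (rho1 z x ^+ 2 - 1) ^+ 2 <= eb1 z x.
Proof.
have t0 := T00; have i0 : 0 <= (4 * eps)^-1 by rewrite invr_ge0 mulr_ge0// ltW.
have s2h : 0 <= s2 / 2 by rewrite divr_ge0// ltW.
rewrite /eb1 -/c -/s2.
case: (leP x (z + kp)) => h1.
- have Epr : pr (z + kp) x = 0 by exact: pr_lo.
  case: (leP (z - kp) x) => h2.
  + have Epl : pl (z - kp) x = 0 by exact: pl_hi.
    rewrite indicT// mulr1 /rho1 /drho1 Epr Epl addr0 expr0n/= subr0 sub0r sqrrN expr1n mulr1 lerD2r.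
    have zz : dpr (z + kp) x * dpl (z - kp) x = 0.
      case: (ltP x (z + kp)) => h3; first by rewrite dpr_out ?mul0r//; left.
      by rewrite [X in _ * X]dpl_out ?mulr0//; right; slra2.
    (* The closed indicators leave a nonzero derivative at the two edges of the plateau, where the
       profile is still 0; the flank term already dominates it. *)
    have key t i : 0 <= t -> t <= T0 -> (i = 0 \/ i = 1) -> prf t = 0 ->
        eps / 2 * (dprf t * i) ^+ 2 <= s2 / 2 * (c ^+ 2 * (dprf t * i)).
      move=> tt0 tT hi pt0; have := prf_dens tt0 tT; rewrite pt0 expr0n/= subr0 => H.
      have d0 := dprf_ge0 tt0 tT.
      case: hi => ->; first by rewrite mulr0 expr0n/= !mulr0.
      by rewrite mulr1; apply: le_trans H; rewrite lerDl mulr_ge0// sqr_ge0.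
    have hi (S : set R) : \1_S x = 0 :> R \/ \1_S x = 1 :> R.
      by rewrite indicE; case: (_ \in _); [right|left].
    have /andP[q1 q2] := rr (z + kp) x; have /andP[q3 q4] := rl (z - kp) x.
    have k1 := key _ _ q1 q2 (hi `[(z + kp), (z + kp + T0)]%classic) Epr.
    have k2 := key _ _ q3 q4 (hi `[(z - kp - T0), (z - kp)]%classic) Epl.
    rewrite -/(dpr (z + kp) x) in k1.
    have dplE : dprf (z - kp - cl (z - kp - T0) (z - kp) x) * \1_(`[(z - kp - T0), (z - kp)]) x = - dpl (z - kp) x.
      by rewrite /dpl opprK.
    rewrite dplE sqrrN in k2.
    have -> : (dpr (z + kp) x + dpl (z - kp) x) ^+ 2 = dpr (z + kp) x ^+ 2 + dpl (z - kp) x ^+ 2.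
      by rewrite sqrrD zz mul0rn addr0.
    by rewrite mulrDr mulrBr; move: k2; rewrite !mulrN; slra2.
  + have Ei : \1_(`[(z - kp), (z + kp)]) x = 0 :> R by apply: indicF; left.
    have dr0 : dpr (z + kp) x = 0 by apply: dpr_out; left; slra2.
    rewrite Ei mulr0 addr0 /rho1 /drho1 Epr dr0 !add0r mulr0 sub0r.
    have /andP[q3 q4] := rl (z - kp) x; have H := prf_dens q3 q4.
    case: (leP (z - kp - T0) x) => h3.
      by rewrite /dpl /pl indicT ?mulr1 ?sqrrN ?mulrN ?opprK//; exact: ltW.
    rewrite pl_lo ?(ltW h3)// dpl_out; last by left.
    by rewrite expr1n subrr expr0n/= !mulr0 addr0 oppr0 mulr0.
- have Epl : pl (z - kp) x = 0 by apply: pl_hi; slra2.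
  have Ei : \1_(`[(z - kp), (z + kp)]) x = 0 :> R by apply: indicF; right.
  have dl0 : dpl (z - kp) x = 0 by apply: dpl_out; right; slra2.
  rewrite Ei mulr0 addr0 /rho1 /drho1 Epl dl0 !addr0 mulr0 subr0.
  have /andP[q3 q4] := rr (z + kp) x; have H := prf_dens q3 q4.
  case: (leP x (z + kp + T0)) => h3.
    by rewrite /dpr /pr indicT ?mulr1//; exact: ltW.
  rewrite pr_hi ?(ltW h3)// dpr_out; last by right.
  by rewrite expr1n subrr expr0n/= !mulr0 addr0.
Qed.

Lemma eb1_integ z : integ `[0, 1] (eb1 z).
Proof.
apply: integD => //; last by apply: integZ => //; exact: integ_indic.
apply: integZ => //; apply: integB => //.
  by have [] := prim_G (prim_pr (z + kp) 0 1).
by have [] := prim_G (prim_pl (z - kp) 0 1).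
Qed.

(** Each flank term is the derivative of [G] along the profile, so it integrates to at most c^2 -
    1/3; the plateau has length 2 kp. *)
Lemma eb1_I z : I 0 1 (eb1 z) <= Num.sqrt 2 * ((1 + eta) ^+ 2 - 3^-1) + kp / (2 * eps).
Proof.
have Pr := prim_G (prim_pr (z + kp) 0 1); have Pl := prim_G (prim_pl (z - kp) 0 1).
have i0 : 0 <= (4 * eps)^-1 by rewrite invr_ge0 mulr_ge0// ltW.
have s2h : 0 <= s2 / 2 by rewrite divr_ge0// ltW.
have iB : integ `[0, 1] (fun x => (c ^+ 2 - pr (z + kp) x ^+ 2) * dpr (z + kp) x
    - (c ^+ 2 - pl (z - kp) x ^+ 2) * dpl (z - kp) x) by apply: integB => //; [exact: Pr.1|exact: Pl.1].
rewrite /eb1 ID//; [|exact: integZ|by apply: integZ => //; exact: integ_indic].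
rewrite IZ// IB//; [|exact: Pr.1|exact: Pl.1].
rewrite -(Pr.2 0 1)// -(Pl.2 0 1)// IZ//; last exact: integ_indic.
have /andP[g1 g2] := G_rng (pr_rng (z + kp) 1); have /andP[g3 g4] := G_rng (pr_rng (z + kp) 0).
have /andP[g5 g6] := G_rng (pl_rng (z - kp) 1); have /andP[g7 g8] := G_rng (pl_rng (z - kp) 0).
apply: lerD.
  apply: (@le_trans _ _ (s2 / 2 * ((c ^+ 2 - 3^-1) + (c ^+ 2 - 3^-1)))).
    by rewrite ler_wpM2l//; slra2.
  by rewrite le_eqVlt; apply/orP; left; apply/eqP; rewrite /c /s2; field.
apply: (@le_trans _ _ ((4 * eps)^-1 * ((z + kp) - (z - kp)))).
  by rewrite ler_wpM2l// I_indic//; slra2.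
by rewrite le_eqVlt; apply/orP; left; apply/eqP; field; rewrite gt_eqF.
Qed.

Variable S : seq R.
Hypotheses (uS : uniq S) (sepS : forall x y, x \in S -> y \in S -> x <> y -> 2 * (kp + T0) < `|x - y|).

(** Transitions around distinct points do not overlap, so this equals the product of the moduli; the
    additive form has the plain sum [drho] as derivative. *)
Definition rho x : R := 1 - \sum_(z <- S) (1 - rho1 z x).
Definition drho x : R := \sum_(z <- S) drho1 z x.

Lemma prim_rho a b : prim a b rho drho.
Proof.
rewrite /rho /drho; elim: S => [|z t IH].
  apply: (prim_ext (prim_cst a b 1)) => x _ _; rewrite big_nil ?subr0//.
have := primD (prim_rho1 z a b) (primB IH (prim_cst a b 1)).
by move/prim_ext; apply => x _ _; rewrite big_cons ?subr0//; ring.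
Qed.

Lemma rho_at x z : z \in S -> `|x - z| <= kp + T0 -> rho x = rho1 z x /\ drho x = drho1 z x.
Proof.
move=> zS xz; have far y : y \in S -> y != z -> kp + T0 < `|x - y|.
  move=> yS /eqP yz; have := sepS zS yS (nesym yz).
  have -> : z - y = (x - y) - (x - z) by ring.
  have := ler_normB (x - y) (x - z); slra2.
rewrite /rho /drho (bigD1_seq z)//= [X in _ /\ X = _](bigD1_seq z)//=.
rewrite big_seq_cond big1 => [|y /andP[yS yz]]; last first.
  by have [-> _] := rho1_out (far y yS yz); rewrite subrr.
rewrite big_seq_cond big1 => [|y /andP[yS yz]]; last by have [] := rho1_out (far y yS yz).
by rewrite !addr0 opprB addrC subrK.
Qed.

Lemma rho_far x : (forall z, z \in S -> kp + T0 < `|x - z|) -> rho x = 1 /\ drho x = 0.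
Proof.
move=> H; rewrite /rho /drho big_seq big1 => [|z /H/rho1_out[-> _]]; last by rewrite subrr.
by rewrite big_seq big1 ?subr0// => z /H/rho1_out[].
Qed.

Lemma rho_cases x : (exists2 z, z \in S & `|x - z| <= kp + T0) \/ (forall z, z \in S -> kp + T0 < `|x - z|).
Proof.
case: (pselect (exists2 z, z \in S & `|x - z| <= kp + T0)) => [|H]; [by left|right => z zS].
by rewrite ltNge; apply/negP => h; apply: H; exists z.
Qed.

Lemma rho_rng x : 0 <= rho x <= 1.
Proof.
case: (rho_cases x) => [[z zS /(rho_at zS)[-> _]]|/rho_far[-> _]]; first exact: rho1_rng.
by rewrite ler01 lexx.
Qed.

Lemma rho_zero x z : z \in S -> `|x - z| < kp -> rho x = 0 /\ drho x = 0.
Proof.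
move=> zS xz; have h : `|x - z| <= kp + T0 by have := T00; slra2.
by have [-> ->] := rho_at zS h; exact: rho1_zero.
Qed.

Lemma rho_dens x : eps / 2 * drho x ^+ 2 + (4 * eps)^-1 * (rho x ^+ 2 - 1) ^+ 2 <= \sum_(z <- S) eb1 z x.
Proof.
case: (rho_cases x) => [[z zS /(rho_at zS)[-> ->]]|/rho_far[-> ->]].
  apply: (le_trans (eb1_dens z x)); rewrite (bigD1_seq z)//= lerDl.
  by apply: sumr_ge0 => y _; exact: eb1_ge0.
rewrite expr1n subrr expr0n/= !mulr0 addr0.
by apply: sumr_ge0 => y _; exact: eb1_ge0.
Qed.

Lemma eb_I : integ `[0, 1] (fun x => \sum_(z <- S) eb1 z x) /\
  I 0 1 (fun x => \sum_(z <- S) eb1 z x) <=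
    (size S)%:R * (Num.sqrt 2 * ((1 + eta) ^+ 2 - 3^-1) + kp / (2 * eps)).
Proof.
elim: S => [|z t [IH1 IH2]].
  split; first by apply: (@eq_integ _ _ (fun=> 0)) => //; [move=> x _; rewrite big_nil|exact: integ_cst].
  by rewrite (@eq_I _ _ _ _ (fun=> 0)) ?I_cst ?mul0r// => x _ _; rewrite big_nil.
have E : (fun x => \sum_(y <- z :: t) eb1 y x) = (fun x => eb1 z x + \sum_(y <- t) eb1 y x).
  by apply/funext => x; rewrite big_cons.
rewrite E; split; first by apply: integD => //; exact: eb1_integ.
rewrite ID//; last exact: eb1_integ.
by rewrite /= -natr1 mulrDl mul1r addrC lerD// eb1_I.
Qed.

Lemma dprf_bnd t : 0 <= t -> t <= T0 -> `|dprf t| <= (1 + eta) ^+ 2 / (Num.sqrt 2 * eps).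
Proof.
move=> t0 tT; rewrite ger0_norm ?dprf_ge0// /dprf ler_wpM2r ?invr_ge0 ?mulr_ge0 ?sqrtr_ge0 ?(ltW eps0)//.
by rewrite gerBl sqr_ge0.
Qed.

Lemma drho_bnd x : `|drho x| <= 2 * ((1 + eta) ^+ 2 / (Num.sqrt 2 * eps)).
Proof.
have C0 : 0 <= (1 + eta) ^+ 2 / (Num.sqrt 2 * eps).
  by rewrite divr_ge0 ?sqr_ge0// mulr_ge0 ?sqrtr_ge0// ltW.
have b1 s y : `|dpr s y| <= (1 + eta) ^+ 2 / (Num.sqrt 2 * eps).
  have /andP[q1 q2] := rr s y; rewrite /dpr normrM.
  apply: le_trans (dprf_bnd q1 q2); rewrite ler_piMr// indicE.
  by case: (_ \in _); rewrite ?normr1 ?normr0.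
have b2 s y : `|dpl s y| <= (1 + eta) ^+ 2 / (Num.sqrt 2 * eps).
  have /andP[q1 q2] := rl s y; rewrite /dpl normrN normrM.
  apply: le_trans (dprf_bnd q1 q2); rewrite ler_piMr// indicE.
  by case: (_ \in _); rewrite ?normr1 ?normr0.
case: (rho_cases x) => [[z zS /(rho_at zS)[_ ->]]|/rho_far[_ ->]]; last by rewrite normr0 mulr_ge0.
by apply: (le_trans (ler_normD _ _)); rewrite mulr_natl lerD.
Qed.

Lemma drho_meas : measurable_fun setT drho.
Proof.
have mcl s t : measurable_fun setT (cl s t).
  by apply: measurable_maxr => //; apply: measurable_minr.
have md : measurable_fun setT dprf by apply: continuous_measurable_fun; exact: dprf_cont.
apply: measurable_sum => z; apply: measurable_funD.
  apply: measurable_funM => //; apply: measurableT_comp => //; exact: measurable_funB.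
apply: measurableT_comp => //; apply: measurable_funM => //.
apply: measurableT_comp => //; exact: measurable_funB.
Qed.

End Profile.

(** * Energy of a modulus times a piecewise phase *)

Section Recovery.
Context {R : realType}.
Local Notation mu := (@lebesgue_measure R).
Implicit Types (f g h : R -> R) (a b x y z r s t m : R).

Lemma open_notin (S : seq R) : open (~` [set` S]).
Proof.
apply: closed_openC; apply: (accessible_finite_set_closed.1 _ _ (finite_seq S)).
by apply: hausdorff_accessible; exact: Rhausdorff.
Qed.

Lemma prim_local a b f g : (forall u v, integ `[u, v] g) ->
  (forall x, a <= x <= b -> exists2 d, 0 < d & prim (x - d) (x + d) f g) -> prim a b f g.
Proof.
move=> ig H; case: (leP a b) => [ab|/prim_gt//].
apply: (@cousin _ (fun x y => prim x y f g)) => // [x y z _ _ _ _ P1 P2|c ac cb].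
  exact: (prim_cat P1 P2).
have [|d d0 P] := H c; first by rewrite ac.
exists d => // x y _ _ _ h1 h2; by apply: (prim_sub P); exact: ltW.
Qed.

Definition offS (S : seq R) f g := forall a b, (forall x, a <= x <= b -> x \notin S) -> prim a b f g.

(* With [dl] small and fixed this decouples the cost of the modulus from
   that of the phase at the price of a factor tending to 1. *)
Lemma young (dl a b : R) : 0 < dl -> (a + b) ^+ 2 <= (1 + dl) * a ^+ 2 + (1 + dl^-1) * b ^+ 2.
Proof.
move=> d0; rewrite -subr_ge0.
have -> : (1 + dl) * a ^+ 2 + (1 + dl^-1) * b ^+ 2 - (a + b) ^+ 2 = dl^-1 * (dl * a - b) ^+ 2.
  by field; rewrite gt_eqF.
by rewrite mulr_ge0 ?sqr_ge0// invr_ge0 ltW.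
Qed.

Variables (alpha eps eta kp : R) (S : seq R) (v1 v2 h1 h2 : R -> R).
Hypotheses (eps0 : 0 < eps) (eta0 : 0 < eta) (kp0 : 0 < kp) (uS : uniq S).
Let W := kp + T0 eps eta.
Hypotheses (sepS : forall x y, x \in S -> y \in S -> x <> y -> 2 * (kp + T0 eps eta) < `|x - y|)
  (inS : forall z, z \in S -> kp + T0 eps eta < z < 1 - (kp + T0 eps eta))
  (o1 : offS S v1 h1) (o2 : offS S v2 h2) (sh1 : sq h1) (sh2 : sq h2)
  (mv1 : measurable_fun setT v1) (mv2 : measurable_fun setT v2)
  (nv : forall x, x \notin S -> v1 x ^+ 2 + v2 x ^+ 2 = 1)
  (nvle : forall x, v1 x ^+ 2 + v2 x ^+ 2 <= 1)
  (hz : forall x, x <= 0 \/ 1 <= x -> h1 x = 0 /\ h2 x = 0)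
  (v0 : v1 0 = 1 /\ v2 0 = 0) (ve : v1 1 = cos alpha /\ v2 1 = sin alpha).

Let W0 : 0 < W. Proof. by rewrite addr_gt0// T0_gt0. Qed.
Let r_ x := rho eps eta kp S x.
Let dr x := drho eps eta kp S x.
Let p1 x := r_ x * v1 x.
Let p2 x := r_ x * v2 x.
Let q1 x := dr x * v1 x + r_ x * h1 x.
Let q2 x := dr x * v2 x + r_ x * h2 x.

Let r_rng x : 0 <= r_ x <= 1. Proof. exact: rho_rng. Qed.

Let vle x : `|v1 x| <= 1 /\ `|v2 x| <= 1.
Proof.
have H := nvle x; have s1 := sqr_ge0 (v1 x); have s2 := sqr_ge0 (v2 x).
by split; (rewrite -(@ler_sqr _ `|_|) ?nnegrE// real_normK ?num_real// expr1n; lra).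
Qed.

Let mr : measurable_fun setT r_.
Proof. by apply: continuous_measurable_fun; apply: prim_continuous => a b; exact: prim_rho. Qed.

Let r_out x : x <= 0 \/ 1 <= x -> r_ x = 1 /\ dr x = 0.
Proof.
move=> hx; apply: rho_far => // z /inS/andP[z1 z2]; rewrite lter_normr.
by case: hx => hx; apply/orP; [right|left]; move: W0; rewrite /W in z1 z2 *; lra.
Qed.

Let C := 2 * ((1 + eta) ^+ 2 / (Num.sqrt 2 * eps)).

Let sq_q (v h : R -> R) : measurable_fun setT v -> (forall x, `|v x| <= 1) -> sq h ->
  sq (fun x => dr x * v x + r_ x * h x).
Proof.
move=> mv vb [mh ih].
have md : measurable_fun setT dr by exact: drho_meas.
have m : measurable_fun setT (fun x => dr x * v x + r_ x * h x).
  by apply: measurable_funD; apply: measurable_funM.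
split=> //; apply: (@integ_le _ setT _ (fun x => (fun=> 2 * C ^+ 2) \_ `[0, 1] x + 2 * h x ^+ 2)) => //.
- exact: measurable_funX.
- move=> x _; rewrite ger0_norm ?sqr_ge0//.
  have Y := @young 1 (dr x * v x) (r_ x * h x) ltr01; apply: (le_trans Y).
  rewrite invr1; apply: lerD; last first.
    rewrite ler_wpM2l// exprMn ler_piMl ?sqr_ge0//.
    by have /andP[? ?] := r_rng x; rewrite expr_le1.
  rewrite patchE; case: ifPn => [_|/negP xn].
    rewrite ler_wpM2l// exprMn -real_normK ?num_real// -[v x ^+ 2]real_normK ?num_real//.
    rewrite -exprMn; have N : `|dr x| * `|v x| <= C.
      by apply: (@le_trans _ _ (`|dr x| * 1)); [rewrite ler_wpM2l|rewrite mulr1; exact: drho_bnd].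
    by rewrite ler_sqr// nnegrE; [apply: mulr_ge0|apply: le_trans N; apply: mulr_ge0].
  have [_ ->] : r_ x = 1 /\ dr x = 0.
    apply: r_out; case: (leP x 0) => h0; [by left|right]; rewrite leNgt; apply/negP => h1'.
    by apply: xn; apply: mem_set; rewrite /= in_itv/= !ltW.
  by rewrite mul0r expr0n/= mulr0.
- apply: integD => //; last exact: integZ.
  by apply: (integ_patch _ (measurable_itv _)).1; exact: integ_cst.
Qed.

(** Absolute continuity is local: near a jump the product is identically 0, and elsewhere both
    factors are absolutely continuous. *)
Let prim_p (v h : R -> R) : offS S v h -> measurable_fun setT v -> (forall x, `|v x| <= 1) -> sq h ->
  forall a b, prim a b (fun x => r_ x * v x) (fun x => dr x * v x + r_ x * h x).
Proof.
move=> ov mv vb sh a b; apply: prim_local => [s t|x _].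
  by apply: sqi_integ; apply: sqi_of_sq; exact: sq_q.
case: (boolP (x \in S)) => xS.
  exists (kp / 2); first by rewrite divr_gt0.
  apply: (prim_ext (prim_cst _ _ 0)) => y y1 y2.
    have [|E _] := rho_zero eps0 eta0 kp0 uS sepS xS (x := y); last by rewrite /r_ E mul0r.
    by rewrite ltr_norml; move: kp0 => ?; apply/andP; split; lra.
  have [|E1 E2] := rho_zero eps0 eta0 kp0 uS sepS xS (x := y); last by rewrite /r_ /dr E1 E2 !mul0r addr0.
  by rewrite ltr_norml; move: kp0 => ?; apply/andP; split; lra.
have oS : open (~` [set` S]) by exact: open_notin.
have [|r r0 Hr] := open_ball oS (x := x); first exact/negP.
exists r => //; apply: prim_mul; first exact: prim_rho.
by apply: ov => y hy; apply/negP; exact: Hr.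
Qed.

Lemma rec_pdata : pdata alpha p1 p2 q1 q2.
Proof.
have b1 x := (vle x).1; have b2 x := (vle x).2.
split.
- by split; apply: prim_p.
- by split; exact: sq_q.
- move=> x hx; have [_ d0] := r_out hx; have [e1 e2] := hz hx.
  by rewrite /q1 /q2 d0 e1 e2 !mul0r !mulr0 addr0.
- have [E _] := r_out (or_introl (lexx 0)); have [e1 e2] := v0.
  by rewrite /p1 /p2 E e1 e2 mulr1 mulr0.
- have [E _] := r_out (or_intror (lexx 1)); have [e1 e2] := ve.
  by rewrite /p1 /p2 E e1 e2 !mul1r.
Qed.

Let eb x := \sum_(z <- S) eb1 eps eta kp z x.

(** On [S] the modulus of v is unspecified, but there the factor [r_] is 0. *)
Let pnorm x : p1 x ^+ 2 + p2 x ^+ 2 = r_ x ^+ 2.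
Proof.
have -> : p1 x ^+ 2 + p2 x ^+ 2 = r_ x ^+ 2 * (v1 x ^+ 2 + v2 x ^+ 2) by rewrite /p1 /p2; ring.
case: (boolP (x \in S)) => xS; last by rewrite nv// mulr1.
have [|E _] := rho_zero eps0 eta0 kp0 uS sepS xS (x := x).
  by rewrite subrr normr0.
by rewrite /r_ E expr0n mul0r.
Qed.

(** The penalised quantity splits as r^2 (v x v' - (tN - kap)) + (r^2 - 1) tN. Its second part is
    unbounded near the jumps; the smallness condition on eps tN^2 lets the potential absorb it at
    the price of a factor 1 + dl. *)
Lemma rec_dens (L kap tN th dl : R) x : 0 < L -> 0 < dl -> 2 * L * eps * (1 + dl^-1) * tN ^+ 2 <= dl ->
  dens L eps kap tN p1 p2 q1 q2 x <=
   (1 + dl) * eb x + ((1 + dl) ^+ 2 * (L / 2) * (v1 x * h2 x - v2 x * h1 x - th) ^+ 2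
   + (eps * (1 + dl^-1) * (h1 x ^+ 2 + h2 x ^+ 2 + kap ^+ 2)
   + L / 2 * (1 + dl) * (1 + dl^-1) * (th - (tN - kap)) ^+ 2)).
Proof.
move=> L0 d0 small; have i0 : 0 < dl^-1 by rewrite invr_gt0.
have /andP[r0 r1] := r_rng x.
have rr1 : r_ x ^+ 2 <= 1 by rewrite expr_le1.
have eb' : eps / 2 * dr x ^+ 2 + (4 * eps)^-1 * (r_ x ^+ 2 - 1) ^+ 2 <= eb x by exact: rho_dens.
have V := nvle x.
have e2 : 0 < eps / 2 by rewrite divr_gt0.
(* [young] separates the derivative of the modulus, which carries the cost, from the phase part,
   whose factor eps kap^2 vanishes in the limit. *)
have A1 : (q1 x - kap * p2 x) ^+ 2 + (q2 x + kap * p1 x) ^+ 2 <=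
   (1 + dl) * dr x ^+ 2 + (1 + dl^-1) * (2 * (h1 x ^+ 2 + h2 x ^+ 2 + kap ^+ 2)).
  have -> : q1 x - kap * p2 x = dr x * v1 x + r_ x * (h1 x - kap * v2 x) by rewrite /q1 /p2; ring.
  have -> : q2 x + kap * p1 x = dr x * v2 x + r_ x * (h2 x + kap * v1 x) by rewrite /q2 /p1; ring.
  have Y1 := young (dr x * v1 x) (r_ x * (h1 x - kap * v2 x)) d0.
  have Y2 := young (dr x * v2 x) (r_ x * (h2 x + kap * v1 x)) d0.
  apply: (le_trans (lerD Y1 Y2)).
  have -> : (1 + dl) * (dr x * v1 x) ^+ 2 + (1 + dl^-1) * (r_ x * (h1 x - kap * v2 x)) ^+ 2 +
     ((1 + dl) * (dr x * v2 x) ^+ 2 + (1 + dl^-1) * (r_ x * (h2 x + kap * v1 x)) ^+ 2) =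
     (1 + dl) * dr x ^+ 2 * (v1 x ^+ 2 + v2 x ^+ 2) +
     (1 + dl^-1) * (r_ x ^+ 2 * ((h1 x - kap * v2 x) ^+ 2 + (h2 x + kap * v1 x) ^+ 2)) by ring.
  apply: lerD; first by rewrite ler_piMr// mulr_ge0 ?sqr_ge0// addr_ge0// ltW.
  rewrite ler_wpM2l ?addr_ge0 ?(ltW i0)//.
  apply: (@le_trans _ _ ((h1 x - kap * v2 x) ^+ 2 + (h2 x + kap * v1 x) ^+ 2)).
    by rewrite ler_piMl// addr_ge0 ?sqr_ge0.
  have : kap ^+ 2 * (v1 x ^+ 2 + v2 x ^+ 2) <= kap ^+ 2 by rewrite ler_piMr ?sqr_ge0.
  have Y3 := @young 1 (h1 x) (- (kap * v2 x)) ltr01; have Y4 := @young 1 (h2 x) (kap * v1 x) ltr01.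
  rewrite invr1 sqrrN in Y3; rewrite invr1 in Y4.
  move: Y3 Y4; rewrite !exprMn mulrDr.
  move: (kap ^+ 2 * v1 x ^+ 2) (kap ^+ 2 * v2 x ^+ 2) ((h1 x - _) ^+ 2) ((h2 x + _) ^+ 2) => y1 y2 y3 y4.
  lra.
have A2 : (p1 x * q2 x - p2 x * q1 x + (p1 x ^+ 2 + p2 x ^+ 2) * kap - tN) ^+ 2 <=
   (1 + dl) ^+ 2 * (v1 x * h2 x - v2 x * h1 x - th) ^+ 2 + (1 + dl) * (1 + dl^-1) * (th - (tN - kap)) ^+ 2
   + (1 + dl^-1) * tN ^+ 2 * (r_ x ^+ 2 - 1) ^+ 2.
  have -> : p1 x * q2 x - p2 x * q1 x + (p1 x ^+ 2 + p2 x ^+ 2) * kap - tN =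
     r_ x ^+ 2 * ((v1 x * h2 x - v2 x * h1 x) - (tN - kap)) + (r_ x ^+ 2 - 1) * tN.
    by rewrite pnorm /p1 /p2 /q1 /q2; ring.
  have Y := young (r_ x ^+ 2 * ((v1 x * h2 x - v2 x * h1 x) - (tN - kap))) ((r_ x ^+ 2 - 1) * tN) d0.
  apply: (le_trans Y).
  have Y2 := young (v1 x * h2 x - v2 x * h1 x - th) (th - (tN - kap)) d0.
  have E : v1 x * h2 x - v2 x * h1 x - th + (th - (tN - kap)) = (v1 x * h2 x - v2 x * h1 x) - (tN - kap) by ring.
  rewrite E in Y2; apply: lerD; last by rewrite le_eqVlt; apply/orP; left; apply/eqP; ring.
  have -> : (1 + dl) ^+ 2 * (v1 x * h2 x - v2 x * h1 x - th) ^+ 2 + (1 + dl) * (1 + dl^-1) * (th - (tN - kap)) ^+ 2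
    = (1 + dl) * ((1 + dl) * (v1 x * h2 x - v2 x * h1 x - th) ^+ 2 + (1 + dl^-1) * (th - (tN - kap)) ^+ 2) by ring.
  rewrite ler_wpM2l ?addr_ge0 ?(ltW d0)//; apply: le_trans Y2.
  by rewrite exprMn ler_piMl ?sqr_ge0// expr_le1 ?sqr_ge0.
rewrite /dens pnorm.
have L2p : 0 <= L / 2 by rewrite divr_ge0// ltW.
have B1 := ler_wpM2l (ltW e2) A1; have B2 := ler_wpM2l L2p A2; rewrite pnorm in B2.
apply: (le_trans (lerD (lerD B1 (lexx _)) B2)).
set P := (r_ x ^+ 2 - 1) ^+ 2 in eb' *; have P0 : 0 <= P by exact: sqr_ge0.
(* Relative to the potential, the extra term has the ratio 2 L eps (1 + 1/dl) tN^2, the quantity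
   assumed to be at most [dl]. *)
have B3 : (4 * eps)^-1 * P + L / 2 * ((1 + dl^-1) * tN ^+ 2 * P) <= (1 + dl) * ((4 * eps)^-1 * P).
  have -> : L / 2 * ((1 + dl^-1) * tN ^+ 2 * P) = (2 * L * eps * (1 + dl^-1) * tN ^+ 2) * ((4 * eps)^-1 * P).
    by field; rewrite !gt_eqF.
  by rewrite [leRHS]mulrDl mul1r lerD2l ler_wpM2r// mulr_ge0// invr_ge0 mulr_ge0// ltW.
have B4 : (1 + dl) * (eps / 2 * dr x ^+ 2 + (4 * eps)^-1 * P) <= (1 + dl) * eb x.
  by rewrite ler_wpM2l// addr_ge0// ltW.
have -> : eps / 2 * ((1 + dl) * dr x ^+ 2 + (1 + dl^-1) * (2 * (h1 x ^+ 2 + h2 x ^+ 2 + kap ^+ 2))) =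
  (1 + dl) * (eps / 2 * dr x ^+ 2) + eps * (1 + dl^-1) * (h1 x ^+ 2 + h2 x ^+ 2 + kap ^+ 2) by field; rewrite gt_eqF.
have -> : L / 2 * ((1 + dl) ^+ 2 * (v1 x * h2 x - v2 x * h1 x - th) ^+ 2 +
    (1 + dl) * (1 + dl^-1) * (th - (tN - kap)) ^+ 2 + (1 + dl^-1) * tN ^+ 2 * P) =
  (1 + dl) ^+ 2 * (L / 2) * (v1 x * h2 x - v2 x * h1 x - th) ^+ 2 +
    L / 2 * (1 + dl) * (1 + dl^-1) * (th - (tN - kap)) ^+ 2 + L / 2 * ((1 + dl^-1) * tN ^+ 2 * P) by ring.
rewrite mulrDr in B4; move: B3 B4.
set y1 := (4 * eps)^-1 * P; set y2 := L / 2 * _; set y3 := (1 + dl) * y1; set y4 := (1 + dl) * (_ * _).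
set y5 := (1 + dl) * eb x; set y6 := eps * _ * _; set y7 := _ * _ * _ ^+ 2; set y8 := L / 2 * _ * _ * _ ^+ 2.
clearbody y1 y2 y3 y4 y5 y6 y7 y8; lra.
Qed.

Lemma rec_I (L kap tN th dl : R) : 0 < L -> 0 < dl -> 2 * L * eps * (1 + dl^-1) * tN ^+ 2 <= dl ->
  I 0 1 (dens L eps kap tN p1 p2 q1 q2) <=
   (1 + dl) * ((size S)%:R * (Num.sqrt 2 * ((1 + eta) ^+ 2 - 3^-1) + kp / (2 * eps)))
   + ((1 + dl) ^+ 2 * (L / 2) * I 0 1 (fun x => (v1 x * h2 x - v2 x * h1 x - th) ^+ 2)
   + (eps * (1 + dl^-1) * (I 0 1 (fun x => h1 x ^+ 2 + h2 x ^+ 2) + kap ^+ 2)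
   + L / 2 * (1 + dl) * (1 + dl^-1) * (th - (tN - kap)) ^+ 2)).
Proof.
move=> L0 d0 small; have [ieb Ieb] := eb_I eps0 eta0 kp0 S.
have sj : sqi 0 1 (fun x => v1 x * h2 x - v2 x * h1 x - th).
  apply: sqiB; last exact: sqi_cst.
  apply: sqiB; apply: (@sqiM_bnd _ _ _ _ _ 1); try (by apply: sqi_of_sq); try (by apply: measurable_funTS);
    by move=> x _ _; have [] := vle x.
have ih : integ `[0, 1] (fun x => h1 x ^+ 2 + h2 x ^+ 2).
  by apply: integD => //; [exact: (sqi_of_sq 0 1 sh1).2|exact: (sqi_of_sq 0 1 sh2).2].
have i1 : integ `[0, 1] (fun x => (1 + dl) * eb x) by exact: integZ.
have i2 : integ `[0, 1] (fun x => (1 + dl) ^+ 2 * (L / 2) * (v1 x * h2 x - v2 x * h1 x - th) ^+ 2).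
  by apply: integZ => //; exact: sj.2.
have i3' : integ `[0, 1] (fun x => h1 x ^+ 2 + h2 x ^+ 2 + kap ^+ 2) by apply: integD => //; exact: integ_cst.
have i3 : integ `[0, 1] (fun x => eps * (1 + dl^-1) * (h1 x ^+ 2 + h2 x ^+ 2 + kap ^+ 2)) by exact: integZ.
have i4 : integ `[0, 1] (fun x => L / 2 * (1 + dl) * (1 + dl^-1) * (th - (tN - kap)) ^+ 2) by exact: integ_cst.
have i34 := integD (measurable_itv _) i3 i4; have i234 := integD (measurable_itv _) i2 i34.
apply: le_trans (I_le (dens_integ L eps kap tN rec_pdata) (integD (measurable_itv _) i1 i234) _) _.
  by move=> x _ _; exact: rec_dens.
have cst v : I 0 1 (fun=> v : R) = v by rewrite I_cst// subr0 mulr1.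
rewrite ID// ID// ID// cst IZ// [X in _ + (X + _) <= _]IZ//; last exact: sj.2.
rewrite [X in _ + (_ + (X + _)) <= _]IZ// ID// ?cst; last exact: integ_cst.
by rewrite lerD2r ler_wpM2l// addr_ge0// ltW.
Qed.

(** |p - v| <= 1 - r <= 1 - r^2, so the distance is controlled by 4 eps times the potential. *)
Lemma rec_dist : I 0 1 (fun x => (p1 x - v1 x) ^+ 2 + (p2 x - v2 x) ^+ 2) <=
  4 * eps * ((size S)%:R * (Num.sqrt 2 * ((1 + eta) ^+ 2 - 3^-1) + kp / (2 * eps))).
Proof.
have [ieb Ieb] := eb_I eps0 eta0 kp0 S.
have s1 : sqi 0 1 (fun x => (r_ x - 1) * v1 x) /\ sqi 0 1 (fun x => (r_ x - 1) * v2 x).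
  have key (v : R -> R) : measurable_fun setT v -> (forall x, `|v x| <= 1) -> sqi 0 1 (fun x => (r_ x - 1) * v x).
    move=> mv vb; have m : measurable_fun setT (fun x => r_ x - 1) by exact: measurable_funB.
    split; first by apply: measurable_funTS; exact: measurable_funM.
    apply: (@integ_le _ _ _ (fun=> 1)) => //; last exact: integ_cst.
      by apply: measurable_funTS; apply: measurable_funX; exact: measurable_funM.
    move=> x _; rewrite ger0_norm ?sqr_ge0// -real_normK ?num_real// expr_le1// normrM.
    rewrite mulr_ile1// ler_norml; have /andP[? ?] := r_rng x; apply/andP; split; lra.
  by split; apply: key => // x; have [] := vle x.
have E x : (p1 x - v1 x) ^+ 2 + (p2 x - v2 x) ^+ 2 = ((r_ x - 1) * v1 x) ^+ 2 + ((r_ x - 1) * v2 x) ^+ 2.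
  by rewrite /p1 /p2; ring.
have e4 : 0 <= 4 * eps by rewrite mulr_ge0// ltW.
apply: (@le_trans _ _ (I 0 1 (fun x => 4 * eps * eb x))); last first.
  by rewrite IZ// ler_wpM2l.
apply: I_le; last first.
- move=> x _ _; rewrite E.
  have -> : ((r_ x - 1) * v1 x) ^+ 2 + ((r_ x - 1) * v2 x) ^+ 2 = (r_ x - 1) ^+ 2 * (v1 x ^+ 2 + v2 x ^+ 2) by ring.
  apply: (@le_trans _ _ ((r_ x - 1) ^+ 2)); first by rewrite ler_piMr ?sqr_ge0.
  have /andP[r0 r1] := r_rng x.
  apply: (@le_trans _ _ ((r_ x ^+ 2 - 1) ^+ 2)).
    have -> : (r_ x ^+ 2 - 1) ^+ 2 = (r_ x - 1) ^+ 2 * (r_ x + 1) ^+ 2 by ring.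
    by rewrite ler_peMr ?sqr_ge0// expr_ge1//; lra.
  have H : eps / 2 * dr x ^+ 2 + (4 * eps)^-1 * (r_ x ^+ 2 - 1) ^+ 2 <= eb x by exact: rho_dens.
  rewrite -ler_pdivrMl ?mulr_gt0//; apply: le_trans H; rewrite lerDr mulr_ge0 ?sqr_ge0//.
  by rewrite divr_ge0// ltW.
- exact: integZ.
- by apply: (@eq_integ _ _ (fun x => ((r_ x - 1) * v1 x) ^+ 2 + ((r_ x - 1) * v2 x) ^+ 2)) => //;
  apply: integD => //; [exact: s1.1.2|exact: s1.2.2].
Qed.

End Recovery.

(** * Piecewise representatives of the limit map *)

Section Hat.
Context {R : realType}.
Local Notation mu := (@lebesgue_measure R).
Local Notation U01 := (@unit_interval R).
Implicit Types (f g h : R -> R) (a b x y z r s t m : R) (w : R -> R * R) (S : seq R).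

Lemma meas_offS S f g : offS S f g -> measurable_fun setT f.
Proof.
move=> o; have oO := @open_notin _ S.
have ac : acU (~` [set` S]) f g by move=> a b H; apply: o => x /H/negP.
rewrite -(setvU [set` S]).
have cS : countable [set` S] by apply: finite_set_countable; exact: finite_seq.
apply/measurable_funU; [exact: open_measurable|exact: countable_measurable|split].
  apply: open_continuous_measurable_fun => // x; rewrite inE => Ux; exact: (acU_cont oO ac Ux).
move=> _ Y _; have cY : countable ([set` S] `&` f @^-1` Y).
  by apply: finite_set_countable; apply: (@sub_finite_set _ _ [set` S]); [exact: subIsetl|exact: finite_seq].
exact: countable_measurable.
Qed.

Lemma end_value (F : set_system R) (FF : ProperFilter F) f (P : R -> R) c z a b :
  f x @[x --> F] --> c -> P x @[x --> F] --> P z -> (\forall x \near F, a < x < b) ->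
  (forall x y, a < x -> x <= y -> y < b -> f y - f x = P y - P x) ->
  forall x, a < x < b -> f x = c + (P x - P z).
Proof.
move=> fc Pz N H x /andP[ax xb].
have E y : a < y < b -> f y = (f x - P x) + P y.
  by move=> /andP[ay yb]; case: (leP x y) => xy; [have := H x y ax xy yb|have := H y x ay (ltW xy) xb]; lra.
have l1 : (f x - P x) + P y @[y --> F] --> (f x - P x) + P z by apply: cvgD => //; exact: cvg_cst.
have l2 : (f x - P x) + P y @[y --> F] --> c.
  by apply: cvg_trans fc; apply: near_eq_cvg; apply: filterS N => y /E.
have E2 : (f x - P x) + P z = c by exact: (cvg_unique (@Rhausdorff R) l1 l2).
by rewrite -E2; ring.
Qed.

(* A piecewise absolutely continuous S^1-valued map, jumping on [S] and extended
   by the boundary data outside [0, 1]; the values on [S] itself are left free. *)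
Definition hat (alpha : R) S (v1 v2 h1 h2 : R -> R) :=
  [/\ offS S v1 h1 /\ offS S v2 h2, sq h1 /\ sq h2,
      (forall x, x \notin S -> v1 x ^+ 2 + v2 x ^+ 2 = 1) /\ (forall x, v1 x ^+ 2 + v2 x ^+ 2 <= 1),
      forall x, x <= 0 \/ 1 <= x -> h1 x = 0 /\ h2 x = 0 &
      (forall x, x <= 0 -> v1 x = 1 /\ v2 x = 0) /\ (forall x, 1 <= x -> v1 x = cos alpha /\ v2 x = sin alpha)].

(** At an endpoint outside [J] the trace equals the boundary datum, so extending by the datum
    creates no new jump; at an endpoint in [J] the jump is recorded in [S]. *)
Lemma hat_base (alpha A : R) (w : R -> R * R) (J : set R) (th := 2 * pi * A) :
  L2_plane U01 w -> jump_set alpha w J ->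
  exists S v1 v2 h1 h2, [/\ uniq S, J = [set` S], hat alpha S v1 v2 h1 h2,
  {ae mu, forall x, U01 x -> w x = (v1 x, v2 x)} &
  (\int[mu]_(x in U01 `\` J) ((current (U01 `\` J) w x - th) ^+ 2)%:E)%E =
    (I 0 1 (fun x => (v1 x * h2 x - v2 x * h1 x - th) ^+ 2))%:E].
Proof.
move=> l2w jJ; have [[fJ J01] [[H1w H2w] nw] _ tr0 tr1] := jJ.
have [S' ES'] := (finite_seqP J).1 fJ; pose S := undup S'.
have ES : J = [set` S] by rewrite ES'; apply/seteqP; split=> x /=; rewrite mem_undup.
have oU : open (U01 `\` J) by apply: openI; [exact: unit_open|rewrite ES; exact: open_notin].
have mU : measurable (U01 `\` J) by exact: open_measurable.
have Usub : U01 `\` J `<=` `[0, 1] by move=> x [/unit_sub].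
have [u1 [a1 e1 sg1]] := H1_inv oU Usub H1w.
have [u2 [a2 e2 sg2]] := H1_inv oU Usub H2w.
set h1 := _ \_ _ in a1 sg1; set h2 := _ \_ _ in a2 sg2.
have c1 x (Ux : (U01 `\` J) x) := acU_cont oU a1 Ux.
have c2 x (Ux : (U01 `\` J) x) := acU_cont oU a2 Ux.
have nu : forall x, (U01 `\` J) x -> u1 x ^+ 2 + u2 x ^+ 2 = 1.
  apply: (cont_ae_eq oU) => [x Ux|x _|].
  - by apply: cvgD; rewrite expr2; under eq_fun do rewrite expr2; apply: cvgM; [exact: c1|exact: c1|exact: c2|exact: c2].
  - exact: cvg_cst.
  - apply: (ae_mono (ae_and nw (ae_and e1 e2))) => x [q1 [q2 q3]] Ux.
    by rewrite q2// q3//; exact: q1.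
have hz x : x <= 0 \/ 1 <= x -> h1 x = 0 /\ h2 x = 0.
  move=> hx; rewrite /h1 /h2 !patchE memNset// => -[/unitP/andP[? ?] _]; case: hx => ?; lin.
have ih1 : integ setT h1 by apply: sq_integT => // x hx; apply: (hz x _).1; case: hx => ?; [left|right]; lin.
have ih2 : integ setT h2 by apply: sq_integT => // x hx; apply: (hz x _).2; case: hx => ?; [left|right]; lin.
have P1 := prim_global ih1 (fun x hx => (hz x (or_introl hx)).1).
have P2 := prim_global ih2 (fun x hx => (hz x (or_introl hx)).2).
(* Interior jump points receive the value 0, which keeps the modulus at most 1 everywhere. *)
pose hatv (u : R -> R) (k0 k1 x : R) := if x <= 0 then k0 else if 1 <= x then k1 else (u \_ (U01 `\` J)) x.
have trace F (l : R * R) : ProperFilter F -> has_trace (U01 `\` J) w F l -> (\forall x \near F, (U01 `\` J) x) ->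
    u1 x @[x --> F] --> l.1 /\ u2 x @[x --> F] --> l.2.
  move=> FF [v [cv aev lv]] N; split.
    apply: cvg_trans (cvg_fst2 _ lv); apply: near_eq_cvg; apply: filterS N => x Ux.
    apply: (@cont_ae_eq R (U01 `\` J) (fun y => (v y).1) u1 oU _ c1 _ x Ux) => [y Uy|]; first by apply: cvg_fst2; apply: cv; rewrite inE.
    by apply: (ae_mono (ae_and aev e1)) => y [q1 q2] Uy; rewrite q1// q2.
  apply: cvg_trans (cvg_snd2 _ lv); apply: near_eq_cvg; apply: filterS N => x Ux.
  apply: (@cont_ae_eq R (U01 `\` J) (fun y => (v y).2) u2 oU _ c2 _ x Ux) => [y Uy|]; first by apply: cvg_snd2; apply: cv; rewrite inE.
  by apply: (ae_mono (ae_and aev e2)) => y [q1 q2] Uy; rewrite q1// q2.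
have ball x : ~ J x -> exists r, [/\ 0 < r, r < 1 & forall y, x - r <= y <= x + r -> ~ J y].
  move=> nJ; have [|r r0 Hr] := open_ball (@open_notin _ S) (x := x); first by rewrite -ES.
  have [k [k0 kr k1]] := small2 r0 ltr01; exists k; split=> // y /andP[? ?]; rewrite ES; apply: Hr.
  by apply/andP; split; lin.
(* Local check at a point off [S]: constant outside [0, 1], the representative inside, and at 0 or 1
   both sides match the same constant plus primitive by the trace. *)
have off u h k0 k1 : acU (U01 `\` J) u h -> (forall a b, prim a b (fun x => I 0 x h) h) ->
    (forall x, x <= 0 \/ 1 <= x -> h x = 0) ->
    (~ J 0 -> u x @[x --> 0^'+] --> k0) -> (~ J 1 -> u x @[x --> 1^'-] --> k1) ->
    offS S (hatv u k0 k1) h.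
  move=> ac P hz' l0 l1 a b Hab.
  have ih' c d : integ `[c, d] h by have [] := P c d.
  have Pz c d : c <= d -> d <= 0 \/ 1 <= c -> I 0 d h = I 0 c h.
    move=> cd hcd; apply/eqP; rewrite -subr_eq0 (P c d).2//.
    rewrite (@eq_I _ _ _ _ (fun=> 0)) ?I_cst ?mul0r// => y y1 y2.
    by apply: hz'; case: hcd => ?; [left|right]; lin.
  apply: prim_local => // x /Hab xS.
  have nJ : ~ J x by rewrite ES; exact/negP.
  have [r [r0 r1 Hr]] := ball x nJ.
  have glob z c d : 0 < d -> (forall y, z - d < y < z + d -> hatv u k0 k1 y = c + (I 0 y h - I 0 z h)) ->
      exists2 d, 0 < d & prim (z - d) (z + d) (hatv u k0 k1) h.
    move=> d0 H; exists (d / 2); first lin.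
    have := primD (prim_cst (z - d / 2) (z + d / 2) (c - I 0 z h)) (P (z - d / 2) (z + d / 2)).
    move/prim_ext; apply => y y1 y2; last by rewrite add0r.
    by rewrite H; [ring|apply/andP; split; lin].
  have incr s t c d : (forall y, s < y < t -> (U01 `\` J) y) -> s < c -> c <= d -> d < t -> u d - u c = I 0 d h - I 0 c h.
    move=> H sc cd dt; have [_ E] := ac c d ltac:(by move=> y /andP[? ?]; apply: H; apply/andP; split; lin).
    by rewrite (E c d)// (P c d).2.
  have hin y : (U01 `\` J) y -> hatv u k0 k1 y = u y.
    by move=> Uy; have [/unitP/andP[y0 y1] _] := Uy; rewrite /hatv !leNgt y0 y1/= patchE mem_set.
  case: (ltgtP x 0) => x0.
  - apply: (glob x k0 (- x)); first lin.
    move=> y /andP[y1 y2]; rewrite /hatv ifT; last lin.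
    case: (leP x y) => xy; [rewrite (Pz x y)//; last by left; lin|rewrite (Pz y x) ?(ltW xy)//; last by left; lin]; ring.
  - case: (ltgtP x 1) => x1.
    + have Ux : (U01 `\` J) x by split=> //; apply/unitP; rewrite x0.
      have [d d0 Hd] := open_ball oU Ux; exists d => //.
      apply: (prim_ext (ac _ _ Hd)) => y y1 y2 //; rewrite hin//; apply: Hd; by rewrite y1.
    + apply: (glob x k1 (x - 1)); first lin.
      move=> y /andP[y1 y2]; rewrite /hatv ifF; last by apply/negbTE; rewrite -ltNge; lin.
      rewrite ifT; last lin.
      case: (leP x y) => xy; [rewrite (Pz x y)//; last by right; lin|rewrite (Pz y x) ?(ltW xy)//; last by right; lin]; ring.
    + subst x; have Ur y : 1 - r < y < 1 -> (U01 `\` J) y.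
        move=> /andP[? ?]; split; first by apply/unitP/andP; split; lin.
        by apply: Hr; apply/andP; split; lin.
      have N1 : \forall y \near 1^'-, 1 - r < y < 1.
        near=> y; apply/andP; split; near: y; [apply: nbhs_left_gt; lin|exact: nbhs_left_lt].
      have E := end_value _ (l1 nJ) (trace_left P (a := 1)) N1 (fun c d => incr _ _ c d Ur).
      apply: (glob 1 k1 r r0) => y /andP[y1 y2]; case: (ltP y 1) => hy.
        by rewrite hin; [apply: E; rewrite y1|apply: Ur; rewrite y1].
      rewrite /hatv ifF; last by apply/negbTE; rewrite -ltNge; lin.
      by rewrite hy (Pz 1 y)//; [ring|right].
  - subst x; have Ur y : 0 < y < 0 + r -> (U01 `\` J) y.
      move=> /andP[? ?]; split; first by apply/unitP/andP; split; lin.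
      by apply: Hr; apply/andP; split; lin.
    have N1 : \forall y \near 0^'+, 0 < y < 0 + r.
      near=> y; apply/andP; split; near: y; [exact: nbhs_right_gt|apply: nbhs_right_lt; lin].
    have E := end_value _ (l0 nJ) (trace_right P (a := 0)) N1 (fun c d => incr _ _ c d Ur).
    apply: (glob 0 k0 r r0) => y /andP[y1 y2]; case: (ltP 0 y) => hy.
      by rewrite hin; [apply: E; rewrite hy|apply: Ur; rewrite hy].
    by rewrite /hatv hy (Pz y 0)//; [ring|left].
have near0 : ~ J 0 -> \forall x \near 0^'+, (U01 `\` J) x.
  move=> /ball[r [r0 r1 Hr]]; near=> x.
  have x0 : 0 < x by near: x; exact: nbhs_right_gt.
  have xr : x < r by near: x; exact: nbhs_right_lt.
  by split; [apply/unitP/andP; split; lin|apply: Hr; apply/andP; split; lin].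
have near1 : ~ J 1 -> \forall x \near 1^'-, (U01 `\` J) x.
  move=> /ball[r [r0 r1 Hr]]; near=> x.
  have x0 : x < 1 by near: x; exact: nbhs_left_lt.
  have xr : 1 - r < x by near: x; apply: nbhs_left_gt; lin.
  by split; [apply/unitP/andP; split; lin|apply: Hr; apply/andP; split; lin].
have t0 : ~ J 0 -> u1 x @[x --> 0^'+] --> (1 : R) /\ u2 x @[x --> 0^'+] --> (0 : R).
  move=> nJ; apply: (trace _ (1, 0)) (near0 nJ) => //; apply: contrapT => h; apply: nJ; exact: tr0.2.
have t1 : ~ J 1 -> u1 x @[x --> 1^'-] --> cos alpha /\ u2 x @[x --> 1^'-] --> sin alpha.
  move=> nJ; apply: (trace _ (expi alpha)) (near1 nJ) => //; apply: contrapT => h; apply: nJ; exact: tr1.2.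
have o1 := off u1 h1 1 (cos alpha) a1 P1 (fun x hx => (hz x hx).1) (fun n => (t0 n).1) (fun n => (t1 n).1).
have o2 := off u2 h2 0 (sin alpha) a2 P2 (fun x hx => (hz x hx).2) (fun n => (t0 n).2) (fun n => (t1 n).2).
set v1 := hatv u1 _ _ in o1; set v2 := hatv u2 _ _ in o2.
have vU x : (U01 `\` J) x -> v1 x = u1 x /\ v2 x = u2 x.
  by move=> Ux; have [/unitP/andP[x0 x1] _] := Ux; rewrite /v1 /v2 /hatv !leNgt x0 x1/= !patchE mem_set.
have aev : {ae mu, forall x, U01 x -> w x = (v1 x, v2 x)}.
  apply: (ae_mono (ae_and (ae_and e1 e2) (ae_notin S))) => x [[q1 q2] xS] Ux.
  have UJ : (U01 `\` J) x by split=> //; rewrite ES; exact/negP.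
  by have [-> ->] := vU x UJ; rewrite q1// q2// /comp1 /comp2; case: (w x).
exists S, v1, v2, h1, h2; split=> //; first exact: undup_uniq.
- split=> //; last by split=> x hx; rewrite /v1 /v2 /hatv ?hx// !ifF//; apply/negbTE; rewrite -ltNge; lin.
  have nn x : (~ x <= 0 /\ ~ 1 <= x /\ J x) \/ v1 x ^+ 2 + v2 x ^+ 2 = 1.
    case: (leP x 0) => x0; first by right; rewrite /v1 /v2 /hatv x0 expr1n expr0n addr0.
    case: (leP 1 x) => x1; first by right; rewrite /v1 /v2 /hatv leNgt x0/= x1 cos2Dsin2.
    case: (pselect (J x)) => Jx; first by left; split; [lin|split=> //; lin].
    have Ux : (U01 `\` J) x by split=> //; apply/unitP; rewrite x0.
    by right; have [-> ->] := vU x Ux; exact: nu.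
  split=> x; first by move=> xS; case: (nn x) => // -[_ [_]]; rewrite ES /= (negbTE xS).
  case: (nn x) => [[/negP x0 [/negP x1 Jx]]|->//].
  by rewrite /v1 /v2 /hatv (negbTE x0) (negbTE x1) !patchE memNset ?expr0n ?addr0//= => -[].
- have sj : sqi 0 1 (fun x => v1 x * h2 x - v2 x * h1 x - th).
    have b u k0 k1 x : (forall x, (U01 `\` J) x -> `|u x| <= 1) -> `|k0| <= 1 -> `|k1| <= 1 -> `|hatv u k0 k1 x| <= 1.
      move=> ub b0 b1; rewrite /hatv; case: ifP => // _; case: ifP => // _; rewrite patchE.
      by case: ifPn => [/set_mem/ub//|_]; rewrite normr0.
    have ub x : (U01 `\` J) x -> `|u1 x| <= 1 /\ `|u2 x| <= 1.
      move=> /nu H; have s1 := sqr_ge0 (u1 x); have s2 := sqr_ge0 (u2 x).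
      by split; (rewrite -(@ler_sqr _ `|_|) ?nnegrE// real_normK ?num_real// expr1n; lin).
    apply: sqiB; last exact: sqi_cst.
    apply: sqiB; apply: (@sqiM_bnd _ _ _ _ _ 1).
    + by apply: measurable_funTS; exact: (meas_offS o1).
    + move=> x _ _; apply: b => [y /ub[]//||]; [by rewrite normr1|exact: cos_max].
    + exact: sqi_of_sq.
    + by apply: measurable_funTS; exact: (meas_offS o2).
    + move=> x _ _; apply: b => [y /ub[]//||]; [by rewrite normr0|exact: sin_max].
    + exact: sqi_of_sq.
  rewrite -int_unit; last exact: sj.2.
  have m01 := @unit_meas R.
  rewrite [RHS](_ : _ = \int[mu]_(x in U01 `\` J) ((v1 x * h2 x - v2 x * h1 x - th) ^+ 2)%:E)%E; last first.
    rewrite (@ge0_negligible_integral _ _ _ mu U01 J)//.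
    - have cJ : countable J by exact: finite_set_countable.
      exact: countable_measurable.
    - apply/measurable_EFinP; apply: measurable_funX.
      by apply: measurable_funS (sj.1) => //; exact: unit_sub.
    - by move=> x _; rewrite lee_fin sqr_ge0.
    - by apply: countable_lebesgue_measure0; apply: finite_set_countable.
  have mh (g : R -> R) : measurable_fun (U01 `\` J) g -> measurable_fun (U01 `\` J) (fun x => (g x)%:E).
    by move=> mg; exact/measurable_EFinP.
  have UJ1 : U01 `\` J `<=` U01 by move=> x [].
  have [[l1 _] [l2 _]] := l2w.
  have mw1 : measurable_fun (U01 `\` J) (weakD (U01 `\` J) (comp1 w)).
    by apply/(measurable_restrictT _ mU); exact: sg1.1.
  have mw2 : measurable_fun (U01 `\` J) (weakD (U01 `\` J) (comp2 w)).
    by apply/(measurable_restrictT _ mU); exact: sg2.1.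
  apply: ae_eq_integral => //.
  - apply: mh; apply: measurable_funX; apply: measurable_funB => //.
    by apply: measurable_funB; apply: measurable_funM => //; apply: (measurable_funS _ UJ1).
  - by apply: mh; apply: measurable_funX; apply: measurable_funS (sj.1) => // x /Usub.
  - apply: (ae_mono aev) => x Hx Ux /=; have := Hx (UJ1 x Ux); rewrite /current /comp1 /comp2 => -> /=.
    by rewrite /h1 /h2 !patchE mem_set.
Unshelve. all: by end_near. Qed.

Lemma hat_bnd alpha S v1 v2 h1 h2 : hat alpha S v1 v2 h1 h2 ->
  forall x, `|v1 x| <= 1 /\ `|v2 x| <= 1.
Proof.
move=> [_ _ [_ nv] _ _] x; have H := nv x; have s1 := sqr_ge0 (v1 x); have s2 := sqr_ge0 (v2 x).
by split; (rewrite -(@ler_sqr _ `|_|) ?nnegrE// real_normK ?num_real// expr1n; lra).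
Qed.

Lemma hat_j alpha S v1 v2 h1 h2 th : hat alpha S v1 v2 h1 h2 ->
  sqi 0 1 (fun x => v1 x * h2 x - v2 x * h1 x - th).
Proof.
move=> H; have vb := hat_bnd H; have [[ho1 ho2] [sh1 sh2] _ _ _] := H.
apply: sqiB; last exact: sqi_cst.
apply: sqiB; apply: (@sqiM_bnd _ _ _ _ _ 1).
- by apply: measurable_funTS; exact: (meas_offS ho1).
- by move=> x _ _; have [] := vb x.
- exact: sqi_of_sq.
- by apply: measurable_funTS; exact: (meas_offS ho2).
- by move=> x _ _; have [] := vb x.
- exact: sqi_of_sq.
Qed.

(* Endpoint jumps are moved to [T] and [1 - T], the map being replaced by the
   boundary datum beyond them: a whole transition profile then fits in [0, 1]. *)
Lemma hat_cut alpha S v1 v2 h1 h2 r T : hat alpha S v1 v2 h1 h2 -> uniq S ->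
  (forall z, z \in S -> 0 <= z <= 1) -> 0 < r ->
  (forall x y, x \in 0 :: 1 :: S -> y \in 0 :: 1 :: S -> x <> y -> 2 * r < `|x - y|) ->
  0 < T -> T <= r / 2 ->
  exists S' v1' v2' h1' h2', [/\ hat alpha S' v1' v2' h1' h2', uniq S', size S' = size S,
    (forall x y, x \in S' -> y \in S' -> x <> y -> 2 * r - 2 * T < `|x - y|) /\
      (forall z, z \in S' -> T <= z <= 1 - T) &
    forall x, [/\ v1' x = v1 x, v2' x = v2 x, h1' x = h1 x & h2' x = h2 x] \/
      ((x <= T \/ 1 - T <= x) /\ h1' x = 0 /\ h2' x = 0)].
Proof.
move=> H uS S01 r0 sep T00 Tr; have [[ho1 ho2] [sh1 sh2] [nv nvle] hz [vl vr]] := H.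
have r2 : 2 * r < 1.
  have := sep 0 1 (mem_head _ _) _ _; rewrite sub0r normrN normr1; apply.
    by rewrite !inE eqxx orbT.
  by move=> /esym/eqP; rewrite oner_eq0.
pose phi z : R := if z == 0 then T else if z == 1 then 1 - T else z.
have phiT z : 0 <= z <= 1 -> `|phi z - z| <= T.
  rewrite /phi; case: eqP => [->|_] _; first by rewrite subr0 gtr0_norm.
  case: eqP => [->|_]; last by rewrite subrr normr0 ltW.
  by rewrite addrAC subrr add0r normrN gtr0_norm.
pose S' := [seq phi z | z <- S].
(* Each of the two points moves by at most T. *)
have sepS z y : z \in S -> y \in S -> z <> y -> 2 * r - 2 * T < `|phi z - phi y|.
  move=> zS yS zy; have := sep z y _ _ zy; rewrite !inE zS yS !orbT => /(_ isT isT).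
  have := phiT z (S01 z zS); have := phiT y (S01 y yS).
  have -> : z - y = (phi z - phi y) - (phi z - z) + (phi y - y) by ring.
  have := ler_normD ((phi z - phi y) - (phi z - z)) (phi y - y).
  have := ler_normB (phi z - phi y) (phi z - z).
  move: `|phi z - phi y| `|phi z - z| `|phi y - y| `|_ - _ + _| `|_ - _| => y1 y2 y3 y4 y5; lra.
pose cut0 x := (0 \in S) && (x <= T); pose cut1 x := (1 \in S) && (1 - T <= x).
pose cutf (k0 k1 : R) (f : R -> R) x := if cut0 x then k0 else if cut1 x then k1 else f x.
have S0' : 0 \in S -> T \in S' by move=> zS; apply/mapP; exists 0 => //; rewrite /phi eqxx.
have S1' : 1 \in S -> 1 - T \in S' by move=> zS; apply/mapP; exists 1 => //; rewrite /phi oner_eq0 eqxx.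
have Sz z : z \in S -> z != 0 -> z != 1 -> z \in S'.
  by move=> zS z0 z1; apply/mapP; exists z => //; rewrite /phi (negbTE z0) (negbTE z1).
have notS x : x \notin S' -> ~~ cut0 x -> ~~ cut1 x -> x \notin S.
  move=> xS' c0 c1; apply/negP => xS; move: xS'; apply/negP; rewrite negbK; apply: Sz => //.
    by apply/eqP => x0; move: c0; rewrite /cut0 -x0 xS x0/= ltW.
  by apply/eqP => x1; move: c1; rewrite /cut1 -x1 xS x1/=; apply/negP; rewrite negbK; lra.
have off v h k0 k1 : offS S v h -> offS S' (cutf k0 k1 v) (cutf 0 0 h).
  move=> o a b Hab; case: (leP a b) => [ab|/prim_gt//].
  case: (boolP (cut0 a)) => [/andP[zS aT]|c0].
    have bT : b < T by rewrite ltNge; apply/negP => Tb; have := Hab T; rewrite aT Tb => /(_ isT); rewrite S0'.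
    by apply: (prim_ext (prim_cst a b k0)) => x ax xb; rewrite /cutf /cut0 zS (le_trans xb (ltW bT)).
  case: (boolP (cut1 b)) => [/andP[zS bT]|c1].
    have aT : 1 - T < a by rewrite ltNge; apply/negP => Ta; have := Hab (1 - T); rewrite Ta bT => /(_ isT); rewrite S1'.
    have cc x : a <= x -> cut0 x = false /\ cut1 x = true.
      move=> ax; rewrite /cut0 /cut1 zS; split; last by rewrite /= (le_trans (ltW aT)).
      by apply/negbTE; rewrite negb_and -ltNge; apply/orP; right; lra.
    by apply: (prim_ext (prim_cst a b k1)) => x ax xb; rewrite /cutf; have [-> ->] := cc x ax.
  have cc x : a <= x -> x <= b -> ~~ cut0 x /\ ~~ cut1 x.
    move=> ax xb; rewrite /cut0 /cut1; split.
      by apply: contraNN c0; rewrite /cut0 => /andP[-> xT]; rewrite (le_trans ax).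
    by apply: contraNN c1; rewrite /cut1 => /andP[-> xT]; rewrite (le_trans xT).
  apply: (prim_ext (o a b _)) => x.
  - by move=> /andP[ax xb]; have [d0 d1] := cc x ax xb; apply: notS => //; apply: Hab; rewrite ax.
  - by move=> ax xb; have [d0 d1] := cc x ax xb; rewrite /cutf (negbTE d0) (negbTE d1).
  - by move=> ax xb; have [d0 d1] := cc x ax xb; rewrite /cutf (negbTE d0) (negbTE d1).
pose Bs := [set x | cut0 x] `|` [set x | cut1 x].
have mB : measurable (~` Bs).
  apply: measurableC; apply: measurableU.
    rewrite /cut0; case: (0 \in S) => /=; last by rewrite (_ : [set _ | _] = set0)//; apply/seteqP; split.
    by rewrite (_ : [set _ | _] = `]-oo, T]%classic)//; apply/seteqP; split=> x /=; rewrite in_itv.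
  rewrite /cut1; case: (1 \in S) => /=; last by rewrite (_ : [set _ | _] = set0)//; apply/seteqP; split.
  by rewrite (_ : [set _ | _] = `[1 - T, +oo[%classic)//; apply/seteqP; split=> x /=; rewrite in_itv/= andbT.
have sqc h : sq h -> sq (cutf 0 0 h).
  move=> sh; have -> : cutf 0 0 h = h \_ (~` Bs).
    apply/funext => x; rewrite /cutf patchE; case: ifPn => c0.
      by rewrite memNset//= => nB; apply: nB; left.
    case: ifPn => c1; first by rewrite memNset//= => nB; apply: nB; right.
    by rewrite mem_set//= => -[|]; exact/negP.
  by apply: sq_patch => //; exact: sq_L2.
have T2 : T < 1 - T by lra.
exists S', (cutf 1 (cos alpha) v1), (cutf 0 (sin alpha) v2), (cutf 0 0 h1), (cutf 0 0 h2); split.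
- split.
  + by split; exact: off.
  + by split; exact: sqc.
  + split=> x.
      move=> xS; rewrite /cutf; case: ifPn => c0; first by rewrite expr1n expr0n addr0.
      by case: ifPn => c1; [exact: cos2Dsin2|apply: nv; exact: notS].
    rewrite /cutf; case: ifPn => c0; first by rewrite expr1n expr0n addr0.
    by case: ifPn => c1; [rewrite cos2Dsin2|exact: nvle].
  + by move=> x /hz[e1 e2]; rewrite /cutf; case: ifP => // _; case: ifP.
  + split=> x hx; rewrite /cutf.
      have -> : cut1 x = false by apply/negbTE; rewrite negb_and -ltNge; apply/orP; right; lra.
      by case: ifP => // _; exact: vl.
    have -> : cut0 x = false by apply/negbTE; rewrite negb_and -ltNge; apply/orP; right; lra.
    by case: ifP => // _; exact: vr.
- rewrite map_inj_in_uniq// => z y zS yS E; apply/eqP/negPn/negP => /eqP zy.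
  by have := sepS z y zS yS zy; rewrite E subrr normr0; lra.
- by rewrite size_map.
- split.
    move=> x y /mapP[z zS ->] /mapP[u uS' ->] zu; apply: sepS => // E; apply: zu; by rewrite E.
  move=> x /mapP[z zS ->]; rewrite /phi; case: eqP => [_|z0]; first by rewrite lexx ltW.
  case: eqP => [_|z1]; first by rewrite lexx ltW.
  have /andP[h3 h4] := S01 z zS.
  have zS3 : z \in [:: 0, 1 & S] by rewrite !inE zS !orbT.
  have h1S : 1 \in [:: 0, 1 & S] by rewrite !inE eqxx orbT.
  have := sep z 0 zS3 (mem_head _ _) z0; have h5 := sep z 1 zS3 h1S z1.
  rewrite subr0 ger0_norm// => h6; rewrite distrC ger0_norm in h5; last lra.
  by apply/andP; split; lra.
- move=> x; rewrite /cutf; case: ifPn => [/andP[_ c0]|_]; first by right; split; [left|].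
  by case: ifPn => [/andP[_ c1]|_]; [right; split; [right|]|left].
Qed.

(** The bound of [eb_I] with eta = sqrt eps and plateau half-width kp = eps^2, for which kp / (2
    eps) = eps / 2 is negligible. It tends to n times 2 sqrt 2 / 3 as eps goes to 0. *)
Definition cost (n : nat) (eps : R) : R :=
  n%:R * (Num.sqrt 2 * ((1 + Num.sqrt eps) ^+ 2 - 3^-1) + eps / 2).

(** The construction depends on eps alone, while the energy bound holds for every [dl]; hence [dl]
    can be sent to 0 after eps. The terms in sqrt eps account for the cut near the endpoints. *)
Lemma recovery_step alpha S v1 v2 h1 h2 : hat alpha S v1 v2 h1 h2 -> uniq S ->
  (forall z, z \in S -> 0 <= z <= 1) ->
  exists2 e0, 0 < e0 & forall eps, 0 < eps -> eps < e0 ->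
  exists p1 p2 q1 q2, [/\ pdata alpha p1 p2 q1 q2,
    forall L kap tN th dl : R, 0 < L -> 0 < dl -> 2 * L * eps * (1 + dl^-1) * tN ^+ 2 <= dl ->
      I 0 1 (dens L eps kap tN p1 p2 q1 q2) <= (1 + dl) * cost (size S) eps
   + ((1 + dl) ^+ 2 * (L / 2) * (I 0 1 (fun x => (v1 x * h2 x - v2 x * h1 x - th) ^+ 2) + th ^+ 2 * (12 * Num.sqrt eps))
   + (eps * (1 + dl^-1) * (I 0 1 (fun x => h1 x ^+ 2 + h2 x ^+ 2) + kap ^+ 2)
   + L / 2 * (1 + dl) * (1 + dl^-1) * (th - (tN - kap)) ^+ 2)) &
    I 0 1 (fun x => (p1 x - v1 x) ^+ 2 + (p2 x - v2 x) ^+ 2) <=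
      8 * eps * cost (size S) eps + 96 * Num.sqrt eps].
Proof.
move=> H uS S01; have [r r0 sep] := separation (0 :: 1 :: S).
have r2 : 2 * r < 1.
  have := sep 0 1 (mem_head _ _) _ _; rewrite sub0r normrN normr1; apply.
    by rewrite !inE eqxx orbT.
  by move=> /esym/eqP; rewrite oner_eq0.
(* Below this threshold sqrt eps < r / 12, so T <= 6 sqrt eps <= r / 2 as [hat_cut] requires. *)
exists ((r / 12) ^+ 2); first by rewrite exprn_gt0// divr_gt0.
move=> eps eps0 epsr; set s := Num.sqrt eps.
have s0 : 0 < s by rewrite sqrtr_gt0.
have ss : s ^+ 2 = eps by rewrite sqr_sqrtr// ltW.
have sr : s < r / 12.
  by rewrite -(@ltr_sqr _ s) ?nnegrE ?(ltW s0) ?ss// divr_ge0// ltW.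
have s1 : s <= 1 by lra.
have kp0 : 0 < eps ^+ 2 by rewrite exprn_gt0.
have t0 := T0_gt0 eps0 s0; have t1 := T0_le eps0 s0.
(* Twice the half-width of a transition, so that one centred at T or 1 - T stays strictly inside (0,
   1). *)
pose T := 2 * (eps ^+ 2 + T0 eps s).
have e2s : eps ^+ 2 <= s.
  rewrite -ss -exprM/=; have -> : s ^+ (2 * 2) = s * s ^+ 3 by rewrite -exprS.
  by rewrite ler_piMr ?(ltW s0)// exprn_ile1// ltW.
have es : 2 * eps / s = 2 * s by rewrite -ss; field; rewrite gt_eqF.
have T6 : T <= 6 * s by rewrite /T; rewrite es in t1; lra.
have T00 : 0 < T by rewrite /T; lra.
have Tr : T <= r / 2 by lra.
have [S' [v1' [v2' [h1' [h2' [H' uS' sS' [sepS' S'T] near]]]]]] := hat_cut H uS S01 r0 sep T00 Tr.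
have vb := hat_bnd H; have vb' := hat_bnd H'.
have [[ho1 ho2] [sh1 sh2] [nv nvle] hz [vl vr]] := H'.
have [_ [sh1o sh2o] [_ nvleo] _ _] := H.
have sepW x y : x \in S' -> y \in S' -> x <> y -> 2 * (eps ^+ 2 + T0 eps s) < `|x - y|.
  by move=> xS yS xy; have := sepS' x y xS yS xy; rewrite -/T; lra.
have inW z : z \in S' -> eps ^+ 2 + T0 eps s < z < 1 - (eps ^+ 2 + T0 eps s).
  by move=> /S'T; rewrite /T => /andP[? ?]; apply/andP; split; lra.
have mv1 := meas_offS ho1; have mv2 := meas_offS ho2.
have ve : v1' 1 = cos alpha /\ v2' 1 = sin alpha by exact: vr.
have v0 : v1' 0 = 1 /\ v2' 0 = 0 by exact: vl.
have PD := rec_pdata (kp := eps ^+ 2) eps0 s0 kp0 uS' sepW inW ho1 ho2 sh1 sh2 mv1 mv2 nvle hz v0 ve.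
have RI := rec_I (kp := eps ^+ 2) eps0 s0 kp0 uS' sepW inW ho1 ho2 sh1 sh2 mv1 mv2 nv nvle hz v0 ve.
have RD := rec_dist (kp := eps ^+ 2) eps0 s0 kp0 uS' sepW mv1 mv2 nvle.
have kE : eps ^+ 2 / (2 * eps) = eps / 2 by field; rewrite gt_eqF.
rewrite kE sS' -/(cost (size S) eps) in RD.
(* The cut modifies the map only on two end strips of total length 2 T <= 12 sqrt eps. It is applied
   with C = th^2 for the phase term, as v' = 0 there, and with C = 4 for the squared distance of two
   maps of modulus at most 1. *)
have ind (f g : R -> R) C : 0 <= C -> integ `[0, 1] f -> integ `[0, 1] g ->
    (forall x, f x = g x \/ ((x <= T \/ 1 - T <= x) /\ f x <= g x + C)) ->
    I 0 1 f <= I 0 1 g + C * (12 * s).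
  move=> C0 fi gi Hfg.
  pose k x : R := \1_(`[0, T]) x + \1_(`[(1 - T), 1]) x.
  have ik : integ `[0, 1] k by apply: integD => //; exact: integ_indic.
  apply: (@le_trans _ _ (I 0 1 (fun x => g x + C * k x))).
    apply: I_le => //; first by apply: integD => //; exact: integZ.
    move=> x x0 x1; have k0 : 0 <= k x by rewrite /k addr_ge0// indicE; case: (_ \in _).
    case: (Hfg x) => [->|[hx]]; first by rewrite lerDl mulr_ge0.
    move/le_trans; apply; rewrite lerD2l ler_peMr// /k.
    by case: hx => hx; [rewrite indicT ?lerDl//|rewrite addrC indicT ?lerDl//]; rewrite indicE; case: (_ \in _).
  rewrite ID//; last exact: integZ.
  rewrite IZ// lerD2l ler_wpM2l// ID; [|exact: integ_indic|exact: integ_indic].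
  have := I_indic (ltW T00); have := @I_indic R (1 - T) 1 ltac:(lra); lra.
exists (fun x => rho eps s (eps ^+ 2) S' x * v1' x), (fun x => rho eps s (eps ^+ 2) S' x * v2' x).
exists (fun x => drho eps s (eps ^+ 2) S' x * v1' x + rho eps s (eps ^+ 2) S' x * h1' x).
exists (fun x => drho eps s (eps ^+ 2) S' x * v2' x + rho eps s (eps ^+ 2) S' x * h2' x).
split=> //.
- move=> L kap tN th dl L0 d0 small; apply: (le_trans (RI L kap tN th dl L0 d0 small)).
  rewrite kE sS' -/(cost (size S) eps) lerD2l.
  have i0 : 0 < dl^-1 by rewrite invr_gt0.
  apply: lerD.
    have K0 : 0 <= (1 + dl) ^+ 2 * (L / 2).
      by apply: mulr_ge0; [exact: sqr_ge0|rewrite divr_ge0// ltW].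
    apply: ler_wpM2l => //; apply: ind; [exact: sqr_ge0|exact: (hat_j th H').2|exact: (hat_j th H).2|].
    move=> x; case: (near x) => [[-> -> -> ->]|[hx [-> ->]]]; [by left|right; split=> //].
    by rewrite !mulr0 subrr sub0r sqrrN lerDr sqr_ge0.
  rewrite lerD2r ler_wpM2l ?mulr_ge0 ?addr_ge0 ?(ltW eps0) ?(ltW i0)// lerD2r.
  apply: I_le.
  + by apply: integD => //; [exact: (sqi_of_sq 0 1 sh1).2|exact: (sqi_of_sq 0 1 sh2).2].
  + by apply: integD => //; [exact: (sqi_of_sq 0 1 sh1o).2|exact: (sqi_of_sq 0 1 sh2o).2].
  + move=> x _ _; case: (near x) => [[_ _ -> ->]//|[_ [-> ->]]].
    by rewrite expr0n/= addr0 addr_ge0 ?sqr_ge0.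
- have sp (i : bool) : sqi 0 1 (fun x => rho eps s (eps ^+ 2) S' x * (if i then v1' x else v2' x)).
    have [[P1 P2] _ _ _ _] := PD; case: i; [exact: prim_sqi (P1 0 1)|exact: prim_sqi (P2 0 1)].
  have sv (v : R -> R) : measurable_fun setT v -> (forall x, `|v x| <= 1) -> sqi 0 1 v.
    move=> mv b; have := @sqiM_bnd R 0 1 v (fun=> 1) 1 (measurable_funTS mv) (fun x _ _ => b x) (sqi_cst 0 1 1).
    by move/sqi_ext; apply => x; rewrite mulr1.
  have [[ho1o ho2o] _ _ _ _] := H.
  have sv1 := sv _ (meas_offS ho1o) (fun x => (vb x).1); have sv2 := sv _ (meas_offS ho2o) (fun x => (vb x).2).
  have sv1' := sv _ mv1 (fun x => (vb' x).1); have sv2' := sv _ mv2 (fun x => (vb' x).2).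
  have i1 : integ `[0, 1] (fun x => (rho eps s (eps ^+ 2) S' x * v1' x - v1' x) ^+ 2 + (rho eps s (eps ^+ 2) S' x * v2' x - v2' x) ^+ 2).
    by apply: integD => //; [exact: (sqiB (sp true) sv1').2|exact: (sqiB (sp false) sv2').2].
  have i2 : integ `[0, 1] (fun x => (v1' x - v1 x) ^+ 2 + (v2' x - v2 x) ^+ 2).
    by apply: integD => //; [exact: (sqiB sv1' sv1).2|exact: (sqiB sv2' sv2).2].
  have B2 : I 0 1 (fun x => (v1' x - v1 x) ^+ 2 + (v2' x - v2 x) ^+ 2) <= 4 * (12 * s).
    have z01 : I 0 1 (fun=> 0 : R) = 0 by rewrite I_cst// mul0r.
    rewrite -[leRHS]add0r -[X in X + _]z01; apply: ind => //; first exact: integ_cst.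
    move=> x.
    case: (near x) => [[-> -> _ _]|[hx _]]; [by left; rewrite !subrr expr0n/= addr0|right; split=> //].
    rewrite add0r; have n1 := nvle x; have n2 := nvleo x.
    have y1 := @young R 1 (v1' x) (- v1 x) ltr01; have y2 := @young R 1 (v2' x) (- v2 x) ltr01.
    by rewrite invr1 sqrrN in y1; rewrite invr1 sqrrN in y2; lra.
  apply: (@le_trans _ _ (I 0 1 (fun x => 2 * ((rho eps s (eps ^+ 2) S' x * v1' x - v1' x) ^+ 2 + (rho eps s (eps ^+ 2) S' x * v2' x - v2' x) ^+ 2)
     + 2 * ((v1' x - v1 x) ^+ 2 + (v2' x - v2 x) ^+ 2)))).
    apply: I_le; last first.
    + move=> x _ _.
      have y1 := @young R 1 (rho eps s (eps ^+ 2) S' x * v1' x - v1' x) (v1' x - v1 x) ltr01.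
      have y2 := @young R 1 (rho eps s (eps ^+ 2) S' x * v2' x - v2' x) (v2' x - v2 x) ltr01.
      rewrite invr1 subrKA in y1; rewrite invr1 subrKA in y2; lra.
    + by apply: integD => //; exact: integZ.
    + by apply: integD => //; [exact: (sqiB (sp true) sv1).2|exact: (sqiB (sp false) sv2).2].
  rewrite ID; [|exact: integZ|exact: integZ].
  by rewrite IZ// IZ//; lra.
Qed.

End Hat.

(** * The two inequalities combined *)

Section Gamma.
Context {R : realType}.
Local Notation mu := (@lebesgue_measure R).
Local Notation U01 := (@unit_interval R).
Implicit Types (w : R -> R * R).

Lemma near_lt_limn_einf (u : nat -> \bar R) (m : \bar R) : (m < limn_einf u)%E ->
  \forall n \near \oo, (m <= u n)%E.
Proof.
move=> mu_; apply: contrapT => /not_near H; move: mu_; rewrite ltNge => /negP; apply.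
rewrite limn_einf_lim; apply: lime_le; first exact: is_cvg_einfs.
apply: nearW => n; have [k nk hk] := H n.
apply: (@le_trans _ _ (u k)); first by apply: ereal_inf_lbound; exists k.
by move/negP: hk; rewrite -ltNge => /ltW.
Qed.

Variables (L alpha beta A : R) (eps : nat -> R).
Hypotheses (L_gt0 : 0 < L) (beta_gt0 : 0 < beta) (beta_lt : beta < 1 / 2)
  (eps_gt0 : forall l, 0 < eps l) (eps_cvg : eps @ \oo --> (0 : R))
  (A_cvg : (fun l => eps l `^ (- beta) - (Num.floor (eps l `^ (- beta)))%:~R) @ \oo --> A).

Let th := 2 * pi * A.
Let s n := Num.sqrt (eps n).
Let kap n := 2 * pi * (Num.floor (eps n `^ (- beta)))%:~R : R.
Let tN n := 2 * pi * eps n `^ (- beta) : R.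

Let s_cvg : s @ \oo --> (0 : R).
Proof. by rewrite -(@sqrtr0 R); apply: (cvg_comp _ _ eps_cvg); exact: sqrt_continuous. Qed.
Let s2 n : s n ^+ 2 = eps n.
Proof. by rewrite sqr_sqrtr// ltW. Qed.
Let ks_cvg : (fun n => kap n * s n) @ \oo --> (0 : R).
Proof. exact: kap_cvg. Qed.
Let dt_cvg : (fun n => tN n - kap n) @ \oo --> th.
Proof.
have -> : (fun n => tN n - kap n) = (fun n => 2 * pi * (eps n `^ (- beta) - (Num.floor (eps n `^ (- beta)))%:~R)).
  by apply/funext => n; rewrite /tN /kap; ring.
by apply: cvgM => //; exact: cvg_cst.
Qed.

(** Makes the smallness condition of [rec_dens] hold eventually for each fixed [dl]: tN differs from
    kap by a convergent amount, and kap sqrt eps tends to 0. *)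
Let ts_cvg : (fun n => (tN n * s n) ^+ 2) @ \oo --> (0 : R).
Proof.
have -> : (0 : R) = 0 ^+ 2 by rewrite expr0n.
apply: cvg_expr2.
have -> : (fun n => tN n * s n) = (fun n => kap n * s n + (tN n - kap n) * s n).
  by apply/funext => n; ring.
rewrite -[X in _ --> X](addr0 0) -[X in _ --> _ + X](mulr0 th).
by apply: cvgD => //; exact: cvgM.
Qed.

Let cost_cvg m : (fun n => cost m (eps n)) @ \oo --> m%:R * (Num.sqrt 2 * (1 - 3^-1)).
Proof.
rewrite /cost; apply: cvgM; first exact: cvg_cst.
have -> : Num.sqrt 2 * (1 - 3^-1) = Num.sqrt 2 * ((1 + 0) ^+ 2 - 3^-1) + 0 / 2 :> R.
  by rewrite addr0 expr1n mul0r addr0.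
apply: cvgD; last by apply: cvgM => //; exact: cvg_cst.
apply: cvgM; first exact: cvg_cst.
apply: cvgB; last exact: cvg_cst.
by apply: cvg_expr2; apply: cvgD => //; exact: cvg_cst.
Qed.

Let bound_cvg m (dl Ij H : R) : (fun n => (1 + dl) * cost m (eps n)
   + ((1 + dl) ^+ 2 * (L / 2) * (Ij + th ^+ 2 * (12 * s n))
   + (eps n * (1 + dl^-1) * (H + kap n ^+ 2)
   + L / 2 * (1 + dl) * (1 + dl^-1) * (th - (tN n - kap n)) ^+ 2))) @ \oo -->
  (1 + dl) * (m%:R * (Num.sqrt 2 * (1 - 3^-1))) + (1 + dl) ^+ 2 * (L / 2) * Ij.
Proof.
apply: cvgD; first by apply: cvgM => //; exact: cvg_cst.
rewrite -[X in _ --> X]addr0; apply: cvgD.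
  apply: cvgM; first exact: cvg_cst.
  rewrite -[X in _ --> X]addr0; apply: cvgD; first exact: cvg_cst.
  rewrite -[X in _ --> X](mulr0 (th ^+ 2)); apply: cvgM; first exact: cvg_cst.
  by rewrite -[X in _ --> X](mulr0 12); apply: cvgM => //; exact: cvg_cst.
rewrite -[X in _ --> X]addr0; apply: cvgD.
  have -> : (fun n => eps n * (1 + dl^-1) * (H + kap n ^+ 2)) =
     (fun n => (1 + dl^-1) * (s n ^+ 2 * H + (kap n * s n) ^+ 2)).
    by apply/funext => n; rewrite -s2; ring.
  rewrite -[X in _ --> X](mulr0 (1 + dl^-1)); apply: cvgM; first exact: cvg_cst.
  have -> : (0 : R) = 0 ^+ 2 * H + 0 ^+ 2 by rewrite expr0n/= mul0r addr0.
  apply: cvgD; last exact: cvg_expr2.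
  by apply: cvgM; [exact: cvg_expr2|exact: cvg_cst].
rewrite -[X in _ --> X](mulr0 (L / 2 * (1 + dl) * (1 + dl^-1))).
apply: cvgM; first exact: cvg_cst.
have -> : (0 : R) = (th - th) ^+ 2 by rewrite subrr expr0n.
apply: cvg_expr2; apply: cvgB => //; exact: cvg_cst.
Qed.

Let dist_cvg m : (fun n => 8 * eps n * cost m (eps n) + 96 * s n) @ \oo --> (0 : R).
Proof.
have -> : (0 : R) = 8 * 0 * (m%:R * (Num.sqrt 2 * (1 - 3^-1))) + 96 * 0 by rewrite !mulr0 mul0r addr0.
apply: cvgD; last by apply: cvgM => //; exact: cvg_cst.
by apply: cvgM => //; apply: cvgM => //; exact: cvg_cst.
Qed.

(** The liminf inequality already bounds the energies from below, so only an upper bound along the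
    constructed sequence is proved. *)
Lemma gamma_recovery w : L2_plane U01 w -> exists wn : nat -> R -> R * R,
  [/\ forall n, L2_plane U01 (wn n), cvg_L2 U01 wn w &
      (fun n => F_energy L alpha beta (eps n) (wn n)) @ \oo --> E_energy L alpha A w].
Proof.
move=> lw; have mU := @unit_meas R.
have liminf wn := @gamma_liminf R L alpha beta A eps L_gt0 beta_gt0 beta_lt eps_gt0 eps_cvg A_cvg wn w.
case: (pselect (exists J, jump_set alpha w J)) => [exJ|nJ]; last first.
  have EE : E_energy L alpha A w = +oo%E by rewrite /E_energy asboolF.
  have cw : cvg_L2 U01 (fun=> w) w.
    rewrite /cvg_L2 (_ : (fun n => _) = fun=> 0%E); first exact: cvg_cst.
    apply/funext => n; apply: integral0_eq => x _.
    by rewrite subrr /sqnorm/= expr0n addr0.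
  (* When the limit energy is infinite, the liminf inequality forces the energies of any
     approximating sequence to diverge, so the constant one serves. *)
  exists (fun=> w); split=> //.
  have := liminf (fun=> w) (fun=> lw) lw cw; rewrite EE leye_eq => /eqP Ey.
  apply/cvgeyPge => M; apply: near_lt_limn_einf; rewrite Ey; exact: ltry.
have [J jJ] : exists J, J = xget set0 (jump_set alpha w) /\ jump_set alpha w J.
  have [J0 hJ0] := exJ; exists (xget set0 (jump_set alpha w)); split=> //.
  exact: (xgetPex _ (ex_intro _ J0 hJ0)).
have [EJ {}jJ] := jJ.
have [S [v1 [v2 [h1 [h2 [uS JS H aew Ecur]]]]]] := hat_base A lw jJ.
set Ij := I 0 1 _ in Ecur.
pose K := 2 * Num.sqrt 2 / 3 : R.
have Ij0 : 0 <= Ij by apply: I_ge0 => x _ _; exact: sqr_ge0.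
have [[fJ J01] _ _ _ _] := jJ.
have EE : E_energy L alpha A w = (L / 2 * Ij + K * (size S)%:R)%:E.
  rewrite /E_energy asboolT// -EJ Ecur -EFinM EFinD; congr (_ + _)%E.
  rewrite (EFinM K); congr (_ * _)%E; apply/eqP; rewrite eq_le.
  rewrite (counting_le (D := S)) ?JS//= /counting asboolT; last by rewrite -JS.
  rewrite lee_fin ler_nat; apply: uniq_leq_size => // x xS.
  by rewrite in_fset_set ?inE// -JS.
set E0 := L / 2 * Ij + _ in EE.
have E00 : 0 <= E0.
  by rewrite addr_ge0// mulr_ge0// ?divr_ge0 ?mulr_ge0 ?sqrtr_ge0// ltW.
have S01 z : z \in S -> 0 <= z <= 1.
  by move=> zS; have := J01 z; rewrite JS => /(_ zS); rewrite /= in_itv.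
have [e0 e00 step] := recovery_step H uS S01.
(* The construction starts once eps is below [e0]; the finitely many earlier terms are filled with
   [w]. *)
have ch n : exists w', L2_plane U01 w' /\ (eps n < e0 -> exists p1 p2 q1 q2,
   [/\ w' = (fun x => (p1 x, p2 x)), pdata alpha p1 p2 q1 q2,
     forall L kap tN th dl : R, 0 < L -> 0 < dl -> 2 * L * eps n * (1 + dl^-1) * tN ^+ 2 <= dl ->
      I 0 1 (dens L (eps n) kap tN p1 p2 q1 q2) <= (1 + dl) * cost (size S) (eps n)
   + ((1 + dl) ^+ 2 * (L / 2) * (I 0 1 (fun x => (v1 x * h2 x - v2 x * h1 x - th) ^+ 2) + th ^+ 2 * (12 * Num.sqrt (eps n)))
   + (eps n * (1 + dl^-1) * (I 0 1 (fun x => h1 x ^+ 2 + h2 x ^+ 2) + kap ^+ 2)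
   + L / 2 * (1 + dl) * (1 + dl^-1) * (th - (tN - kap)) ^+ 2)) &
    I 0 1 (fun x => (p1 x - v1 x) ^+ 2 + (p2 x - v2 x) ^+ 2) <=
      8 * eps n * cost (size S) (eps n) + 96 * Num.sqrt (eps n)]).
  case: (ltP (eps n) e0) => he; last by exists w.
  have [p1 [p2 [q1 [q2 [pd B1 B2]]]]] := step _ (eps_gt0 n) he.
  have [[P1 P2] _ _ _ _] := pd.
  exists (fun x => (p1 x, p2 x)); split; last by exists p1, p2, q1, q2.
  have key p : sqi 0 1 p -> L2 U01 p.
    move=> [mp ip]; have U01' := @unit_sub R; apply: sqr_L2; first exact: (measurable_funS (measurable_itv _) U01' mp).
    exact: (integS mU (measurable_itv _) U01' ip).
  by split; apply: key; [exact: prim_sqi (P1 0 1)|exact: prim_sqi (P2 0 1)].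
have [wn Hwn] := choice ch.
have lwn n : L2_plane U01 (wn n) := (Hwn n).1.
have Ne : \forall n \near \oo, eps n < e0.
  move/cvgrPdist_lt/(_ _ e00): eps_cvg; apply: filterS => n.
  by rewrite sub0r normrN; apply: le_lt_trans; exact: ler_norm.
have cw : cvg_L2 U01 wn w.
  apply: (@squeeze_cvge _ _ _ _ (fun=> 0%E) _ (fun n => (8 * eps n * cost (size S) (eps n) + 96 * s n)%:E)).
  - apply: filterS Ne => n en; apply/andP; split.
      by apply: integral_ge0 => x _; rewrite lee_fin /sqnorm addr_ge0 ?sqr_ge0.
    have [p1 [p2 [q1 [q2 [Ew pd _ B2]]]]] := (Hwn n).2 en.
    apply: le_trans (_ : ((I 0 1 (fun x => (p1 x - v1 x) ^+ 2 + (p2 x - v2 x) ^+ 2))%:E <= _)%E); last by rewrite lee_fin.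
    have [[P1 P2] _ _ _ _] := pd.
    have vb := hat_bnd H; have [[ho1 ho2] _ _ _ _] := H.
    have sv (v : R -> R) : measurable_fun setT v -> (forall x, `|v x| <= 1) -> sqi 0 1 v.
      move=> mv b; have := @sqiM_bnd R 0 1 v (fun=> 1) 1 (measurable_funTS mv) (fun x _ _ => b x) (sqi_cst 0 1 1).
      by move/sqi_ext; apply => x; rewrite mulr1.
    have sv1 := sv _ (meas_offS ho1) (fun x => (vb x).1); have sv2 := sv _ (meas_offS ho2) (fun x => (vb x).2).
    have iD : integ `[0, 1] (fun x => (p1 x - v1 x) ^+ 2 + (p2 x - v2 x) ^+ 2).
      by apply: integD => //; [exact: (sqiB (prim_sqi (P1 0 1)) sv1).2|exact: (sqiB (prim_sqi (P2 0 1)) sv2).2].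
    rewrite -int_unit//.
    apply: ae_ge0_le_integral => //.
    + by move=> x _; rewrite lee_fin /sqnorm addr_ge0 ?sqr_ge0.
    + have [[m1 _] [m2 _]] := lwn n; have [[m3 _] [m4 _]] := lw.
      apply/measurable_EFinP; rewrite /sqnorm.
      by apply: measurable_funD; apply: measurable_funX; apply: measurable_funB.
    + by move=> x _; rewrite lee_fin addr_ge0 ?sqr_ge0.
    + by apply/measurable_EFinP; apply: measurable_funS (integ_meas iD) => //; exact: unit_sub.
    + by apply: (ae_mono aew) => x Hx Ux; rewrite Ew Hx// /sqnorm.
  - exact: cvg_cst.
  - by apply/cvg_EFin; [exact: nearW|exact: dist_cvg].
exists wn; split=> //.
have up e : 0 < e -> \forall n \near \oo, (F_energy L alpha beta (eps n) (wn n) <= (E0 + e)%:E)%E.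
  (* For dl < 1 the factors 1 + dl and (1 + dl)^2 are at most 1 + 3 dl, so the limit of the bounds
     is at most E0 + 3 dl E0 < E0 + e. *)
  move=> ep; have e3 : 0 < e / (3 * E0 + 1) by rewrite divr_gt0//; lra.
  have [dl [d0 d1 de]] := small2 ltr01 e3.
  have i0 : 0 < dl^-1 by rewrite invr_gt0.
  have lt : (1 + dl) * ((size S)%:R * (Num.sqrt 2 * (1 - 3^-1))) + (1 + dl) ^+ 2 * (L / 2) * Ij < E0 + e.
    have a0 : 0 <= K * (size S)%:R by rewrite !mulr_ge0 ?sqrtr_ge0// invr_ge0.
    have b0 : 0 <= L / 2 * Ij by rewrite mulr_ge0 ?divr_ge0// ltW.
    have -> : (size S)%:R * (Num.sqrt 2 * (1 - 3^-1)) = K * (size S)%:R by rewrite /K; field.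
    have h3 : dl * (3 * E0 + 1) < e by rewrite -ltr_pdivlMr//; lra.
    have dd : dl ^+ 2 <= dl by rewrite expr2 ler_piMl// ltW.
    rewrite -mulrA; move: a0 b0 h3; rewrite /E0; move: (K * _) (L / 2 * Ij) => x y x0 y0 h3.
    have k1 : (1 + dl) * x <= x + 3 * dl * x.
      by rewrite mulrDl mul1r lerD2l ler_wpM2r//; lra.
    have k2 : (1 + dl) ^+ 2 * y <= y + 3 * dl * y.
      have -> : (1 + dl) ^+ 2 = 1 + (2 * dl + dl ^+ 2) by ring.
      by rewrite mulrDl mul1r lerD2l ler_wpM2r//; lra.
    have -> : y + x + e = (x + 3 * dl * x) + (y + 3 * dl * y) + (e - dl * (3 * (y + x) + 1)) + dl by ring.
    lra.
  have c0 : (fun n => 2 * L * (1 + dl^-1) * (tN n * s n) ^+ 2) @ \oo --> (0 : R).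
    by rewrite -[X in _ --> X](mulr0 (2 * L * (1 + dl^-1))); apply: cvgM => //; exact: cvg_cst.
  have N1 := cvgr_lt _ (@bound_cvg (size S) dl Ij (I 0 1 (fun x => h1 x ^+ 2 + h2 x ^+ 2))) _ lt.
  have N2 := cvgr_lt _ c0 _ d0.
  near=> n.
  have en : eps n < e0 by near: n.
  have [p1 [p2 [q1 [q2 [Ew pd B1 _]]]]] := (Hwn n).2 en.
  rewrite (F_formula _ _ _ pd (lwn n)); last by apply: aeW => x _; rewrite Ew.
  rewrite lee_fin; apply: (le_trans (B1 L (kap n) (tN n) th dl L_gt0 d0 _)); last first.
    by apply: ltW; near: n; exact: N1.
  have -> : 2 * L * eps n * (1 + dl^-1) * tN n ^+ 2 = 2 * L * (1 + dl^-1) * (tN n * s n) ^+ 2.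
    by rewrite -s2; ring.
  by apply: ltW; near: n; exact: N2.
rewrite EE; apply/fine_cvgP; split.
  apply: filterS (up 1 ltr01) => n h; rewrite ge0_fin_numE; last exact: F_ge0.
  exact: le_lt_trans h (ltry _).
apply/cvgrPdist_le => e ep.
have low := liminf wn lwn lw cw.
have N1 : \forall n \near \oo, ((E0 - e)%:E <= F_energy L alpha beta (eps n) (wn n))%E.
  by apply: near_lt_limn_einf; apply: lt_le_trans low; rewrite EE lte_fin; lra.
apply: filterS2 N1 (up e ep) => n.
have F0 := @F_ge0 R L alpha beta (eps n) (wn n) L_gt0 (eps_gt0 n).
rewrite /=; case: (F_energy _ _ _ _ _) F0 => [r||]//= _; rewrite !lee_fin => r1 r2.
by rewrite ler_norml; apply/andP; split; lra.
Unshelve. all: by end_near. Qed.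

End Gamma.

Theorem theorem5p3 (R : realType) (L alpha beta A : R) (eps : nat -> R)
  (L_gt0 : 0 < L) (alpha_ge0 : 0 <= alpha) (alpha_lt : alpha < 2 * pi)
  (beta_gt0 : 0 < beta) (beta_lt : beta < 1 / 2)
  (A_ge0 : 0 <= A) (A_le1 : A <= 1)
  (eps_gt0 : forall l, 0 < eps l)
  (eps_cvg : eps @ \oo --> (0 : R))
  (A_cvg : (fun l => eps l `^ (- beta) - (Num.floor (eps l `^ (- beta)))%:~R)
             @ \oo --> A) :
  Gamma_cvg_L2 unit_interval
    (fun l => F_energy L alpha beta (eps l)) (E_energy L alpha A).
Proof.
split=> [wn w lwn lw cw|w lw]; first exact: gamma_liminf.
exact: gamma_recovery.
Qed.
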